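(* Let $\mathcal T_n$ be a conditioned Galton--Watson tree defined by an offspring distribution $\xi$ with $\mathbb E\xi=1$ and $0<\sigma^2:=\operatorname{Var}\xi<\infty$. (i) The estimate $$\mathbb E X_n(\alpha)=\mu(\alpha)n+\frac{1}{\sqrt2\,\sigma}\frac{\Gamma(\alpha-\frac12)}{\Gamma(\alpha)}\,n^{\alpha+\frac12}+o\bigl(n^{(\operatorname{Re}\alpha)_++\frac12}\bigr)\qquad\text{as } n\to\infty$$ holds also for $\alpha=\frac12+\mathrm iy$ with $y$ real, $y\ne0$. Moreover, this estimate holds uniformly on compact subsets of $\{\alpha:-\frac12<\operatorname{Re}\alpha\le\frac12\}\setminus\{\frac12\}$. (ii) The limit result $$n^{-\alpha-\frac12}\bigl[X_n(\alpha)-n\mu(\alpha)\bigr]\xrightarrow{d}\sigma^{-1}Y(\alpha)\qquad\text{as } n\to\infty$$ holds also for $\alpha=\frac12+\mathrm iy$ with $y$ real, $y\ne0$. Moreover, it holds in the space $C(\hat D)$ of continuous functions on the set $\hat D:=\{\alpha:0<\operatorname{Re}\alpha\le\frac12\}\setminus\{\frac12\}$.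
   Context: The offspring distribution is the distribution of a non-negative integer-valued random variable $\xi$. The Galton--Watson tree $\mathcal T$ with offspring distribution $\xi$ is the random rooted ordered tree in which each node has a number of children that is an independent copy of $\xi$ (it is a.s. finite here). $|T|$ denotes the number of nodes of a tree $T$. The conditioned Galton--Watson tree $\mathcal T_n$ is $\mathcal T$ conditioned on $|\mathcal T|=n$; only $n$ with $\mathbb P(|\mathcal T|=n)>0$ are considered, and $n\to\infty$ through such $n$. For a rooted tree $T$ and a node $v\in T$, $T_v$ is the subtree consisting of $v$ and all its descendants. For $\alpha\in\mathbb C$, $X_n(\alpha):=\sum_{v\in\mathcal T_n}|\mathcal T_{n,v}|^\alpha$ (where $\mathcal T_{n,v}=(\mathcal T_n)_v$), $\tilde X_n(\alpha):=X_n(\alpha)-\mathbb E X_n(\alpha)$. For $\operatorname{Re}\alpha<\frac12$, $\mu(\alpha):=\mathbb E|\mathcal T|^\alpha=\sum_{n\ge1}n^\alpha\,\mathbb P(|\mathcal T|=n)$; this function has a continuous extension to $\{\operatorname{Re}\alpha\le\frac12\}\setminus\{\frac12\}$, and for $\operatorname{Re}\alpha=\frac12$, $\alpha\neq\frac12$, $\mu(\alpha)$ is defined as this continuous extension. $x_+:=\max(x,0)$; $1/\Gamma$ is regarded as an entire function. The topology in $C(\hat D)$ is that of uniform convergence on compact subsets of $\hat D$; convergence ''in $C(\hat D)$'' means convergence in distribution of random elements of $C(\hat D)$. Let $H_+:=\{\operatorname{Re}\alpha>0\}$ and let $\mathcal H(H_+)$ be the space of analytic functions on $H_+$ with the topology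 of uniform convergence on compact sets. $\tilde Y=(\tilde Y(\alpha))_{\alpha\in H_+}$ denotes the random analytic function on $H_+$ (unique in distribution and not depending on the offspring distribution) such that, for every offspring distribution $\xi$ with $\mathbb E\xi=1$ and $0<\sigma^2=\operatorname{Var}\xi<\infty$, $\sigma n^{-\alpha-\frac12}\tilde X_n(\alpha)\xrightarrow{d}\tilde Y(\alpha)$ in $\mathcal H(H_+)$. For $\operatorname{Re}\alpha>0$, $\alpha\ne\frac12$, $$Y(\alpha):=\tilde Y(\alpha)+\frac1{\sqrt2}\frac{\Gamma(\alpha-\frac12)}{\Gamma(\alpha)}.$$ *)

(* Defs.v *)
From HB Require Import structures.
From mathcomp Require Import all_boot all_order all_algebra complex.
From mathcomp Require Import all_classical all_reals all_analysis.
Import Order.TTheory GRing.Theory Num.Theory.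
Import numFieldNormedType.Exports.

Set Implicit Arguments.
Unset Strict Implicit.
Unset Printing Implicit Defensive.

Local Open Scope classical_set_scope.
Local Open Scope complex_scope.
Local Open Scope ring_scope.

(* The Euclidean topology, i.e. the one that the norm of the field [R[i]]
   already induces on [R[i]^o]. *)
HB.instance Definition _ (R : realType) :=
  PseudoPointedMetric.copy R[i] (R[i])^o.

Section Complex.
Context {R : realType}.
Implicit Types (z a : R[i]).

Definition cexp z : R[i] :=
  (expR (complex.Re z))%:C * (cos (complex.Im z) +i* sin (complex.Im z)).

(* [n ^ a] for a positive natural number [n]; the value at [n = 0] is junk. *)
Definition npow (n : nat) a : R[i] := cexp (a * (ln (n%:R : R))%:C).

(* The entire function [1 / Gamma], by Gauss's limit formula. *)
Definition rGamma z : R[i] :=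
  limn (fun n : nat =>
    (\prod_(k < n.+1) (z + k%:R)) / ((n`!)%:R * npow n z)).

(* Off the poles [0, -1, -2, ...] of Gamma, where this has the value [0]. *)
Definition Gamma z : R[i] := (rGamma z)^-1.

Definition one_half : R[i] := (2^-1 : R)%:C.

Definition gamma_term a : R[i] :=
  ((Num.sqrt 2 : R)%:C)^-1 * (Gamma (a - one_half) * rGamma a).

Definition right_half_plane : set R[i] := [set a | 0 < complex.Re a].

Definition Dhat : set R[i] := [set a | 0 < complex.Re a <= 2^-1] `\ one_half.

Definition strip : set R[i] := [set a | - 2^-1 < complex.Re a <= 2^-1] `\ one_half.

End Complex.

(* [funs D] carries the topology of uniform convergence on the compact subsets
   of [D]. Its points are functions on the whole plane, but two functions that
   agree on [D] are topologically indistinguishable: [D]-continuous (resp.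
   analytic) elements of [funs D] therefore represent C(D) (resp. H(D)), with
   the same open sets and the same continuous real functionals. *)
Definition funs {R : realType} (D : set R[i]) : Type :=
  {family compactly_in D, R[i] -> R[i]}.
HB.instance Definition _ (R : realType) (D : set R[i]) :=
  Uniform.copy (funs D) {family compactly_in D, R[i] -> R[i]}.

Definition continuous_funs {R : realType} (D : set R[i]) : set (funs D) :=
  [set f | {within D, continuous (f : R[i] -> R[i])}].
Arguments continuous_funs {R} D.

(* For an open set [D]. *)
Definition analytic_funs {R : realType} (D : set R[i]) : set (funs D) :=
  [set f | forall z, D z -> derivable (f : R[i]^o -> R[i]^o) z 1].
Arguments analytic_funs {R} D.

Inductive tree := Node of seq tree.

HB.instance Definition _ := gen_eqMixin tree.
HB.instance Definition _ := gen_choiceMixin tree.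

(* The subtrees T_v, one for each node v of T. *)
Fixpoint subtrees (t : tree) : seq tree :=
  let: Node s := t in t :: flatten [seq subtrees u | u <- s].

Definition tree_size (t : tree) : nat := size (subtrees t).

Lemma tree_sizeE s : tree_size (Node s) = (\sum_(u <- s) tree_size u).+1.
Proof. by rewrite /tree_size /= size_flatten /shape -map_comp sumnE big_map. Qed.

Lemma tree_size_gt0 t : (0 < tree_size t)%N.
Proof. by case: t. Qed.

Lemma finite_trees n : finite_set [set t | tree_size t = n].
Proof.
suff H k : finite_set [set t | (tree_size t <= k)%N].
  by apply: sub_finite_set (H n) => t /= ->.
elim: k => [|k IH].
  apply: sub_finite_set (finite_set0 tree) => t /=.
  by rewrite leqNgt tree_size_gt0.
pose small m := [set s : seq tree |
  (size s <= m)%N /\ all (fun u => tree_size u <= k)%N s].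
have L m : finite_set (small m).
  elim: m => [|m IHm].
    apply: sub_finite_set (finite_set1 [::]) => s /= [].
    by rewrite leqn0 size_eq0 => /eqP.
  apply: (@sub_finite_set _ _ ([set [::]] `|`
      [set x :: l | x in [set t | (tree_size t <= k)%N] & l in small m])).
    move=> [|x l] /= []; first by left.
    by move=> sl /andP[xk lk]; right; exists x => //; exists l.
  by rewrite finite_setU; split; [exact: finite_set1|exact: finite_image2].
apply: sub_finite_set (finite_image Node (L k)) => -[s] /=.
rewrite tree_sizeE ltnS => sk; exists s => //; split.
  apply: leq_trans sk; rewrite -sum1_size; apply: leq_sum => u _.
  exact: tree_size_gt0.
apply/allP => u us; apply: leq_trans sk.
by rewrite (big_rem u)//= leq_addr.
Qed.

Section GaltonWatson.
Context {R : realType} (xi : probability nat R).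

Definition offspring_prob (k : nat) : R := fine (xi [set k]).

(* P(T = t) : the root has [size s] children with probability
   [offspring_prob (size s)], and the subtrees hanging from them are
   independent copies of T. *)
Fixpoint gw_prob (t : tree) : R :=
  let: Node s := t in
  offspring_prob (size s) * \prod_(q <- [seq gw_prob u | u <- s]) q.

(* P(|T| = n); an actual sum over all trees of size [n], by [finite_trees] (a
   sum indexed by a set is [0] if its support is infinite). *)
Definition gw_size_prob (n : nat) : R :=
  \sum_(t \in [set t | tree_size t = n]) gw_prob t.

Definition admissible : set nat := [set n | 0 < gw_size_prob n].

Definition admissible_oo : set_system nat := within admissible \oo.

(* E f(T_n), where T_n is T conditioned on |T| = n, for a real function f. *)
Definition cgw_expect (n : nat) (f : tree -> R) : R :=
  (\sum_(t \in [set t | tree_size t = n]) gw_prob t * f t) / gw_size_prob n.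

Definition cgw_cexpect (n : nat) (f : tree -> R[i]) : R[i] :=
  cgw_expect n (fun t => complex.Re (f t)) +i*
  cgw_expect n (fun t => complex.Im (f t)).

Definition X (t : tree) (a : R[i]) : R[i] :=
  \sum_(u <- subtrees t) npow (tree_size u) a.

Definition EX (n : nat) (a : R[i]) : R[i] := cgw_cexpect n (X ^~ a).

(* E |T|^a; only meaningful for Re a < 1/2. *)
Definition mu_series (a : R[i]) : R[i] :=
  limn (fun N : nat => \sum_(1 <= n < N) npow n a * (gw_size_prob n)%:C).

(* Extended by continuity to Re a = 1/2, a <> 1/2. *)
Definition mu (a : R[i]) : R[i] :=
  if complex.Re a < 2^-1 then mu_series a
  else lim (mu_series b @[b --> within [set b | complex.Re b < 2^-1] (nbhs a)]).

End GaltonWatson.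

Definition critical {R : realType} (xi : probability nat R) (sigma : R) :=
  [/\ 0 < sigma,
      ('E_xi[fun k : nat => k%:R] = 1%:E)%E &
      ('V_xi[fun k : nat => k%:R%R] = (sigma ^+ 2)%:E)%E].

Section Distribution.
Context {R : realType} d (T : measurableType d) (P : probability T R).
Context (V : topologicalType) (S : set V).

(* A random element (Borel measurable map) of the subspace [S] of [V]. *)
Definition random_element (Y : T -> V) :=
  (forall w, S (Y w)) /\ (forall U, open U -> measurable (Y @^-1` U)).

Definition bounded_continuous (phi : V -> R) :=
  {within S, continuous phi} /\ exists M : R, forall x, S x -> `|phi x| <= M.

(* Z_n(T_n) converges in distribution, as random elements of [S], to [Y]. *)
Definition cvg_in_distribution (xi : probability nat R)
    (Z : nat -> tree -> V) (Y : T -> V) :=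
  [/\ forall n t, admissible xi n -> tree_size t = n -> S (Z n t),
      random_element Y &
      forall phi, bounded_continuous phi ->
        (cgw_expect xi n (phi \o Z n))%:E @[n --> admissible_oo xi]
          --> ('E_P[phi \o Y])%E].

End Distribution.
Arguments cvg_in_distribution {R d T} P {V} S xi Z Y.

(* The characterization of the random analytic function Ytilde. *)
Definition is_Ytilde {R : realType} d (T : measurableType d)
    (P : probability T R) (Yt : T -> R[i] -> R[i]) :=
  forall (xi : probability nat R) (sigma : R), critical xi sigma ->
    cvg_in_distribution P (analytic_funs right_half_plane) xi
      (fun n t a => sigma%:C * npow n (- a - one_half) * (X t a - EX xi n a)) Yt.

Definition Y_of {R : realType} {T : Type} (Yt : T -> R[i] -> R[i])
    (w : T) (a : R[i]) : R[i] := Yt w a + gamma_term a.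

(* f_n(a) = o(g_n(a)) along the filter [F], uniformly in [a \in K]. *)
Definition uniformly_little_o {R : realType} (F : set_system nat)
    (K : set R[i]) (f : nat -> R[i] -> R[i]) (g : nat -> R[i] -> R) :=
  forall eps : R, 0 < eps ->
    \forall n \near F, forall a, K a -> `|f n a| <= (eps * g n a)%:C.

(* Main.v *)
Require Import Defs.
From mathcomp Require Import all_boot all_order all_algebra complex.
From mathcomp Require Import all_classical all_reals all_analysis.
From mathcomp Require Import ring lra zify.
Import Order.TTheory GRing.Theory Num.Theory.
Import numFieldNormedType.Exports.
Local Open Scope classical_set_scope.
Local Open Scope complex_scope.
Local Open Scope ring_scope.
Set Implicit Arguments.
Unset Strict Implicit.
Unset Printing Implicit Defensive.

(** Write [q n] for the probability that the Galton-Watson tree has [n] nodes and [S] for the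
   random walk whose steps are offspring numbers. The cycle lemma ([otter_dwass]) gives
   [n * q n = P(S_n = n - 1)], and counting in all trees of size [n] the fringe subtrees of size
   [m] gives ([EX_formula])
   [E X_n(a) = sum_(m <= n) m^a q m P(S_(n-m) = n - m) / q n].
   So everything depends on the return probabilities of a walk with finite variance, known up to
   relative errors [o(1)] from a local limit theorem. Only [n = 1 mod h] matter, [h] being the
   span of the offspring distribution.

   With [u k = m^(a-1) P(S_m = m - 1)], [m = h k + 1], and [ret l = P(S_(h l) = h l)], the
   numerator is the convolution of [u] and [ret]. It is compared with an exactly solvable one.
   Up to constants, let [v] be the coefficients of [(1 - z)^(1/2 - a)] and [w] those of
   [(1 - z)^(-1/2)]; they have the same leading asymptotics as [u] and [ret], and Vandermonde's
   identity evaluates their convolution as a coefficient of [(1 - z)^(-a)], which is the Gamma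
   function term of the statement. The remainder is essentially [ret N] times the partial sum of
   [u - v], because [ret] varies slowly ([convolution_expansion]).

   Hence the theorem reduces to the convergence of [sum (u - v)], with a rate and locally
   uniformly up to the line [Re a = 1/2] ([sum_u_sub_v]); the sum is then the continuous
   extension of [mu] ([muE]), since [sum v = 0] to the left of that line. On the line
   [|u k - v k|] is only [o(1/k)], which need not be summable. The way out is to replace the
   variance in the local limit theorem by the variance of the steps truncated at the square root
   of the number of steps. The error is then absolutely summable ([llt_hit_trunc],
   [sum_truncation_error]), while what has been introduced is a factor that decreases
   monotonically to [0], so that summation by parts ([abel_bound]) uses the boundedness of the
   oscillating sums of [m^(a - 3/2)].

   The limit law follows from that of the analytic functions [n^(-a-1/2) (X_n(a) - E X_n(a))]:
   the two differ by a deterministic shift, which by the first part converges uniformly on compact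
   sets, and a version of the continuous mapping theorem for varying maps ([uniform_mapping])
   applies. The limit at a single point is its image under evaluation. *)

(** * Random walks and the cycle lemma *)

Section Walk.
Context {R : realType} (p : nat -> R).

(** Truncated, so as to be a polynomial: the coefficients of its powers below [N] do not
   depend on the truncation. *)
Definition pgf (N : nat) : {poly R} := \poly_(k < N) p k.

(** The probability that a sum of [n] independent offspring numbers equals [i]. *)
Definition walk (n i : nat) : R := ((pgf i.+1) ^+ n)`_i.

Lemma coef_exp_eq (A B : {poly R}) i n :
  (forall j, (j <= i)%N -> A`_j = B`_j) -> forall j, (j <= i)%N ->
  (A ^+ n)`_j = (B ^+ n)`_j.
Proof.
move=> AB; elim: n => [|n IH] j ji; first by rewrite !expr0.
rewrite !exprS !coefM; apply: eq_bigr => k _; rewrite AB ?IH//.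
- by apply: leq_trans ji; rewrite leq_subr.
- by apply: leq_trans ji; rewrite -ltnS.
Qed.

Lemma walkE N n i : (i < N)%N -> ((pgf N) ^+ n)`_i = walk n i.
Proof.
move=> iN; apply: (@coef_exp_eq _ _ i) => // j ji.
by rewrite !coef_poly ltnS ji (leq_ltn_trans ji iN).
Qed.

Lemma walk0 i : walk 0 i = (i == 0)%:R.
Proof. by rewrite /walk expr0 coef1. Qed.

Lemma walkS n i : walk n.+1 i = \sum_(j < i.+1) p j * walk n (i - j).
Proof.
rewrite /walk exprS coefM; apply: eq_bigr => j _.
rewrite coef_poly ltn_ord; congr (_ * _); apply: walkE.
by rewrite ltnS leq_subr.
Qed.

(** By symmetry each of the [n + 1] steps contributes the same to the mean of the sum; in
   terms of generating functions, this is the coefficient form of [(f^(n+1))' = (n+1) f'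
   f^n]. *)
Lemma walk_first_step n i :
  n.+1%:R * \sum_(j < i.+1) j%:R * p j * walk n (i - j) = i%:R * walk n.+1 i.
Proof.
have -> : i%:R * walk n.+1 i = ('X * ((pgf i.+1) ^+ n.+1)^`())`_i.
  by rewrite coefXM coef_deriv; case: i => [|i] /=; rewrite ?mul0r// mulr_natl.
rewrite deriv_exp /= mulrnAr coefMn -[RHS]mulr_natl; congr (_ * _).
have -> : 'X * ((pgf i.+1)^`() * pgf i.+1 ^+ n) =
  ('X * (pgf i.+1)^`()) * pgf i.+1 ^+ n by ring.
rewrite coefM; apply: eq_bigr => j _; congr (_ * _); last first.
  by apply/esym/walkE; rewrite ltnS leq_subr.
rewrite coefXM coef_deriv; case: j => -[|j] jP/=; first by rewrite !mul0r.
by rewrite coef_poly (leq_trans jP)// mulr_natl.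
Qed.

(** In a forest of [k] trees with [m] nodes the offspring numbers sum to [m - k]. *)
Definition walk_to (n m k : nat) : R := if (k <= m)%N then walk n (m - k) else 0.

Lemma walk_to_gt n m k : (m < k)%N -> walk_to n m k = 0.
Proof. by rewrite /walk_to ltnNge => /negbTE ->. Qed.

Lemma walk_to_step n m k K : (m - k < K)%N ->
  \sum_(j < K) p j * walk_to n m (k + j) = walk_to n.+1 m k.
Proof.
move=> K_; rewrite [RHS]/walk_to; case: leqP => km; last first.
  by rewrite big1// => j _; rewrite walk_to_gt ?mulr0// ltn_addr.
rewrite walkS (big_ord_widen K (fun j => p j * walk n (m - k - j)))//.
rewrite [RHS]big_mkcond/=; apply: eq_bigr => j _.
rewrite /walk_to ltnS -leq_subRL// subnDA.
by case: ifP => // _; rewrite mulr0.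
Qed.

Lemma walk_to_step_weighted n m k K : (m - k < K)%N -> (k <= m)%N ->
  n.+1%:R * \sum_(j < K) (k + j)%:R * p j * walk_to n m (k + j) =
  (n.+1%:R * k%:R + (m - k)%:R) * walk_to n.+1 m k.
Proof.
move=> mkK km.
under eq_bigr do rewrite natrD -mulrA mulrDl.
rewrite big_split/= -mulr_sumr walk_to_step// mulrDr mulrDl mulrA; congr (_ + _).
rewrite {2}/walk_to km -walk_first_step; congr (_ * _).
rewrite (big_ord_widen K (fun j => j%:R * p j * walk n (m - k - j)))//.
rewrite [RHS]big_mkcond/=; apply: eq_bigr => j _.
rewrite /walk_to ltnS -leq_subRL// subnDA mulrA.
by case: ifP => // _; rewrite mulr0.
Qed.

End Walk.

(** One step of the depth-first exploration, read backwards. *)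
Definition graft (j : nat) (w : seq tree) : seq tree :=
  Node (take j w) :: drop j w.

(** The recursion peels off the first root, so that [n] decreases although the number of
   trees need not. *)
Fixpoint forests (n k : nat) : seq (seq tree) :=
  match n, k with
  | 0, 0 => [:: [::]]
  | 0, _.+1 | _.+1, 0 => [::]
  | n.+1, k.+1 =>
    flatten [seq [seq graft j w | w <- forests n (k + j)] | j <- iota 0 n.+1]
  end.

Lemma forestsS n k : forests n.+1 k.+1 =
  flatten [seq [seq graft j w | w <- forests n (k + j)] | j <- iota 0 n.+1].
Proof. by []. Qed.

Definition forest_size (s : seq tree) : nat := \sum_(u <- s) tree_size u.

Lemma forest_size_cat s t : forest_size (s ++ t) = (forest_size s + forest_size t)%N.
Proof. by rewrite /forest_size big_cat. Qed.

Lemma size_le_forest_size s : (size s <= forest_size s)%N.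
Proof.
by rewrite /forest_size -sum1_size; apply: leq_sum => u _; exact: tree_size_gt0.
Qed.

Lemma forest_size_graft j w : forest_size (graft j w) = (forest_size w).+1.
Proof.
rewrite /forest_size /graft big_cons tree_sizeE addSn; congr S.
by rewrite -big_cat cat_take_drop.
Qed.

Lemma mem_forests n k s :
  (s \in forests n k) = (size s == k) && (forest_size s == n).
Proof.
elim: n k s => [|n IH] [|k] s.
- rewrite inE; case: s => [|t s]; first by rewrite /forest_size big_nil.
  by [].
- rewrite in_nil; apply/esym/negP => /andP[/eqP sk /eqP s0].
  by have := size_le_forest_size s; rewrite sk s0.
- rewrite in_nil; apply/esym/negP => /andP[/eqP/size0nil -> /eqP].
  by rewrite /forest_size big_nil.
rewrite forestsS; apply/flatten_mapP/andP => [[j]|[]].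
  rewrite mem_iota add0n => /andP[_ jn] /mapP[w]; rewrite IH.
  case/andP => /eqP wk /eqP wn ->; rewrite forest_size_graft wn eqxx; split=> //.
  by rewrite /graft /= size_drop wk addnK.
case: s => [//|[l] s]; rewrite [size _]/= => /eqP[sk] /eqP ln.
have nE : n = forest_size (l ++ s).
  apply/eqP; rewrite -eqSS -ln /forest_size big_cons tree_sizeE addSn -big_cat.
  by rewrite eqxx.
exists (size l).
  rewrite mem_iota add0n/= ltnS nE; apply: leq_trans (size_le_forest_size _).
  by rewrite size_cat leq_addr.
apply/mapP; exists (l ++ s); first by rewrite IH size_cat sk addnC eqxx nE eqxx.
by rewrite /graft take_size_cat// drop_size_cat.
Qed.

Lemma forests_uniq n k : uniq (forests n k).
Proof.
elim: n k => [|n IH] [|k] //; rewrite forestsS.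
have : uniq (iota 0 n.+1) by exact: iota_uniq.
elim: (iota 0 n.+1) => [//|j js IHj] /= /andP[jjs ujs].
rewrite cat_uniq IHj// andbT map_inj_in_uniq ?IH//=; last first.
  move=> w w' _ _ [t d].
  by rewrite -(cat_take_drop j w) t d cat_take_drop.
apply/hasPn => s /flatten_mapP[i ijs /mapP[w]]; rewrite mem_forests.
case/andP => /eqP wk _ ->; apply/mapP => -[w']; rewrite mem_forests.
case/andP => /eqP w'k _ [tt dd].
have : size (drop i w) = size (drop j w') by rewrite dd.
rewrite !size_drop wk w'k !addnK => _.
have : size (take i w) = size (take j w') by rewrite tt.
rewrite !size_takel ?wk ?w'k ?leq_addl// => ij.
by move: jjs; rewrite -ij ijs.
Qed.

Definition count_subtrees (m : nat) (s : seq tree) : nat :=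
  count (fun u => tree_size u == m) (flatten [seq subtrees u | u <- s]).

Lemma count_subtrees_graft m j w :
  count_subtrees m (graft j w) =
  ((tree_size (Node (take j w)) == m) + count_subtrees m w)%N.
Proof.
rewrite /count_subtrees /graft /= -flatten_cat -map_cat cat_take_drop.
by [].
Qed.

Lemma tree_size_subtrees t u : u \in subtrees t -> (tree_size u <= tree_size t)%N.
Proof.
move: t u; fix H 1 => -[l] v; rewrite /= inE => /predU1P[->//|vl].
rewrite tree_sizeE; apply: leqW; move: vl.
elim: l => [//|x l IHl] /=; rewrite mem_cat => /orP[/H|/IHl] vx.
  by rewrite big_cons (leq_trans vx)// leq_addr.
by rewrite big_cons (leq_trans vx)// leq_addl.
Qed.

Section Forest.
Context {R : realType} (xi : probability nat R).
Local Notation p := (offspring_prob xi).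

Definition forest_prob (s : seq tree) : R := \prod_(u <- s) gw_prob xi u.

Lemma forest_prob_graft j w : (j <= size w)%N ->
  forest_prob (graft j w) = p j * forest_prob w.
Proof.
move=> jw; rewrite /forest_prob /graft big_cons /= size_takel// big_map -mulrA.
by rewrite -big_cat cat_take_drop.
Qed.

Definition forest_sum (n k : nat) (f : seq tree -> R) : R :=
  \sum_(s <- forests n k) forest_prob s * f s.

Lemma forest_sumS n k f : forest_sum n.+1 k.+1 f =
  \sum_(j < n.+1) p j * forest_sum n (k + j) (fun w => f (graft j w)).
Proof.
rewrite /forest_sum forestsS big_flatten big_map -[X in iota 0 X]subn0.
rewrite -/(index_iota 0 n.+1) big_mkord; apply: eq_bigr => j _.
rewrite big_map mulr_sumr [LHS]big_seq [RHS]big_seq; apply: eq_bigr => w.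
rewrite mem_forests => /andP[/eqP wk _].
by rewrite forest_prob_graft ?wk ?leq_addl// mulrA.
Qed.

Lemma forest_sum_gt n k f : (n < k)%N -> forest_sum n k f = 0.
Proof.
move=> nk; rewrite /forest_sum big_seq big1// => s; rewrite mem_forests.
case/andP => /eqP sk /eqP sn; have := size_le_forest_size s.
by rewrite sk sn leqNgt nk.
Qed.

Definition forest_size_prob (n k : nat) : R := forest_sum n k (fun=> 1).

Lemma forest_size_probS n k : forest_size_prob n.+1 k.+1 =
  \sum_(j < n.+1) p j * forest_size_prob n (k + j).
Proof. exact: forest_sumS. Qed.

(** Induction on [n]: peeling off the first root turns the claim for [n] into a weighted
   one-step recursion of the walk, which [walk_to_step_weighted] solves. *)
Lemma kemperman n k :
  n%:R * forest_size_prob n k = k%:R * walk_to p n n k.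
Proof.
elim: n k => [|n IH] k.
  rewrite mul0r; case: k => [|k]; first by rewrite mul0r.
  by rewrite walk_to_gt ?mulr0.
case: k => [|k]; first by rewrite /forest_size_prob /forest_sum big_nil mulr0 mul0r.
have [nk|kn] := ltnP n k.
  by rewrite /forest_size_prob forest_sum_gt ?walk_to_gt ?mulr0.
have -> : walk_to p n.+1 n.+1 k.+1 = walk_to p n.+1 n k.
  by rewrite /walk_to ltnS subSS.
rewrite forest_size_probS; case: n kn IH => [|n] kn IH.
  move: kn; rewrite leqn0 => /eqP ->; rewrite big_ord1 addn0 -(@walk_to_step _ p 0 0 0 1)//.
  rewrite big_ord1 addn0 !mul1r; congr (_ * _).
  rewrite /forest_size_prob /forest_sum big_seq1 /forest_prob big_nil mulr1.
  by rewrite /walk_to/= walk0.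
have n0 : n.+1%:R != 0 :> R by rewrite pnatr_eq0.
apply: (mulfI n0); rewrite mulrCA mulr_sumr.
under eq_bigr => j _ do rewrite mulrCA IH mulrCA mulrA.
rewrite walk_to_step_weighted// ?ltnS ?leq_subr// mulrA; congr (_ * _).
by rewrite natrB// -!natr1; ring.
Qed.

Definition trees (n : nat) : seq tree :=
  [seq head (Node [::]) s | s <- forests n 1].

Lemma mem_trees n t : (t \in trees n) = (tree_size t == n).
Proof.
apply/mapP/eqP => [[s]|tn].
  rewrite mem_forests => /andP[+ /eqP].
  by case: s => [//|u [|//]] _; rewrite /forest_size big_seq1 => <- ->.
by exists [:: t] => //; rewrite mem_forests/= /forest_size big_seq1 tn eqxx.
Qed.

Lemma trees_uniq n : uniq (trees n).
Proof.
rewrite map_inj_in_uniq ?forests_uniq// => s t; rewrite !mem_forests.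
move=> /andP[/eqP s1 _] /andP[/eqP t1 _].
by case: s s1 => [//|a [|//]] _; case: t t1 => [//|b [|//]] _ /= ->.
Qed.

Lemma sum_trees n (f : tree -> R) :
  \sum_(t \in [set t | tree_size t = n]) f t = \sum_(t <- trees n) f t.
Proof.
rewrite [RHS]fsbig_seq ?trees_uniq//; apply: eq_fsbigl; apply/seteqP; split=> t /=.
  by move=> tn; rewrite mem_trees tn.
by rewrite mem_trees => /eqP.
Qed.

Lemma trees_forest_sum n (f : seq tree -> R) :
  \sum_(t <- trees n) gw_prob xi t * f [:: t] = forest_sum n 1 f.
Proof.
rewrite big_map /forest_sum big_seq [RHS]big_seq; apply: eq_bigr => s.
rewrite mem_forests => /andP[/eqP s1 _]; case: s s1 => [//|a [|//]] _ /=.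
by rewrite /forest_prob big_seq1.
Qed.

Lemma gw_size_probE n : gw_size_prob xi n = forest_size_prob n 1.
Proof.
rewrite /gw_size_prob sum_trees /forest_size_prob -trees_forest_sum.
by apply: eq_bigr => t _; rewrite mulr1.
Qed.

(** The case of a single tree. *)
Lemma otter_dwass n : n%:R * gw_size_prob xi n = walk_to p n n 1.
Proof. by rewrite gw_size_probE kemperman mul1r. Qed.

Lemma forest_sum_first_tree m n k : (m <= n)%N ->
  forest_sum n k.+1 (fun s => (tree_size (head (Node [::]) s) == m)%:R) =
  gw_size_prob xi m * forest_size_prob (n - m) k.
Proof.
move=> mn; rewrite gw_size_probE /forest_size_prob {2 3}/forest_sum.
under eq_bigr do rewrite mulr1.
under [X in _ = _ * X]eq_bigr do rewrite mulr1.
rewrite big_distrlr/= /forest_sum.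
transitivity (\sum_(a <- [seq (i, j) | i <- forests m 1, j <- forests (n - m) k])
  forest_prob a.1 * forest_prob a.2); last by rewrite big_allpairs_dep.
under eq_bigr do rewrite mulr_natr mulrb.
rewrite -big_mkcond/= -big_filter.
have E : perm_eq [seq s <- forests n k.+1 | tree_size (head (Node [::]) s) == m]
   [seq a.1 ++ a.2 | a <- [seq (i, j) | i <- forests m 1, j <- forests (n - m) k]].
  apply: uniq_perm.
  - by rewrite filter_uniq// forests_uniq.
  - rewrite map_inj_in_uniq; first by apply: allpairs_uniq; rewrite ?forests_uniq// => -[? ?] [? ?].
    move=> [a b] [a' b'] /allpairsP[[x y]/= [+ _ [-> ->]]].
    rewrite mem_forests => /andP[/eqP x1 _] /allpairsP[[x' y']/= [+ _ [-> ->]]].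
    rewrite mem_forests => /andP[/eqP x1' _].
    case: x x1 => [//|t [|//]] _; case: x' x1' => [//|t' [|//]] _.
    by move=> /= [-> ->].
  move=> s; rewrite mem_filter mem_forests; apply/and3P/mapP.
    case: s => [[]//|t s] /= [/eqP tm /eqP[sk] /eqP sn].
    exists ([:: t], s) => //; apply/allpairsP; exists ([:: t], s) => /=.
    rewrite !mem_forests /= sk eqxx /forest_size big_seq1 tm eqxx; split=> //.
    by rewrite -sn /forest_size big_cons tm addKn eqxx.
  move=> [[a b] /allpairsP[[x y]/= [xm ym [-> ->]]] ->] /=.
  move: xm ym; rewrite !mem_forests => /andP[/eqP x1 /eqP xm] /andP[/eqP yk /eqP yn].
  rewrite forest_size_cat size_cat x1 yk xm yn subnKC// !eqxx; split=> //.
  case: x x1 xm => [//|t [|//]] _.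
  by rewrite /forest_size big_seq1 /= => ->.
rewrite (perm_big _ E)/= big_map; apply: eq_bigr => a _.
by rewrite /forest_prob big_cat.
Qed.

(** Cutting off the fringe subtree leaves a forest in which one vertex has been marked; the
   recursion through the first root shows that the number of ways is governed by the walk
   alone. *)
Lemma forest_sum_count_subtrees m n k : (0 < m <= n)%N ->
  forest_sum n k (fun s => (count_subtrees m s)%:R) =
  gw_size_prob xi m * k%:R * walk_to p (n - m) (n - m).+1 k.
Proof.
case/andP=> m0; elim: n k => [|n IH] k mn.
  by move: mn; rewrite leqn0 => /eqP mE; rewrite mE in m0.
case: k => [|k]; first by rewrite /forest_sum big_nil mulr0 mul0r.
have -> : forest_sum n.+1 k.+1 (fun s => (count_subtrees m s)%:R) =
   \sum_(j < n.+1) p j * forest_sum n (k + j) (fun s => (count_subtrees m s)%:R)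
   + forest_sum n.+1 k.+1 (fun s => (tree_size (head (Node [::]) s) == m)%:R).
  rewrite !forest_sumS -big_split/=; apply: eq_bigr => j _; rewrite -mulrDr.
  congr (_ * _); rewrite /forest_sum -big_split/=; apply: eq_bigr => s _.
  by rewrite count_subtrees_graft natrD -mulrDr addrC.
rewrite forest_sum_first_tree//; move: mn; rewrite leq_eqVlt => /predU1P[->|mn].
  rewrite subnn big1 ?add0r; last first.
    move=> j _; rewrite {1}/forest_sum big_seq big1 ?mulr0// => s.
    rewrite mem_forests => /andP[_ /eqP sn].
    suff -> : count_subtrees n.+1 s = 0%N by rewrite mulr0.
    apply/eqP; rewrite -leqn0 leqNgt -has_count; apply/hasPn => u.
    move=> /flatten_mapP[t ts] ut; rewrite neq_ltn; apply/orP; left.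
    rewrite ltnS -sn; apply: (@leq_trans (tree_size t)); last first.
      by rewrite /forest_size (big_rem t)//= leq_addr.
    exact: tree_size_subtrees.
  rewrite /forest_size_prob; case: k => [|k].
    rewrite /forest_sum big_seq1 /forest_prob big_nil !mulr1 /walk_to.
    by rewrite walk0 mulr1.
  by rewrite forest_sum_gt// walk_to_gt ?mulr0.
rewrite ltnS in mn.
under eq_bigr => j _ do rewrite (IH _ mn).
rewrite (eq_bigr (fun j : 'I_n.+1 => gw_size_prob xi m * ((k + j)%:R * p j *
  walk_to p (n - m) (n - m).+1 (k + j)))); last by move=> j _; ring.
rewrite -mulr_sumr -mulrA -mulrDr; congr (_ * _).
rewrite subSn//; set N := (n - m)%N.
have -> : walk_to p N.+1 N.+2 k.+1 = walk_to p N.+1 N.+1 k by rewrite /walk_to ltnS subSS.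
have [kN|kN] := ltnP N.+1 k.
  rewrite walk_to_gt// mulr0 /forest_size_prob forest_sum_gt// addr0 big1// => j _.
  by rewrite walk_to_gt ?mulr0// ltn_addr.
have N0 : N.+1%:R != 0 :> R by rewrite pnatr_eq0.
apply: (mulfI N0); rewrite [LHS]mulrDr kemperman.
rewrite walk_to_step_weighted//; last first.
  by rewrite ltnS (leq_trans (leq_subr _ _))// /N -subSn// leq_subLR -addn1 addnC leq_add2r.
by rewrite natrB// -[k.+1%:R]natr1; ring.
Qed.

Lemma X_count n t a : tree_size t = n ->
  X t a = \sum_(1 <= m < n.+1) (count_subtrees m [:: t])%:R * npow m a :> R[i].
Proof.
move=> tn; rewrite /X.
transitivity (\sum_(u <- subtrees t) \sum_(1 <= m < n.+1)
    (tree_size u == m)%:R * npow m a : R[i]).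
  rewrite big_seq [RHS]big_seq; apply: eq_bigr => u /tree_size_subtrees ut.
  rewrite (bigD1_seq (tree_size u)) ?iota_uniq//=; last first.
    by rewrite mem_index_iota ltnS -tn ut tree_size_gt0.
  rewrite eqxx mul1r big1 ?addr0// => m.
  by rewrite eq_sym => /negbTE ->; rewrite mul0r.
rewrite exchange_big/=; apply: eq_bigr => m _; rewrite -mulr_suml; congr (_ * _).
rewrite /count_subtrees/= cats0 -sum1_count [in RHS]big_mkcond/= natr_sum.
by apply: eq_bigr => u _; case: eqP.
Qed.

Lemma cgw_expectE n f :
  cgw_expect xi n f = (\sum_(t <- trees n) gw_prob xi t * f t) / gw_size_prob xi n.
Proof. by rewrite /cgw_expect sum_trees. Qed.

(** Linearity of expectation over the subtree sizes; the last factor comes from the rest of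
   the tree. *)
Lemma EX_formula n a :
  EX xi n a = \sum_(1 <= m < n.+1) npow m a *
    (gw_size_prob xi m * walk p (n - m) (n - m) / gw_size_prob xi n)%:C.
Proof.
pose ct m t := (count_subtrees m [:: t])%:R : R.
have E m : (0 < m < n.+1)%N ->
    \sum_(t <- trees n) gw_prob xi t * ct m t =
    gw_size_prob xi m * walk p (n - m) (n - m).
  move=> mn; rewrite (@trees_forest_sum n (fun s => (count_subtrees m s)%:R)).
  rewrite forest_sum_count_subtrees ?mulr1; last by move: mn; rewrite ltnS.
  by rewrite /walk_to subSS subn0.
have L (F : R[i] -> R) : {morph F : x y / x + y} -> F 0 = 0 ->
    (forall (c : R) x, F (c%:C * x) = c * F x) ->
    cgw_expect xi n (fun t => F (X t a)) =
    F (\sum_(1 <= m < n.+1) npow m a *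
      (gw_size_prob xi m * walk p (n - m) (n - m) / gw_size_prob xi n)%:C).
  move=> FD F0 FZ; rewrite (big_morph F FD F0) cgw_expectE.
  transitivity ((\sum_(t <- trees n) \sum_(1 <= m < n.+1)
      gw_prob xi t * ct m t * F (npow m a)) / gw_size_prob xi n).
    congr (_ / _); rewrite big_seq [RHS]big_seq; apply: eq_bigr => t.
    rewrite mem_trees => /eqP tn; rewrite (X_count a tn) (big_morph F FD F0) mulr_sumr.
    apply: eq_bigr => m _; rewrite -mulrA; congr (_ * _).
    by rewrite -FZ; congr (F (_ * _)); rewrite /ct rmorph_nat.
  rewrite exchange_big/= mulr_suml; apply: eq_big_nat => m mn.
  by rewrite -mulr_suml E// [npow m a * _]mulrC [RHS]FZ mulrAC.
rewrite /EX /cgw_cexpect !L//; first by case: (\sum_(_ <= _ < _) _).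
- by move=> [? ?] [? ?].
- by move=> c [x y] /=; rewrite mul0r addr0.
- by move=> [? ?] [? ?].
- by move=> c [x y] /=; rewrite mul0r subr0.
Qed.

Lemma offspring_prob_ge0 k : 0 <= p k.
Proof. by rewrite /offspring_prob fine_ge0. Qed.

Lemma gw_prob_ge0 t : 0 <= gw_prob xi t.
Proof.
move: t; fix H 1 => -[l]; rewrite /= mulr_ge0 ?offspring_prob_ge0//.
elim: l => [|x l IHl] /=; first by rewrite big_nil.
by rewrite big_cons mulr_ge0.
Qed.

End Forest.

(** * Elementary estimates *)

Section RealBounds.
Context {R : realType}.
Implicit Types (x y u : R).

(** The trigonometric bounds below follow from this one by differentiating until the
   derivative has an evident sign. *)
Lemma ge0_of_derive (f df : R -> R) :
  (forall x, is_derive x 1 f (df x)) -> f 0 = 0 ->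
  (forall x, 0 <= x -> 0 <= df x) -> forall x, 0 <= x -> 0 <= f x.
Proof.
move=> fd f0 df0 x x0.
have fc : {within `[0, x], continuous f}.
  by apply: derivable_within_continuous => z _; exact: ex_derive.
have [c] := MVT_segment x0 (fun z _ => fd z) fc.
rewrite f0 !subr0 => cx ->; apply: mulr_ge0 => //; apply: df0.
by move: cx; rewrite in_itv/= => /andP[].
Qed.

Lemma cosB1_ge0 x : 0 <= 1 - cos x. Proof. by rewrite subr_ge0 cos_le1. Qed.

Lemma sub_sin_ge0 x : 0 <= x -> 0 <= x - sin x.
Proof.
apply: (@ge0_of_derive (fun x => x - sin x) (fun x => 1 - cos x)).
- by rewrite /= sin0 subr0.
- by move=> z _; exact: cosB1_ge0.
Qed.

Lemma cos_ge_quad x : 0 <= x -> 0 <= cos x - 1 + x ^+ 2 / 2.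
Proof.
apply: (@ge0_of_derive (fun x => cos x - 1 + x ^+ 2 / 2) (fun x => x - sin x)).
- move=> z; apply: is_derive_eq; rewrite /GRing.scale/=; lra.
- by rewrite /= cos0; lra.
- by move=> z; exact: sub_sin_ge0.
Qed.

Lemma sin_ge_cubic x : 0 <= x -> 0 <= x ^+ 3 / 6 - (x - sin x).
Proof.
apply: (@ge0_of_derive (fun x => x ^+ 3 / 6 - (x - sin x))
  (fun x => cos x - 1 + x ^+ 2 / 2)).
- move=> z; apply: is_derive_eq; rewrite /GRing.scale/=; lra.
- by rewrite /= sin0; lra.
- by move=> z; exact: cos_ge_quad.
Qed.

Lemma cos_ge_quartic x : 0 <= x -> 0 <= x ^+ 4 / 24 - (cos x - 1 + x ^+ 2 / 2).
Proof.
apply: (@ge0_of_derive (fun x => x ^+ 4 / 24 - (cos x - 1 + x ^+ 2 / 2))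
  (fun x => x ^+ 3 / 6 - (x - sin x))).
- move=> z; apply: is_derive_eq; rewrite /GRing.scale/=; lra.
- by rewrite /= cos0; lra.
- by move=> z; exact: sin_ge_cubic.
Qed.

Lemma abs_sub_sin u : `|sin u - u| = `|u| - sin `|u|.
Proof.
have [u0|u0] := leP 0 u.
  by rewrite (ger0_norm u0) distrC ger0_norm// sub_sin_ge0.
have Nu : 0 <= - u by rewrite oppr_ge0 ltW.
have E : sin u - u = - u - sin (- u) by rewrite sinN opprK addrC.
by rewrite (ltr0_norm u0) E ger0_norm ?sub_sin_ge0.
Qed.

Lemma cos_abs u : cos `|u| = cos u.
Proof. by have [u0|u0] := leP 0 u; rewrite ?(ger0_norm u0)// (ltr0_norm u0) cosN. Qed.

Lemma sin_cubic u : `|sin u - u| <= `|u| ^+ 3.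
Proof.
rewrite abs_sub_sin; have := sin_ge_cubic (normr_ge0 u).
have := exprn_ge0 3 (normr_ge0 u); lra.
Qed.

Lemma sin_linear u : `|sin u - u| <= 2 * `|u|.
Proof.
rewrite abs_sub_sin; have := sin_ge_cubic (normr_ge0 u).
have [u1|u1] := leP `|u| 1; last first.
  by have := sin_geN1 `|u|; move: u1; lra.
suff : `|u| ^+ 3 <= `|u| by have := normr_ge0 u; lra.
by rewrite exprS ler_piMr// expr_le1.
Qed.

Lemma sin_quad u : `|sin u - u| <= 2 * u ^+ 2.
Proof.
have [u1|u1] := leP `|u| 1.
  apply: le_trans (sin_cubic u) _; rewrite -(real_normK (num_real u)) exprS.
  apply: (@le_trans _ _ (1 * `|u| ^+ 2)); first by rewrite ler_wpM2r.
  by rewrite ler_wpM2r// ler1n.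
apply: le_trans (sin_linear u) _; rewrite ler_wpM2l//.
by rewrite -(real_normK (num_real u)) expr2 ler_peMl// ltW.
Qed.

Lemma abs_sin_le u : `|sin u| <= `|u|.
Proof.
have H (v : R) : 0 <= v -> `|sin v| <= v.
  move=> v0; rewrite ler_norml; have := sub_sin_ge0 v0; rewrite subr_ge0 => ->.
  rewrite andbT; have [v1|v1] := leP v 1; last by have := sin_geN1 v; move: v1; lra.
  have := sin_ge_cubic v0; suff : v ^+ 3 <= v by move: v0; lra.
  by rewrite exprS ler_piMr// expr_le1.
have [u0|u0] := leP 0 u; first by rewrite (ger0_norm u0) H.
by rewrite (ltr0_norm u0) -normrN -sinN H// oppr_ge0 ltW.
Qed.

Lemma cos_quad u : 1 - cos u <= u ^+ 2 / 2.
Proof.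
have := cos_ge_quad (normr_ge0 u); rewrite cos_abs real_normK ?num_real//; lra.
Qed.

Lemma cos_linear u : `|cos u - 1| <= `|u|.
Proof.
rewrite distrC ger0_norm ?cosB1_ge0//; have [u2|u2] := leP `|u| 2.
  apply: le_trans (cos_quad u) _; rewrite -(real_normK (num_real u)) expr2 -mulrA.
  by rewrite ler_piMr// ler_pdivrMr// mul1r.
by have := cos_geN1 u; move: u2; lra.
Qed.

Lemma cos_cubic u : `|cos u - 1 + u ^+ 2 / 2| <= `|u| ^+ 3.
Proof.
have u2 : u ^+ 2 = `|u| ^+ 2 by rewrite real_normK// num_real.
rewrite u2 -cos_abs ger0_norm ?cos_ge_quad//.
have [u1|u1] := leP `|u| 1.
  have := cos_ge_quartic (normr_ge0 u).
  suff : `|u| ^+ 4 <= `|u| ^+ 3 by have := exprn_ge0 3 (normr_ge0 u); lra.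
  by rewrite exprSr ler_piMr// exprn_ge0.
apply: (@le_trans _ _ (`|u| ^+ 2)); last by rewrite [leRHS]exprSr ler_peMr ?exprn_ge0// ltW.
by have := cos_le1 `|u|; have := exprn_ge0 2 (normr_ge0 u); lra.
Qed.

Lemma sin_jordan x : 0 <= x -> x <= pi / 2 -> x / 3 <= sin x.
Proof.
move=> x0 xpi; have := sin_ge_cubic x0.
suff : x ^+ 3 <= 4 * x by lra.
have x2 : x <= 2 by have /andP[_] := @pihalf_02 R; move: xpi; lra.
rewrite exprSr ler_wpM2r// (_ : 4 = 2 ^+ 2); last by rewrite expr2; lra.
by rewrite ler_pXn2r ?nnegrE.
Qed.

Lemma sin_half_sqr (t : R) : - pi <= t <= pi -> t ^+ 2 / 36 <= sin (t / 2) ^+ 2.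
Proof.
have H (v : R) : 0 <= v -> v <= pi -> v ^+ 2 / 36 <= sin (v / 2) ^+ 2.
  move=> v0 vpi; have : v / 2 / 3 <= sin (v / 2).
    by apply: sin_jordan; move: v0 vpi; lra.
  have -> : v ^+ 2 / 36 = (v / 2 / 3) ^+ 2 by field.
  by move=> h; rewrite ler_pXn2r ?nnegrE//; move: v0 h; lra.
move=> /andP[t1 t2]; have [t0|t0] := leP 0 t; first exact: H.
by rewrite -sqrrN -[X in _ <= X]sqrrN -sinN -mulNr H//; move: t0 t1; lra.
Qed.

Lemma expR_quad x : `|x| <= 2^-1 -> `|expR x - 1 - x| <= 2 * x ^+ 2.
Proof.
rewrite ler_norml => /andP[x1 x2]; rewrite ger0_norm; last first.
  by have := expR_ge1Dx x; lra.
have x3 : 0 < 1 - x by move: x2; lra.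
have : expR x <= (1 - x)^-1.
  rewrite -[x]opprK expRN opprK lef_pV2 ?posrE ?expR_gt0//.
  exact: expR_ge1Dx.
suff : (1 - x)^-1 - 1 - x <= 2 * x ^+ 2 by lra.
have -> : (1 - x)^-1 - 1 - x = x ^+ 2 / (1 - x) by field; rewrite gt_eqF.
rewrite ler_pdivrMr// mulrAC ler_peMl ?sqr_ge0//; move: x2; lra.
Qed.

Lemma expRN_quad y : 0 <= y -> `|expR (- y) - 1 + y| <= 2 * y ^+ 2.
Proof.
move=> y0; have [y1|y1] := leP y 2^-1.
  have := @expR_quad (- y); rewrite normrN ger0_norm// opprK sqrrN; exact.
rewrite ger0_norm; last by have := expR_ge1Dx (- y); lra.
have e1 : expR (- y) <= 1 by rewrite -expR0 ler_expR oppr_le0.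
apply: (@le_trans _ _ y); first by move: e1; lra.
by rewrite expr2 mulrA ler_peMl//; move: y1; lra.
Qed.

Lemma ln_quad x : `|x| <= 2^-1 -> `|ln (1 + x) - x| <= 2 * x ^+ 2.
Proof.
rewrite ler_norml => /andP[x1 x2].
have x3 : 0 < 1 + x by move: x1; lra.
rewrite distrC ger0_norm; last by rewrite subr_ge0 le_ln1Dx//; move: x1; lra.
have : ln (1 + x)^-1 <= (1 + x)^-1 - 1.
  have i0 : 0 < (1 + x)^-1 by rewrite invr_gt0.
  have := @le_ln1Dx R ((1 + x)^-1 - 1); rewrite [1 + (_ - 1)]addrC subrK; apply.
  by move: i0; lra.
rewrite lnV ?posrE//.
suff : (1 + x)^-1 - 1 + x <= 2 * x ^+ 2 by lra.
have -> : (1 + x)^-1 - 1 + x = x ^+ 2 / (1 + x) by field; rewrite gt_eqF.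
rewrite ler_pdivrMr// mulrAC ler_peMl ?sqr_ge0//; move: x1; lra.
Qed.

End RealBounds.

Notation cabs := (@ComplexField.Normc.normc _).

Section Modulus.
Context {R : realType}.
Implicit Types (x y z a b : R[i]).
Local Notation Re := complex.Re.
Local Notation Im := complex.Im.

Lemma cabsE z : `|z| = (cabs z)%:C.
Proof. by rewrite normc_def; case: z. Qed.

Lemma cabs_ge0 z : 0 <= cabs z. Proof. by case: z => ? ?; exact: sqrtr_ge0. Qed.

Lemma cabsM x y : cabs (x * y) = cabs x * cabs y.
Proof. exact: ComplexField.Normc.normcM. Qed.

Lemma cabsV x : cabs x^-1 = (cabs x)^-1.
Proof. exact: ComplexField.Normc.normcV. Qed.

Lemma cabsN x : cabs (- x) = cabs x. Proof. exact: normcN. Qed.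

Lemma cabs0 : cabs (0 : R[i]) = 0. Proof. exact: ComplexField.Normc.normc0. Qed.
Lemma cabs1 : cabs (1 : R[i]) = 1. Proof. exact: ComplexField.Normc.normc1. Qed.

Lemma ler_cabsD x y : cabs (x + y) <= cabs x + cabs y. Proof. exact: le_normcD. Qed.

Lemma ler_cabsB x y : cabs (x - y) <= cabs x + cabs y.
Proof. by rewrite -(cabsN y); exact: ler_cabsD. Qed.

Lemma cabs_distC x y : cabs (x - y) = cabs (y - x).
Proof. by rewrite -cabsN opprB. Qed.

Lemma lerB_cabs x y : cabs x - cabs y <= cabs (x - y).
Proof. by rewrite lerBlDr; apply: le_trans (ler_cabsD _ _); rewrite subrK. Qed.

Lemma cabs_real (r : R) : cabs r%:C = `|r|.
Proof. by rewrite /= expr0n addr0 sqrtr_sqr. Qed.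

Lemma natc n : n%:R = (n%:R : R)%:C :> R[i]. Proof. by rewrite rmorph_nat. Qed.

Lemma cabs_nat n : cabs (n%:R : R[i]) = n%:R.
Proof. by rewrite natc cabs_real ger0_norm. Qed.

Lemma cabsX x n : cabs (x ^+ n) = cabs x ^+ n.
Proof. by elim: n => [|n IH]; rewrite ?cabs1// !exprS cabsM IH. Qed.

Lemma ler_cabs_sum (I : Type) (r : seq I) (Q : pred I) (F : I -> R[i]) :
  cabs (\sum_(i <- r | Q i) F i) <= \sum_(i <- r | Q i) cabs (F i).
Proof.
elim/big_rec2: _ => [|i y1 y2 _ H]; first by rewrite cabs0.
by apply: le_trans (ler_cabsD _ _) _; rewrite lerD2l.
Qed.

Lemma cabs_sqr z : cabs z ^+ 2 = Re z ^+ 2 + Im z ^+ 2.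
Proof. by case: z => x y; rewrite /= sqr_sqrtr// addr_ge0// sqr_ge0. Qed.

Lemma abs_Re_le z : `|Re z| <= cabs z.
Proof.
rewrite -(ler_pXn2r (_ : 0 < 2)%N) ?nnegrE ?cabs_ge0//.
by rewrite cabs_sqr real_normK ?num_real// lerDl sqr_ge0.
Qed.

Lemma abs_Im_le z : `|Im z| <= cabs z.
Proof.
rewrite -(ler_pXn2r (_ : 0 < 2)%N) ?nnegrE ?cabs_ge0//.
by rewrite cabs_sqr real_normK ?num_real// lerDr sqr_ge0.
Qed.

Lemma cabs_le_ReIm z : cabs z <= `|Re z| + `|Im z|.
Proof.
rewrite -(ler_pXn2r (_ : 0 < 2)%N) ?nnegrE ?cabs_ge0 ?addr_ge0//.
rewrite cabs_sqr sqrrD !real_normK ?num_real// addrAC lerDl.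
by rewrite mulrn_wge0// mulr_ge0.
Qed.

Lemma cabs_eq0 z : (cabs z == 0) = (z == 0).
Proof.
apply/eqP/eqP => [/ComplexField.Normc.eq0_normc//|->]; exact: cabs0.
Qed.

Lemma cabs_gt0 z : (0 < cabs z) = (z != 0).
Proof. by rewrite lt_neqAle cabs_ge0 andbT eq_sym cabs_eq0. Qed.

Lemma cexpD x y : cexp (x + y) = cexp x * cexp y.
Proof.
case: x => a b; case: y => c d; rewrite /cexp /= expRD cosD sinD.
by apply/eqP; rewrite eq_complex /=; apply/andP; split; apply/eqP; ring.
Qed.

Lemma cexp0 : cexp (0 : R[i]) = 1.
Proof. by rewrite /cexp /= expR0 cos0 sin0 mul1r. Qed.

Lemma cabs_cexp z : cabs (cexp z) = expR (Re z).
Proof.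
rewrite /cexp cabsM cabs_real gtr0_norm ?expR_gt0// [X in _ * X]/=.
by rewrite cos2Dsin2 sqrtr1 mulr1.
Qed.

Lemma cexp_neq0 z : cexp z != 0.
Proof. by rewrite -cabs_gt0 cabs_cexp expR_gt0. Qed.

Lemma cexpN z : cexp (- z) = (cexp z)^-1.
Proof.
apply: (mulfI (cexp_neq0 z)); rewrite -cexpD subrr cexp0 mulfV//.
exact: cexp_neq0.
Qed.

Lemma cexp_real (r : R) : cexp r%:C = (expR r)%:C.
Proof. by rewrite /cexp/= cos0 sin0 mulr1. Qed.

Lemma cexp_quad z : cabs z <= 2^-1 -> cabs (cexp z - 1 - z) <= 4 * cabs z ^+ 2.
Proof.
move=> z1; apply: le_trans (cabs_le_ReIm _) _; rewrite cabs_sqr.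
have x1 := le_trans (abs_Re_le z) z1; have y1 := le_trans (abs_Im_le z) z1.
case: z {z1} x1 y1 => x y /= x1 y1; rewrite !mul0r subr0 addr0 oppr0 addr0.
have ex := expR_quad x1; have ey := sin_quad y; have cy := cos_quad y.
have cy0 := cosB1_ge0 y.
have xx : x ^+ 2 <= 4^-1.
  rewrite -(real_normK (num_real x)) (_ : 4^-1 = 2^-1 ^+ 2); last by field.
  by rewrite ler_pXn2r ?nnegrE ?invr_ge0.
have e2 : expR x <= 2.
  by move: ex x1 xx; rewrite !ler_norml => /andP[_ +] /andP[_]; lra.
have e1 : `|expR x - 1| <= 2 * `|x|.
  have -> : expR x - 1 = (expR x - 1 - x) + x by ring.
  apply: le_trans (ler_normD _ _) _; rewrite mulr_natl mulr2n lerD2r.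
  apply: le_trans ex _; rewrite -(real_normK (num_real x)) expr2 mulrA.
  by rewrite ler_piMl//; move: x1; lra.
have eR : `|expR x * cos y - 1 - x| <= 2 * x ^+ 2 + y ^+ 2.
  have -> : expR x * cos y - 1 - x = (expR x - 1 - x) - expR x * (1 - cos y) by ring.
  apply: le_trans (ler_normB _ _) _; apply: lerD => //.
  rewrite normrM (ger0_norm cy0) (ger0_norm (expR_ge0 _)).
  apply: (@le_trans _ _ (2 * (y ^+ 2 / 2))); last by rewrite mulrCA mulfV// mulr1.
  by apply: ler_pM => //; exact: expR_ge0.
have eI : `|expR x * sin y - y| <= x ^+ 2 + 3 * y ^+ 2.
  have -> : expR x * sin y - y = (expR x - 1) * sin y + (sin y - y) by ring.
  apply: le_trans (ler_normD _ _) _.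
  have : `|expR x - 1| * `|sin y| <= 2 * `|x| * `|y|.
    by apply: ler_pM => //; exact: abs_sin_le.
  have : 2 * `|x| * `|y| <= x ^+ 2 + y ^+ 2.
    rewrite -(real_normK (num_real x)) -(real_normK (num_real y)).
    have := sqr_ge0 (`|x| - `|y|); rewrite sqrrB; lra.
  rewrite normrM; move: ey; lra.
by have := sqr_ge0 x; have := sqr_ge0 y; move: eR eI; lra.
Qed.

Lemma cexp_linear z : cabs z <= 2^-1 -> cabs (cexp z - 1) <= 3 * cabs z.
Proof.
move=> z1; have -> : cexp z - 1 = (cexp z - 1 - z) + z by rewrite subrK.
apply: le_trans (ler_cabsD _ _) _.
suff : 4 * cabs z ^+ 2 <= 2 * cabs z by have := cexp_quad z1; lra.
by rewrite expr2 mulrA ler_wpM2r ?cabs_ge0//; move: z1; lra.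
Qed.

Lemma npowD n a b : npow n (a + b) = npow n a * npow n b.
Proof. by rewrite /npow mulrDl cexpD. Qed.

Lemma npow_neq0 n a : npow n a != 0. Proof. exact: cexp_neq0. Qed.

Lemma npowN n a : npow n (- a) = (npow n a)^-1.
Proof. by rewrite /npow mulNr cexpN. Qed.

Lemma npow_real n (r : R) : (0 < n)%N -> npow n r%:C = (n%:R `^ r)%:C.
Proof.
move=> n0; rewrite /npow -rmorphM cexp_real; congr (_%:C).
by rewrite /powR pnatr_eq0 gtn_eqF.
Qed.

Lemma npow_id n : (0 < n)%N -> npow n (1 : R[i]) = n%:R.
Proof. by move=> n0; rewrite (npow_real 1 n0) powRr1// natc. Qed.

Lemma cabs_npow n a : (0 < n)%N -> cabs (npow n a) = n%:R `^ Re a.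
Proof.
move=> n0; rewrite /npow cabs_cexp /powR pnatr_eq0 gtn_eqF//; congr expR.
by case: a => a b /=; rewrite mulr0 subr0.
Qed.

Lemma npowM m n a : (0 < m)%N -> (0 < n)%N -> npow (m * n) a = npow m a * npow n a.
Proof.
by move=> m0 n0; rewrite /npow -cexpD -mulrDr -rmorphD natrM lnM// posrE ltr0n.
Qed.

Lemma npow_ratio m n a :
  npow m a = npow n a * cexp (a * (ln (m%:R : R) - ln n%:R)%:C).
Proof. by rewrite /npow -cexpD -mulrDr -rmorphD addrC subrK. Qed.

End Modulus.

(** * Limits of complex functions *)

Section ComplexTopology.
Context {R : realType}.

(** Reduces convergence in the complex plane to real inequalities on the modulus [cabs]. *)
Lemma cvgcP {T} (F : set_system T) {FF : Filter F} (f : T -> R[i]) (l : R[i]) :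
  f @ F --> l <-> forall e : R, 0 < e -> \forall x \near F, cabs (f x - l) < e.
Proof.
have H : f @ F --> l <-> forall e : R[i], 0 < e -> \forall x \near F, `|l - f x| < e.
  exact: (@cvgrPdist_lt _ (R[i])^o).
split=> [/H fl e e0|h].
  have /fl : 0 < e%:C by rewrite ltcR.
  by apply: filterS => x; rewrite cabsE ltcR cabs_distC.
apply/H => e e0; have eE : e = (complex.Re e)%:C.
  by move: e0; rewrite ltcE/= => /andP[/eqP i0 _]; case: e i0 => a b /= ->.
have /h : 0 < complex.Re e by move: e0; rewrite ltcE => /andP[].
by apply: filterS => x; rewrite cabs_distC eE cabsE ltcR.
Qed.

Lemma hausdorffc : hausdorff_space R[i].
Proof. exact: (@norm_hausdorff _ (R[i])^o). Qed.

Lemma nbhscP (z : R[i]) (A : set R[i]) :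
  nbhs z A <-> exists2 d : R, 0 < d & forall w, cabs (w - z) < d -> A w.
Proof.
split=> [|[d d0 dA]].
  move=> /(@nbhs_ballP _ (R[i])^o)[e /= e0 eA].
  have eE : e = (complex.Re e)%:C.
    by move: e0; rewrite ltcE/= => /andP[/eqP i0 _]; case: e i0 {eA} => a b /= ->.
  exists (complex.Re e); first by move: e0; rewrite ltcE => /andP[].
  move=> w wz; apply: eA; rewrite -ball_normE/= cabsE cabs_distC eE ltcR.
  exact: wz.
apply/(@nbhs_ballP _ (R[i])^o); exists d%:C; first by rewrite /= ltcR.
by move=> w; rewrite -ball_normE/= cabsE cabs_distC ltcR => /dA.
Qed.

Lemma complete_cabs (u : nat -> R[i]) :
  (forall e, 0 < e -> exists N, forall n, (N <= n)%N -> cabs (u n - u N) < e) ->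
  exists l : R[i], u @ \oo --> l.
Proof.
move=> cu.
have H (F : R[i] -> R) : (forall x y, F (x - y) = F x - F y) ->
    (forall z, `|F z| <= cabs z) -> exists l : R, (F \o u) @ \oo --> l.
  move=> FB Fle; have : cauchy ((F \o u) @ \oo).
    apply: cauchy_exP => e e0; have [N uN] := cu _ e0.
    exists (F (u N)); exists N => // n /uN un.
    rewrite -ball_normE/= distrC -FB; exact: le_lt_trans (Fle _) un.
  by move=> /cauchy_cvg cF; exists (lim ((F \o u) @ \oo)).
have [a ua] := H (@complex.Re R) ltac:(by move=> [? ?] [? ?]) (@abs_Re_le R).
have [b ub] := H (@complex.Im R) ltac:(by move=> [? ?] [? ?]) (@abs_Im_le R).
exists (a +i* b); apply/cvgcP => e e0.
have e2 : 0 < e / 2 by rewrite divr_gt0.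
move/cvgrPdist_lt : ua => /(_ _ e2) ua; move/cvgrPdist_lt : ub => /(_ _ e2) ub.
near=> n; apply: le_lt_trans (cabs_le_ReIm _) _.
have ur : `|a - complex.Re (u n)| < e / 2 by near: n; exact: ua.
have ui : `|b - complex.Im (u n)| < e / 2 by near: n; exact: ub.
move: ur ui; case: (u n) => x y /=; rewrite (distrC a) (distrC b); lra.
Unshelve. all: by end_near. Qed.

Lemma cvg_cabs_le {T} (F : set_system T) {FF : ProperFilter F} (f : T -> R[i]) l c (M : R) :
  f @ F --> l -> (\forall x \near F, cabs (f x - c) <= M) -> cabs (l - c) <= M.
Proof.
move=> /cvgcP fl fM; apply/ler_addgt0Pr => e e0.
have {}fl := fl _ e0; near F => x.
have -> : l - c = (f x - c) - (f x - l) by ring.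
apply: le_trans (ler_cabsB _ _) _; apply: lerD; first by near: x.
by apply: ltW; near: x.
Unshelve. all: by end_near. Qed.

Lemma continuous_cexp : continuous (cexp : R[i] -> R[i]).
Proof.
move=> z; apply/(@cvgcP _ _ (nbhs_filter z)) => e e0; pose k := 3 * cabs (cexp z) + 1.
have k0 : 0 < k by rewrite ltr_wpDl// mulr_ge0// cabs_ge0.
apply/nbhscP; exists (Num.min 2^-1 (e / k)).
  by rewrite lt_min invr_gt0 ltr0n divr_gt0.
move=> w; rewrite lt_min => /andP[w1 w2].
have -> : cexp w - cexp z = cexp z * (cexp (w - z) - 1).
  by rewrite mulrBr -cexpD mulr1 [z + _]addrC subrK.
rewrite cabsM; have h := cexp_linear (ltW w1).
apply: le_lt_trans (ler_wpM2l (cabs_ge0 _) h) _.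
rewrite mulrCA; move: w2; rewrite ltr_pdivlMr// => w2.
apply: le_lt_trans w2; rewrite mulrA [leRHS]mulrC ler_wpM2r ?cabs_ge0// /k.
by rewrite lerDl.
Qed.

Lemma continuous_npow n : continuous (npow n : R[i] -> R[i]).
Proof.
move=> z; apply: (@cvg_comp _ _ _ (fun a : R[i] => a * (ln n%:R)%:C) cexp);
  last exact: continuous_cexp.
apply: (@cvgM R[i] _ (nbhs z) _ id (fun=> (ln n%:R)%:C)); first exact: cvg_id.
exact: cvg_cst.
Qed.

End ComplexTopology.

(** * The reciprocal Gamma function and rising factorials *)

Section Gauss.
Context {R : realType}.
Implicit Types (z x y : R[i]) (n m : nat) (M d : R).

(** The products in the limit formula for [1 / Gamma]. *)
Definition gauss_prod n z : R[i] :=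
  (\prod_(k < n.+1) (z + k%:R)) / ((n`!)%:R * npow n z).

Lemma rGammaE z : rGamma z = limn (fun n => gauss_prod n z).
Proof. by []. Qed.

(** The coefficient of [z^n] in [(1 - z)^(-x)]. *)
Definition rising n z : R[i] := (\prod_(k < n) (z + k%:R)) / (n`!)%:R.

Lemma fact_neq0c n : (n`!)%:R != 0 :> R[i].
Proof. by rewrite pnatr_eq0 gtn_eqF// fact_gt0. Qed.

Lemma rising0 z : rising 0 z = 1.
Proof. by rewrite /rising big_ord0 fact0 divr1. Qed.

Lemma risingS n z : n.+1%:R * rising n.+1 z = (z + n%:R) * rising n z.
Proof.
rewrite /rising big_ord_recr/= factS natrM.
have n0 : n.+1%:R != 0 :> R[i] by rewrite pnatr_eq0.
have E (a b c e : R[i]) : a != 0 -> b != 0 -> a * (c * e / (a * b)) = e * (c / b).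
  by move=> a0 b0; field; rewrite a0 b0.
by apply: E => //; exact: fact_neq0c.
Qed.

Lemma rising1 n : rising n 1 = 1.
Proof.
elim: n => [|n IH]; first exact: rising0.
have n0 : n.+1%:R != 0 :> R[i] by rewrite pnatr_eq0.
by apply: (mulfI n0); rewrite risingS IH -natr1 addrC.
Qed.

(** The coefficient identity of [(1 - z)^(-x) (1 - z)^(-y) = (1 - z)^(-x-y)]; by induction
   from [risingS]. *)
Lemma vandermonde n x y :
  \sum_(k < n.+1) rising k x * rising (n - k) y = rising n (x + y).
Proof.
elim: n => [|n IH]; first by rewrite big_ord1 !rising0 mul1r.
have n0 : n.+1%:R != 0 :> R[i] by rewrite pnatr_eq0.
apply: (mulfI n0); rewrite risingS -IH mulr_sumr.
transitivity (\sum_(k < n.+2) k%:R * rising k x * rising (n.+1 - k) y +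
   \sum_(k < n.+2) rising k x * ((n.+1 - k)%:R * rising (n.+1 - k) y)).
  rewrite -big_split/=; apply: eq_bigr => k _.
  by rewrite natrB -1?ltnS//; ring.
rewrite big_ord_recl mul0r mul0r add0r [X in _ + X]big_ord_recr/= subnn mul0r mulr0 addr0.
rewrite -big_split/= mulr_sumr; apply: eq_bigr => k _.
have kn : (k <= n)%N by rewrite -ltnS.
rewrite /bump/= ?add1n subSS risingS subSn// risingS natrB//; ring.
Qed.

Lemma sum_rising n x : \sum_(k < n.+1) rising k x = rising n (x + 1).
Proof. by rewrite -vandermonde; apply: eq_bigr => k _; rewrite rising1 mulr1. Qed.

Lemma risingE n z : (z + n%:R) * rising n z = gauss_prod n z * npow n z.
Proof.
rewrite /rising /gauss_prod big_ord_recr/= invfM.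
by field; rewrite fact_neq0c npow_neq0.
Qed.

Lemma rising_shift n z : z * rising n (z + 1) = gauss_prod n z * npow n z.
Proof.
rewrite /rising /gauss_prod big_ord_recl/= addr0 invfM.
rewrite [in RHS](eq_bigr (fun k : 'I_n => z + 1 + k%:R)); last first.
  by move=> k _; rewrite /bump/= add1n -natr1; ring.
by field; rewrite fact_neq0c npow_neq0.
Qed.

(** Consecutive products have ratio [(1 + z/(n+1)) exp(z ln(n/(n+1)))], in which the terms
   of first order cancel. *)
Lemma gauss_prod_step M : 1 <= M -> forall n, 4 * M <= n.+1%:R -> forall z, cabs z <= M ->
  exists2 eta, gauss_prod n.+1 z = gauss_prod n z * (1 + eta) &
    cabs eta <= 40 * M ^+ 2 / n.+1%:R ^+ 2.
Proof.
move=> M1 n nM z zM; pose x : R := n.+1%:R^-1.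
have x0 : 0 < x by rewrite invr_gt0.
have Mx : M * x <= 4^-1.
  by rewrite /x ler_pdivrMr// ler_pdivlMl// mulrC mulrC.
have x4 : x <= 4^-1 by apply: le_trans Mx; rewrite ler_peMl// ltW.
have n0 : (0 < n)%N.
  by rewrite -(ltr_nat R); have := nM; rewrite -natr1; move: M1; lra.
pose l := ln (1 - x).
have lx : `|l + x| <= 2 * x ^+ 2.
  have := @ln_quad R (- x); rewrite opprK sqrrN normrN gtr0_norm//; apply.
  by move: x4; lra.
have lE : ln n%:R - ln n.+1%:R = l.
  rewrite /l -ln_div ?posrE ?ltr0n//; congr ln; rewrite /x -natr1.
  by field; rewrite natr1 pnatr_eq0.
have xx : x ^+ 2 <= x / 4 by rewrite expr2 ler_wpM2l// ltW.
have l2 : `|l| <= 2 * x.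
  have -> : l = (l + x) - x by rewrite addrK.
  by apply: le_trans (ler_normB _ _) _; rewrite (gtr0_norm x0); move: lx xx x0; lra.
pose r := cexp (z * l%:C) - 1 - z * l%:C.
have zl : cabs (z * l%:C) <= 2 * (M * x).
  rewrite cabsM cabs_real [leRHS]mulrCA; apply: ler_pM => //; exact: cabs_ge0.
have rle : cabs r <= 16 * (M * x) ^+ 2.
  apply: le_trans (cexp_quad _) _; first by apply: le_trans zl _; move: Mx; lra.
  have -> : 16 * (M * x) ^+ 2 = 4 * (2 * (M * x)) ^+ 2 by ring.
  by rewrite ler_wpM2l// ler_pXn2r ?nnegrE ?cabs_ge0// mulr_ge0// mulr_ge0 ?(ltW x0)//; move: M1; lra.
exists ((1 + z * x%:C) * (1 + z * l%:C + r) - 1); last first.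
  have -> : (1 + z * x%:C) * (1 + z * l%:C + r) - 1 =
    z * (l + x)%:C + z * x%:C * (z * l%:C) + (1 + z * x%:C) * r.
    by rewrite rmorphD; ring.
  have zx : cabs (z * x%:C) <= M * x.
    by rewrite cabsM cabs_real gtr0_norm// ler_wpM2r// ltW.
  apply: le_trans (ler_cabsD _ _) _.
  have t1 : cabs (z * (l + x)%:C) <= 2 * (M * x) ^+ 2.
    rewrite cabsM cabs_real; apply: (@le_trans _ _ (M * (2 * x ^+ 2))).
      by apply: ler_pM => //; exact: cabs_ge0.
    rewrite exprMn mulrCA ler_wpM2l// ler_wpM2r ?sqr_ge0// expr2 ler_peMl//.
    by move: M1; lra.
  have t2 : cabs (z * x%:C * (z * l%:C)) <= 2 * (M * x) ^+ 2.
    rewrite cabsM; apply: (@le_trans _ _ ((M * x) * (2 * (M * x)))).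
      by apply: ler_pM => //; exact: cabs_ge0.
    by rewrite expr2; lra.
  have t3 : cabs ((1 + z * x%:C) * r) <= 2 * (16 * (M * x) ^+ 2).
    rewrite cabsM; apply: ler_pM; rewrite ?cabs_ge0//.
    apply: le_trans (ler_cabsD _ _) _; rewrite cabs1; move: zx Mx; lra.
  have -> : 40 * M ^+ 2 / n.+1%:R ^+ 2 = 40 * (M * x) ^+ 2.
    by rewrite exprMn [x ^+ 2]exprVn [RHS]mulrA.
  have := ler_cabsD (z * (l + x)%:C) (z * x%:C * (z * l%:C)).
  have := sqr_ge0 (M * x); move: t1 t2 t3; lra.
have -> : 1 + z * l%:C + r = cexp (z * l%:C) by rewrite /r; ring.
have -> : cexp (z * l%:C) = npow n z / npow n.+1 z.
  by rewrite -lE rmorphB mulrBr cexpD cexpN.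
rewrite /gauss_prod [in LHS]big_ord_recr/= factS natrM [1 + (_ - 1)]addrC subrK.
have n1 : n.+1%:R != 0 :> R[i] by rewrite pnatr_eq0.
have -> : x%:C = (n.+1%:R)^-1 by rewrite /x fmorphV rmorph_nat.
have E (Q N F a b : R[i]) : N != 0 -> F != 0 -> a != 0 -> b != 0 ->
    Q * (z + N) / (N * F * b) = Q / (F * a) * ((1 + z / N) * (a / b)).
  by move=> N0 F0 a0 b0; field; rewrite N0 F0 a0 b0.
by apply: E; rewrite ?npow_neq0 ?fact_neq0c.
Qed.

(** The product of the factors [1 + eta] converges, since their distances from [1] are
   summable. *)
Lemma gauss_prod_ratio M : 1 <= M -> exists2 C, 0 < C & exists N, (0 < N)%N /\
  forall n, (N <= n)%N -> forall m, (n <= m)%N -> forall z, cabs z <= M ->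
  exists2 P, gauss_prod m z = gauss_prod n z * P & cabs (P - 1) <= C / n%:R.
Proof.
move=> M1; pose C := 40 * M ^+ 2; exists (2 * C).
  have M0 : 0 < M by move: M1; lra.
  by rewrite mulr_gt0// /C mulr_gt0// exprn_gt0.
have C0 : 0 <= C by rewrite mulr_ge0// sqr_ge0.
have C20 : 0 <= 2 * C by rewrite mulr_ge0.
exists (Num.truncn (2 * C + 4 * M)).+1; split=> // n nN m nm z zM.
have nC : 2 * C + 4 * M <= n%:R.
  apply/ltW/(lt_le_trans (truncnS_gt _)); by rewrite ler_nat.
have n0 : (0 < n)%N by exact: leq_trans nN.
have n0R : 0 < n%:R :> R by rewrite ltr0n.
suff [P -> PC] : exists2 P, gauss_prod m z = gauss_prod n z * P &
    cabs (P - 1) <= 2 * C * (n%:R^-1 - m%:R^-1).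
  exists P => //; apply: le_trans PC _; rewrite ler_wpM2l//.
  by rewrite lerBlDr lerDl invr_ge0.
elim: m nm => [|m IH]; first by rewrite leqNgt n0.
rewrite leq_eqVlt => /predU1P[<-|].
  by exists 1; rewrite ?mulr1// !subrr cabs0 mulr0.
rewrite ltnS => nm; have [P PE PC] := IH nm.
have mM : 4 * M <= m.+1%:R.
  have : n%:R <= m.+1%:R :> R by rewrite ler_nat leqW.
  by move: nC C0; lra.
have [eta etaE etaC] := gauss_prod_step M1 mM zM.
exists (P * (1 + eta)); first by rewrite etaE PE mulrA.
have m0 : (0 < m)%N := leq_trans n0 nm.
have m0R : 0 < m%:R :> R by rewrite ltr0n.
have mV : 0 < (m%:R : R)^-1 by rewrite invr_gt0.
have P1 : cabs P <= 2.
  have -> : P = (P - 1) + 1 by rewrite subrK.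
  apply: le_trans (ler_cabsD _ _) _; rewrite cabs1.
  suff : 2 * C * (n%:R^-1 - m%:R^-1) <= 1 by move: PC; lra.
  apply: (@le_trans _ _ (2 * C / n%:R)).
    by rewrite ler_wpM2l// lerBlDr lerDl ltW.
  by rewrite ler_pdivrMr// mul1r; move: nC M1; lra.
have -> : P * (1 + eta) - 1 = (P - 1) + P * eta by ring.
apply: le_trans (ler_cabsD _ _) _.
have h1 : cabs (P * eta) <= 2 * (C / m.+1%:R ^+ 2).
  by rewrite cabsM; apply: ler_pM; rewrite ?cabs_ge0.
have h2 : (m.+1%:R ^+ 2)^-1 <= m%:R^-1 - m.+1%:R^-1 :> R.
  have m1 : m%:R + 1 != 0 :> R by rewrite gt_eqF// ltr_wpDl// ltW.
  have -> : m%:R^-1 - m.+1%:R^-1 = (m%:R * m.+1%:R)^-1 :> R.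
    by rewrite -natr1; field; rewrite m1 gt_eqF.
  rewrite lef_pV2 ?posrE ?exprn_gt0 ?mulr_gt0 ?ltr0n ?m0//.
  by rewrite expr2 ler_wpM2r// ler_nat.
have h3 := ler_wpM2l C20 h2.
have G (a b c d e f g : R) : a <= c * (d - e) -> b <= c * f -> c * f <= c * (e - g) ->
    a + b <= c * (d - g) by rewrite !mulrBr; lra.
by apply: G PC _ h3; rewrite -mulrA.
Qed.

Lemma gauss_limit M : 1 <= M -> exists2 C, 0 < C & exists N, (0 < N)%N /\
  forall n, (N <= n)%N -> forall z, cabs z <= M ->
  cabs (rGamma z - gauss_prod n z) <= cabs (gauss_prod n z) * (C / n%:R).
Proof.
move=> /gauss_prod_ratio[C C0 [N [N0 H]]]; exists C => //; exists N; split=> //.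
have D n : (N <= n)%N -> forall m, (n <= m)%N -> forall z, cabs z <= M ->
    cabs (gauss_prod m z - gauss_prod n z) <= cabs (gauss_prod n z) * (C / n%:R).
  move=> Nn m nm z zM; have [P -> PC] := H _ Nn _ nm _ zM.
  by rewrite -{2}(mulr1 (gauss_prod n z)) -mulrBr cabsM ler_wpM2l ?cabs_ge0.
move=> n Nn z zM.
suff cz : (gauss_prod ^~ z) @ \oo --> rGamma z.
  apply: (cvg_cabs_le cz); exists n => // m /= nm; exact: D.
have [|l ul] := @complete_cabs R (gauss_prod ^~ z); last first.
  by rewrite rGammaE (cvg_lim hausdorffc ul).
move=> e e0; pose B := cabs (gauss_prod N z) * (1 + C).
have BB m : (N <= m)%N -> cabs (gauss_prod m z) <= B.
  move=> Nm; have := D _ (leqnn N) _ Nm _ zM.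
  have := lerB_cabs (gauss_prod m z) (gauss_prod N z).
  have : C / N%:R <= C by rewrite ler_pdivrMr ?ltr0n// ler_peMr ?(ltW C0)// ler1n.
  move=> /(ler_wpM2l (cabs_ge0 (gauss_prod N z))); rewrite /B mulrDr; lra.
have B0 : 0 <= B by apply: le_trans (BB _ (leqnn _)); exact: cabs_ge0.
pose K := maxn N (Num.truncn (B * C / e)).+1.
have K0 : 0 < K%:R :> R by rewrite ltr0n leq_max N0.
exists K => m Km; apply: le_lt_trans (D _ (leq_maxl _ _) _ Km _ zM) _.
apply: (@le_lt_trans _ _ (B * (C / K%:R))).
  by apply: ler_wpM2r; [rewrite divr_ge0// ltW|apply: BB; exact: leq_maxl].
rewrite mulrA ltr_pdivrMr// -ltr_pdivrMl// [e^-1 * _]mulrC.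
apply: lt_le_trans (truncnS_gt _) _; by rewrite ler_nat; exact: leq_maxr.
Qed.

Lemma gauss_prod_bound M : 1 <= M -> exists2 B, 0 < B & exists N, (0 < N)%N /\
  forall n, (N <= n)%N -> forall z, cabs z <= M -> cabs (gauss_prod n z) <= B.
Proof.
move=> M1; have [C C0 [N [N0 H]]] := gauss_prod_ratio M1.
have M0 : 0 <= M by apply: le_trans M1.
pose B0 := (\prod_(k < N.+1) (M + k%:R)) / ((N`!)%:R) * N%:R `^ M.
have N0R : 0 < N%:R :> R by rewrite ltr0n.
have P0 : 0 <= \prod_(k < N.+1) (M + k%:R) by apply: prodr_ge0 => k _; rewrite addr_ge0.
have F0 : 0 < (N`!)%:R :> R by rewrite ltr0n fact_gt0.
exists (B0 * (1 + C / N%:R) + 1).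
  rewrite ltr_wpDl// mulr_ge0 ?addr_ge0 ?divr_ge0 ?(ltW C0)//.
  by rewrite /B0 mulr_ge0 ?powR_ge0 ?divr_ge0.
exists N; split=> // n Nn z zM; have [P -> PC] := H _ (leqnn _) _ Nn _ zM.
rewrite cabsM ler_wpDr//; apply: ler_pM; rewrite ?cabs_ge0//; last first.
  have -> : P = 1 + (P - 1) by ring.
  by apply: le_trans (ler_cabsD _ _) _; rewrite cabs1 lerD2l.
rewrite /gauss_prod cabsM cabsV cabsM cabs_nat invfM mulrA /B0.
have -> : cabs (\prod_(k < N.+1) (z + k%:R)) = \prod_(k < N.+1) cabs (z + k%:R).
  by apply: (big_morph (fun z => cabs z)); [exact: cabsM|exact: cabs1].
apply: ler_pM.
- by apply: divr_ge0; [apply: prodr_ge0 => k _; exact: cabs_ge0|exact: ltW].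
- by rewrite invr_ge0 cabs_ge0.
- rewrite ler_wpM2r ?invr_ge0 ?(ltW F0)//; apply: ler_prod => k _.
  rewrite cabs_ge0/=; apply: le_trans (ler_cabsD _ _) _.
  by rewrite cabs_nat lerD2r.
- rewrite cabs_npow// -powRN; apply: ler_powR; first by rewrite ler1n.
  by apply: le_trans zM; apply: le_trans (abs_Re_le z); rewrite -normrN ler_norm.
Qed.

(** For a fixed large [n] the Gauss product is within a factor of two of its limit, and it
   is a product of finitely many factors bounded from below. *)
Lemma rGamma_bounds M d : 1 <= M -> 0 < d ->
  exists2 c, 0 < c & forall z, cabs z <= M -> (forall k : nat, d <= cabs (z + k%:R)) ->
  c <= cabs (rGamma z).
Proof.
move=> M1 d0; have [C C0 [N [N0 H]]] := gauss_limit M1.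
pose n := maxn N (Num.truncn (2 * C)).+1.
have n0 : (0 < n)%N by rewrite leq_max N0.
have n0R : 0 < n%:R :> R by rewrite ltr0n.
have nC : C / n%:R <= 2^-1.
  rewrite ler_pdivrMr// ler_pdivlMl//; apply/ltW/(lt_le_trans (truncnS_gt _)).
  by rewrite ler_nat; exact: leq_maxr.
have f0 : 0 < (n`!)%:R :> R by rewrite ltr0n fact_gt0.
exists (d ^+ n.+1 / ((n`!)%:R * n%:R `^ M) / 2).
  by rewrite !divr_gt0 ?exprn_gt0// mulr_gt0// powR_gt0.
move=> z zM zd; have h := H n (leq_maxl _ _) z zM.
have gl : d ^+ n.+1 / ((n`!)%:R * n%:R `^ M) <= cabs (gauss_prod n z).
  rewrite /gauss_prod cabsM cabsV cabsM cabs_nat cabs_npow//.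
  have -> : cabs (\prod_(k < n.+1) (z + k%:R)) = \prod_(k < n.+1) cabs (z + k%:R).
    by apply: (big_morph (fun z => cabs z)); [exact: cabsM|exact: cabs1].
  apply: ler_pM.
  - by rewrite exprn_ge0// ltW.
  - by rewrite invr_ge0 mulr_ge0 ?powR_ge0// ltW.
  - rewrite -[n.+1 in X in X <= _]card_ord -prodr_const; apply: ler_prod => k _.
    by rewrite ltW//= zd.
  - rewrite lef_pV2 ?posrE ?mulr_gt0 ?powR_gt0// ler_wpM2l ?(ltW f0)//.
    by apply: ler_powR; [rewrite ler1n|exact: le_trans (ler_norm _) (le_trans (abs_Re_le z) zM)].
have := lerB_cabs (gauss_prod n z) (rGamma z); rewrite cabs_distC.
have := ler_wpM2l (cabs_ge0 (gauss_prod n z)) nC; move: h gl; lra.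
Qed.

Lemma powR_div n (x : R) : (0 < n)%N -> n%:R `^ (x - 1) = n%:R `^ x / n%:R.
Proof.
by move=> n0; rewrite powRB ?powRr1// pnatr_eq0 gtn_eqF// implybT.
Qed.

(** Uniform Stirling formula: the rising factorial is the Gauss product up to [n^(z-1)] and
   a factor [1 + O(1/n)]. *)
Lemma rising_asymp M : 1 <= M -> exists2 C, 0 < C & exists N, (0 < N)%N /\
  forall n, (N <= n)%N -> forall z, cabs z <= M ->
  cabs (rising n z - rGamma z * npow n (z - 1)) <= C * n%:R `^ (complex.Re z - 2).
Proof.
move=> M1; have [C C0 [N1 [N10 H1]]] := gauss_limit M1.
have [B B0 [N2 [N20 H2]]] := gauss_prod_bound M1.
have M0 : 0 < M by apply: lt_le_trans M1.
exists (B * (C + 2 * M)); first by rewrite mulr_gt0// addr_gt0// mulr_gt0.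
exists (maxn (maxn N1 N2) (Num.truncn (2 * M)).+1); split; first by rewrite !leq_max N10.
move=> n; rewrite !geq_max => /andP[/andP[N1n N2n] Mn] z zM.
have n0 : (0 < n)%N by exact: leq_trans N1n.
have n0R : 0 < n%:R :> R by rewrite ltr0n.
have nM : 2 * M <= n%:R.
  by apply/ltW/(lt_le_trans (truncnS_gt _)); rewrite ler_nat.
have zn : n%:R / 2 <= cabs (z + n%:R).
  have := lerB_cabs n%:R (- z); rewrite opprK cabsN cabs_nat addrC.
  by move: nM zM; rewrite [n%:R + z]addrC; lra.
have zn0 : z + n%:R != 0 by rewrite -cabs_gt0; apply: lt_le_trans zn; rewrite divr_gt0.
have -> : rising n z - rGamma z * npow n (z - 1) =
    ((gauss_prod n z - rGamma z) + gauss_prod n z * (- (z / (z + n%:R)))) *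
     npow n (z - 1).
  have -> : rising n z = gauss_prod n z * (n%:R / (z + n%:R)) * npow n (z - 1).
    have E : npow n z = npow n (z - 1) * n%:R.
      by rewrite -[in LHS](subrK 1 z) [LHS]npowD npow_id.
    by apply: (mulfI zn0); rewrite risingE E; field.
  by field.
have -> : complex.Re z - 2 = complex.Re z - 1 - 1 by ring.
rewrite cabsM cabs_npow// powR_div// [leRHS]mulrA [leRHS]mulrAC.
have -> : complex.Re (z - 1) = complex.Re z - 1 by case: (z).
rewrite ler_wpM2r ?powR_ge0//; apply: le_trans (ler_cabsD _ _) _.
have gB := H2 _ N2n _ zM.
have nV : 0 <= (n%:R : R)^-1 by rewrite invr_ge0.
have -> : B * (C + 2 * M) / n%:R = B * (C / n%:R) + B * (2 * M / n%:R) by ring.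
apply: lerD.
  rewrite cabs_distC; apply: le_trans (H1 _ N1n _ zM) _.
  by rewrite ler_wpM2r// divr_ge0 ?(ltW C0).
rewrite cabsM cabsN; apply: ler_pM; rewrite ?cabs_ge0// cabsM cabsV.
rewrite ler_pdivrMr; last by apply: lt_le_trans zn; rewrite divr_gt0.
apply: (le_trans zM); apply: (@le_trans _ _ (2 * M / n%:R * (n%:R / 2))).
  by rewrite le_eqVlt; apply/orP; left; apply/eqP; field; rewrite gt_eqF.
by rewrite ler_wpM2l// divr_ge0// mulr_ge0// ltW.
Qed.

Lemma rising_shift_bound M : 1 <= M -> exists2 B, 0 < B & exists N, (0 < N)%N /\
  forall n, (N <= n)%N -> forall z, cabs z <= M -> z != 0 ->
  cabs (rising n (z + 1)) <= B * n%:R `^ complex.Re z / cabs z.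
Proof.
move=> M1; have [B B0 [N [N0 H]]] := gauss_prod_bound M1; exists B => //; exists N.
split=> // n Nn z zM z0; rewrite ler_pdivlMr ?cabs_gt0// mulrC -cabsM rising_shift.
by rewrite cabsM cabs_npow ?(leq_trans N0)// ler_wpM2r ?powR_ge0// H.
Qed.

Lemma continuous_gauss_prod n : continuous (gauss_prod n : R[i] -> R[i]).
Proof.
move=> z; rewrite /gauss_prod.
have cp m : {for z, continuous (fun z : R[i] => \prod_(k < m) (z + k%:R))}.
  elim: m => [|m IH].
    rewrite (_ : (fun z : R[i] => _) = fun=> 1); first exact: cst_continuous.
    by apply/funext => w; rewrite big_ord0.
  rewrite (_ : (fun z : R[i] => _) =
      (fun z : R[i] => (\prod_(k < m) (z + k%:R)) * (z + m%:R))); last first.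
    by apply/funext => w; rewrite big_ord_recr.
  apply: (@cvgM R[i] _ (nbhs z)); first exact: IH.
  by apply: (@cvgD R[i] (R[i])^o _ (nbhs z)); [exact: cvg_id|exact: cvg_cst].
apply: (@cvgM R[i] _ (nbhs z)); first exact: cp.
apply: (@cvgV R[i] _ (nbhs z)); first by rewrite mulf_neq0// ?fact_neq0c// npow_neq0.
apply: (@cvgM R[i] _ (nbhs z)); first exact: cvg_cst.
exact: continuous_npow.
Unshelve. all: by end_near. Qed.

Lemma continuous_rGamma : continuous (rGamma : R[i] -> R[i]).
Proof.
move=> z; pose M := cabs z + 1.
have M1 : 1 <= M by rewrite lerDr cabs_ge0.
have [C C0 [N1 [N10 H1]]] := gauss_limit M1.
have [B B0 [N2 [N20 H2]]] := gauss_prod_bound M1.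
apply/(@cvgcP _ _ _ (nbhs_filter z)) => e e0.
pose n := maxn (maxn N1 N2) (Num.truncn (4 * (B * C) / e)).+1.
have n0 : (0 < n)%N by rewrite !leq_max N10.
have nR : 0 < n%:R :> R by rewrite ltr0n.
have nC : B * (C / n%:R) <= e / 4.
  rewrite mulrA ler_pdivrMr//.
  have : 4 * (B * C) / e <= n%:R.
    apply/ltW/(lt_le_trans (truncnS_gt _)).
    by rewrite ler_nat; exact: leq_maxr.
  rewrite ler_pdivrMr//; lra.
have D w : cabs w <= M -> cabs (rGamma w - gauss_prod n w) <= e / 4.
  move=> wM; apply: le_trans nC.
  have nN1 : (N1 <= n)%N by rewrite !leq_max leqnn.
  have nN2 : (N2 <= n)%N by rewrite !leq_max leqnn orbT.
  apply: le_trans (H1 _ nN1 _ wM) _.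
  by rewrite ler_wpM2r ?divr_ge0 ?(ltW C0)// H2.
have e4 : 0 < e / 4 by rewrite divr_gt0.
have /(@cvgcP _ _ _ (nbhs_filter z))/(_ _ e4) gz := @continuous_gauss_prod n z.
have wM : \forall w \near z, cabs w <= M.
  apply/nbhscP; exists 1 => // w wz; rewrite /M -lerBlDl.
  exact: le_trans (lerB_cabs _ _) (ltW wz).
near=> w; have -> : rGamma w - rGamma z = (rGamma w - gauss_prod n w) +
  (gauss_prod n w - gauss_prod n z) - (rGamma z - gauss_prod n z) by ring.
apply: le_lt_trans (ler_cabsB _ _) _.
have a1 : cabs (rGamma w - gauss_prod n w) <= e / 4 by apply: D; near: w.
have a2 : cabs (gauss_prod n w - gauss_prod n z) < e / 4 by near: w.
have a3 : cabs (rGamma z - gauss_prod n z) <= e / 4 by apply: D; rewrite lerDl.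
have := ler_cabsD (rGamma w - gauss_prod n w) (gauss_prod n w - gauss_prod n z).
by move: a1 a2 a3; lra.
Unshelve. all: by end_near. Qed.

End Gauss.

(** * Expectations of the offspring number *)

Section Mean.
Context {R : realType} (xi : probability nat R).

(** A real-valued integral, additive on the functions of quadratic growth, which are
   integrable since the variance is finite. *)
Definition mean (f : nat -> R) : R := \int[xi]_(k in [set: nat]) f k.

Definition quad_bounded (f : nat -> R) :=
  exists C : R, forall k, `|f k| <= C * (1 + k%:R ^+ 2).

Definition finite_second_moment :=
  xi.-integrable [set: nat] (EFin \o (fun k : nat => k%:R ^+ 2 : R)).

Lemma quad_boundedD f g : quad_bounded f -> quad_bounded g ->
  quad_bounded (fun k => f k + g k).
Proof.
move=> [C fC] [D gD]; exists (C + D) => k; rewrite mulrDl.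
by apply: le_trans (ler_normD _ _) _; exact: lerD.
Qed.

Lemma quad_boundedZ c f : quad_bounded f -> quad_bounded (fun k => c * f k).
Proof.
move=> [C fC]; exists (`|c| * C) => k; rewrite normrM -mulrA.
by rewrite ler_wpM2l.
Qed.

Lemma quad_bounded_le f g : quad_bounded g -> (forall k, `|f k| <= `|g k|) ->
  quad_bounded f.
Proof. by move=> [C gC] fg; exists C => k; exact: le_trans (fg k) (gC k). Qed.

Lemma quad_bounded_bounded (f : nat -> R) (C : R) :
  (forall k, `|f k| <= C) -> quad_bounded f.
Proof.
move=> fC; exists C => k; apply: (le_trans (fC k)).
by rewrite ler_peMr ?lerDl ?sqr_ge0// (le_trans _ (fC k)).
Qed.

Hypothesis m2 : finite_second_moment.

Lemma quad_bounded_integrable f : quad_bounded f ->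
  xi.-integrable [set: nat] (EFin \o f).
Proof.
move=> [C fC]; pose g : nat -> R := fun k => C * (1 + k%:R ^+ 2).
apply: (@le_integrable _ _ _ xi _ _ _ (EFin \o g)) => //.
  by move=> k _; rewrite /= lee_fin; apply: (le_trans (fC k)); exact: ler_norm.
have i1 : xi.-integrable [set: nat] (EFin \o (cst 1 : nat -> R)).
  by apply: finite_measure_integrable_cst.
have -> : EFin \o g = (fun k => C%:E * (1%:E + (k%:R ^+ 2)%:E))%E.
  by apply/funext => k; rewrite /g /= EFinM EFinD.
apply: integrableZl => //; apply: integrableD => //; exact: i1.
Qed.

Lemma meanD f g : quad_bounded f -> quad_bounded g ->
  mean (fun k => f k + g k) = mean f + mean g.
Proof. by move=> qf qg; apply: RintegralD => //; exact: quad_bounded_integrable. Qed.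

Lemma meanB f g : quad_bounded f -> quad_bounded g ->
  mean (fun k => f k - g k) = mean f - mean g.
Proof. by move=> qf qg; apply: RintegralB => //; exact: quad_bounded_integrable. Qed.

Lemma meanZ c f : quad_bounded f -> mean (fun k => c * f k) = c * mean f.
Proof. by move=> qf; apply: RintegralZl => //; exact: quad_bounded_integrable. Qed.

Lemma le_mean f g : quad_bounded f -> quad_bounded g -> (forall k, f k <= g k) ->
  mean f <= mean g.
Proof. by move=> qf qg fg; apply: le_Rintegral => //; exact: quad_bounded_integrable. Qed.

Lemma mean_ge0 f : (forall k, 0 <= f k) -> 0 <= mean f.
Proof. by move=> f0; apply: Rintegral_ge0. Qed.

Lemma norm_mean f : quad_bounded f -> `|mean f| <= mean (fun k => `|f k|).
Proof.
move=> qf; apply: le_normr_Rintegral => //; exact: quad_bounded_integrable.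
Qed.

Lemma norm_mean_le f g : quad_bounded g -> (forall k, `|f k| <= g k) -> `|mean f| <= mean g.
Proof.
move=> qg fg; have qf : quad_bounded f.
  by apply: quad_bounded_le qg _ => k; apply: le_trans (fg k) (ler_norm _).
apply: (le_trans (norm_mean qf)); apply: le_mean => //.
by apply: quad_bounded_le qf _ => k; rewrite normr_id.
Qed.

Lemma mean1 : mean (fun=> 1) = 1.
Proof.
rewrite /mean /Rintegral integral_cst//= mul1e.
by have -> : xi [set: nat] = 1%E by exact: probability_setT.
Qed.

Lemma quad_bounded_indic (A : pred nat) : quad_bounded (fun k => (A k)%:R).
Proof. by apply: (@quad_bounded_bounded _ 1) => k; case: (A k); rewrite ?normr0 ?normr1. Qed.

Lemma quad_bounded_restr (A : pred nat) f :
  quad_bounded f -> quad_bounded (fun k => f k * (A k)%:R).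
Proof.
move=> qf; apply: quad_bounded_le qf _ => k.
by rewrite normrM; case: (A k); rewrite ?mulr1// ?normr1 ?mulr1// normr0 mulr0.
Qed.

Lemma mean_indic1 k : mean (fun j => (j == k)%:R) = offspring_prob xi k.
Proof.
rewrite /mean /Rintegral /offspring_prob; congr fine.
rewrite -[in RHS](setIT [set k]) -integral_indic//.
apply: eq_integral => j _; rewrite indicE.
by case: eqP => jk; [rewrite mem_set|rewrite memNset].
Qed.

Lemma mean_point f k : quad_bounded f -> (forall j, 0 <= f j) ->
  f k * offspring_prob xi k <= mean f.
Proof.
move=> qf f0; rewrite -mean_indic1 -meanZ; last exact: quad_bounded_indic.
apply: le_mean => //; first by apply: quad_boundedZ; exact: quad_bounded_indic.
by move=> j; case: eqP => [->|_]; rewrite ?mulr1 ?mulr0.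
Qed.

Lemma mean_trunc f N :
  mean (fun k => f k * (k < N)%:R) = \sum_(k < N) f k * offspring_prob xi k.
Proof.
elim: N => [|N IH].
  rewrite big_ord0 -[RHS](mulr0 (mean (fun=> 1))) mulrC -meanZ; last first.
    by apply: (@quad_bounded_bounded _ 1) => k; rewrite normr1.
  by congr mean; apply/funext => k; rewrite ltn0 mulr0 mul0r.
rewrite big_ord_recr/= -IH -mean_indic1 -meanZ; last exact: quad_bounded_indic.
rewrite -meanD; last 2 first.
- exists (\sum_(k < N) `|f k|) => k; case: ltnP => kN; last first.
    by rewrite mulr0 normr0 mulr_ge0 ?sumr_ge0// addr_ge0// sqr_ge0.
  rewrite mulr1; apply: (@le_trans _ _ (\sum_(k < N) `|f k|)).
    by rewrite (bigD1 (Ordinal kN))//= lerDl sumr_ge0.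
  by rewrite ler_peMr ?sumr_ge0// lerDl sqr_ge0.
- by apply: quad_boundedZ; exact: quad_bounded_indic.
congr mean; apply/funext => k; rewrite ltnS leq_eqVlt.
by case: eqP => [->|_]; rewrite ?ltnn ?mulr0 ?add0r ?addr0.
Qed.

Lemma cvg_mean_trunc f : quad_bounded f ->
  (fun N => mean (fun k => f k * (k < N)%:R)) @ \oo --> mean f.
Proof.
move=> qf; have fi := quad_bounded_integrable qf.
have [|||||_ _ h] := @dominated_convergence _ _ _ xi [set: nat] (@measurableT _ _)
   (fun N k => (f k * (k < N)%:R)%:E) (EFin \o f) (fun k => `|(f k)%:E|%E).
- by [].
- by [].
- apply: aeW => k _; apply: cvg_near_cst; exists k.+1 => // N /= kN.
  by rewrite kN mulr1.
- exact: integrable_abse.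
- apply: aeW => k N _; rewrite /= lee_fin normrM.
  by case: (k < N)%N; rewrite ?normr1 ?mulr1// normr0 mulr0.
rewrite /mean /Rintegral; apply: fine_cvg; rewrite fineK//.
apply: integrable_fin_num => //; exact: quad_bounded_integrable.
Qed.

Lemma mean_tail f : quad_bounded f -> forall e : R, 0 < e -> exists N : nat,
  forall M, (N <= M)%N -> `|mean (fun k => f k * (M <= k)%:R)| < e.
Proof.
move=> qf e e0; have /cvgrPdist_lt/(_ _ e0)[N _ H] := cvg_mean_trunc qf.
exists N => M /H; congr (`|_| < _); rewrite -meanB//; last exact: quad_bounded_restr.
by congr mean; apply/funext => k; case: ltnP; rewrite ?mulr0 ?mulr1 ?subrr ?subr0.
Qed.

(** A nonnegative function of mean zero vanishes on the support, and there [g] vanishes with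
   it. *)
Lemma mean_eq0 f : quad_bounded f -> (forall k, 0 <= f k) -> mean f = 0 ->
  forall g, quad_bounded g -> (forall k, f k = 0 -> g k = 0) -> mean g = 0.
Proof.
move=> qf f0 mf g qg fg.
have H N : mean (fun k => g k * (k < N)%:R) = 0.
  rewrite mean_trunc big1// => k _; have [->|fk] := eqVneq (g k) 0; first by rewrite mul0r.
  suff -> : offspring_prob xi k = 0 by rewrite mulr0.
  have fk0 : 0 < f k.
    by rewrite lt_neqAle f0 andbT; apply: contra_neq fk => /esym/fg.
  have := mean_point k qf f0; rewrite mf pmulr_rle0// => p0.
  by apply/eqP; rewrite eq_le p0 /offspring_prob fine_ge0.
apply/esym; apply: (@cvg_unique _ _ ((fun N => mean (fun k => g k * (k < N)%:R)) @ \oo)) => //.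
  rewrite (_ : (fun N => _) = fun=> 0); first exact: cvg_cst.
  by apply/funext => N; rewrite H.
exact: cvg_mean_trunc.
Qed.

End Mean.

Section Critical.
Context {R : realType} (xi : probability nat R) (sigma : R).
Hypothesis crit : critical xi sigma.

Let mean_1E : (\int[xi]_k (k%:R : R)%:E = 1%:E)%E.
Proof. by have [_ + _] := crit; rewrite unlock. Qed.

Let var_E : (\int[xi]_k ((k%:R - 1) ^+ 2 : R)%:E = (sigma ^+ 2)%:E)%E.
Proof.
have [_ e] := crit; rewrite /variance unlock e/= unlock => <-.
by apply: eq_integral => k _.
Qed.

Lemma critical_second_moment : finite_second_moment xi.
Proof.
have i1 : xi.-integrable [set: nat] (EFin \o (fun k : nat => (k%:R - 1) ^+ 2 : R)).
  apply/integrableP; split; first by [].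
  rewrite (_ : (\int[xi]_x _)%E = (sigma ^+ 2)%:E) ?ltry//.
  rewrite -var_E; apply: eq_integral => k _.
  by rewrite /= ger0_norm// sqr_ge0.
have i2 : xi.-integrable [set: nat] (EFin \o (cst 1 : nat -> R)).
  by apply: finite_measure_integrable_cst.
have i3 : xi.-integrable [set: nat]
    (fun k : nat => 2%:E * (((k%:R - 1) ^+ 2)%:E + 1%:E) : \bar R)%E.
  by apply: integrableZl => //; apply: integrableD => //.
apply: le_integrable i3 => // k _; rewrite /= lee_fin.
rewrite ger0_norm ?sqr_ge0// ger0_norm; last by rewrite mulr_ge0// addr_ge0// sqr_ge0.
have := sqr_ge0 ((k%:R : R) - 2); rewrite !expr2; lra.
Qed.

Lemma mean_id : mean xi (fun k => k%:R) = 1.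
Proof. by rewrite /mean /Rintegral mean_1E. Qed.

Lemma mean_var : mean xi (fun k => (k%:R - 1) ^+ 2) = sigma ^+ 2.
Proof. by rewrite /mean /Rintegral var_E. Qed.

Lemma quad_bounded_sqr : quad_bounded (fun k : nat => (k%:R - 1) ^+ 2 : R).
Proof.
exists 2 => k; rewrite ger0_norm ?sqr_ge0//.
have := sqr_ge0 ((k%:R : R) + 1); rewrite !expr2; lra.
Qed.

Lemma quad_bounded_id : quad_bounded (fun k : nat => k%:R - 1 : R).
Proof.
exists 2 => k; rewrite ler_norml; apply/andP; split.
  have := sqr_ge0 ((k%:R : R) + 1); rewrite !expr2; have : 0 <= k%:R :> R by []; nra.
have := sqr_ge0 ((k%:R : R) - 1); rewrite !expr2; have : 0 <= k%:R :> R by []; nra.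
Qed.

Lemma mean_centered : mean xi (fun k => k%:R - 1) = 0.
Proof.
have m2 := critical_second_moment.
have q1 : quad_bounded (fun=> 1 : R).
  by apply: (@quad_bounded_bounded _ _ 1) => k; rewrite normr1.
have q2 : quad_bounded (fun k : nat => k%:R : R).
  have -> : (fun k : nat => k%:R : R) = (fun k => (k%:R - 1) + 1).
    by apply/funext => k; rewrite subrK.
  by apply: quad_boundedD => //; exact: quad_bounded_id.
by rewrite (meanB m2 q2 q1) mean_id mean1 subrr.
Qed.

(** Otherwise the offspring number, whose mean is [1], would be at least [1], hence
   constant, against the positive variance. *)
Lemma offspring_prob0_gt0 : 0 < offspring_prob xi 0.
Proof.
have m2 := critical_second_moment; have [s0 _ _] := crit.
rewrite lt_neqAle; apply/andP; split; last by rewrite /offspring_prob fine_ge0.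
apply/eqP => p0.
pose f k : R := k%:R - 1 + (k == 0)%:R.
have qi : quad_bounded (fun k : nat => (k == 0)%:R : R) by exact: (@quad_bounded_indic _ (pred1 0)).
have qf : quad_bounded f by apply: quad_boundedD => //; exact: quad_bounded_id.
have f0 k : 0 <= f k.
  rewrite /f; case: k => [|k] /=; first by rewrite sub0r addNr.
  by rewrite addr0 subr_ge0 ler1n.
have mf : mean xi f = 0.
  by rewrite meanD//; [rewrite mean_centered mean_indic1 -p0 addr0|exact: quad_bounded_id].
pose g k : R := (k%:R - 1) ^+ 2 - (k == 0)%:R.
have qn : quad_bounded (fun k : nat => -1 * (k == 0)%:R : R) by exact: quad_boundedZ.
have gE : g = fun k => (k%:R - 1) ^+ 2 + -1 * (k == 0)%:R.
  by apply/funext => k; rewrite /g mulN1r.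
have qg : quad_bounded g by rewrite gE; apply: quad_boundedD => //; exact: quad_bounded_sqr.
have : mean xi g = 0.
  apply: (mean_eq0 m2 qf f0 mf qg) => -[|[|k]]; rewrite /f /g /=.
  - by rewrite sub0r sqrrN expr1n subrr.
  - by rewrite subrr expr0n subr0.
  - by move=> /eqP; rewrite addr0 subr_eq0 pnatr_eq1.
rewrite gE meanD//; last exact: quad_bounded_sqr.
rewrite mean_var meanZ// mean_indic1 -p0 mulr0 addr0 => /eqP.
by rewrite sqrf_eq0 gt_eqF.
Qed.

End Critical.

(** * Integrals over a period *)

Section PeriodIntegral.
Context {R : realType}.
Implicit Types (f g : R -> R) (t : R).
Local Notation mu := (@lebesgue_measure R).

Definition Ipi f : R := \int[mu]_(t in `[- pi, pi]) f t.

Lemma continuous_integrable_pi f : continuous f ->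
  mu.-integrable `[- pi, pi] (EFin \o f).
Proof.
move=> cf; apply: continuous_compact_integrable; first exact: segment_compact.
exact: continuous_subspaceT.
Qed.

Lemma IpiD f g : continuous f -> continuous g ->
  Ipi (fun t => f t + g t) = Ipi f + Ipi g.
Proof. by move=> cf cg; apply: RintegralD => //; exact: continuous_integrable_pi. Qed.

Lemma IpiB f g : continuous f -> continuous g ->
  Ipi (fun t => f t - g t) = Ipi f - Ipi g.
Proof. by move=> cf cg; apply: RintegralB => //; exact: continuous_integrable_pi. Qed.

Lemma IpiZ c f : continuous f -> Ipi (fun t => c * f t) = c * Ipi f.
Proof. by move=> cf; apply: RintegralZl => //; exact: continuous_integrable_pi. Qed.

Lemma eq_Ipi f g : f =1 g -> Ipi f = Ipi g.
Proof. by move=> fg; congr Ipi; exact/funext. Qed.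

Lemma Ipi_sum n (c : nat -> R) (f : nat -> R -> R) : (forall k, continuous (f k)) ->
  Ipi (fun t => \sum_(k < n) c k * f k t) = \sum_(k < n) c k * Ipi (f k).
Proof.
move=> cf; have cc k : continuous (fun t => c k * f k t).
  by move=> t; apply: cvgM; [exact: cvg_cst|exact: cf].
have cs m : continuous (fun t => \sum_(k < m) c k * f k t).
  elim: m => [|m IH].
    rewrite (_ : (fun t => _) = fun=> 0); first exact: cst_continuous.
    by apply/funext => t; rewrite big_ord0.
  rewrite (_ : (fun t => _) = fun t => \sum_(k < m) c k * f k t + c m * f m t); last first.
    by apply/funext => t; rewrite big_ord_recr.
  by move=> t; apply: cvgD; [exact: IH|exact: cc].
elim: n => [|n IH].
  rewrite big_ord0 (_ : (fun t => _) = fun t => 0 * (cst 0 t)); last first.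
    by apply/funext => t; rewrite big_ord0 mul0r.
  by rewrite IpiZ ?mul0r//; exact: cst_continuous.
rewrite big_ord_recr/= -IH -IpiZ// -IpiD//.
by apply: eq_Ipi => t; rewrite big_ord_recr.
Qed.

Lemma le_norm_Ipi f g : continuous f -> continuous g ->
  (forall t, - pi <= t <= pi -> `|f t| <= g t) -> `|Ipi f| <= Ipi g.
Proof.
move=> cf cg fg.
apply: le_trans (le_normr_Rintegral _ _) _ => //.
  exact: continuous_integrable_pi.
apply: le_Rintegral => //.
- apply: continuous_integrable_pi => t; apply: continuous_comp; first exact: cf.
  exact: norm_continuous.
- exact: continuous_integrable_pi.
Qed.

Lemma continuous_gauss a : continuous (fun t : R => expR (- (a * t ^+ 2))).
Proof.
move=> t; apply: (@continuous_comp _ _ _ (fun t => - (a * t ^+ 2)) expR).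
  apply: cvgN; apply: cvgM; first exact: cvg_cst.
  exact: exprn_continuous.
exact: continuous_expR.
Qed.

Lemma Rintegral_gauss a : 0 < a ->
  mu.-integrable [set: R] (EFin \o (fun t => expR (- (a * t ^+ 2)))) /\
  \int[mu]_(t in [set: R]) expR (- (a * t ^+ 2)) = Num.sqrt (pi / a).
Proof.
move=> a0; pose s : R := Num.sqrt ((2 * a)^-1).
have s2 : s ^+ 2 = (2 * a)^-1 by rewrite sqr_sqrtr// invr_ge0 mulr_ge0// ltW.
have s0 : s != 0 by rewrite -sqrf_eq0 s2 invr_eq0 mulf_neq0// gt_eqF.
have E t : normal_pdf 0 s t = (Num.sqrt (pi / a))^-1 * expR (- (a * t ^+ 2)).
  rewrite normal_pdfE// /normal_peak /normal_fun s2 subr0.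
  congr ((Num.sqrt _)^-1 * expR _); last by rewrite -mulr_natr; field; rewrite gt_eqF.
  by rewrite -mulr_natr; field; rewrite gt_eqF.
have q0 : 0 < Num.sqrt (pi / a) by rewrite sqrtr_gt0 divr_gt0 ?pi_gt0.
have F t : expR (- (a * t ^+ 2)) = Num.sqrt (pi / a) * normal_pdf 0 s t.
  by rewrite E [RHS]mulrA mulfV ?mul1r// gt_eqF.
have i1 : mu.-integrable [set: R] (EFin \o normal_pdf 0 s) by exact: integrable_normal_pdf.
have -> : (fun t => expR (- (a * t ^+ 2))) = fun t => Num.sqrt (pi / a) * normal_pdf 0 s t.
  by apply/funext.
split.
  have -> : EFin \o (fun t => Num.sqrt (pi / a) * normal_pdf 0 s t) =
    (fun t => (Num.sqrt (pi / a))%:E * (normal_pdf 0 s t)%:E)%E by [].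
  exact: integrableZl.
by rewrite RintegralZl// /Rintegral integral_normal_pdf mulr1.
Qed.

Lemma Ipi_gauss_split a : 0 < a ->
  Num.sqrt (pi / a) = Ipi (fun t => expR (- (a * t ^+ 2))) +
   \int[mu]_(t in ~` `[- pi, pi]) expR (- (a * t ^+ 2)).
Proof.
move=> a0; have [ig <-] := Rintegral_gauss a0.
rewrite -(setUv (`[- pi, pi] : set R)) Rintegral_setU//.
- exact: measurableC.
- by rewrite setUv.
- by apply/disj_setPS; rewrite setICr.
Qed.

Lemma Ipi_gauss_le a : 0 < a -> Ipi (fun t => expR (- (a * t ^+ 2))) <= Num.sqrt (pi / a).
Proof.
move=> a0; rewrite (Ipi_gauss_split a0) lerDl; apply: Rintegral_ge0 => t _.
exact: expR_ge0.
Qed.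

(** Outside the period the integrand is at most [exp(-a t^2 / 2) / a], up to a constant. *)
Lemma Ipi_gauss_approx a : 0 < a ->
  `|Ipi (fun t => expR (- (a * t ^+ 2))) - Num.sqrt (pi / a)| <=
   2 / a * Num.sqrt (2 * pi / a).
Proof.
move=> a0; rewrite distrC {1}(Ipi_gauss_split a0) addrAC subrr add0r.
rewrite ger0_norm; last by apply: Rintegral_ge0 => t _; exact: expR_ge0.
have mC : measurable (~` `[- pi, pi] : set R) by exact: measurableC.
have a2 : 0 < a / 2 by rewrite divr_gt0.
have [ig _] := Rintegral_gauss a0; have [ig2 e2] := Rintegral_gauss a2.
have igc : mu.-integrable (~` `[- pi, pi]) (EFin \o (fun t => expR (- (a * t ^+ 2)))).
  exact: integrableS ig.
have ig2c : mu.-integrable (~` `[- pi, pi]) (EFin \o (fun t => expR (- (a / 2 * t ^+ 2)))).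
  exact: integrableS ig2.
apply: (@le_trans _ _ (\int[mu]_(t in ~` `[- pi, pi]) (2 / a * expR (- (a / 2 * t ^+ 2))))).
  apply: le_Rintegral => //.
    have -> : EFin \o (fun t => 2 / a * expR (- (a / 2 * t ^+ 2))) =
      (fun t => (2 / a)%:E * (expR (- (a / 2 * t ^+ 2)))%:E)%E by [].
    exact: integrableZl.
  move=> t tpi; have t1 : 1 <= t ^+ 2.
    have : 1 <= `|t|.
      rewrite leNgt; apply/negP => t1; apply: tpi; rewrite /= in_itv/=.
      move: t1; rewrite ltr_norml => /andP[t1 t2].
      by apply/andP; have := @pi_ge2 R; move: t1 t2; split; lra.
    by move=> t1; rewrite -(real_normK (num_real t)) exprn_ege1.
  have -> : - (a * t ^+ 2) = - (a / 2 * t ^+ 2) - (a / 2 * t ^+ 2) by field.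
  rewrite expRD ler_wpM2r ?expR_ge0// expRN.
  have -> : 2 / a = (a / 2)^-1 by rewrite invf_div.
  rewrite lef_pV2 ?posrE ?expR_gt0//.
  apply: (@le_trans _ _ (a / 2 * t ^+ 2)); first by rewrite ler_peMr// ltW.
  by apply: le_trans (expR_ge1Dx _); rewrite lerDr.
rewrite RintegralZl// ler_wpM2l ?divr_ge0 ?(ltW a0)//.
have -> : 2 * pi / a = pi / (a / 2) by field; rewrite gt_eqF.
rewrite (Ipi_gauss_split a2) lerDr; apply: Rintegral_ge0 => t _; exact: expR_ge0.
Qed.

Lemma exp_absorbs_power (c : R) k : 0 < c -> exists2 K : R, 0 < K &
  forall u : R, 0 <= u -> u ^+ k * expR (- (c * u ^+ 2)) <= K * expR (- (c / 2 * u ^+ 2)).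
Proof.
move=> c0; pose D := k`!%:R * (2 / c) ^+ k : R.
have D0 : 0 <= D by rewrite mulr_ge0// exprn_ge0// divr_ge0// ltW.
exists (1 + D); first by rewrite ltr_pwDl.
move=> u u0; have -> : - (c * u ^+ 2) = - (c / 2 * u ^+ 2) - (c / 2 * u ^+ 2) by field.
rewrite expRD mulrA ler_wpM2r ?expR_ge0//.
pose y := c / 2 * u ^+ 2; have y0 : 0 <= y by rewrite mulr_ge0 ?sqr_ge0// divr_ge0// ltW.
rewrite -/y expRN ler_pdivrMr ?expR_gt0//.
have ey : 1 <= expR y by rewrite -expR0 ler_expR.
have h : y ^+ k / k`!%:R <= expR y.
  case: (k) => [|m]; first by rewrite expr0 fact0 divr1.
  by apply: le_trans (expR_ge1Dxn m y0); rewrite lerDr.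
have h2 : u ^+ k <= 1 + (u ^+ k) ^+ 2.
  have := sqr_ge0 (u ^+ k - 1); have := sqr_ge0 (u ^+ k); rewrite sqrrB; lra.
apply: (le_trans h2); rewrite mulrDl mul1r lerD//.
have -> : (u ^+ k) ^+ 2 = D * (y ^+ k / k`!%:R).
  have f0 : k`!%:R != 0 :> R by rewrite pnatr_eq0 gtn_eqF// fact_gt0.
  have -> : D * (y ^+ k / k`!%:R) = (2 / c * y) ^+ k.
    have G (f p q : R) : f != 0 -> f * q * (p / f) = q * p by move=> ?; field.
    by rewrite [RHS]exprMn /D G.
  rewrite -!exprM mulnC exprM; congr (_ ^+ k).
  by rewrite /y; field; rewrite gt_eqF.
by rewrite ler_wpM2l.
Qed.

(** The polynomial factor is absorbed into half of the exponent; rescaling by the square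
   root of [n] then gives the power of [n]. *)
Lemma gauss_moment_bound (c : R) k : 0 < c -> exists2 C : R, 0 < C &
  forall n : nat, (0 < n)%N -> forall A : R, 0 <= A -> forall f, continuous f ->
  (forall t, - pi <= t <= pi -> `|f t| <= A * (`|t| ^+ k * expR (- (c * n%:R * t ^+ 2)))) ->
  `|Ipi f| <= A * C / Num.sqrt n%:R ^+ k.+1.
Proof.
move=> c0; have [K K0 HK] := exp_absorbs_power k c0.
have c2 : 0 < c / 2 by rewrite divr_gt0.
exists (K * Num.sqrt (pi / (c / 2))).
  by rewrite mulr_gt0// sqrtr_gt0 divr_gt0// pi_gt0.
move=> n n0 A A0 f cf Hf; pose s : R := Num.sqrt n%:R.
have nR : 0 < n%:R :> R by rewrite ltr0n.
have s0 : 0 < s by rewrite sqrtr_gt0.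
have s2 : s ^+ 2 = n%:R by rewrite sqr_sqrtr// ltW.
have a0 : 0 < c / 2 * n%:R by rewrite mulr_gt0.
apply: (@le_trans _ _ (Ipi (fun t => (A * K / s ^+ k) * expR (- (c / 2 * n%:R * t ^+ 2))))).
  apply: le_norm_Ipi => //.
    move=> t; apply: cvgM; first exact: cvg_cst.
    exact: continuous_gauss.
  move=> t tpi; apply: (le_trans (Hf t tpi)).
  have := HK (s * `|t|) (mulr_ge0 (ltW s0) (normr_ge0 t)).
  rewrite !exprMn s2 real_normK ?num_real// (mulrA c) (mulrA (c / 2)) => h.
  have sk : 0 < s ^+ k by rewrite exprn_gt0.
  have h' : `|t| ^+ k * expR (- (c * n%:R * t ^+ 2)) <=
      K * expR (- (c / 2 * n%:R * t ^+ 2)) / s ^+ k.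
    by rewrite ler_pdivlMr// mulrC (mulrA (s ^+ k)).
  apply: le_trans (ler_wpM2l A0 h') _.
  by rewrite le_eqVlt; apply/orP; left; apply/eqP; ring.
rewrite IpiZ; last exact: continuous_gauss.
apply: (@le_trans _ _ (A * K / s ^+ k * Num.sqrt (pi / (c / 2 * n%:R)))).
  rewrite ler_wpM2l ?Ipi_gauss_le//.
  by rewrite divr_ge0 ?exprn_ge0 ?mulr_ge0 ?(ltW K0) ?(ltW s0).
have -> : pi / (c / 2 * n%:R) = pi / (c / 2) / n%:R by rewrite invfM mulrA.
rewrite sqrtrM; last by rewrite divr_ge0 ?pi_ge0// ltW.
rewrite sqrtrV -/s; last exact: ltW.
rewrite le_eqVlt; apply/orP; left; apply/eqP; rewrite exprSr.
have sk : s ^+ k != 0 by rewrite expf_neq0// gt_eqF.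
by field; rewrite sk gt_eqF.
Qed.

Lemma Ipi_derive (F f : R -> R) : (forall t, is_derive t 1 F (f t)) -> continuous f ->
  Ipi f = F pi - F (- pi).
Proof.
move=> dF cf; rewrite /Ipi /Rintegral.
rewrite (@continuous_FTC2 _ f F)//.
- by have := @pi_gt0 R; lra.
- exact: continuous_subspaceT.
- have cF : continuous F.
    by move=> t; apply: differentiable_continuous; apply/derivable1_diffP; exact: ex_derive.
  split.
  + by move=> t _; exact: ex_derive.
  + by apply: cvg_at_right_filter; exact: cF.
  + by apply: cvg_at_left_filter; exact: cF.
- by move=> t _; rewrite derive1E; exact: derive_val.
Qed.

Lemma Ipi_cos (j : R) (m : int) : j = m%:~R -> m != 0 -> Ipi (fun t => cos (j * t)) = 0.
Proof.
move=> jm m0; have j0 : j != 0 by rewrite jm intr_eq0.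
have D t : is_derive t 1 (fun t => sin (j * t) / j) (cos (j * t)).
  by apply: is_derive_eq; rewrite /GRing.scale/=; field.
have cj : continuous (fun t : R => cos (j * t)).
  move=> t; apply: (@continuous_comp _ _ _ (fun t => j * t) cos); last exact: continuous_cos.
  by apply: cvgM; [exact: cvg_cst|exact: cvg_id].
rewrite (Ipi_derive D cj); have N n : sin (n%:R * pi) = 0 :> R.
  elim: n => [|n IH]; first by rewrite mul0r sin0.
  by rewrite -natr1 mulrDl mul1r sinDpi IH oppr0.
have S : sin (j * pi) = 0.
  rewrite jm; case: (m) => n; first by rewrite -pmulrn N.
  by rewrite NegzE mulrNz mulNr sinN -pmulrn N oppr0.
by rewrite mulrN sinN S oppr0 mul0r subrr.
Qed.

Lemma Ipi_1 : Ipi (fun=> 1) = 2 * pi.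
Proof.
have D (t : R) : is_derive t 1 id (1 : R) by exact: is_derive_id.
rewrite (Ipi_derive D); last exact: cst_continuous.
by rewrite opprK mulr_natl mulr2n.
Qed.

End PeriodIntegral.

(** * Complex exponentials and characteristic functions *)

Section Cis.
Context {R : realType}.
Implicit Types (u v t : R).

Definition cis u : R[i] := cos u +i* sin u.

Lemma cisD u v : cis (u + v) = cis u * cis v.
Proof.
apply/eqP; rewrite eq_complex /= cosD sinD.
by apply/andP; split; apply/eqP; ring.
Qed.

Lemma cis0 : cis 0 = 1.
Proof. by rewrite /cis cos0 sin0. Qed.

Lemma cabs_cis u : cabs (cis u) = 1.
Proof. by rewrite /= cos2Dsin2 sqrtr1. Qed.

Lemma cis_nat n u : cis (n%:R * u) = cis u ^+ n.
Proof.
elim: n => [|n IH]; first by rewrite mul0r cis0.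
by rewrite -natr1 mulrDl mul1r cisD IH exprSr.
Qed.

Lemma cabs_cisB1 u : cabs (cis u - 1) <= 2 * `|u|.
Proof.
apply: (le_trans (cabs_le_ReIm _)) => /=; rewrite oppr0 addr0.
by have := cos_linear u; have := abs_sin_le u; lra.
Qed.

Lemma cabs_cisB u v : cabs (cis u - cis v) <= 2 * `|u - v|.
Proof.
have -> : cis u - cis v = cis v * (cis (u - v) - 1).
  by rewrite mulrBr -cisD mulr1 [v + _]addrC subrK.
by rewrite cabsM cabs_cis mul1r; exact: cabs_cisB1.
Qed.

(** Continuity of both components, the form in which integrals over a period need it. *)
Definition ccont (F : R -> R[i]) :=
  continuous (fun t => complex.Re (F t)) /\ continuous (fun t => complex.Im (F t)).

Lemma ccont_cst z : ccont (fun=> z).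
Proof. by split; exact: cst_continuous. Qed.

Lemma ccontB F G : ccont F -> ccont G -> ccont (fun t => F t - G t).
Proof.
move=> [a b] [c d]; split.
  rewrite (_ : (fun t => _) = fun t => complex.Re (F t) - complex.Re (G t)); last first.
    by apply/funext => t; case: (F t); case: (G t).
  by move=> t; apply: cvgB; [exact: a|exact: c].
rewrite (_ : (fun t => _) = fun t => complex.Im (F t) - complex.Im (G t)); last first.
  by apply/funext => t; case: (F t); case: (G t).
by move=> t; apply: cvgB; [exact: b|exact: d].
Qed.

Lemma ccontM F G : ccont F -> ccont G -> ccont (fun t => F t * G t).
Proof.
move=> [a b] [c d]; split.
  rewrite (_ : (fun t => _) = fun t => complex.Re (F t) * complex.Re (G t) -
      complex.Im (F t) * complex.Im (G t)); last first.
    by apply/funext => t; case: (F t); case: (G t).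
  by move=> t; apply: cvgB; apply: cvgM; [exact: a|exact: c|exact: b|exact: d].
rewrite (_ : (fun t => _) = fun t => complex.Re (F t) * complex.Im (G t) +
    complex.Im (F t) * complex.Re (G t)); last first.
  by apply/funext => t; case: (F t); case: (G t) => /= *; rewrite addrC.
by move=> t; apply: cvgD; apply: cvgM; [exact: a|exact: d|exact: b|exact: c].
Qed.

Lemma ccontX F n : ccont F -> ccont (fun t => F t ^+ n).
Proof.
move=> cF; elim: n => [|n IH]; first exact: ccont_cst.
rewrite (_ : (fun t => _) = fun t => F t * F t ^+ n); first exact: ccontM.
by apply/funext => t; rewrite exprS.
Qed.

Lemma ccont_lipschitz (F : R -> R[i]) (K : R) :
  (forall u v, cabs (F u - F v) <= K * `|u - v|) -> ccont F.
Proof.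
move=> FK.
have H (f : R -> R) : (forall u v, `|f u - f v| <= K * `|u - v|) -> continuous f.
  move=> fK t; apply/cvgrPdist_lt => e e0; have K1 : 0 < `|K| + 1 by rewrite ltr_wpDl.
  near=> s; apply: (le_lt_trans (fK t s)).
  apply: (@le_lt_trans _ _ ((`|K| + 1) * `|t - s|)).
    by rewrite ler_wpM2r// ler_wpDr// ler_norm.
  rewrite -ltr_pdivlMl//; near: s; apply: cvgr_dist_lt => //.
  by rewrite mulr_gt0// invr_gt0.
split; apply: H => u v; apply: le_trans (FK u v).
  apply: le_trans (abs_Re_le _); by case: (F u); case: (F v).
apply: le_trans (abs_Im_le _); by case: (F u); case: (F v).
Unshelve. all: by end_near. Qed.

Lemma ccont_cis (a : R) : ccont (fun t => cis (t * a)).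
Proof.
apply: (@ccont_lipschitz _ (2 * `|a|)) => u v; apply: (le_trans (cabs_cisB _ _)).
by rewrite -mulrBl normrM mulrCA mulrC mulrAC.
Qed.

Lemma ccont_real (f : R -> R) : continuous f -> ccont (fun t => (f t)%:C).
Proof. by move=> cf; split => //; exact: cst_continuous. Qed.

(** The real part suffices: all integrals of interest are real by symmetry. *)
Definition cIpi (F : R -> R[i]) : R := Ipi (fun t => complex.Re (F t)).

Lemma cIpiB F G : ccont F -> ccont G -> cIpi (fun t => F t - G t) = cIpi F - cIpi G.
Proof.
move=> [cF _] [cG _]; rewrite /cIpi -IpiB//; apply: eq_Ipi => t.
by case: (F t); case: (G t).
Qed.

Lemma cIpi_sup (F : R -> R[i]) (M : R) : ccont F ->
  (forall t, - pi <= t <= pi -> cabs (F t) <= M) -> `|cIpi F| <= M * (2 * pi).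
Proof.
move=> [cF _] FM; rewrite -Ipi_1 -IpiZ; last exact: cst_continuous.
apply: le_norm_Ipi => //; first by move=> t; exact: cst_continuous.
by move=> t tpi; rewrite mulr1; apply: le_trans (abs_Re_le _) (FM t tpi).
Qed.

Lemma cabs_expB (a b : R[i]) (M : R) n : cabs a <= M -> cabs b <= M ->
  cabs (a ^+ n.+1 - b ^+ n.+1) <= n.+1%:R * M ^+ n * cabs (a - b).
Proof.
move=> aM bM; have M0 : 0 <= M by apply: le_trans aM; exact: cabs_ge0.
elim: n => [|n IH]; first by rewrite !expr1 expr0 mulr1 mul1r.
have -> : a ^+ n.+2 - b ^+ n.+2 = a * (a ^+ n.+1 - b ^+ n.+1) + (a - b) * b ^+ n.+1.
  by rewrite ![_ ^+ n.+2]exprS; ring.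
apply: le_trans (ler_cabsD _ _) _; rewrite !cabsM cabsX.
rewrite -[n.+2%:R]natr1 !mulrDl mul1r; apply: lerD.
  have E (x y z : R) : x * (M * y) * z = M * (x * y * z) by ring.
  by rewrite [M ^+ n.+1]exprS E; apply: ler_pM; rewrite ?cabs_ge0.
rewrite mulrC ler_wpM2r ?cabs_ge0// lerXn2r// nnegrE//; exact: cabs_ge0.
Qed.

End Cis.

Section CharFun.
Context {R : realType} (xi : probability nat R).
Hypothesis m2 : finite_second_moment xi.
Local Notation p := (offspring_prob xi).
Local Notation mean := (mean xi).

Lemma quad_bounded_cos (f : nat -> R) : quad_bounded (fun k => cos (f k)).
Proof.
apply: (@quad_bounded_bounded _ _ 1) => k.
by rewrite ler_norml cos_geN1 cos_le1.
Qed.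

Lemma quad_bounded_sin (f : nat -> R) : quad_bounded (fun k => sin (f k)).
Proof.
apply: (@quad_bounded_bounded _ _ 1) => k.
by rewrite ler_norml sin_geN1 sin_le1.
Qed.

(** The mean of [exp(i f)]. *)
Definition cmean (f : nat -> R) : R[i] :=
  mean (fun k => cos (f k)) +i* mean (fun k => sin (f k)).

Lemma cmeanD f u : cmean (fun k => f k + u) = cmean f * cis u.
Proof.
have qc := quad_bounded_cos f; have qs := quad_bounded_sin f.
have E1 : mean (fun k => cos (f k + u)) =
    cos u * mean (fun k => cos (f k)) - sin u * mean (fun k => sin (f k)).
  rewrite -(meanZ m2 (cos u) qc) -(meanZ m2 (sin u) qs).
  rewrite -(meanB m2 (quad_boundedZ _ qc) (quad_boundedZ _ qs)).
  by congr (mean _); apply/funext => k; rewrite cosD; ring.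
have E2 : mean (fun k => sin (f k + u)) =
    cos u * mean (fun k => sin (f k)) + sin u * mean (fun k => cos (f k)).
  rewrite -(meanZ m2 (cos u) qs) -(meanZ m2 (sin u) qc).
  rewrite -(meanD m2 (quad_boundedZ _ qs) (quad_boundedZ _ qc)).
  by congr (mean _); apply/funext => k; rewrite sinD; ring.
by apply/eqP; rewrite eq_complex /= E1 E2; apply/andP; split; apply/eqP; ring.
Qed.

End CharFun.

(** * The span of the offspring distribution *)

Section Span.
Context {R : realType} (xi : probability nat R) (sigma : R).
Hypothesis crit : critical xi sigma.
Local Notation p := (offspring_prob xi).
Local Notation mean := (mean xi).
Local Notation cmean := (cmean xi).
Let m2 := critical_second_moment crit.

Lemma offspring_prob_le1 k : p k <= 1.
Proof.
rewrite -mean_indic1 -[leRHS](mean1 xi); apply: (le_mean m2).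
- exact: (quad_bounded_indic (fun j => j == k)).
- by apply: (@quad_bounded_bounded _ _ 1) => j; rewrite normr1.
- by move=> j; case: eqP.
Qed.

(** With [e] the direction of the mean, [1 - |E exp(i f)|] is the mean of [|exp(i f) - e|^2
   / 2]; the two points [i] and [j] alone contribute this much, since [e] cannot be close to
   both values. *)
Lemma cmean_defect (f : nat -> R) i j (m : R) : 0 <= m -> m <= p i -> m <= p j ->
  m / 2 * sin ((f i - f j) / 2) ^+ 2 <= 1 - cabs (cmean f).
Proof.
move=> m0 mi mj; set r := cabs _.
have sq1 : sin ((f i - f j) / 2) ^+ 2 <= 1.
  have := cos2Dsin2 ((f i - f j) / 2); have := sqr_ge0 (cos ((f i - f j) / 2)); lra.
have m1 : m <= 1 := le_trans mi (offspring_prob_le1 i).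
have [r0|r0] := eqVneq r 0.
  rewrite r0 subr0; apply: (@le_trans _ _ (1 * 1)); last by rewrite mulr1.
  apply: ler_pM => //; rewrite ?divr_ge0 ?sqr_ge0//; move: m1; lra.
set C := mean (fun k => cos (f k)); set S := mean (fun k => sin (f k)).
have r2 : r ^+ 2 = C ^+ 2 + S ^+ 2 by rewrite cabs_sqr.
pose a := C / r; pose b := S / r.
have ab : a ^+ 2 + b ^+ 2 = 1.
  by rewrite /a /b !exprMn -mulrDl -r2 -exprMn mulfV// expr1n.
(* With (a, b) the direction of the mean, g is half the squared distance to it. *)
pose g k := 1 - (a * cos (f k) + b * sin (f k)).
have gE k : g k = 2^-1 * ((a - cos (f k)) ^+ 2 + (b - sin (f k)) ^+ 2).
  have -> : (a - cos (f k)) ^+ 2 + (b - sin (f k)) ^+ 2 =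
    (a ^+ 2 + b ^+ 2) + (cos (f k) ^+ 2 + sin (f k) ^+ 2) -
     2 * (a * cos (f k) + b * sin (f k)) by ring.
  by rewrite ab cos2Dsin2 /g; field.
have g0 k : 0 <= g k by rewrite gE mulr_ge0 ?invr_ge0// addr_ge0 ?sqr_ge0.
have q1 : quad_bounded (fun=> 1 : R).
  by apply: (@quad_bounded_bounded _ _ 1) => k; rewrite normr1.
have qc := quad_boundedZ a (quad_bounded_cos f); have qs := quad_boundedZ b (quad_bounded_sin f).
have qcs := quad_boundedD qc qs.
have qg : quad_bounded g.
  have -> : g = fun k => 1 + (-1) * (a * cos (f k) + b * sin (f k)).
    by apply/funext => k; rewrite /g; ring.
  by apply: quad_boundedD => //; exact: quad_boundedZ.
have mg : mean g = 1 - r.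
  rewrite /g (meanB m2 q1 qcs) (meanD m2 qc qs) mean1.
  rewrite (meanZ m2 _ (quad_bounded_cos f)) (meanZ m2 _ (quad_bounded_sin f)) -/C -/S.
  have -> : a * C + b * S = (C ^+ 2 + S ^+ 2) / r by rewrite /a /b; ring.
  by rewrite -r2 expr2 mulfK.
have := mean_point m2 i qg g0; have := mean_point m2 j qg g0; rewrite mg.
have := ler_wpM2l (g0 i) mi; have := ler_wpM2l (g0 j) mj.
suff : m * sin ((f i - f j) / 2) ^+ 2 <= m * (g i + g j) by lra.
rewrite ler_wpM2l// !gE.
have -> : sin ((f i - f j) / 2) ^+ 2 = 2^-1 * (1 - cos (f i - f j)).
  set u := (f i - f j) / 2; have -> : f i - f j = u + u by rewrite /u; field.
  by rewrite cosD; have := cos2Dsin2 u; rewrite !expr2; lra.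
rewrite cosB; have := cos2Dsin2 (f i); have := cos2Dsin2 (f j).
have := sqr_ge0 ((a - cos (f i)) + (a - cos (f j))).
have := sqr_ge0 ((b - sin (f i)) + (b - sin (f j))).
rewrite !expr2; lra.
Qed.

Lemma cabs_cmean_le1 f : cabs (cmean f) <= 1.
Proof.
have := @cmean_defect f 0 0 0 (lexx _) (offspring_prob_ge0 _ _) (offspring_prob_ge0 _ _).
by rewrite !mul0r subr_ge0.
Qed.

Definition chf (s : R) : R[i] := cmean (fun k => s * k%:R).

(** The modulus of the characteristic function stays away from [1] unless [exp(i s g) = 1]. *)
Definition spanned (g : nat) := exists2 c : R, 0 < c &
  forall s, c * sin (s * g%:R / 2) ^+ 2 <= 1 - cabs (chf s).

(** Apply [cmean_defect] to the points [0] and [k], both of positive probability. *)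
Lemma spanned_support k : 0 < p k -> spanned k.
Proof.
move=> pk; exists (Num.min (p 0) (p k) / 2).
  by rewrite divr_gt0// lt_min (offspring_prob0_gt0 crit).
move=> s; have := @cmean_defect (fun k => s * k%:R) k 0 (Num.min (p 0) (p k)).
rewrite mulr0 subr0; apply; rewrite ?ge_min ?lexx ?orbT//.
by rewrite le_min !offspring_prob_ge0.
Qed.

(** From [|sin (a + b)| <= |sin a| + |sin b|]. *)
Lemma spanned_comb (x y z : nat) (e : R) : e ^+ 2 = 1 -> spanned x -> spanned y ->
  z%:R = x%:R + e * y%:R -> spanned z.
Proof.
move=> e1 [cx cx0 X] [cy cy0 Y] zE; pose c := (2 * (cx^-1 + cy^-1))^-1.
have K0 : 0 < 2 * (cx^-1 + cy^-1) by rewrite mulr_gt0// addr_gt0// invr_gt0.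
exists c; first by rewrite invr_gt0.
move=> s; set r := 1 - _; pose u := s * x%:R / 2; pose v := e * (s * y%:R / 2).
have Xr : sin u ^+ 2 <= r / cx by rewrite ler_pdivlMr// mulrC; exact: X.
have sv : sin v ^+ 2 = sin (s * y%:R / 2) ^+ 2.
  move/eqP: e1; rewrite sqrf_eq1 /v => /orP[/eqP ->|/eqP ->]; first by rewrite mul1r.
  by rewrite mulN1r sinN sqrrN.
have Yr : sin v ^+ 2 <= r / cy by rewrite ler_pdivlMr// mulrC sv; exact: Y.
have -> : s * z%:R / 2 = u + v by rewrite zE /u /v; ring.
rewrite /c ler_pdivrMl//; apply: (@le_trans _ _ (2 * (sin u ^+ 2 + sin v ^+ 2))).
  rewrite sinD; set a := sin u; set b := sin v.
  have ca : cos u ^+ 2 <= 1 by have := cos2Dsin2 u; have := sqr_ge0 (sin u); lra.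
  have cb : cos v ^+ 2 <= 1 by have := cos2Dsin2 v; have := sqr_ge0 (sin v); lra.
  have h1 : (a * cos v) ^+ 2 <= a ^+ 2 by rewrite exprMn ler_piMr ?sqr_ge0.
  have h2 : (cos u * b) ^+ 2 <= b ^+ 2 by rewrite exprMn ler_piMl ?sqr_ge0.
  have := sqr_ge0 (a * cos v - cos u * b); move: h1 h2.
  by move: (a * cos v) (cos u * b) => A B; rewrite !expr2; lra.
have -> : 2 * (cx^-1 + cy^-1) * r = 2 * (r / cx + r / cy) by ring.
by rewrite ler_wpM2l// lerD.
Qed.

(** The positive [g] such that [spanned g] include the positive points of the support and
   are closed under remainders, so the least one divides all points of the support, as in
   the Euclidean algorithm. *)
Lemma span_exists : exists h : nat,
  [/\ (0 < h)%N, forall k, 0 < p k -> (h %| k)%N & spanned h].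
Proof.
have ex : exists n, (0 < n)%N && `[< spanned n >].
  have [k /andP[k0 pk]] : exists k, (0 < k)%N && (0 < p k).
    apply: contrapT => nk.
    have pz k : (0 < k)%N -> p k = 0.
      move=> k0; apply/eqP; rewrite eq_le offspring_prob_ge0 andbT leNgt.
      by apply/negP => pk; apply: nk; exists k; rewrite k0.
    pose f (k : nat) : R := k%:R.
    have qf : quad_bounded f.
      have -> : f = fun k => (k%:R - 1) + 1 by apply/funext => k; rewrite /f subrK.
      apply: quad_boundedD; first exact: quad_bounded_id.
      by apply: (@quad_bounded_bounded _ _ 1) => k; rewrite normr1.
    have : (fun N => mean (fun k => f k * (k < N)%:R)) @ \oo --> (0 : R).
      rewrite (_ : (fun N => _) = fun=> 0); first exact: cvg_cst.
      apply/funext => N; rewrite mean_trunc// big1// => -[[|k] kN] _ /=.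
        by rewrite /f mul0r.
      by rewrite pz// mulr0.
    move=> /(cvg_unique (@Rhausdorff R) (cvg_mean_trunc m2 qf)).
    by rewrite (mean_id crit) => /eqP; rewrite oner_eq0.
  by exists k; rewrite k0; apply/asboolP; exact: spanned_support.
case: (ex_minnP ex) => h /andP[h0 /asboolP sh] hmin; exists h; split=> // k pk.
rewrite /dvdn; apply/negPn/negP => kh.
have sk := spanned_support pk.
have sm q : (q * h <= k)%N -> spanned (k - q * h).
  elim: q => [|q IH] qk; first by rewrite mul0n subn0.
  have qk' : (q * h <= k)%N by apply: leq_trans qk; rewrite leq_mul2r leqnSn orbT.
  apply: (@spanned_comb _ _ _ (-1) _ (IH qk') sh); first by rewrite sqrrN expr1n.
  by rewrite !natrB// -addn1 mulnDl mul1n natrD; ring.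
have : spanned (k %% h).
  have -> : (k %% h = k - k %/ h * h)%N by rewrite {2}(divn_eq k h) addKn.
  by apply: sm; exact: leq_trunc_div.
move=> /asboolP skh; have := hmin (k %% h)%N; rewrite lt0n kh skh => /(_ isT).
by rewrite leqNgt ltn_mod h0.
Qed.

End Span.

(** * Fourier inversion for the walk *)

Section Fourier.
Context {R : realType} (xi : probability nat R) (sigma : R).
Hypothesis crit : critical xi sigma.
Local Notation p := (offspring_prob xi).
Let m2 := critical_second_moment crit.
Variable h : nat.
Hypothesis h0 : (0 < h)%N.
Hypothesis h_span : forall k, 0 < p k -> (h %| k)%N.

Lemma pgf_exp_span N n j : ~~ (h %| j)%N -> ((pgf p N) ^+ n)`_j = 0.
Proof.
elim: n j => [|n IH] j hj.
  by rewrite expr0 coef1; case: j hj => //; rewrite dvdn0.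
rewrite exprS coefM big1// => i _.
have [hji|hji] := boolP (h %| j - i)%N; last by rewrite IH// mulr0.
have hi : ~~ (h %| i)%N.
  by apply: contra hj => hi; rewrite -(subnKC (leq_ord i)) dvdn_add.
rewrite coef_poly; case: ifP => _; rewrite ?mul0r//.
suff -> : p i = 0 by rewrite mul0r.
apply/eqP; rewrite eq_le offspring_prob_ge0 andbT leNgt.
by apply: contra hi => /h_span.
Qed.

Lemma walk_span n i : ~~ (h %| i)%N -> walk p n i = 0.
Proof. by move=> hi; rewrite /walk pgf_exp_span. Qed.

(** The characteristic function of the truncated distribution; its powers are trigonometric
   polynomials, for which Fourier inversion is a finite computation. *)
Definition tchf (N : nat) (s : R) : R[i] :=
  \sum_(k < N) (p k)%:C * cis (s * k%:R).

Lemma tchf_horner N s :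
  tchf N s = (map_poly (real_complex R) (pgf p N)).[cis s].
Proof.
rewrite /pgf (@horner_coef_wide _ N); last first.
  by apply: leq_trans (size_poly _ _) _; rewrite ?size_map_poly ?size_poly.
rewrite /tchf; apply: eq_bigr => k _.
by rewrite coef_map/= coef_poly ltn_ord -cis_nat [s * _]mulrC.
Qed.

Lemma tchf_exp N n s : tchf N s ^+ n =
  \sum_(j < size (pgf p N ^+ n)) ((pgf p N ^+ n)`_j)%:C * cis (s * j%:R).
Proof.
rewrite tchf_horner -horner_exp -rmorphXn/= (@horner_coef_wide _ (size (pgf p N ^+ n))).
  by apply: eq_bigr => j _; rewrite coef_map/= -cis_nat [s * _]mulrC.
exact: size_poly.
Qed.

Lemma tchf_approx (e : R) : 0 < e -> exists N0, forall N, (N0 <= N)%N ->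
  forall s, cabs (chf xi s - tchf N s) <= e.
Proof.
move=> e0; have q1 : quad_bounded (fun=> 1 : R).
  by apply: (@quad_bounded_bounded _ _ 1) => k; rewrite normr1.
have e2 : 0 < e / 2 by rewrite divr_gt0.
have [N0 H] := mean_tail m2 q1 e2; exists N0 => N /H {}H s.
have T (f : nat -> R) : (forall k, `|f k| <= 1) ->
    `|mean xi f - \sum_(k < N) f k * p k| <= e / 2.
  move=> f1; have qf := quad_bounded_bounded f1.
  rewrite -mean_trunc// -(meanB m2 qf (quad_bounded_restr (fun k => (k < N)%N) qf)).
  apply: le_trans (ltW H); apply: le_trans (ler_norm _).
  apply: (norm_mean_le m2); first exact: (quad_bounded_restr (fun k => (N <= k)%N) q1).
  move=> k; case: ltnP => _; rewrite ?mulr1 ?subrr ?normr0 ?mulr0 ?subr0//.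
have -> : tchf N s = (\sum_(k < N) cos (s * k%:R) * p k) +i* (\sum_(k < N) sin (s * k%:R) * p k).
  rewrite /tchf; elim: (N) => [|M IH]; first by rewrite !big_ord0.
  rewrite !big_ord_recr/= IH; apply/eqP; rewrite eq_complex/= !mul0r subr0 addr0.
  by rewrite ![_ * p M]mulrC !eqxx.
apply: (le_trans (cabs_le_ReIm _)).
have -> : e = e / 2 + e / 2 by field.
apply: lerD.
  apply: (T (fun k => cos (s * k%:R))) => k.
  by rewrite ler_norml cos_geN1 cos_le1.
apply: (T (fun k => sin (s * k%:R))) => k.
by rewrite ler_norml sin_geN1 sin_le1.
Qed.

Lemma ccont_chf (a b : R) : ccont (fun t => chf xi (t * a)).
Proof.
have qi : quad_bounded (fun k : nat => k%:R : R).
  have -> : (fun k : nat => k%:R : R) = fun k => (k%:R - 1) + 1.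
    by apply/funext => k; rewrite subrK.
  apply: quad_boundedD; first exact: quad_bounded_id.
  by apply: (@quad_bounded_bounded _ _ 1) => k; rewrite normr1.
apply: (@ccont_lipschitz _ _ (4 * `|a|)) => u v.
have T (f : R -> R) : (forall x y, `|f x - f y| <= 2 * `|x - y|) ->
    (forall x, `|f x| <= 1) ->
    `|mean xi (fun k => f (u * a * k%:R)) - mean xi (fun k => f (v * a * k%:R))|
     <= 2 * `|a| * `|u - v|.
  move=> fL f1.
  have qu : quad_bounded (fun k : nat => f (u * a * k%:R)) by exact: quad_bounded_bounded.
  have qv : quad_bounded (fun k : nat => f (v * a * k%:R)) by exact: quad_bounded_bounded.
  rewrite -(meanB m2 qu qv) -[leRHS]mulr1 -[X in _ <= _ * X](mean_id crit) -(meanZ m2 _ qi).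
  apply: norm_mean_le => //; first exact: quad_boundedZ.
  move=> k; apply: (le_trans (fL _ _)).
  rewrite -mulrBl -mulrBl !normrM (ger0_norm (ler0n _ k)).
  by rewrite le_eqVlt; apply/orP; left; apply/eqP; ring.
apply: (le_trans (cabs_le_ReIm _)).
have -> : 4 * `|a| * `|u - v| = 2 * `|a| * `|u - v| + 2 * `|a| * `|u - v| by ring.
apply: lerD.
  apply: (T cos) => [x y|x]; last by rewrite ler_norml cos_geN1 cos_le1.
  by apply: le_trans (cabs_cisB x y); exact: abs_Re_le (cis x - cis y).
apply: (T sin) => [x y|x]; last by rewrite ler_norml sin_geN1 sin_le1.
by apply: le_trans (cabs_cisB x y); exact: abs_Im_le (cis x - cis y).
Qed.

Lemma Ipi_tchf N n i : (h %| i)%N -> (i < N)%N ->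
  cIpi (fun t => tchf N (t / h%:R) ^+ n * cis (- (t / h%:R * i%:R))) =
  2 * pi * walk p n i.
Proof.
move=> hi iN; have hR : h%:R != 0 :> R by rewrite pnatr_eq0 gtn_eqF.
set Q := pgf p N ^+ n.
have E t : complex.Re (tchf N (t / h%:R) ^+ n * cis (- (t / h%:R * i%:R))) =
    \sum_(j < size Q) Q`_j * cos ((j%:R - i%:R) / h%:R * t).
  rewrite tchf_exp mulr_suml -/Q.
  rewrite (big_morph (@complex.Re R) (id1 := 0) (op1 := +%R)) => //; last by move=> [? ?] [? ?].
  apply: eq_bigr => j _; rewrite -mulrA -cisD /=  mul0r subr0; congr (_ * cos _); ring.
rewrite /cIpi (eq_Ipi E) (@Ipi_sum R _ (fun j => Q`_j) (fun j t => cos ((j%:R - i%:R) / h%:R * t))); last first.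
  move=> j t; apply: (@continuous_comp _ _ _ (fun t : R => (j%:R - i%:R) / h%:R * t) cos); last exact: continuous_cos.
  by apply: cvgM; [exact: cvg_cst|exact: cvg_id].
have T (j : nat) : Q`_j * Ipi (fun t => cos ((j%:R - i%:R) / h%:R * t)) =
    if j == i then 2 * pi * walk p n i else 0.
  case: eqP => [->|/eqP ji].
    rewrite subrr mul0r -(@walkE _ p N n i)// mulrC -Ipi_1; congr (_ * _).
    by apply: eq_Ipi => t; rewrite mul0r cos0.
  have [hj|hj] := boolP (h %| j)%N; last by rewrite /Q pgf_exp_span ?mul0r.
  rewrite (@Ipi_cos _ _ ((j %/ h)%:Z - (i %/ h)%:Z)) ?mulr0//.
    rewrite -{1}(divnK hj) -{1}(divnK hi) rmorphB/= !natrM -!pmulrn.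
    by field.
  by rewrite subr_eq0 eqz_nat; apply: contra ji => /eqP e; rewrite -(divnK hj) e divnK.
under eq_bigr do rewrite T.
have [iQ|iQ] := ltnP i (size Q).
  by rewrite (bigD1 (Ordinal iQ))//= eqxx big1 ?addr0// => j /negbTE ij; rewrite -val_eqE/= in ij; rewrite ij.
rewrite big1 => [|j _]; last by case: eqP => // ji; have := ltn_ord j; rewrite ji ltnNge iQ.
by rewrite -(@walkE _ p N n i)// -/Q nth_default ?mulr0.
Qed.

(** Both sides are limits of those for the truncated distribution. The variable is rescaled
   by [h], which makes the integrand periodic and leaves [0] as the only point of the period
   where the characteristic function has modulus [1]. *)
Lemma walk_fourier n i : (h %| i)%N ->
  cIpi (fun t => chf xi (t / h%:R) ^+ n * cis (- (t / h%:R * i%:R))) =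
  2 * pi * walk p n i.
Proof.
move=> hi; case: n => [|n].
  by rewrite -(@Ipi_tchf i.+1 0 i).
apply/eqP; rewrite -subr_eq0 -normr_le0; apply/ler_addgt0Pl => e e0; rewrite addr0.
pose K : R := n.+1%:R * 2 ^+ n * (2 * pi).
have K0 : 0 < K by rewrite !mulr_gt0 ?pi_gt0 ?exprn_gt0.
have e1 : 0 < Num.min 1 (e / K) by rewrite lt_min ltr01 divr_gt0.
have [N0 HN] := tchf_approx e1; pose N := maxn N0 i.+1.
have {}HN := HN N (leq_maxl _ _).
rewrite -(@Ipi_tchf N)//; last exact: leq_maxr.
have cc : ccont (fun t : R => cis (- (t / h%:R * i%:R))).
  rewrite (_ : (fun t => _) = fun t => cis (t * - (i%:R / h%:R))); first exact: ccont_cis.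
  by apply/funext => t; congr cis; ring.
have ct : ccont (fun t => tchf N (t / h%:R)).
  have cp m : ccont (fun t => \sum_(k < m) (p k)%:C * cis (t / h%:R * k%:R)).
    elim: m => [|m IH].
      rewrite (_ : (fun t => _) = fun=> 0); first exact: ccont_cst.
      by apply/funext => t; rewrite big_ord0.
    rewrite (_ : (fun t => _) = fun t => (\sum_(k < m) (p k)%:C * cis (t / h%:R * k%:R)) -
       (- (p m)%:C) * cis (t * (m%:R / h%:R))).
      apply: ccontB => //; apply: ccontM; [exact: ccont_cst|exact: ccont_cis].
    apply/funext => t; rewrite big_ord_recr/= mulNr opprK; congr (_ + _ * cis _); ring.
  exact: cp.
have cf := ccont_chf h%:R^-1 0.
rewrite -cIpiB; last 2 first.
- by apply: ccontM => //; exact: ccontX.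
- by apply: ccontM => //; exact: ccontX.
apply: (@le_trans _ _ (n.+1%:R * 2 ^+ n * (e / K) * (2 * pi))); last first.
  by rewrite le_eqVlt; apply/orP; left; apply/eqP; rewrite mulrAC -/K mulrC divfK// gt_eqF.
apply: cIpi_sup.
  by apply: ccontB; apply: ccontM => //; exact: ccontX.
move=> t _; rewrite -mulrBl cabsM cabs_cis mulr1.
have d := HN (t / h%:R).
have d1 : cabs (chf xi (t / h%:R) - tchf N (t / h%:R)) <= 1.
  by apply: (le_trans d); rewrite ge_min lexx.
have c1 : cabs (chf xi (t / h%:R)) <= 1 by exact: (cabs_cmean_le1 crit).
apply: le_trans (@cabs_expB _ _ _ 2 n _ _) _.
- by apply: (le_trans c1); lra.
- have := lerB_cabs (tchf N (t / h%:R)) (chf xi (t / h%:R)).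
  by rewrite cabs_distC; move: d1 c1; lra.
- by rewrite ler_wpM2l ?mulr_ge0 ?exprn_ge0//; apply: (le_trans d); rewrite ge_min lexx orbT.
Qed.

End Fourier.

(** * Sums of powers of square roots *)

Section RootSums.
Context {R : realType}.
Implicit Types (x : R) (n M : nat).
Local Notation sq n := (Num.sqrt (n%:R : R)).

Lemma sq_gt0 n : (0 < n)%N -> 0 < sq n.
Proof. by move=> n0; rewrite sqrtr_gt0 ltr0n. Qed.

Lemma sq_sqr n : sq n ^+ 2 = n%:R.
Proof. by rewrite sqr_sqrtr. Qed.

Lemma le_sq m n : (m <= n)%N -> sq m <= sq n.
Proof. by move=> mn; rewrite ler_sqrt// ler_nat. Qed.

Lemma inv_sq_diff n : (0 < n)%N -> (sq n ^+ 3)^-1 <= 4 * ((sq n)^-1 - (sq n.+1)^-1).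
Proof.
move=> n0; set a := sq n; set b := sq n.+1.
have a0 : 0 < a := sq_gt0 n0; have b0 : 0 < b := sq_gt0 (ltn0Sn n).
have ab : b ^+ 2 = a ^+ 2 + 1 by rewrite !sq_sqr natr1.
have a1 : 1 <= a ^+ 2 by rewrite sq_sqr ler1n.
have b2 : b <= 3 / 2 * a.
  rewrite -(ler_pXn2r (_ : 0 < 2)%N) ?nnegrE ?mulr_ge0 ?(ltW a0) ?(ltW b0)//.
  rewrite ab exprMn; move: a1; lra.
have le : a <= b by apply: le_sq.
have -> : a^-1 - b^-1 = (a * b * (a + b))^-1.
  have : (b - a) * (b + a) = 1 by rewrite -subr_sqr ab; ring.
  have sab : a + b != 0 by rewrite gt_eqF// addr_gt0.
  move=> e; rewrite -[RHS]mul1r -[in RHS]e; field.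
  by rewrite sab !gt_eqF.
have -> : 4 * (a * b * (a + b))^-1 = (a * b * (a + b) / 4)^-1.
  by rewrite invf_div.
rewrite lef_pV2 ?posrE ?exprn_gt0 ?divr_gt0 ?mulr_gt0 ?addr_gt0//.
rewrite ler_pdivrMr//.
have h1 : a * b <= 3 / 2 * a ^+ 2 by have := ler_wpM2l (ltW a0) b2; rewrite !expr2; lra.
have h2 : a + b <= 5 / 2 * a by move: b2; lra.
apply: (@le_trans _ _ ((3 / 2 * a ^+ 2) * (5 / 2 * a))).
  by apply: ler_pM => //; rewrite ?mulr_ge0 ?addr_ge0 ?(ltW a0) ?(ltW b0).
have : 0 <= a ^+ 3 by rewrite exprn_ge0// ltW.
rewrite !exprS !expr0; lra.
Qed.

Lemma sum_inv_cube_tail M x : 0 <= x ->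
  \sum_(1 <= n < M.+1) (x <= sq n)%R%:R * x * (sq n ^+ 3)^-1 <= 4.
Proof.
move=> x0; pose f n : R := Num.min (1 : R) (x / sq n).
have H : \sum_(1 <= n < M.+1) (x <= sq n)%R%:R * x * (sq n ^+ 3)^-1 <=
    4 - 4 * f M.+1.
  elim: M => [|M IH].
    rewrite big_nil.
    have : f 1%N <= 1 by rewrite /f ge_min lexx.
    lra.
  rewrite big_nat_recr//=; have le12 : sq M.+1 <= sq M.+2 by apply: le_sq.
  have p1 : 0 < sq M.+1 by apply: sq_gt0.
  have p2 : 0 < sq M.+2 by apply: sq_gt0.
  case: (leP x (sq M.+1)) => xM; last first.
    rewrite !mul0r addr0; apply: (le_trans IH).
    have h : f M.+2 <= f M.+1.
      rewrite /f le_min !ge_min lexx/=; apply/orP; right.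
      by rewrite ler_wpM2l// lef_pV2.
    by move: h; lra.
  have e1 : f M.+1 = x / sq M.+1.
    by apply/min_idPr; rewrite ler_pdivrMr// mul1r.
  have e2 : f M.+2 = x / sq M.+2.
    by apply/min_idPr; rewrite ler_pdivrMr// mul1r (le_trans xM).
  have := ler_wpM2l x0 (inv_sq_diff (ltn0Sn M)).
  move: IH; rewrite e1 e2 [true%:R]/(1 : R) mul1r.
  move: (\sum_(1 <= i < M.+1) _) ((sq M.+1)^-1) ((sq M.+2)^-1) ((sq M.+1 ^+ 3)^-1) => S a b c.
  rewrite mulrCA mulrBr; lra.
have h : 0 <= f M.+1 by rewrite /f le_min ler01/= divr_ge0// sqrtr_ge0.
by move: H h; lra.
Qed.

Lemma sum_inv_sq_head M x : 0 <= x ->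
  \sum_(1 <= n < M.+1) (sq n < x)%R%:R * (sq n)^-1 <= 2 * x.
Proof.
move=> x0; pose f n : R := Num.min x (sq n).
have H : \sum_(1 <= n < M.+1) (sq n < x)%R%:R * (sq n)^-1 <= 2 * f M.
  elim: M => [|M IH].
    by rewrite big_nil mulr_ge0// /f le_min x0 sqrtr_ge0.
  rewrite big_nat_recr//=; have p1 : 0 < sq M.+1 by apply: sq_gt0.
  have le01 : sq M <= sq M.+1 by apply: le_sq.
  case: (ltP (sq M.+1) x) => xM; last first.
    rewrite mul0r addr0; apply: (le_trans IH).
    have h : f M <= f M.+1.
      by rewrite /f le_min !ge_min lexx/= le01 orbT.
    by move: h; lra.
  have e1 : f M.+1 = sq M.+1 by apply/min_idPr/ltW.
  have e2 : f M = sq M by apply/min_idPr; apply: le_trans (ltW xM).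
  move: IH; rewrite e1 e2 mul1r.
  suff : (sq M.+1)^-1 <= 2 * (sq M.+1 - sq M) by lra.
  rewrite -(ler_pM2r p1) mulVf ?gt_eqF//.
  have b2 := sq_sqr M.+1; have a2 := sq_sqr M; have d := sqr_ge0 (sq M.+1 - sq M).
  have ab : sq M.+1 ^+ 2 = sq M ^+ 2 + 1 by rewrite a2 b2 natr1.
  by move: ab d; rewrite !expr2; lra.
have h : f M <= x by rewrite /f ge_min lexx.
by move: H h; lra.
Qed.

End RootSums.

Section LLT.
Context {R : realType} (xi : probability nat R) (sigma : R).
Hypothesis crit : critical xi sigma.
Local Notation p := (offspring_prob xi).
Local Notation mean := (mean xi).
Local Notation cmean := (cmean xi).
Let m2 := critical_second_moment crit.
Variable h : nat.
Hypothesis h0 : (0 < h)%N.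
Hypothesis h_span : forall k, 0 < p k -> (h %| k)%N.
Hypothesis h_spanned : spanned xi h.
Local Notation sq n := (Num.sqrt (n%:R : R)).

Let hR : 0 < h%:R :> R. Proof. by rewrite ltr0n. Qed.

(** The centred offspring number, in units of the span. *)
Definition step (k : nat) : R := (k%:R - 1) / h%:R.

Definition step_var : R := (sigma / h%:R) ^+ 2.
Local Notation X := step.
Local Notation V := step_var.

Lemma step_var_gt0 : 0 < V.
Proof. by have [s0 _ _] := crit; rewrite exprn_gt0// divr_gt0. Qed.

Lemma quad_bounded_step : quad_bounded X.
Proof.
have -> : X = fun k => h%:R^-1 * (k%:R - 1) by apply/funext => k; rewrite /step mulrC.
by apply: quad_boundedZ; exact: quad_bounded_id.
Qed.

Lemma quad_bounded_step2 : quad_bounded (fun k => X k ^+ 2).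
Proof.
have -> : (fun k => X k ^+ 2) = fun k => (h%:R^-1) ^+ 2 * (k%:R - 1) ^+ 2.
  by apply/funext => k; rewrite /step exprMn mulrC.
by apply: quad_boundedZ; exact: quad_bounded_sqr.
Qed.

Lemma mean_step : mean X = 0.
Proof.
have -> : X = fun k => h%:R^-1 * (k%:R - 1) by apply/funext => k; rewrite /step mulrC.
by rewrite (meanZ m2)// ?(mean_centered crit) ?mulr0//; exact: quad_bounded_id.
Qed.

Lemma mean_step2 : mean (fun k => X k ^+ 2) = V.
Proof.
have -> : (fun k => X k ^+ 2) = fun k => (h%:R^-1) ^+ 2 * (k%:R - 1) ^+ 2.
  by apply/funext => k; rewrite /step exprMn mulrC.
rewrite (meanZ m2); last exact: quad_bounded_sqr.
by rewrite (mean_var crit) /step_var exprMn mulrC.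
Qed.

(** The characteristic function of a step. *)
Definition psi (t : R) : R[i] := cmean (fun k => t * X k).

Lemma psiE t : psi t = chf xi (t / h%:R) * cis (- (t / h%:R)).
Proof.
rewrite -cmeanD//; congr cmean; apply/funext => k.
by rewrite /step; ring.
Qed.

Lemma ccont_psi : ccont psi.
Proof.
have -> : psi = fun t => chf xi (t / h%:R) * cis (t * - h%:R^-1).
  by apply/funext => t; rewrite psiE mulrN.
by apply: ccontM; [exact: (ccont_chf crit _ 0)|exact: ccont_cis].
Qed.

Lemma walk_psi n m : (m <= n)%N -> (h %| n - m)%N ->
  cIpi (fun t => psi t ^+ n * cis (t * (m%:R / h%:R))) = 2 * pi * walk p n (n - m).
Proof.
move=> mn hnm; rewrite -(walk_fourier crit h0 h_span)//; congr cIpi; apply/funext => t.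
rewrite psiE exprMn -[LHS]mulrA; congr (_ * _).
rewrite -(cis_nat n) -(cisD (n%:R * _)); congr cis.
by rewrite natrB//; ring.
Qed.

Lemma psi_le1 t : cabs (psi t) <= 1.
Proof. exact: (cabs_cmean_le1 crit). Qed.

(** As the distribution is spanned by [h], [1 - |psi t|] is at least a multiple of [sin (t /
   2) ^ 2], where the sine is at least a multiple of [t]. *)
Lemma psi_decay : exists2 c : R, 0 < c /\ c <= V / 4 &
  forall t, - pi <= t <= pi -> cabs (psi t) <= expR (- (c * t ^+ 2)).
Proof.
have [c c0 H] := h_spanned; pose c' := Num.min (c / 36) (V / 4).
exists c'.
  by rewrite lt_min !divr_gt0// ?step_var_gt0// ge_min lexx orbT.
move=> t tpi; rewrite psiE cabsM cabs_cis mulr1.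
have := H (t / h%:R); rewrite divfK ?gt_eqF// => Hc.
have := sin_half_sqr tpi => Hs.
have : c' * t ^+ 2 <= c * sin (t / 2) ^+ 2.
  apply: (@le_trans _ _ (c * (t ^+ 2 / 36))); last by rewrite ler_wpM2l// ltW.
  have -> : c * (t ^+ 2 / 36) = c / 36 * t ^+ 2 by ring.
  by rewrite ler_wpM2r ?sqr_ge0// ge_min lexx.
have := expR_ge1Dx (- (c' * t ^+ 2)); move: Hc; lra.
Qed.

(** The sine and the cosine are expanded with a common error [b]; the function [w] allows to
   replace the square of the step by its truncation. *)
Lemma psi_approx (t W : R) (w b : nat -> R) :
  quad_bounded w -> quad_bounded b -> W = mean w -> 0 <= W -> W <= V ->
  (forall k, `|cos (t * X k) - 1 + t ^+ 2 * w k / 2| <= b k) ->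
  (forall k, `|sin (t * X k) - t * X k| <= b k) ->
  cabs (psi t - (expR (- (W / 2 * t ^+ 2)))%:C) <= 2 * mean b + V ^+ 2 * t ^+ 4.
Proof.
move=> qw qb WE W0 WV Hc Hs.
have q1 : quad_bounded (fun=> 1 : R).
  by apply: (@quad_bounded_bounded _ _ 1) => k; rewrite normr1.
have qc := quad_bounded_cos (fun k => t * X k).
have qs := quad_bounded_sin (fun k => t * X k).
have qx := quad_boundedZ t quad_bounded_step.
have e1 : mean (fun k => sin (t * X k) - t * X k) = mean (fun k => sin (t * X k)).
  by rewrite (meanB m2 qs qx) (meanZ m2 _ quad_bounded_step) mean_step mulr0 subr0.
have qw2 := quad_boundedZ (t ^+ 2 / 2) qw.
have qm1 := quad_boundedZ (-1) q1.
have e2 : mean (fun k => cos (t * X k) - 1 + t ^+ 2 * w k / 2) =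
    mean (fun k => cos (t * X k)) - 1 + t ^+ 2 / 2 * W.
  have -> : (fun k => cos (t * X k) - 1 + t ^+ 2 * w k / 2) =
      fun k => (cos (t * X k) + -1 * 1) + t ^+ 2 / 2 * w k.
    by apply/funext => k; rewrite mulr1; ring.
  rewrite (meanD m2 (quad_boundedD qc qm1) qw2) (meanD m2 qc qm1).
  by rewrite (meanZ m2 _ q1) (meanZ m2 _ qw) mean1 WE; ring.
have h1 : `|mean (fun k => cos (t * X k)) - 1 + t ^+ 2 / 2 * W| <= mean b.
  by rewrite -e2; exact: (norm_mean_le m2 qb Hc).
have h2 : `|mean (fun k => sin (t * X k))| <= mean b.
  by rewrite -e1; exact: (norm_mean_le m2 qb Hs).
have y0 : 0 <= W / 2 * t ^+ 2 by rewrite mulr_ge0 ?sqr_ge0// divr_ge0.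
have h3 := expRN_quad y0.
have h4 : 2 * (W / 2 * t ^+ 2) ^+ 2 <= V ^+ 2 * t ^+ 4.
  have -> : 2 * (W / 2 * t ^+ 2) ^+ 2 = (W ^+ 2 / 2) * t ^+ 4 by field.
  rewrite ler_wpM2r//; first by rewrite (_ : t ^+ 4 = (t ^+ 2) ^+ 2) ?sqr_ge0// -exprM.
  have : W ^+ 2 <= V ^+ 2 by rewrite lerXn2r// nnegrE// (le_trans W0).
  by have := sqr_ge0 W; lra.
apply: (le_trans (cabs_le_ReIm _)); rewrite /psi /= oppr0 addr0.
have : `|mean (fun k => cos (t * X k)) - expR (- (W / 2 * t ^+ 2))| <=
   mean b + 2 * (W / 2 * t ^+ 2) ^+ 2.
  set C := mean _; set g := expR _.
  have -> : C - g = (C - 1 + t ^+ 2 / 2 * W) - (g - 1 + W / 2 * t ^+ 2) by ring.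
  by apply: le_trans (ler_normB _ _) _; exact: lerD.
move: h2 h4; lra.
Qed.

Definition trunc_var (A : R) : R := mean (fun k => X k ^+ 2 * (`|X k| <= A)%R%:R).
Definition trunc_third (A : R) : R := mean (fun k => `|X k| ^+ 3 * (`|X k| <= A)%R%:R).
Definition tail_first (A : R) : R := mean (fun k => `|X k| * (A < `|X k|)%R%:R).
Definition tail_second (A : R) : R := mean (fun k => X k ^+ 2 * (A < `|X k|)%R%:R).

Lemma quad_bounded_trunc_third A : quad_bounded (fun k => `|X k| ^+ 3 * (`|X k| <= A)%R%:R).
Proof.
apply: quad_bounded_le (quad_boundedZ A quad_bounded_step2) _ => k.
case: (leP `|X k| A) => kA; last by rewrite /= mulr0n mulr0 normr0.
have A0 : 0 <= A by apply: le_trans kA.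
rewrite /= mulr1n mulr1 normrX normr_id [leRHS]normrM normrX (ger0_norm A0) exprS.
by rewrite ler_wpM2r// exprn_ge0.
Qed.

Lemma quad_bounded_norm_step : quad_bounded (fun k => `|X k|).
Proof. by apply: quad_bounded_le quad_bounded_step _ => k; rewrite normr_id. Qed.

(** Steps of size at most [A] are expanded to third order, larger ones to first order. *)
Lemma psi_approx_trunc (A t : R) :
  cabs (psi t - (expR (- (trunc_var A / 2 * t ^+ 2)))%:C) <=
  2 * `|t| ^+ 3 * trunc_third A + 4 * `|t| * tail_first A + V ^+ 2 * t ^+ 4.
Proof.
pose S := fun k => `|X k| <= A; pose L := fun k => A < `|X k|.
have q3 := quad_boundedZ (`|t| ^+ 3) (quad_bounded_trunc_third A).
have q1 := quad_bounded_restr L quad_bounded_norm_step.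
have q1' := quad_boundedZ (2 * `|t|) q1.
have qw := quad_bounded_restr S quad_bounded_step2.
apply: le_trans (@psi_approx t (trunc_var A) _ _ qw (quad_boundedD q3 q1') _ _ _ _ _) _ => //.
- by apply: mean_ge0 => k; rewrite mulr_ge0// sqr_ge0.
- rewrite -mean_step2; apply: (le_mean m2) => //; first exact: quad_bounded_step2.
  by move=> k; rewrite ler_piMr ?sqr_ge0//; case: (`|X k| <= A).
- move=> k; rewrite /S /L; case: (leP `|X k| A) => kA; rewrite /= !(mulr1n, mulr0n, mulr1, mulr0, addr0, add0r).
    by rewrite -!exprMn -normrM; exact: cos_cubic.
  rewrite mul0r addr0 -mulrA -normrM; apply: (le_trans (cos_linear _)).
  by rewrite ler_peMl// ler1n.
- move=> k; rewrite /S /L; case: (leP `|X k| A) => kA; rewrite /= !(mulr1n, mulr0n, mulr1, mulr0, addr0, add0r).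
    by rewrite -exprMn -normrM; exact: sin_cubic.
  by rewrite -mulrA -normrM; exact: sin_linear.
rewrite (meanD m2 q3 q1') (meanZ m2 _ (quad_bounded_trunc_third A)) (meanZ m2 _ q1).
rewrite -/(trunc_third A) -/(tail_first A); lra.
Qed.

(** Dominated convergence. *)
Lemma tail_second_small (e : R) : 0 < e -> exists2 A : R, 0 < A &
  forall B, A <= B -> tail_second B <= e.
Proof.
move=> e0; have [N H] := mean_tail m2 quad_bounded_step2 e0.
exists N.+1%:R => // B NB; apply: le_trans (ltW (H N (leqnn _))).
apply: le_trans (ler_norm _); apply: (le_mean m2).
- exact: (quad_bounded_restr (fun k => B < `|X k|) quad_bounded_step2).
- exact: (quad_bounded_restr (fun k => (N <= k)%N) quad_bounded_step2).
move=> k; rewrite ler_wpM2l ?sqr_ge0//; case: (ltP B `|X k|) => // Bk.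
case: leqP => // kN; exfalso; move: Bk; apply/negP; rewrite -leNgt.
apply: le_trans NB; rewrite /step normrM normrV ?unitfE ?gt_eqF// (gtr0_norm hR).
rewrite ler_pdivrMr//; apply: (@le_trans _ _ (N.+1%:R * 1)); last first.
  by rewrite ler_wpM2l// ler1n.
rewrite mulr1; apply: le_trans (ler_normB _ _) _; rewrite normr1 normr_nat natr1.
by rewrite ler_nat ltnS ltnW.
Qed.

(** With the truncation fixed at a level where the neglected part of the variance is small. *)
Lemma psi_approx_eps (e : R) : 0 < e -> exists2 K : R, 0 < K &
  forall t, - pi <= t <= pi ->
  cabs (psi t - (expR (- (V / 2 * t ^+ 2)))%:C) <= e * `|t| ^+ 2 + K * `|t| ^+ 3.
Proof.
move=> e0; have e4 : 0 < e / 4 by rewrite divr_gt0.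
have [A A0 /(_ _ (lexx _)) HA] := tail_second_small e4.
exists (2 * trunc_third A + V ^+ 2 * pi + 1).
  rewrite ltr_wpDl//; apply: addr_ge0.
    by apply: mulr_ge0 => //; apply: mean_ge0 => k; rewrite mulr_ge0// exprn_ge0.
  by apply: mulr_ge0; [exact: sqr_ge0|exact: pi_ge0].
move=> t tpi; pose L := fun k => A < `|X k|.
have q3 := quad_boundedZ (`|t| ^+ 3) (quad_bounded_trunc_third A).
have q2 := quad_bounded_restr L quad_bounded_step2.
have q2' := quad_boundedZ (2 * t ^+ 2) q2.
apply: le_trans (@psi_approx t V _ _ quad_bounded_step2 (quad_boundedD q3 q2') _ _ _ _ _) _ => //.
- by rewrite mean_step2.
- by apply: ltW; exact: step_var_gt0.
- move=> k; rewrite /L; case: (leP `|X k| A) => kA; rewrite /= !(mulr1n, mulr0n, mulr1, mulr0, addr0, add0r).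
    by rewrite -!exprMn -normrM; exact: cos_cubic.
  rewrite -exprMn ger0_norm; last first.
    by have := cos_cubic (t * X k); have := @cos_ge_quad _ _ (normr_ge0 (t * X k)); rewrite cos_abs real_normK ?num_real.
  rewrite -[2 * _ * _]mulrA -exprMn; have := cos_le1 (t * X k); have := sqr_ge0 (t * X k); lra.
- move=> k; rewrite /L; case: (leP `|X k| A) => kA; rewrite /= !(mulr1n, mulr0n, mulr1, mulr0, addr0, add0r).
    by rewrite -exprMn -normrM; exact: sin_cubic.
  by rewrite -[2 * _ * _]mulrA -exprMn; exact: sin_quad.
rewrite (meanD m2 q3 q2') (meanZ m2 _ (quad_bounded_trunc_third A)) (meanZ m2 _ q2).
rewrite -/(trunc_third A) -/(tail_second A).
have t2 : t ^+ 2 = `|t| ^+ 2 by rewrite real_normK// num_real.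
have t4 : t ^+ 4 <= pi * `|t| ^+ 3.
  rewrite (_ : t ^+ 4 = `|t| ^+ 4); last by rewrite -[4%N]/(2 * 2)%N !exprM t2.
  rewrite exprS ler_wpM2r ?exprn_ge0//.
  by rewrite ler_norml.
have := ler_wpM2l (sqr_ge0 V) t4; have := ler_wpM2l (sqr_ge0 t) HA.
have := exprn_ge0 3 (normr_ge0 t); rewrite -t2 !mulrDl !mulrDr; lra.
Qed.

End LLT.

(** * The local limit theorem *)

Section Moments.
Context {R : realType}.

(** Each power of [t] costs a factor [n^(-1/2)]. *)
Lemma cIpi_moments (c : R) : 0 < c -> exists2 C : R, 0 < C &
  forall n : nat, (0 < n)%N -> forall a1 a2 a3 a4 : R,
  0 <= a1 -> 0 <= a2 -> 0 <= a3 -> 0 <= a4 -> forall F, ccont F ->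
  (forall t, - pi <= t <= pi -> cabs (F t) <=
    (a1 * `|t| + a2 * `|t| ^+ 2 + a3 * `|t| ^+ 3 + a4 * `|t| ^+ 4) *
     expR (- (c * n%:R * t ^+ 2))) ->
  `|cIpi F| <= C * (a1 / Num.sqrt n%:R ^+ 2 + a2 / Num.sqrt n%:R ^+ 3 +
    a3 / Num.sqrt n%:R ^+ 4 + a4 / Num.sqrt n%:R ^+ 5).
Proof.
move=> c0.
have [C1 C10 H1] := gauss_moment_bound 1 c0; have [C2 C20 H2] := gauss_moment_bound 2 c0.
have [C3 C30 H3] := gauss_moment_bound 3 c0; have [C4 C40 H4] := gauss_moment_bound 4 c0.
exists (C1 + C2 + C3 + C4); first by rewrite !addr_gt0.
move=> n n0 a1 a2 a3 a4 a10 a20 a30 a40 F [cF _] HF.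
pose m k (t : R) : R := `|t| ^+ k * expR (- (c * n%:R * t ^+ 2)).
have cm k : continuous (m k).
  move=> t; apply: cvgM; last exact: continuous_gauss.
  apply: (@continuous_comp _ _ _ (fun t : R => `|t|) (fun x => x ^+ k)).
    exact: norm_continuous.
  exact: exprn_continuous.
have m0 k t : 0 <= m k t by rewrite mulr_ge0 ?exprn_ge0 ?expR_ge0.
have cz a k : continuous (fun t => a * m k t).
  by move=> t; apply: cvgM; [exact: cvg_cst|exact: cm].
have B k (C : R) : (forall n : nat, (0 < n)%N -> forall A : R, 0 <= A -> forall f, continuous f ->
   (forall t, - pi <= t <= pi -> `|f t| <= A * (`|t| ^+ k * expR (- (c * n%:R * t ^+ 2)))) ->
   `|Ipi f| <= A * C / Num.sqrt n%:R ^+ k.+1) -> Ipi (m k) <= C / Num.sqrt n%:R ^+ k.+1.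
  move=> H; rewrite -[C]mul1r; apply: le_trans (ler_norm _) _.
  by apply: H => // t _; rewrite mul1r ger0_norm.
have s0 : 0 < Num.sqrt n%:R :> R by apply: sq_gt0.
apply: (@le_trans _ _ (Ipi (fun t => a1 * m 1%N t + a2 * m 2%N t + a3 * m 3%N t + a4 * m 4%N t))).
  apply: le_norm_Ipi => //.
    by move=> t; do 3 (apply: cvgD; last exact: cz); exact: cz.
  move=> t tpi; apply: le_trans (abs_Re_le _) _; apply: (le_trans (HF t tpi)).
  by rewrite /m expr1 !mulrDl !mulrA.
have c12 : continuous (fun t => a1 * m 1%N t + a2 * m 2%N t).
  by move=> t; apply: cvgD; exact: cz.
have c123 : continuous (fun t => a1 * m 1%N t + a2 * m 2%N t + a3 * m 3%N t).
  by move=> t; apply: cvgD; [exact: c12|exact: cz].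
rewrite (IpiD c123 (cz _ _)) (IpiD c12 (cz _ _)) (IpiD (cz _ _) (cz _ _)) !(IpiZ _ (cm _)).
have L a b (C : R) k : 0 <= a -> C <= b -> Ipi (m k) <= C / Num.sqrt n%:R ^+ k.+1 ->
    a * Ipi (m k) <= b * (a / Num.sqrt n%:R ^+ k.+1).
  move=> a0 Cb h; apply: (le_trans (ler_wpM2l a0 h)); rewrite mulrCA ler_wpM2r//.
  by rewrite divr_ge0 ?exprn_ge0 ?(ltW s0).
rewrite !mulrDr; apply: lerD; last by apply: L (B _ _ H4) => //; move: C10 C20 C30; lra.
apply: lerD; last by apply: L (B _ _ H3) => //; move: C10 C20 C40; lra.
apply: lerD; first by apply: L (B _ _ H1) => //; move: C40 C20 C30; lra.
by apply: L (B _ _ H2) => //; move: C10 C40 C30; lra.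
Qed.

End Moments.

Section LLT.
Context {R : realType} (xi : probability nat R) (sigma : R).
Hypothesis crit : critical xi sigma.
Local Notation p := (offspring_prob xi).
Let m2 := critical_second_moment crit.
Variable h : nat.
Hypothesis h0 : (0 < h)%N.
Hypothesis h_span : forall k, 0 < p k -> (h %| k)%N.
Hypothesis h_spanned : spanned xi h.
Local Notation sq n := (Num.sqrt (n%:R : R)).
Local Notation X := (step (R := R) h).
Local Notation V := (step_var sigma h).
Local Notation psi := (psi xi h).
Let hR : 0 < h%:R :> R. Proof. by rewrite ltr0n. Qed.
Let V0 : 0 < V := step_var_gt0 crit h0.

(** The characteristic function of a Gaussian sum of [n] steps of variance [W]. *)
Definition gss (W : R) (n : nat) (t : R) : R := expR (- (W / 2 * n%:R * t ^+ 2)).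

Lemma ccont_gss W n : ccont (fun t => (gss W n t)%:C).
Proof. by apply: ccont_real => t; exact: continuous_gauss. Qed.

(** By [a^n - b^n = (a - b) sum a^i b^(n-1-i)], with both bases bounded by a Gaussian; one
   factor is lost, whence [2 <= n]. *)
Lemma psi_exp_decay : exists2 c : R, 0 < c & forall n t, - pi <= t <= pi ->
  cabs (psi t ^+ n) <= expR (- (c * n%:R * t ^+ 2)) /\
  forall W, V / 2 <= W -> (2 <= n)%N ->
  cabs (psi t ^+ n - (gss W n t)%:C) <=
    n%:R * cabs (psi t - (expR (- (W / 2 * t ^+ 2)))%:C) *
    expR (- (c * n%:R * t ^+ 2)).
Proof.
have [c [c0 cV] H] := psi_decay crit h0 h_spanned.
have E (k : nat) (a t : R) : expR (- (a * t ^+ 2)) ^+ k = expR (- (a * k%:R * t ^+ 2)).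
  by rewrite -expRM_natl; congr expR; ring.
exists (c / 2); first by rewrite divr_gt0.
move=> n t tpi; split.
  rewrite cabsX; apply: (@le_trans _ _ (expR (- (c * t ^+ 2)) ^+ n)).
    by rewrite lerXn2r ?nnegrE ?cabs_ge0 ?expR_ge0// H.
  rewrite E ler_expR lerN2 -!mulrA; apply: ler_wpM2l; first exact: ltW.
  have nt : 0 <= n%:R * t ^+ 2 by apply: mulr_ge0 => //; exact: sqr_ge0.
  by rewrite ler_piMl//; lra.
move=> W VW n2; have -> : gss W n t = expR (- (W / 2 * t ^+ 2)) ^+ n by rewrite E.
rewrite rmorphXn/=; case: n n2 => [//|n] n2.
have gc : cabs ((expR (- (W / 2 * t ^+ 2)))%:C) <= expR (- (c * t ^+ 2)).
  rewrite cabs_real ger0_norm ?expR_ge0// ler_expR lerN2 ler_wpM2r ?sqr_ge0//.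
  by move: VW cV; lra.
apply: le_trans (cabs_expB n (H t tpi) gc) _.
rewrite [leRHS]mulrAC ler_wpM2r ?cabs_ge0// ler_wpM2l// E ler_expR lerN2.
rewrite ler_wpM2r ?sqr_ge0//.
have : n.+1%:R <= 2 * n%:R :> R by rewrite -natrM ler_nat; move: n2; clear; lia.
by move: c0 => c0 hn; have := ler_wpM2l (ltW c0) hn; lra.
Qed.

Lemma psi_near1 : exists2 C : R, 0 < C & forall t, - pi <= t <= pi ->
  cabs (psi t - 1) <= C * `|t| ^+ 2.
Proof.
exists (4 * V + V ^+ 2 * pi ^+ 2).
  apply: ltr_pwDl; first exact: mulr_gt0.
  by apply: mulr_ge0; exact: sqr_ge0.
move=> t tpi; have t2 : t ^+ 2 = `|t| ^+ 2 by rewrite real_normK// num_real.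
have q0 : quad_bounded (fun=> 0 : R).
  by apply: (@quad_bounded_bounded _ _ 0) => k; rewrite normr0.
have qb := quad_boundedZ (2 * t ^+ 2) (@quad_bounded_step2 R h).
have m0 : 0 = mean xi (fun=> 0 : R).
  by have := meanB m2 q0 q0; rewrite !subrr => ->.
have := @psi_approx _ _ _ crit h t 0 _ _ q0 qb m0 (lexx _) (ltW V0).
rewrite mul0r mul0r oppr0 expR0 => hh; apply: le_trans (hh _ _) _.
- move=> k; rewrite mulr0 mul0r addr0 distrC ger0_norm ?cosB1_ge0//.
  by rewrite -[2 * _ * _]mulrA -exprMn; have := cos_quad (t * X k); have := sqr_ge0 (t * X k); lra.
- by move=> k; rewrite -[2 * _ * _]mulrA -exprMn; exact: sin_quad.
rewrite (meanZ m2 _ (@quad_bounded_step2 R h)) (mean_step2 crit h) t2.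
have t4 : t ^+ 4 <= pi ^+ 2 * `|t| ^+ 2.
  have -> : t ^+ 4 = `|t| ^+ 2 * `|t| ^+ 2 by rewrite -t2 -exprD.
  by rewrite ler_wpM2r ?sqr_ge0// lerXn2r ?nnegrE ?pi_ge0// ler_norml.
have := ler_wpM2l (sqr_ge0 V) t4; rewrite !mulrDl !mulrA; lra.
Qed.

(** [1 / sqrt (2 pi W)], in the form in which the Gaussian integral gives it. *)
Definition kap (W : R) : R := Num.sqrt (2 * pi / W) / (2 * pi).

Lemma Ipi_gss W n : 0 < W -> (0 < n)%N ->
  `|Ipi (gss W n) - 2 * pi * kap W / sq n| <= 4 / W * Num.sqrt (4 * pi / W) / n%:R.
Proof.
move=> W0 n0; have nR : 0 < n%:R :> R by rewrite ltr0n.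
have a0 : 0 < W / 2 * n%:R by rewrite mulr_gt0// divr_gt0.
have := Ipi_gauss_approx a0.
have -> : Num.sqrt (pi / (W / 2 * n%:R)) = 2 * pi * kap W / sq n.
  rewrite /kap mulrCA mulfV ?mulr1; last by rewrite mulf_neq0// gt_eqF// pi_gt0.
  rewrite -sqrtrV ?(ltW nR)// -sqrtrM; last by rewrite divr_ge0 ?mulr_ge0 ?pi_ge0// ltW.
  by congr Num.sqrt; field; rewrite !gt_eqF.
move=> H; apply: (le_trans H).
have -> : 2 * pi / (W / 2 * n%:R) = 4 * pi / W / n%:R by field; rewrite !gt_eqF.
rewrite sqrtrM; last by rewrite divr_ge0 ?mulr_ge0 ?pi_ge0// ltW.
have -> : 2 / (W / 2 * n%:R) = 4 / W / n%:R by field; rewrite !gt_eqF.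
rewrite sqrtrV ?(ltW nR)//; set S := Num.sqrt (4 * pi / W).
have -> : 4 / W / n%:R * (S / sq n) = 4 / W * S / n%:R * (sq n)^-1 by ring.
have S0 : 0 <= S by exact: sqrtr_ge0.
rewrite ler_piMr//; last first.
  by rewrite invf_le1 ?sq_gt0// -[leLHS]sqrtr1 ler_wsqrtr// ler1n.
by rewrite divr_ge0// mulr_ge0// divr_ge0// ltW.
Qed.

Lemma div_sq_mul (a : R) n : (0 < n)%N -> a / sq n * n%:R = a * sq n.
Proof.
move=> n0; rewrite -[X in _ * X = _](@sq_sqr R n).
by move: (sq n) (@sq_gt0 R n n0) => s s0; field; rewrite gt_eqF.
Qed.

Lemma sq_large (x : R) : exists2 N : nat, (0 < N)%N & forall n, (N <= n)%N -> x <= sq n.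
Proof.
exists (Num.truncn (x ^+ 2)).+1 => // n nN.
have [x0|x0] := leP x 0; first by apply: (le_trans x0); exact: sqrtr_ge0.
rewrite -(ler_pXn2r (_ : 0 < 2)%N) ?nnegrE ?(ltW x0) ?sqrtr_ge0// sq_sqr.
by apply/ltW/(lt_le_trans (truncnS_gt _)); rewrite ler_nat.
Qed.

(** The local limit theorem in Fourier form. The weight [z] is bounded for probabilities ([j
   = 0]), and of first order at [0] for differences between neighbouring values ([j = 1]),
   which gains a factor [n^(-1/2)]. *)
Lemma llt_eps j (e : R) : (j <= 1)%N -> 0 < e -> exists2 N, (1 < N)%N & forall n, (N <= n)%N ->
  forall z, ccont z -> (forall t, cabs (z t) <= `|t| ^+ j) ->
  `|cIpi (fun t => (psi t ^+ n - (gss V n t)%:C) * z t)| <= e / sq n ^+ j.+1.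
Proof.
move=> j1 e0; have [c c0 H] := psi_exp_decay; have [C C0 HC] := cIpi_moments c0.
have e1 : 0 < e / (2 * C) by rewrite divr_gt0// mulr_gt0.
have [K K0 HK] := psi_approx_eps crit h0 e1.
have [N N0 HN] := sq_large (2 * C * K / e).
exists N.+1 => // n nN z cz zj.
have n1 : (1 < n)%N by apply: leq_trans nN.
have n0 : (0 < n)%N by apply: ltnW.
have s0 : 0 < sq n by apply: sq_gt0.
have s2 := @sq_sqr R n.
have sK : C * K / sq n <= e / 2.
  rewrite ler_pdivrMr//; have := HN n (ltnW nN); rewrite ler_pdivrMr//; lra.
have VV : V / 2 <= V by move: V0; lra.
have cF : ccont (fun t => (psi t ^+ n - (gss V n t)%:C) * z t).
  by apply: ccontM => //; apply: ccontB; [apply: ccontX; exact: (ccont_psi crit h)|exact: ccont_gss].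
have bF t : - pi <= t <= pi -> cabs ((psi t ^+ n - (gss V n t)%:C) * z t) <=
   (n%:R * (e / (2 * C)) * `|t| ^+ (2 + j) + n%:R * K * `|t| ^+ (3 + j)) *
     expR (- (c * n%:R * t ^+ 2)).
  move=> tpi; have [_ /(_ V VV n1) h1] := H n t tpi.
  rewrite cabsM; apply: (le_trans (ler_pM (cabs_ge0 _) (cabs_ge0 _) h1 (zj t))).
  rewrite mulrAC ler_wpM2r ?expR_ge0//.
  apply: (@le_trans _ _ (n%:R * (e / (2 * C) * `|t| ^+ 2 + K * `|t| ^+ 3) * `|t| ^+ j)).
    by rewrite ler_wpM2r ?exprn_ge0// ler_wpM2l// HK.
  by rewrite !exprD le_eqVlt; apply/orP; left; apply/eqP; ring.
have A1 : 0 <= n%:R * (e / (2 * C)) by rewrite mulr_ge0// ltW.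
have A2 : 0 <= n%:R * K by rewrite mulr_ge0// ltW.
case: j j1 zj bF => [|[|//]] _ zj bF.
  apply: le_trans (HC n n0 0 (n%:R * (e / (2 * C))) (n%:R * K) 0 _ _ _ _ _ cF _) _ => //.
    by move=> t tpi; rewrite !mul0r add0r addr0; exact: bF.
  rewrite !mul0r add0r addr0 expr1; move: (sq n) s0 s2 sK => s s0 s2 sK; rewrite -s2.
  have -> : C * (s ^+ 2 * (e / (2 * C)) / s ^+ 3 + s ^+ 2 * K / s ^+ 4) =
     (e / 2 + C * K / s) / s.
    by field; rewrite !gt_eqF.
  by rewrite ler_wpM2r ?invr_ge0 ?(ltW s0)//; move: sK; lra.
apply: le_trans (HC n n0 0 0 (n%:R * (e / (2 * C))) (n%:R * K) _ _ _ _ _ cF _) _ => //.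
  by move=> t tpi; rewrite !mul0r !add0r; exact: bF.
rewrite !mul0r !add0r; move: (sq n) s0 s2 sK => s s0 s2 sK; rewrite -s2.
have -> : C * (s ^+ 2 * (e / (2 * C)) / s ^+ 4 + s ^+ 2 * K / s ^+ 5) =
   (e / 2 + C * K / s) / s ^+ 2.
  by field; rewrite !gt_eqF.
by rewrite ler_wpM2r ?invr_ge0 ?exprn_ge0 ?(ltW s0)//; move: sK; lra.
Qed.

Let cIpi_gss W n : cIpi (fun t => (gss W n t)%:C) = Ipi (gss W n).
Proof. by []. Qed.

Lemma walk_return n : (h %| n)%N -> cIpi (fun t => psi t ^+ n) = 2 * pi * walk p n n.
Proof.
move=> hn; have := walk_psi crit h0 h_span (leq0n n); rewrite subn0 => <- //.
by congr cIpi; apply/funext => t; rewrite mul0r mulr0 cis0 mulr1.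
Qed.

Lemma walk_hit n : (h %| n)%N ->
  cIpi (fun t => psi t ^+ n.+1 * cis (t / h%:R)) = 2 * pi * walk p n.+1 n.
Proof.
move=> hn; have := walk_psi crit h0 h_span (ltn0Sn n); rewrite subn1 /= => <- //.
by congr cIpi; apply/funext => t; rewrite mul1r.
Qed.

Let tp0 : 0 < 2 * pi :> R. Proof. by rewrite mulr_gt0// pi_gt0. Qed.

Lemma llt_return (e : R) : 0 < e -> exists2 N, (0 < N)%N & forall n, (N <= n)%N -> (h %| n)%N ->
  `|sq n * walk p n n - kap V| <= e.
Proof.
move=> e0; have ep : 0 < e * pi by rewrite mulr_gt0 ?pi_gt0.
have [N1 N10 H1] := llt_eps (leq0n _) ep.
pose G := 4 / V * Num.sqrt (4 * pi / V).
have [N2 N20 H2] := sq_large (G / (e * pi)).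
exists (maxn N1 N2); first by rewrite leq_max (ltnW N10).
move=> n; rewrite geq_max => /andP[n1 n2] hn.
have n0 : (0 < n)%N by apply: leq_trans N20 n2.
have s0 : 0 < sq n by apply: sq_gt0.
have z1 (t : R) : cabs (1 : R[i]) <= `|t| ^+ 0 by rewrite cabs1 expr0.
have := H1 n n1 (fun=> 1) (ccont_cst _) z1; rewrite expr1.
have -> : cIpi (fun t => (psi t ^+ n - (gss V n t)%:C) * 1) = 2 * pi * walk p n n - Ipi (gss V n).
  rewrite -walk_return// -cIpi_gss -cIpiB; last 2 first.
  - by apply: ccontX; exact: (ccont_psi crit h).
  - exact: ccont_gss.
  by congr cIpi; apply/funext => t; rewrite mulr1.
move=> h1.
have h2 := Ipi_gss V0 n0; rewrite -/G in h2.
have h3 : G / n%:R <= e * pi / sq n.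
  rewrite ler_pdivrMr ?ltr0n// (div_sq_mul _ n0) mulrC -ler_pdivrMr//; exact: H2.
rewrite -(ler_pM2l tp0) -[X in X * `|_|]ger0_norm ?(ltW tp0)// -normrM.
have -> : 2 * pi * (sq n * walk p n n - kap V) =
  sq n * ((2 * pi * walk p n n - Ipi (gss V n)) + (Ipi (gss V n) - 2 * pi * kap V / sq n)).
  by field; rewrite gt_eqF.
rewrite normrM (ger0_norm (ltW s0)) mulrC -ler_pdivlMr//.
apply: le_trans (ler_normD _ _) _; move: h1 h2 h3.
have -> : 2 * pi * e / sq n = e * pi / sq n + e * pi / sq n by ring.
lra.
Qed.

(** The two integrands differ by the factor [psi t * cis (t / h) - 1], whose first-order
   part at [0] is imaginary, so that the Gaussian, which is real, gives no contribution. *)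
Lemma llt_hit_return (e : R) : 0 < e -> exists2 N, (0 < N)%N & forall n, (N <= n)%N -> (h %| n)%N ->
  `|walk p n.+1 n - walk p n n| <= e / n%:R.
Proof.
move=> e0; have eh : 0 < e * h%:R by rewrite mulr_gt0.
have [N1 N10 H1] := llt_eps (leqnn _) eh.
have [c c0 H] := psi_exp_decay; have [C C0 HC] := cIpi_moments c0.
have [D D0 HD] := psi_near1; pose D' := D + 3 / h%:R ^+ 2.
have D'0 : 0 < D' by rewrite addr_gt0// divr_gt0 ?exprn_gt0.
have [N2 N20 H2] := sq_large (C * D' / e).
exists (maxn N1 N2); first by rewrite leq_max (ltnW N10).
move=> n; rewrite geq_max => /andP[n1 n2] hn.
have n0 : (0 < n)%N by apply: leq_trans N20 n2.
have s0 : 0 < sq n by apply: sq_gt0.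
pose it t : R[i] := 0 +i* (t / h%:R).
pose Dt t := psi t * cis (t / h%:R) - 1 - it t.
have cit : ccont it.
  split; first exact: cst_continuous.
  by move=> t; apply: cvgM; [exact: cvg_id|exact: cvg_cst].
have cps := ccont_psi crit h.
have cis' : ccont (fun t : R => cis (t / h%:R)) by exact: ccont_cis.
have cD : ccont Dt.
  apply: ccontB => //; apply: ccontB; last exact: ccont_cst.
  exact: ccontM.
have bD t : - pi <= t <= pi -> cabs (Dt t) <= D' * `|t| ^+ 2.
  move=> tpi; have -> : Dt t = (psi t - 1) * cis (t / h%:R) + (cis (t / h%:R) - 1 - it t).
    by rewrite /Dt; ring.
  apply: le_trans (ler_cabsD _ _) _; rewrite cabsM cabs_cis mulr1 /D' mulrDl.
  apply: lerD; first exact: HD.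
  apply: (le_trans (cabs_le_ReIm _)) => /=; rewrite !subr0.
  set u := t / h%:R.
  have -> : 3 / h%:R ^+ 2 * `|t| ^+ 2 = 3 * u ^+ 2.
    by rewrite real_normK ?num_real// /u exprMn exprVn; ring.
  have h1 := sin_quad u; have h2 := cos_quad u; have h3 := cosB1_ge0 u.
  have -> : `|cos u - 1| = 1 - cos u by rewrite distrC ger0_norm.
  by have := sqr_ge0 u; move: h1 h2; lra.
have E : 2 * pi * (walk p n.+1 n - walk p n n) =
   cIpi (fun t => psi t ^+ n * Dt t) + cIpi (fun t => (psi t ^+ n - (gss V n t)%:C) * it t).
  have c1 : ccont (fun t => psi t ^+ n.+1 * cis (t / h%:R)) by apply: ccontM => //; exact: ccontX.
  have c2 : ccont (fun t => psi t ^+ n) by exact: ccontX.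
  have c3 : ccont (fun t => psi t ^+ n * Dt t) by exact: ccontM.
  have c4 : ccont (fun t => (gss V n t)%:C) by exact: ccont_gss.
  have c5 : ccont (fun t => (psi t ^+ n - (gss V n t)%:C) * it t) by apply: ccontM => //; exact: ccontB.
  rewrite mulrBr -walk_hit// -walk_return// -cIpiB//.
  apply/eqP; rewrite -subr_eq -cIpiB//; last exact: ccontB.
  apply/eqP/eq_Ipi => t.
  rewrite /=; have -> : psi t ^+ n.+1 * cis (t / h%:R) - psi t ^+ n -
     (psi t ^+ n - (gss V n t)%:C) * it t = psi t ^+ n * Dt t + (gss V n t)%:C * it t.
    by rewrite /Dt exprS; ring.
  by rewrite /it; case: (psi t ^+ n * _) => x y /=; rewrite !(mulr0, mul0r, subr0, addr0).
have b1 : `|cIpi (fun t => psi t ^+ n * Dt t)| <= e / n%:R.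
  apply: le_trans (HC n n0 0 D' 0 0 _ _ _ _ _ _ _) _ => //; first exact: ltW.
  - by apply: ccontM => //; exact: ccontX.
  - move=> t tpi; have [h1 _] := H n t tpi.
    by rewrite !mul0r !add0r !addr0 cabsM mulrC; apply: ler_pM; rewrite ?cabs_ge0// bD.
  rewrite !mul0r !add0r !addr0 ler_pdivlMr ?ltr0n//.
  have -> : C * (D' / sq n ^+ 3) * n%:R = C * D' / sq n.
    have := @sq_sqr R n; move: (sq n) s0 => s s0 <-.
    by field; rewrite gt_eqF.
  rewrite ler_pdivrMr// [e * _]mulrC -ler_pdivrMr//; exact: H2.
have b2 : `|cIpi (fun t => (psi t ^+ n - (gss V n t)%:C) * it t)| <= e / n%:R.
  pose z t := h%:R%:C * it t.
  have cz : ccont z by apply: ccontM => //; exact: ccont_cst.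
  have zb t : cabs (z t) <= `|t| ^+ 1.
    rewrite /z cabsM cabs_real expr1.
    have -> : cabs (it t) = `|t / h%:R| by rewrite /it /= expr0n add0r sqrtr_sqr.
    by rewrite -normrM mulrC divfK// gt_eqF.
  have := H1 n n1 z cz zb; rewrite sq_sqr.
  have -> : cIpi (fun t => (psi t ^+ n - (gss V n t)%:C) * z t) =
     h%:R * cIpi (fun t => (psi t ^+ n - (gss V n t)%:C) * it t).
    have [cc _] : ccont (fun t => (psi t ^+ n - (gss V n t)%:C) * it t).
      by apply: ccontM => //; apply: ccontB; [exact: ccontX|exact: ccont_gss].
    rewrite /cIpi -IpiZ//; apply: eq_Ipi => t; rewrite /z mulrCA.
    by case: (_ * it t) => x y /=; rewrite mul0r subr0.
  rewrite normrM (ger0_norm (ltW hR)) => hh; rewrite -(ler_pM2l hR); apply: (le_trans hh).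
  by rewrite le_eqVlt; apply/orP; left; apply/eqP; ring.
have p3 : 2 <= 2 * pi :> R by have := @pi_ge2 R; lra.
have : `|2 * pi * (walk p n.+1 n - walk p n n)| <= 2 * (e / n%:R).
  by rewrite E; apply: le_trans (ler_normD _ _) _; move: b1 b2; lra.
rewrite normrM (ger0_norm (ltW tp0)) => hh.
rewrite -(ler_pM2l (_ : 0 < 2 :> R))//; apply: le_trans hh.
by rewrite ler_wpM2r.
Qed.

(** The integrands differ by the factor [psi^h - 1], which is of second order at [0]. *)
Lemma walk_return_diff : exists2 C : R, 0 < C & forall n, (0 < n)%N -> (h %| n)%N ->
  `|walk p n n - walk p (n + h) (n + h)| <= C / sq n ^+ 3.
Proof.
have [c c0 H] := psi_exp_decay; have [C C0 HC] := cIpi_moments c0.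
have [D D0 HD] := psi_near1; exists (C * (h%:R * D)); first by rewrite !mulr_gt0.
move=> n n0 hn; have s0 : 0 < sq n by apply: sq_gt0.
have cps := ccont_psi crit h.
have hb : forall t, - pi <= t <= pi -> cabs (1 - psi t ^+ h) <= h%:R * D * `|t| ^+ 2.
  move=> t tpi; have := @cabs_expB _ 1 (psi t) 1 h.-1; rewrite (prednK h0) expr1n => hh.
  apply: le_trans (hh _ (psi_le1 crit h t)) _; first by rewrite cabs1.
  by rewrite expr1n mulr1 cabs_distC -mulrA ler_wpM2l// HD.
have cE : ccont (fun t => psi t ^+ n * (1 - psi t ^+ h)).
  by apply: ccontM; [exact: ccontX|apply: ccontB; [exact: ccont_cst|exact: ccontX]].
have E : 2 * pi * (walk p n n - walk p (n + h) (n + h)) = cIpi (fun t => psi t ^+ n * (1 - psi t ^+ h)).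
  rewrite mulrBr -!walk_return ?dvdn_addr// -cIpiB; [|exact: ccontX|exact: ccontX].
  by congr cIpi; apply/funext => t; rewrite mulrBr mulr1 exprD.
have b : `|2 * pi * (walk p n n - walk p (n + h) (n + h))| <= C * (h%:R * D) / sq n ^+ 3.
  rewrite E; apply: le_trans (HC n n0 0 (h%:R * D) 0 0 _ _ _ _ _ cE _) _ => //.
  - by rewrite mulr_ge0 ?(ltW D0).
  - move=> t tpi; have [h1 _] := H n t tpi.
    by rewrite !mul0r !add0r !addr0 cabsM mulrC; apply: ler_pM; rewrite ?cabs_ge0// hb.
  by rewrite !mul0r !add0r !addr0 mulrA.
apply: le_trans b; rewrite normrM (ger0_norm (ltW tp0)) ler_peMl//.
by have := @pi_ge2 R; lra.
Qed.

(** Summable against [n^(-1/2)], see [sum_truncation_error]. *)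
Definition truncation_error (n : nat) : R :=
  trunc_third xi h (sq n) / n%:R + tail_first xi h (sq n) + n%:R^-1.

Lemma trunc_var_split A : trunc_var xi h A + tail_second xi h A = V.
Proof.
rewrite -(mean_step2 crit h) /trunc_var /tail_second.
rewrite -(meanD m2 (quad_bounded_restr (fun k => `|X k| <= A) (@quad_bounded_step2 R h))
  (quad_bounded_restr (fun k => A < `|X k|) (@quad_bounded_step2 R h))).
congr (mean _ _); apply/funext => k; rewrite -mulrDr.
by case: (leP `|X k| A) => _; rewrite ?addr0 ?add0r mulr1.
Qed.

Lemma le_trunc_var A B : A <= B -> trunc_var xi h A <= trunc_var xi h B.
Proof.
move=> AB; apply: (le_mean m2).
- exact: (quad_bounded_restr (fun k => `|X k| <= A) (@quad_bounded_step2 R h)).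
- exact: (quad_bounded_restr (fun k => `|X k| <= B) (@quad_bounded_step2 R h)).
move=> k; rewrite ler_wpM2l ?sqr_ge0//; case: (leP `|X k| A) => // kA.
by rewrite (le_trans kA AB).
Qed.

Lemma trunc_var_le A : trunc_var xi h A <= V.
Proof.
by rewrite -(trunc_var_split A) lerDl; apply: mean_ge0 => k; rewrite mulr_ge0// sqr_ge0.
Qed.

(** The same computation with the variance truncated at the scale of the square root of the
   number of steps. Without a moment beyond the second the neglected part of the variance
   has no rate; leaving it out of the Gaussian makes the error summable. *)
Lemma llt_hit_trunc : exists2 C : R, 0 < C & exists2 N, (0 < N)%N &
  forall n, (N <= n)%N -> (h %| n)%N ->
  V / 2 <= trunc_var xi h (sq n.+1) /\
  `|walk p n.+1 n - kap (trunc_var xi h (sq n.+1)) / sq n.+1| <= C * truncation_error n.+1.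
Proof.
have [c c0 H] := psi_exp_decay; have [C C0 HC] := cIpi_moments c0.
have V2 : 0 < V / 2 by rewrite divr_gt0.
have [A A0 HA] := tail_second_small crit h0 V2.
have [N N0 HN] := sq_large A.
pose G := 8 / V * Num.sqrt (8 * pi / V).
have G0 : 0 <= G by rewrite mulr_ge0 ?sqrtr_ge0// divr_ge0// ltW.
exists (C * (4 + 2 / h%:R + V ^+ 2) + G).
  apply: ltr_pwDl => //; apply: mulr_gt0 => //; apply: ltr_pwDr; first exact: exprn_gt0.
  by apply: addr_ge0 => //; apply: divr_ge0.
exists N => // m Nm hm; set n := m.+1.
have WV : V / 2 <= trunc_var xi h (sq n).
  have := trunc_var_split (sq n); have := HA (sq n) (HN n (leqW Nm)); move: V0; lra.
split=> //; set W := trunc_var _ _ _ in WV *.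
have n2 : (2 <= n)%N by rewrite ltnS (leq_trans N0).
have n0 : (0 < n)%N by [].
have nR : 0 < n%:R :> R by rewrite ltr0n.
have s0 : 0 < sq n by apply: sq_gt0.
have s2 := @sq_sqr R n.
have W0 : 0 < W by apply: lt_le_trans WV.
set T3 := trunc_third xi h (sq n); set T1 := tail_first xi h (sq n).
have T30 : 0 <= T3 by apply: mean_ge0 => k; rewrite mulr_ge0// exprn_ge0.
have T10 : 0 <= T1 by apply: mean_ge0 => k; rewrite mulr_ge0.
have cps := ccont_psi crit h.
have c1 : ccont (fun t => psi t ^+ n * cis (t / h%:R)).
  by apply: ccontM; [exact: ccontX|exact: ccont_cis].
have c2 : ccont (fun t => psi t ^+ n * cis (t / h%:R) - (gss W n t)%:C).
  by apply: ccontB => //; exact: ccont_gss.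
have E : 2 * pi * walk p n m - Ipi (gss W n) =
    cIpi (fun t => psi t ^+ n * cis (t / h%:R) - (gss W n t)%:C).
  by rewrite cIpiB//; [rewrite walk_hit|exact: ccont_gss].
have b : `|2 * pi * walk p n m - Ipi (gss W n)| <=
    C * (4 + 2 / h%:R + V ^+ 2) * truncation_error n.
  rewrite E; apply: le_trans (HC n n0 (n%:R * (4 * T1) + 2 / h%:R) 0 (n%:R * (2 * T3)) (n%:R * V ^+ 2) _ _ _ _ _ c2 _) _ => //.
  - by rewrite addr_ge0 ?divr_ge0// !mulr_ge0.
  - by rewrite !mulr_ge0.
  - by rewrite mulr_ge0// sqr_ge0.
  - move=> t tpi; have [h1 /(_ W WV n2) h2] := H n t tpi.
    have -> : psi t ^+ n * cis (t / h%:R) - (gss W n t)%:C =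
      psi t ^+ n * (cis (t / h%:R) - 1) + (psi t ^+ n - (gss W n t)%:C) by ring.
    apply: le_trans (ler_cabsD _ _) _; rewrite mul0r addr0.
    have h3 := psi_approx_trunc crit h (sq n) t; rewrite -/W -/T3 -/T1 in h3.
    have t4 : t ^+ 4 = `|t| ^+ 4.
      by rewrite -[4%N]/(2 * 2)%N !exprM real_normK// num_real.
    rewrite t4 in h3.
    have h4 : cabs (psi t ^+ n * (cis (t / h%:R) - 1)) <=
        2 / h%:R * `|t| * expR (- (c * n%:R * t ^+ 2)).
      rewrite cabsM mulrC; apply: ler_pM; rewrite ?cabs_ge0//.
      apply: le_trans (cabs_cisB1 _) _; rewrite normrM (ger0_norm (_ : 0 <= h%:R^-1)) ?invr_ge0//.
      by rewrite le_eqVlt; apply/orP; left; apply/eqP; ring.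
    have h5 := ler_wpM2r (expR_ge0 (- (c * n%:R * t ^+ 2))) (ler_wpM2l (ler0n R n) h3).
    apply: (le_trans (lerD h4 (le_trans h2 h5))).
    by rewrite le_eqVlt; apply/orP; left; apply/eqP; ring.
  rewrite mul0r addr0 /truncation_error -/T3 -/T1 -[leRHS]mulrA ler_wpM2l ?(ltW C0)//.
  have e2 : sq n ^+ 4 = n%:R ^+ 2 by rewrite -[4%N]/(2 * 2)%N exprM s2.
  rewrite s2 e2.
  have q5 : n%:R * V ^+ 2 / sq n ^+ 5 <= V ^+ 2 / n%:R.
    have -> : sq n ^+ 5 = n%:R ^+ 2 * sq n by rewrite -e2 -exprSr.
    have -> : n%:R * V ^+ 2 / (n%:R ^+ 2 * sq n) = V ^+ 2 / n%:R / sq n.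
      by field; rewrite !gt_eqF.
    rewrite ler_piMr ?divr_ge0 ?sqr_ge0// invf_le1//.
    by rewrite -[leLHS]sqrtr1 ler_wsqrtr// ler1n.
  have -> : (n%:R * (4 * T1) + 2 / h%:R) / n%:R = 4 * T1 + 2 / h%:R / n%:R by field; rewrite !gt_eqF.
  have -> : n%:R * (2 * T3) / n%:R ^+ 2 = 2 * (T3 / n%:R) by field; rewrite !gt_eqF.
  have v1 : 0 <= T3 / n%:R by rewrite divr_ge0.
  have v2 : 0 <= (n%:R : R)^-1 by rewrite invr_ge0.
  have v3 : 0 <= 2 / h%:R :> R by rewrite divr_ge0.
  have v4 := sqr_ge0 V.
  have B (a i w y z q : R) : 0 <= a -> 0 <= i -> 0 <= w -> 0 <= y -> 0 <= z -> q <= z * i ->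
      4 * w + y * i + 2 * a + q <= (4 + y + z) * (a + w + i).
    move=> a0 i0 w0 y0 z0; have := mulr_ge0 y0 a0; have := mulr_ge0 y0 w0.
    have := mulr_ge0 z0 a0; have := mulr_ge0 z0 w0; rewrite !mulrDl !mulrDr; lra.
  exact: B.
have g := Ipi_gss W0 n0.
have gG : 4 / W * Num.sqrt (4 * pi / W) / n%:R <= G * truncation_error n.
  apply: (@le_trans _ _ (G / n%:R)).
    rewrite ler_wpM2r ?invr_ge0// /G; apply: ler_pM; rewrite ?sqrtr_ge0 ?divr_ge0 ?(ltW W0)//.
      rewrite ler_pdivrMr// mulrAC ler_pdivlMr//; move: WV; lra.
    rewrite ler_wsqrtr// ler_pdivrMr// mulrAC ler_pdivlMr//.
    by have := ler_wpM2l (ltW (@pi_gt0 R)) WV; lra.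
  rewrite ler_wpM2l// /truncation_error -/T3 -/T1.
  by rewrite lerDr addr_ge0// divr_ge0.
have : `|2 * pi * (walk p n m - kap W / sq n)| <= (C * (4 + 2 / h%:R + V ^+ 2) + G) * truncation_error n.
  have -> : 2 * pi * (walk p n m - kap W / sq n) = (2 * pi * walk p n m - Ipi (gss W n)) +
     (Ipi (gss W n) - 2 * pi * kap W / sq n) by field; rewrite gt_eqF.
  apply: le_trans (ler_normD _ _) _; rewrite [leRHS]mulrDl; apply: lerD => //.
  exact: le_trans g gG.
apply: le_trans; rewrite normrM (ger0_norm (ltW tp0)) ler_peMl//.
by have := @pi_ge2 R; lra.
Qed.

(** Exchange the sum with the mean: for a given step [x] the third moments are summed over
   [n >= x^2] and the tails over [n < x^2], and both sums are bounded by a multiple of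
   [x^2]. *)
Lemma sum_truncation_error : exists2 C : R, 0 < C & forall M,
  \sum_(1 <= n < M.+1) truncation_error n / sq n <= C.
Proof.
exists (6 * V + 4 + 1); first by rewrite ltr_wpDl// addr_ge0// mulr_ge0// ltW.
move=> M; rewrite /truncation_error.
have qX2 := @quad_bounded_step2 R h.
pose a (n : nat) : R := (sq n ^+ 3)^-1; pose b (n : nat) : R := (sq n)^-1.
have E n : (trunc_third xi h (sq n) / n%:R + tail_first xi h (sq n) + n%:R^-1) / sq n =
   a n * trunc_third xi h (sq n) + b n * tail_first xi h (sq n) + a n.
  have -> : a n = (n%:R)^-1 * (sq n)^-1 by rewrite /a exprSr invfM sq_sqr.
  by rewrite /b; ring.
under eq_bigr do rewrite E.
rewrite !big_split/=.
have ML (f : nat -> nat -> R) (g : nat -> R) : (forall n, quad_bounded (f n)) ->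
    \sum_(1 <= n < M.+1) g n * mean xi (f n) =
    mean xi (fun k => \sum_(1 <= n < M.+1) g n * f n k).
  move=> qf; elim: (index_iota 1 M.+1) => [|i s IH].
    rewrite big_nil (_ : (fun k => _) = fun k => 0 * f 0%N k).
      by rewrite (meanZ m2 _ (qf _)) mul0r.
    by apply/funext => k; rewrite big_nil mul0r.
  rewrite big_cons IH (_ : (fun k => \sum_(n <- i :: s) _) =
     fun k => g i * f i k + \sum_(n <- s) g n * f n k); last first.
    by apply/funext => k; rewrite big_cons.
  rewrite (meanD m2 (quad_boundedZ _ (qf i))); first by rewrite (meanZ m2 _ (qf i)).
  elim: s {IH} => [|x s IH].
    rewrite (_ : (fun k => _) = fun k => 0 * f 0%N k); first exact: quad_boundedZ.
    by apply/funext => k; rewrite big_nil mul0r.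
  rewrite (_ : (fun k => \sum_(n <- x :: s) _) =
     fun k => g x * f x k + \sum_(n <- s) g n * f n k); last first.
    by apply/funext => k; rewrite big_cons.
  by apply: quad_boundedD => //; exact: quad_boundedZ.
have q3 n : quad_bounded (fun k => `|X k| ^+ 3 * (`|X k| <= sq n)%R%:R) by exact: quad_bounded_trunc_third.
have q1 n : quad_bounded (fun k => `|X k| * (sq n < `|X k|)%R%:R).
  exact: (quad_bounded_restr (fun k => sq n < `|X k|) (@quad_bounded_norm_step R h)).
have b3 : \sum_(1 <= n < M.+1) a n * trunc_third xi h (sq n) <= 4 * V.
  rewrite (ML (fun n k => `|X k| ^+ 3 * (`|X k| <= sq n)%R%:R) a q3).
  have P k : \sum_(1 <= n < M.+1) a n * (`|X k| ^+ 3 * (`|X k| <= sq n)%R%:R) <= 4 * X k ^+ 2.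
    have -> : \sum_(1 <= n < M.+1) a n * (`|X k| ^+ 3 * (`|X k| <= sq n)%R%:R) =
       X k ^+ 2 * \sum_(1 <= n < M.+1) (`|X k| <= sq n)%R%:R * `|X k| * (sq n ^+ 3)^-1.
      rewrite mulr_sumr; apply: eq_bigr => n _; rewrite /a.
      by rewrite -(real_normK (num_real (X k))); ring.
    by rewrite mulrC ler_wpM2r ?sqr_ge0//; exact: sum_inv_cube_tail.
  rewrite -(mean_step2 crit h) -(meanZ m2 _ qX2).
  apply: (le_trans (ler_norm _)); apply: (norm_mean_le m2); first exact: quad_boundedZ.
  move=> k; rewrite ger0_norm//; apply: sumr_ge0 => n _.
  by rewrite mulr_ge0 ?invr_ge0 ?exprn_ge0 ?sqrtr_ge0// mulr_ge0// exprn_ge0.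
have b1 : \sum_(1 <= n < M.+1) b n * tail_first xi h (sq n) <= 2 * V.
  rewrite (ML (fun n k => `|X k| * (sq n < `|X k|)%R%:R) b q1).
  have P k : \sum_(1 <= n < M.+1) b n * (`|X k| * (sq n < `|X k|)%R%:R) <= 2 * X k ^+ 2.
    have -> : \sum_(1 <= n < M.+1) b n * (`|X k| * (sq n < `|X k|)%R%:R) =
       `|X k| * \sum_(1 <= n < M.+1) (sq n < `|X k|)%R%:R * (sq n)^-1.
      by rewrite mulr_sumr; apply: eq_bigr => n _; rewrite /b; ring.
    rewrite -(real_normK (num_real (X k))) expr2 mulrCA ler_wpM2l//.
    exact: sum_inv_sq_head.
  rewrite -(mean_step2 crit h) -(meanZ m2 _ qX2).
  apply: (le_trans (ler_norm _)); apply: (norm_mean_le m2); first exact: quad_boundedZ.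
  move=> k; rewrite ger0_norm//; apply: sumr_ge0 => n _.
  by rewrite mulr_ge0 ?invr_ge0 ?sqrtr_ge0// mulr_ge0.
have b0 : \sum_(1 <= n < M.+1) a n <= 4.
  apply: le_trans (sum_inv_cube_tail M (@ler01 R)).
  rewrite big_nat [leRHS]big_nat; apply: ler_sum => n /andP[n1 _].
  rewrite (_ : (1 <= sq n) = true) ?mul1r//.
  by rewrite -[leLHS]sqrtr1 ler_wsqrtr// ler1n.
by move: b0 b1 b3; lra.
Qed.

End LLT.

(** * The coefficients to be convolved *)

Section Tends.
Context {R : realType}.
Implicit Types (x y : nat -> R) (c : R).
Local Notation sq n := (Num.sqrt (n%:R : R)).

Definition tends x c := forall e, 0 < e -> exists N, forall n, (N <= n)%N -> `|x n - c| <= e.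

Lemma tends_bounded x c : tends x c -> exists2 B : R, 0 < B & forall n, `|x n| <= B.
Proof.
move=> /(_ 1 ltr01)[N H]; exists (\sum_(k < N) `|x k| + `|c| + 1).
  by rewrite ltr_wpDl// addr_ge0// sumr_ge0.
move=> n; have [nN|Nn] := ltnP n N.
  by rewrite -addrA ler_wpDr ?addr_ge0// (bigD1 (Ordinal nN))//= lerDl sumr_ge0.
have -> : x n = (x n - c) + c by rewrite subrK.
apply: le_trans (ler_normD _ _) _; rewrite addrC -addrA ler_wpDl ?sumr_ge0// lerD2l.
exact: H.
Qed.

Lemma tendsZ a x c : tends x c -> tends (fun n => a * x n) (a * c).
Proof.
move=> xc e e0; have a0 : 0 < `|a| + 1 by rewrite ltr_wpDl.
have [|N H] := xc (e / (`|a| + 1)); first by rewrite divr_gt0.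
exists N => n /H h; rewrite -mulrBr normrM.
apply: (@le_trans _ _ ((`|a| + 1) * (e / (`|a| + 1)))).
  by apply: ler_pM => //; rewrite lerDl.
by rewrite mulrC divfK// gt_eqF.
Qed.

Lemma tends_eq_near x y c N0 : tends x c -> (forall n, (N0 <= n)%N -> x n = y n) -> tends y c.
Proof.
move=> xc xy e /xc[N H]; exists (maxn N N0) => n; rewrite geq_max => /andP[n1 n2].
by rewrite -xy// H.
Qed.

Lemma tends_sub x (f : nat -> nat) c : tends x c -> (forall n, (n <= f n)%N) ->
  tends (fun n => x (f n)) c.
Proof. by move=> xc fn e /xc[N H]; exists N => n Nn; apply: H; exact: leq_trans (fn n). Qed.

Lemma tends_sq_shift x c : tends (fun n => sq n * x n) c -> tends (fun n => sq n.+1 * x n) c.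
Proof.
move=> xc e e0; have [B B0 HB] := tends_bounded xc.
have e2 : 0 < e / 2 by rewrite divr_gt0.
have [N1 H1] := xc _ e2; have [N2 N20 H2] := sq_large (2 * B / e).
exists (maxn N1 N2) => n; rewrite geq_max => /andP[n1 n2].
have n0 : (0 < n)%N by apply: leq_trans N20 n2.
have s0 : 0 < sq n by apply: sq_gt0.
have sn : sq n.+1 - sq n <= 1.
  have E : sq n.+1 ^+ 2 = sq n ^+ 2 + 1 by rewrite !sq_sqr natr1.
  suff : sq n.+1 <= sq n + 1 by lra.
  rewrite -(ler_pXn2r (_ : 0 < 2)%N) ?nnegrE ?sqrtr_ge0 ?addr_ge0 ?sqrtr_ge0//.
  by rewrite E; move: (sq n) s0 => s s0; rewrite !expr2; lra.
have sn0 : 0 <= sq n.+1 - sq n by rewrite subr_ge0 le_sq.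
have xb : `|x n| <= e / 2.
  have := HB n; rewrite normrM (ger0_norm (ltW s0)) mulrC -ler_pdivlMr// => h.
  apply: (le_trans h); rewrite ler_pdivrMr//.
  have := H2 n n2; rewrite ler_pdivrMr//; lra.
have -> : sq n.+1 * x n - c = (sq n.+1 - sq n) * x n + (sq n * x n - c) by ring.
apply: le_trans (ler_normD _ _) _; have := H1 n n1; rewrite normrM (ger0_norm sn0).
suff : (sq n.+1 - sq n) * `|x n| <= 1 * (e / 2) by lra.
exact: ler_pM.
Qed.

End Tends.

Section Wallis.
Context {R : realType}.
Local Notation sq n := (Num.sqrt (n%:R : R)).

(** The coefficients of [(1 - z)^(-1/2)], equal to [binom(2l, l) / 4^l]. *)
Definition cb (l : nat) : R := (\prod_(j < l) (2^-1 + j%:R)) / (l`!)%:R.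

Lemma cb_rising l : (cb l)%:C = rising l (one_half : R[i]).
Proof.
rewrite /cb /rising fmorph_div/= rmorph_nat rmorph_prod; congr (_ / _).
by apply: eq_bigr => j _; rewrite rmorphD/= rmorph_nat.
Qed.

Lemma cbS l : l.+1%:R * cb l.+1 = (2^-1 + l%:R) * cb l.
Proof.
rewrite /cb big_ord_recr/= factS natrM.
have E (a b c e : R) : a != 0 -> b != 0 -> a * (c * e / (a * b)) = e * (c / b).
  by move=> a0 b0; field; rewrite a0 b0.
by apply: E; rewrite pnatr_eq0// gtn_eqF// fact_gt0.
Qed.

Definition half_cos (t : R) : R := (1 + cos t) / 2.

Lemma continuous_half_cosX l : continuous (fun t => half_cos t ^+ l).
Proof.
move=> t; apply: (@continuous_comp _ _ _ half_cos (fun x => x ^+ l)); last exact: exprn_continuous.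
apply: cvgM; last exact: cvg_cst.
by apply: cvgD; [exact: cvg_cst|exact: continuous_cos].
Qed.

(** Integration by parts gives the recursion [cbS]. *)
Lemma Ipi_half_cos l : Ipi (fun t => half_cos t ^+ l) = 2 * pi * cb l.
Proof.
elim: l => [|l IH].
  rewrite /cb big_ord0 fact0 divr1 mulr1 -Ipi_1; apply: eq_Ipi => t; exact: expr0.
have l0 : l.+1%:R != 0 :> R by rewrite pnatr_eq0.
apply: (mulfI l0); rewrite mulrCA cbS mulrCA -IH.
pose F (t : R) := sin t * half_cos t ^+ l.
pose f (t : R) := (2 * l.+1%:R) * half_cos t ^+ l.+1 + (- (2 * l%:R + 1)) * half_cos t ^+ l.
have dF (t : R) : is_derive t (1 : R) F (f t).
  have s2 : sin t * sin t = (1 - cos t) * (1 + cos t).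
    by have := cos2Dsin2 t; rewrite !expr2; lra.
  have dg : is_derive t (1 : R) half_cos (- sin t / 2).
    by rewrite /half_cos; apply: is_derive_eq; rewrite /GRing.scale/=; field.
  have := is_deriveM (is_derive_sin t) (is_deriveX l dg); rewrite exprfctE => dM.
  apply: (is_derive_eq dM); rewrite /GRing.scale/= /f.
  have -> : sin t * (l%:R * half_cos t ^+ l.-1 * (- sin t / 2)) + half_cos t ^+ l * cos t =
    - (l%:R * half_cos t ^+ l.-1 / 2) * (sin t * sin t) + half_cos t ^+ l * cos t by ring.
  rewrite s2; case: (l) => [|k] /=.
    by rewrite !expr0 expr1 !mul0r oppr0 mul0r add0r /half_cos; field.
  by rewrite !exprS; set q := half_cos t ^+ k; rewrite -!natr1 /half_cos; field.
have cf : continuous f.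
  move=> t; apply: cvgD; apply: cvgM; try exact: cvg_cst; exact: continuous_half_cosX.
have := Ipi_derive dF cf; rewrite /F sinN sinpi oppr0 !mul0r subrr /f.
have c1 : continuous (fun t => (2 * l.+1%:R) * half_cos t ^+ l.+1).
  by move=> t; apply: cvgM; [exact: cvg_cst|exact: continuous_half_cosX].
have c2 : continuous (fun t => (- (2 * l%:R + 1)) * half_cos t ^+ l).
  by move=> t; apply: cvgM; [exact: cvg_cst|exact: continuous_half_cosX].
rewrite (IpiD c1 c2) !IpiZ; try exact: continuous_half_cosX.
lra.
Qed.

End Wallis.

Section WallisLimit.
Context {R : realType}.
Local Notation sq n := (Num.sqrt (n%:R : R)).
Local Notation cb := (cb (R := R)).

Lemma half_cos_bounds (t : R) : - pi <= t <= pi ->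
  [/\ 0 <= half_cos t, half_cos t <= expR (- (t ^+ 2 / 36)) &
    `|half_cos t - expR (- (2^-1 / 2 * t ^+ 2))| <= `|t| ^+ 3 + `|t| ^+ 4].
Proof.
move=> tpi; have hE : half_cos t = 1 - sin (t / 2) ^+ 2.
  rewrite /half_cos {1}(_ : t = t / 2 + t / 2); last by field.
  rewrite cosD; have := cos2Dsin2 (t / 2); rewrite !expr2; lra.
split.
- by rewrite divr_ge0// -[1]opprK addrC subr_ge0 cos_geN1.
- rewrite hE; have := sin_half_sqr tpi; have := expR_ge1Dx (- (t ^+ 2 / 36)); lra.
have y0 : 0 <= 2^-1 / 2 * t ^+ 2 :> R by rewrite mulr_ge0 ?sqr_ge0// divr_ge0.
have := expRN_quad y0; have := cos_cubic t.
have -> : (2^-1 / 2 * t ^+ 2) ^+ 2 = `|t| ^+ 4 / 16.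
  by rewrite -[4%N]/(2 * 2)%N exprM real_normK ?num_real//; field.
have -> : half_cos t - expR (- (2^-1 / 2 * t ^+ 2)) =
  (cos t - 1 + t ^+ 2 / 2) / 2 - (expR (- (2^-1 / 2 * t ^+ 2)) - 1 + 2^-1 / 2 * t ^+ 2).
  by rewrite /half_cos; field.
move=> h1 h2; apply: le_trans (ler_normB _ _) _.
rewrite normrM (ger0_norm (_ : 0 <= 2^-1)) ?invr_ge0//.
by have := exprn_ge0 4 (normr_ge0 t); have := exprn_ge0 3 (normr_ge0 t); move: h1 h2; lra.
Qed.

(** The numbers [cb l] are return probabilities of the symmetric walk with characteristic
   function [(1 + cos t) / 2], so the method for the walk applies. *)
Lemma cb_llt : tends (fun l => sq l * cb l) (kap 2^-1).
Proof.
have c0 : 0 < 72^-1 :> R by rewrite invr_gt0.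
have [C C0 HC] := cIpi_moments c0.
have W0 : 0 < 2^-1 :> R by rewrite invr_gt0.
pose G : R := 4 / 2^-1 * Num.sqrt (4 * pi / 2^-1).
have G0 : 0 <= G by rewrite mulr_ge0 ?sqrtr_ge0.
move=> e e0; have [N N0 HN] := sq_large ((2 * C + G) / e).
exists N.+1 => n Nn; have n2 : (2 <= n)%N by apply: leq_trans Nn.
have n0 : (0 < n)%N by apply: ltnW.
have nR : 0 < n%:R :> R by rewrite ltr0n.
have s0 : 0 < sq n by apply: sq_gt0.
pose F t : R[i] := (half_cos t ^+ n)%:C - (gss 2^-1 n t)%:C.
have c1 : ccont (fun t : R => (half_cos t ^+ n)%:C).
  by apply: ccont_real; exact: continuous_half_cosX.
have cF : ccont F by apply: ccontB => //; exact: ccont_gss.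
have FE : cIpi F = 2 * pi * cb n - Ipi (gss 2^-1 n).
  by rewrite /F cIpiB//; [rewrite -Ipi_half_cos|exact: ccont_gss].
have h1 : `|2 * pi * cb n - Ipi (gss 2^-1 n)| <= 2 * C / n%:R.
  rewrite -FE; apply: le_trans (HC n n0 0 0 n%:R n%:R _ _ _ _ F cF _) _ => //.
    move=> t tpi; have [b1 b2 b3] := half_cos_bounds tpi.
    rewrite !mul0r !add0r -mulrDr.
    have gE : gss 2^-1 n t = expR (- (2^-1 / 2 * t ^+ 2)) ^+ n.
      by rewrite /gss -expRM_natl; congr expR; ring.
    pose M := expR (- (t ^+ 2 / 36)).
    have gM : expR (- (2^-1 / 2 * t ^+ 2)) <= M.
      by rewrite ler_expR lerN2; have := sqr_ge0 t; lra.
    rewrite /F gE !rmorphXn/=.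
    case: n n2 {Nn n0 nR s0 c1 cF FE gE F} => [//|n] n2.
    have a1 : cabs ((half_cos t)%:C) <= M by rewrite cabs_real ger0_norm.
    have a2 : cabs ((expR (- (2^-1 / 2 * t ^+ 2)))%:C) <= M.
      by rewrite cabs_real ger0_norm ?expR_ge0.
    apply: le_trans (cabs_expB n a1 a2) _.
    rewrite -rmorphB cabs_real [leLHS]mulrAC; apply: ler_pM => //.
    - by rewrite exprn_ge0// expR_ge0.
    - by rewrite ler_wpM2l.
    rewrite /M -expRM_natl ler_expR mulrN lerN2.
    have : n.+1%:R <= 2 * n%:R :> R by rewrite -natrM ler_nat; move: n2; clear; lia.
    by move=> hn; have := ler_wpM2l (sqr_ge0 t) hn; lra.
  rewrite !mul0r !add0r.
  have s1 : 1 <= sq n by rewrite -[leLHS]sqrtr1 ler_wsqrtr// ler1n.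
  have -> : 2 * C / n%:R = C * (n%:R^-1 + n%:R^-1) by ring.
  apply: ler_wpM2l; first exact: ltW.
  have E4 : n%:R / sq n ^+ 4 = n%:R^-1 :> R.
    by rewrite -[4%N]/(2 * 2)%N exprM sq_sqr; field; rewrite gt_eqF.
  have -> : n%:R / sq n ^+ 5 = n%:R^-1 / sq n by rewrite exprSr invfM mulrA E4.
  rewrite E4 lerD2l ler_piMr ?invr_ge0// invf_le1//.
have h2 := Ipi_gss W0 n0; rewrite -/G in h2.
have p2 : 1 <= 2 * pi :> R by have := @pi_ge2 R; lra.
have tp : 0 < 2 * pi :> R by lra.
have : `|2 * pi * (sq n * cb n - kap 2^-1)| <= e.
  have -> : 2 * pi * (sq n * cb n - kap 2^-1) = sq n * ((2 * pi * cb n - Ipi (gss 2^-1 n)) +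
     (Ipi (gss 2^-1 n) - 2 * pi * kap 2^-1 / sq n)) by field; rewrite gt_eqF.
  rewrite normrM (ger0_norm (ltW s0)) mulrC -ler_pdivlMr//.
  apply: le_trans (ler_normD _ _) _; apply: le_trans (lerD h1 h2) _.
  rewrite -mulrDl ler_pdivrMr// div_sq_mul// [e * _]mulrC -ler_pdivrMr//.
  exact: HN (ltnW Nn).
by apply: le_trans; rewrite normrM (ger0_norm (ltW tp)) ler_peMl.
Qed.

Lemma cb_bound : exists2 B : R, 0 < B & forall l,
  `|cb l| <= B / sq l.+1 /\ `|cb l - cb l.+1| <= B / sq l.+1 ^+ 3.
Proof.
have [B B0 HB] := tends_bounded (tends_sq_shift cb_llt); exists B => // l.
have s0 : 0 < sq l.+1 by apply: sq_gt0.
have b1 : `|cb l| <= B / sq l.+1.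
  by rewrite ler_pdivlMr// mulrC -{1}(ger0_norm (ltW s0)) -normrM; exact: HB.
split=> //; have -> : cb l - cb l.+1 = cb l / (2 * l.+1%:R).
  have l0 : l.+1%:R != 0 :> R by rewrite pnatr_eq0.
  apply: (mulfI l0); rewrite mulrBr cbS -natr1.
  by field; rewrite natr1.
have E : 2 * l.+1%:R = 2 * sq l.+1 ^+ 2 by rewrite sq_sqr.
rewrite normrM E (ger0_norm (_ : 0 <= (2 * sq l.+1 ^+ 2)^-1)); last first.
  by rewrite invr_ge0 mulr_ge0// sqr_ge0.
apply: (le_trans (ler_wpM2r _ b1)); first by rewrite invr_ge0 mulr_ge0// sqr_ge0.
have -> : B / sq l.+1 / (2 * sq l.+1 ^+ 2) = B / sq l.+1 ^+ 3 / 2 by field; rewrite gt_eqF.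
by rewrite ler_piMr ?divr_ge0 ?exprn_ge0 ?(ltW B0) ?(ltW s0)//; lra.
Qed.

End WallisLimit.

Section WalkSequences.
Context {R : realType} (xi : probability nat R) (sigma : R).
Hypothesis crit : critical xi sigma.
Local Notation p := (offspring_prob xi).
Variable h : nat.
Hypothesis h0 : (0 < h)%N.
Hypothesis h_span : forall k, 0 < p k -> (h %| k)%N.
Hypothesis h_spanned : spanned xi h.
Local Notation sq n := (Num.sqrt (n%:R : R)).
Local Notation V := (step_var sigma h).
Let hR : 0 < h%:R :> R. Proof. by rewrite ltr0n. Qed.

(** The possible sizes of a tree. *)
Definition lattice_point (k : nat) : nat := (h * k).+1.
Local Notation lat := lattice_point.
(** By [otter_dwass] this is the size of the tree times the probability of that size. *)
Definition hit_prob (k : nat) : R := walk p (lat k) (h * k).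
Local Notation hit := hit_prob.
Definition return_prob (l : nat) : R := walk p (h * l) (h * l).
Local Notation ret := return_prob.

Lemma le_lat k : (k < lat k)%N.
Proof. by rewrite ltnS leq_pmull. Qed.

Lemma latS k : lat k.+1 = (lat k + h)%N.
Proof. by rewrite /lattice_point mulnS addSn addnC. Qed.

Lemma tends_ret : tends (fun l => sq l.+1 * ret l) (kap V / sq h).
Proof.
apply: tends_sq_shift; have sh : 0 < sq h by apply: sq_gt0.
have H : tends (fun l => (sq h)^-1 * (sq (h * l) * ret l)) ((sq h)^-1 * kap V).
  apply: tendsZ => e e0; have [N N0 HN] := llt_return crit h0 h_span h_spanned e0.
  exists N => n Nn; apply: HN; last exact: dvdn_mulr.
  by apply: (leq_trans Nn); rewrite leq_pmull.
rewrite mulrC; apply: (@tends_eq_near _ _ _ _ 0 H) => l _.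
by rewrite natrM sqrtrM// !mulrA mulVf ?gt_eqF// mul1r.
Qed.

Lemma hit_sub_ret (e : R) : 0 < e -> exists N, forall k, (N <= k)%N ->
  `|hit k - ret k| <= e / (h * k)%:R.
Proof.
move=> e0; have [N N0 HN] := llt_hit_return crit h0 h_span h_spanned e0.
exists N => k Nk; apply: HN; last exact: dvdn_mulr.
by apply: (leq_trans Nk); rewrite leq_pmull.
Qed.

Lemma tends_hit : tends (fun k => sq (lat k) * hit k) (kap V).
Proof.
have H1 : tends (fun n => sq n.+1 * (if (h %| n)%N then walk p n.+1 n else kap V / sq n)) (kap V).
  apply: tends_sq_shift => e e0; have e2 : 0 < e / 2 by rewrite divr_gt0.
  have [N1 N10 H1] := llt_return crit h0 h_span h_spanned e2.
  have [N2 N20 H2] := llt_hit_return crit h0 h_span h_spanned e2.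
  exists (maxn N1 N2) => n; rewrite geq_max => /andP[n1 n2].
  have n0 : (0 < n)%N by apply: leq_trans N20 n2.
  have s0 : 0 < sq n by apply: sq_gt0.
  case: ifPn => hn; last by rewrite mulrC divfK ?subrr ?normr0 ?(ltW e0)// gt_eqF.
  have -> : sq n * walk p n.+1 n - kap V = sq n * (walk p n.+1 n - walk p n n) +
    (sq n * walk p n n - kap V) by ring.
  apply: le_trans (ler_normD _ _) _; have := H1 n n1 hn; have := H2 n n2 hn.
  rewrite normrM (ger0_norm (ltW s0)) => h1 h2.
  suff : sq n * `|walk p n.+1 n - walk p n n| <= e / 2 by lra.
  apply: le_trans (ler_wpM2l (ltW s0) h1) _.
  have s1 : 1 <= sq n by rewrite -[leLHS]sqrtr1 ler_wsqrtr// ler1n.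
  have -> : sq n * (e / 2 / n%:R) = e / 2 * (sq n)^-1.
    by have := @sq_sqr R n; move: (sq n) s0 => s s0 <-; field; rewrite gt_eqF.
  by rewrite ler_piMr ?(ltW e2)// invf_le1.
have H2 := tends_sub H1 (fun n => leq_pmull n h0).
by apply: (@tends_eq_near _ _ _ _ 0 H2) => k _; rewrite dvdn_mulr.
Qed.

Lemma ret_bound : exists2 B : R, 0 < B & forall l,
  `|ret l| <= B / sq l.+1 /\ `|ret l - ret l.+1| <= B / sq l.+1 ^+ 3.
Proof.
have [B B0 HB] := tends_bounded tends_ret.
have [C C0 HC] := walk_return_diff crit h0 h_span h_spanned.
exists (B + 4 * C + `|ret 0 - ret 1|); first by rewrite ltr_pwDl// addr_gt0// mulr_gt0.
move=> l; have s0 : 0 < sq l.+1 by apply: sq_gt0.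
have n0 := normr_ge0 (ret 0 - ret 1).
split.
  rewrite ler_pdivlMr// mulrC -{1}(ger0_norm (ltW s0)) -normrM.
  by apply: le_trans (HB l) _; move: C0; lra.
case: l s0 => [|l] s0.
  by rewrite sqrtr1 expr1n divr1 lerDr addr_ge0 ?mulr_ge0 ?(ltW B0) ?(ltW C0).
have hl : (0 < h * l.+1)%N by rewrite muln_gt0 h0.
have := HC (h * l.+1)%N hl (dvdn_mulr _ (dvdnn _)).
rewrite -[X in (_ + X)%N]muln1 -mulnDr addn1 -/(ret _) -/(ret _) => H.
apply: (le_trans H); have s1 : 0 < sq l.+1 by apply: sq_gt0.
apply: (@le_trans _ _ (C / sq l.+1 ^+ 3)).
  rewrite ler_wpM2l ?(ltW C0)// lef_pV2 ?posrE ?exprn_gt0 ?sq_gt0//.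
  by rewrite lerXn2r ?nnegrE ?sqrtr_ge0// le_sq// leq_pmull.
apply: (@le_trans _ _ (4 * C / sq l.+2 ^+ 3)); last first.
  rewrite ler_wpM2r ?invr_ge0 ?exprn_ge0 ?(ltW s0)//; move: B0 n0; lra.
rewrite ler_pdivrMr ?exprn_gt0// mulrAC ler_pdivlMr ?exprn_gt0//.
suff key : sq l.+2 ^+ 3 <= 4 * sq l.+1 ^+ 3 by have := ler_wpM2l (ltW C0) key; lra.
have q : sq l.+2 ^+ 2 <= 2 * sq l.+1 ^+ 2.
  by rewrite !sq_sqr -natrM ler_nat; lia.
have q2 : sq l.+2 <= 2 * sq l.+1.
  rewrite -(ler_pXn2r (_ : 0 < 2)%N) ?nnegrE ?mulr_ge0 ?sqrtr_ge0//.
  by rewrite exprMn; apply: (le_trans q); have := sqr_ge0 (sq l.+1); lra.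
rewrite exprSr [sq l.+1 ^+ 3]exprSr.
apply: le_trans (ler_pM _ _ q q2) _; rewrite ?sqr_ge0 ?sqrtr_ge0//.
by rewrite le_eqVlt; apply/orP; left; apply/eqP; ring.
Qed.

Lemma hit_trunc : exists2 C : R, 0 < C & exists N, forall k, (N <= k)%N ->
  V / 2 <= trunc_var xi h (sq (lat k)) /\
  `|hit k - kap (trunc_var xi h (sq (lat k))) / sq (lat k)| <=
    C * truncation_error xi h (lat k).
Proof.
have [C C0 [N N0 HN]] := llt_hit_trunc crit h0 h_span h_spanned.
exists C => //; exists N => k Nk; apply: HN; last exact: dvdn_mulr.
by apply: (leq_trans Nk); rewrite leq_pmull.
Qed.

Lemma truncation_error_ge0 n : 0 <= truncation_error xi h n.
Proof.
apply: addr_ge0; last by rewrite invr_ge0.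
apply: addr_ge0; last by apply: mean_ge0 => k; rewrite mulr_ge0.
by rewrite divr_ge0//; apply: mean_ge0 => k; rewrite mulr_ge0// exprn_ge0.
Qed.

Lemma truncation_error_tail (e : R) : 0 < e -> exists N, forall K L, (N <= K)%N ->
  \sum_(K <= k < L) truncation_error xi h (lat k) / sq (lat k) <= e.
Proof.
move=> e0; have [C C0 HC] := sum_truncation_error crit h0.
pose f n := truncation_error xi h n / sq n.
have f0 n : 0 <= f n by rewrite divr_ge0 ?truncation_error_ge0 ?sqrtr_ge0.
pose S M := \sum_(1 <= n < M.+1) f n.
have [N HN] : exists N, forall M, (N <= M)%N -> S M - S N <= e.
  have ub : has_sup (range S).
    by split; [exists (S 0%N), 0%N|exists C => _ [M _ <-]; exact: HC].
  have [_ [N _ <-] HN] := sup_adherent e0 ub.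
  exists N => M NM; have : S M <= sup (range S) by apply: ub_le_sup; [case: ub|exists M].
  by move: HN; lra.
exists N => K L NK.
have H : \sum_(K <= k < L) f (lat k) <= \sum_(lat K <= n < lat (maxn K L)) f n.
  have [LK|KL] := leqP L K; first by rewrite big_geq// sumr_ge0.
  elim: L KL => [//|L IH].
  rewrite ltnS leq_eqVlt => /predU1P[<-|KL].
    rewrite big_nat1 latS big_ltn; last by rewrite -[X in (X < _)%N]addn0 ltn_add2l.
    by rewrite lerDl sumr_ge0.
  rewrite big_nat_recr ?(ltnW KL)//= [leRHS](@big_cat_nat _ _ _ (lat L))/=; last 2 first.
  - by rewrite /lattice_point ltnS leq_mul2l (ltnW KL) orbT.
  - by rewrite /lattice_point ltnS leq_mul2l leqnSn orbT.
  apply: lerD; first exact: IH.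
  rewrite latS big_ltn; last by rewrite -[X in (X < _)%N]addn0 ltn_add2l.
  by rewrite lerDl sumr_ge0.
apply: (le_trans H); set M := (lat (maxn K L)).
have NM : (N < M)%N by apply: leq_trans (le_lat _); rewrite ltnS leq_max NK.
have NlK : (N < lat K)%N by apply: leq_trans (le_lat _); rewrite ltnS.
apply: le_trans (HN M.-1 _); last by rewrite -ltnS prednK// (leq_trans _ NM).
rewrite /S prednK ?(leq_trans _ NM)// [X in _ <= X - _](@big_cat_nat _ _ _ N.+1)//= addrAC subrr add0r.
rewrite [leRHS](@big_cat_nat _ _ _ (lat K))//=; last first.
  by rewrite /lattice_point ltnS leq_mul2l leq_maxl orbT.
by rewrite lerDr sumr_ge0.
Qed.

Lemma kap_anti (U W : R) : 0 < U -> U <= W -> kap W <= kap U.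
Proof.
move=> U0 UW; rewrite ler_wpM2r ?invr_ge0 ?mulr_ge0 ?pi_ge0// ler_wsqrtr//.
rewrite ler_wpM2l ?mulr_ge0 ?pi_ge0// lef_pV2// posrE.
exact: lt_le_trans UW.
Qed.

Lemma kap_gt0 (W : R) : 0 < W -> 0 < kap W.
Proof. by move=> W0; rewrite divr_gt0 ?sqrtr_gt0 ?divr_gt0 ?mulr_gt0 ?pi_gt0. Qed.

(** The excess that stems from truncating the variance. It is monotone, as the truncated
   variance increases. *)
Definition kap_excess (k : nat) : R := kap (trunc_var xi h (sq (lat k))) - kap V.

Lemma kap_excess_mono : exists N, forall k, (N <= k)%N ->
  0 <= kap_excess k /\ kap_excess k.+1 <= kap_excess k.
Proof.
have [C C0 [N HN]] := hit_trunc; exists N => k Nk; have [h1 _] := HN k Nk.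
have V0 := step_var_gt0 crit h0.
have W0 : 0 < trunc_var xi h (sq (lat k)) by apply: lt_le_trans h1; rewrite divr_gt0.
split; first by rewrite subr_ge0 kap_anti// (trunc_var_le crit).
rewrite lerD2r; apply: (kap_anti W0); apply: (le_trunc_var crit); apply: le_sq.
by rewrite /lattice_point ltnS leq_mul2l leqnSn orbT.
Qed.

Lemma kap_excess_small (e : R) : 0 < e -> exists N, forall k, (N <= k)%N -> kap_excess k <= e.
Proof.
move=> e0; have V0 := step_var_gt0 crit h0; have kV := kap_gt0 V0.
pose d := V * (1 - (kap V / (kap V + e)) ^+ 2).
have ke : 0 < kap V + e by rewrite addr_gt0.
have r1 : kap V / (kap V + e) < 1 by rewrite ltr_pdivrMr// mul1r ltrDl.
have r0 : 0 < kap V / (kap V + e) by rewrite divr_gt0.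
have d0 : 0 < d.
  by rewrite mulr_gt0// subr_gt0 expr_lt1 ?ltW.
have [A A0 HA] := tail_second_small crit h0 d0.
have [N N0 HN] := sq_large A.
exists N => k Nk; have NA : A <= sq (lat k) by apply: HN; apply: leq_trans Nk (ltnW (le_lat k)).
have := HA _ NA; have := trunc_var_split crit h (sq (lat k)).
set W := trunc_var _ _ _; set r := kap V / (kap V + e) in r0 r1 d d0 HA * => e1 e2.
have Wr : V * r ^+ 2 <= W by move: e1 e2; rewrite /d mulrBr mulr1; lra.
have Vr0 : 0 < V * r ^+ 2 by rewrite mulr_gt0// exprn_gt0.
have := kap_anti Vr0 Wr.
have -> : kap (V * r ^+ 2) = kap V + e.
  rewrite /kap (_ : 2 * pi / (V * r ^+ 2) = 2 * pi / V * r^-1 ^+ 2); last first.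
    by move: (V) V0 => v v0; field; rewrite !gt_eqF.
  rewrite sqrtrM; last by apply: divr_ge0; [apply: mulr_ge0 => //; exact: pi_ge0|exact: ltW].
  rewrite sqrtr_sqr (gtr0_norm (_ : 0 < r^-1)) ?invr_gt0// mulrAC -/(kap V).
  rewrite {1}/r invf_div.
  by rewrite mulrC divfK// gt_eqF.
by rewrite /kap_excess -/W; lra.
Qed.

End WalkSequences.

(** * The convergence of the regularized series *)

Section PowR.
Context {R : realType}.
Implicit Types (x y r : R).

Lemma powR_anti x y r : 0 < x -> x <= y -> r <= 0 -> y `^ r <= x `^ r.
Proof.
move=> x0 xy r0; rewrite -(opprK r) !(powRN _ (- r)).
have y0 : 0 < y by apply: lt_le_trans xy.
rewrite lef_pV2 ?posrE ?powR_gt0//; apply: ge0_ler_powR; rewrite ?oppr_ge0// nnegrE ltW//.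
Qed.

Lemma powR_le1 x r : 1 <= x -> r <= 0 -> x `^ r <= 1.
Proof. by move=> x1 r0; have := powR_anti (@ltr01 R) x1 r0; rewrite powR1. Qed.

Lemma powR_scale x y c r : 0 < x -> 1 <= c -> y <= c * x -> 0 < y -> - 3 <= r -> r <= 0 ->
  x `^ r <= c ^+ 3 * y `^ r.
Proof.
move=> x0 c1 ycx y0 r3 r0; have c0 : 0 < c by apply: lt_le_trans c1.
apply: (@le_trans _ _ (c ^+ 3 * (c * x) `^ r)); last first.
  by rewrite ler_wpM2l ?exprn_ge0 ?(ltW c0)//; apply: powR_anti.
rewrite powRM ?(ltW c0) ?(ltW x0)// mulrA ler_peMl ?powR_ge0//.
rewrite -(powR_mulrn _ (ltW c0)) -powRD; last by rewrite (gt_eqF c0) implybT.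
rewrite -[leLHS](powRr0 c) ler_powR//; lra.
Qed.

Lemma powRB1 x r : 0 < x -> x `^ (r - 1) = x `^ r / x.
Proof. by move=> x0; rewrite powRB ?powRr1 ?(ltW x0)// (gt_eqF x0) implybT. Qed.

Lemma powRB2 x r : 0 < x -> x `^ (r - 2) = x `^ r / x ^+ 2.
Proof.
move=> x0; have -> : r - 2 = r - 1 - 1 by ring.
by rewrite !powRB1// expr2 invfM mulrA.
Qed.

End PowR.

Section Abel.
Context {R : realType}.

(** Summation by parts, against the partial sums of [z]. *)
Lemma abel_bound (f : nat -> R) (z : nat -> R[i]) (K : nat) (B : R) :
  (forall k, (K <= k)%N -> 0 <= f k /\ f k.+1 <= f k) ->
  (forall L, cabs (\sum_(K <= k < L) z k) <= B) ->
  forall L, cabs (\sum_(K <= k < L) (f k)%:C * z k) <= 2 * (f K * B).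
Proof.
move=> fm zB; pose S L := \sum_(K <= k < L) z k.
have B0 : 0 <= B by apply: le_trans (zB K); exact: cabs_ge0.
have H L : (K <= L)%N ->
    cabs (\sum_(K <= k < L) (f k)%:C * z k - (f L)%:C * S L) <= (f K - f L) * B.
  elim: L => [|L IH].
    rewrite leqn0 => /eqP K0; rewrite /S K0 !big_geq// mulr0 subrr cabs0.
    by rewrite subrr mul0r.
  rewrite leq_eqVlt => /predU1P[<-|].
    by rewrite /S !big_geq// mulr0 subrr cabs0 subrr mul0r.
  rewrite ltnS => KL; have {}IH := IH KL; have [fL0 fL] := fm L KL.
  have -> : \sum_(K <= k < L.+1) (f k)%:C * z k - (f L.+1)%:C * S L.+1 =
     (\sum_(K <= k < L) (f k)%:C * z k - (f L)%:C * S L) + (f L - f L.+1)%:C * S L.+1.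
    by rewrite /S !(big_nat_recr L K)//= rmorphB; ring.
  have -> : (f K - f L.+1) * B = (f K - f L) * B + (f L - f L.+1) * B by ring.
  apply: le_trans (ler_cabsD _ _) _; apply: lerD => //.
  by rewrite cabsM cabs_real ger0_norm ?subr_ge0// ler_wpM2l ?subr_ge0// zB.
move=> L; have [LK|KL] := leqP L K.
  by rewrite big_geq// cabs0 !mulr_ge0//; have [] := fm K (leqnn _).
have {}H := H L (ltnW KL).
have fL : 0 <= f L by have [] := fm L (ltnW KL).
have := lerB_cabs (\sum_(K <= k < L) (f k)%:C * z k) ((f L)%:C * S L).
have : cabs ((f L)%:C * S L) <= f L * B.
  by rewrite cabsM cabs_real ger0_norm// ler_wpM2l// zB.
move: H; rewrite mulrBl; have [fK _] := fm K (leqnn _).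
have : f L * B <= f K * B.
  rewrite ler_wpM2r//; elim: L KL {fL} => [//|L IH].
  rewrite ltnS leq_eqVlt => /predU1P[<-|KL]; first by have [_] := fm K (leqnn _).
  by apply: le_trans (IH KL); have [_] := fm L (ltnW KL).
have := mulr_ge0 fK B0; lra.
Qed.

End Abel.

Section Region.
Context {R : realType}.
Local Notation Re := complex.Re.

(** These sets exhaust the strip, and every estimate is uniform on each of them: [d] keeps
   [a] away from the left edge and from the singular point, [M] bounds it. *)
Definition region (d M : R) (a : R[i]) :=
  [/\ - 2^-1 + d <= Re a, Re a <= 2^-1, d <= cabs (a - one_half) & cabs a <= M].

Lemma Re_sub_half (a : R[i]) : Re (a - one_half) = Re a - 2^-1.
Proof. by case: a. Qed.

Lemma Re_sub1 (a : R[i]) : Re (a - 1) = Re a - 1.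
Proof. by case: a. Qed.

Lemma region_facts d M a : 0 < d -> region d M a ->
  [/\ - 1 + d <= Re (a - one_half), Re (a - one_half) <= 0,
   cabs (a - one_half) <= M + 1 &
   forall k : nat, d <= cabs (a - one_half + k%:R)].
Proof.
move=> d0 [h1 h2 h3 h4]; rewrite Re_sub_half; split; [lra|lra| |].
  apply: le_trans (ler_cabsB _ _) _; apply: lerD => //.
  by rewrite cabs_real ger0_norm ?invr_ge0//; lra.
case=> [|k]; first by rewrite addr0.
apply: le_trans (abs_Re_le _); apply: le_trans (ler_norm _).
have -> : Re (a - one_half + k.+1%:R) = Re a - 2^-1 + k.+1%:R.
  by rewrite natc; case: (a).
have : 1 <= k.+1%:R :> R by rewrite ler1n.
move: h1; lra.
Qed.

End Region.

Section Coefficients.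
Context {R : realType} (xi : probability nat R) (sigma : R).
Hypothesis crit : critical xi sigma.
Local Notation p := (offspring_prob xi).
Variable h : nat.
Hypothesis h0 : (0 < h)%N.
Hypothesis h_span : forall k, 0 < p k -> (h %| k)%N.
Hypothesis h_spanned : spanned xi h.
Local Notation sq n := (Num.sqrt (n%:R : R)).
Local Notation V := (step_var sigma h).
Local Notation Re := complex.Re.
Local Notation lat := (lattice_point h).
Local Notation hit := (hit_prob xi h).
Local Notation ret := (return_prob xi h).
Local Notation kV := (kap (step_var sigma h)).
Local Notation b_ a := (a - one_half).
Let hR : 0 < h%:R :> R. Proof. by rewrite ltr0n. Qed.
Let V0 : 0 < V := step_var_gt0 crit h0.
Let kV0 : 0 < kV := kap_gt0 V0.

(** By [otter_dwass] this is the term of size [lat k] in the series for the moment [E|T|^a]. *)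
Definition size_term (a : R[i]) (k : nat) : R[i] := npow (lat k) (a - 1) * (hit k)%:C.
Local Notation u := size_term.

(** The coefficients of [(1 - z)^(1/2 - a)], scaled so as to be asymptotic to those of the
   series for the moment. *)
Definition model_term (a : R[i]) (k : nat) : R[i] :=
  kV%:C * npow h (b_ a - 1) * (rising k (b_ a) / rGamma (b_ a)).
Local Notation v := model_term.

Let latR k : 0 < (lat k)%:R :> R. Proof. by rewrite ltr0n. Qed.
Let lat1 k : 1 <= (lat k)%:R :> R. Proof. by rewrite ler1n. Qed.

Lemma npow_half n : (0 < n)%N -> npow n (one_half : R[i]) = (sq n)%:C.
Proof. by move=> n0; rewrite npow_real// powR12_sqrt. Qed.

Lemma uE a k : u a k = npow (lat k) (b_ a - 1) * (sq (lat k) * hit k)%:C.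
Proof.
rewrite /size_term; have -> : a - 1 = (b_ a - 1) + one_half by ring.
by rewrite npowD npow_half// rmorphM mulrA.
Qed.

Lemma cabs_npow_lat (a : R[i]) k : cabs (npow (lat k) (b_ a - 1) : R[i]) = ((lat k)%:R : R) `^ (Re (b_ a) - 1).
Proof. by rewrite cabs_npow// Re_sub1. Qed.

(** Finitely many indices do not affect a bound with an unspecified constant. *)
Lemma fill_bound (d M C : R) (f : R[i] -> nat -> R) (k0 : nat) : 0 < d ->
  (forall k, (k0 <= k)%N -> forall a, region d M a -> f a k <= C * (lat k)%:R `^ (Re (b_ a) - 2)) ->
  (forall k, exists B, forall a, region d M a -> f a k <= B) ->
  exists2 C', 0 < C' & forall k a, region d M a -> f a k <= C' * (lat k)%:R `^ (Re (b_ a) - 2).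
Proof.
move=> d0 + HB; elim: k0 C => [|k0 IH] C HC.
  exists (`|C| + 1); first by rewrite ltr_wpDl.
  move=> k a ra; apply: le_trans (HC k _ a ra) _ => //.
  by rewrite ler_wpM2r ?powR_ge0// ler_wpDr// ler_norm.
have [B {}HB] := HB k0; apply: (IH (`|C| + `|B| * (lat k0)%:R ^+ 3)) => k.
rewrite leq_eqVlt => /predU1P[<-|k0k] a ra.
  have [r1 r2 _ _] := region_facts d0 ra.
  apply: (le_trans (HB a ra)); rewrite mulrDl ler_wpDl ?mulr_ge0 ?powR_ge0//.
  apply: (le_trans (ler_norm _)); rewrite -mulrA ler_peMr//.
  have := @powR_scale _ 1 (lat k0)%:R (lat k0)%:R (Re (b_ a) - 2) ltr01 (lat1 k0).
  rewrite [_ * 1]mulr1 powR1; apply => //; move: r1 r2 d0; lra.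
apply: (le_trans (HC k k0k a ra)); rewrite mulrDl ler_wpDr//.
by rewrite ler_wpM2r ?powR_ge0// ler_norm.
Qed.

Lemma cabs_npow_h_le1 (a : R[i]) (d M : R) : 0 < d -> region d M a -> cabs (npow h (b_ a - 1)) <= 1.
Proof.
move=> d0 /(region_facts d0)[_ r2 _ _]; rewrite cabs_npow// Re_sub1.
by apply: powR_le1; [rewrite ler1n|lra].
Qed.

Lemma npow_lat_shift (M : R) : 1 <= M -> exists2 C, 0 < C & exists N, (0 < N)%N /\
  forall k, (N <= k)%N -> forall c : R[i], cabs c <= M ->
  cabs (npow (h * k) c - npow (lat k) c) <= C / (lat k)%:R * cabs (npow (lat k) c).
Proof.
move=> M1; have M0 : 0 < M by apply: lt_le_trans M1.
exists (6 * M); first by rewrite mulr_gt0.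
exists (Num.truncn (2 * M)).+1; split=> // k Nk c cM.
have k0 : (0 < k)%N by apply: leq_trans Nk.
have hk0 : (0 < h * k)%N by rewrite muln_gt0 h0.
have hkR : 0 < (h * k)%:R :> R by rewrite ltr0n.
have kM : 2 * M <= (h * k)%:R.
  apply: (@le_trans _ _ k%:R); last by rewrite ler_nat leq_pmull.
  by apply/ltW/(lt_le_trans (truncnS_gt _)); rewrite ler_nat.
pose l : R := ln (h * k)%:R - ln (lat k)%:R.
have ll : `|l| <= (h * k)%:R^-1.
  rewrite distrC ger0_norm; last by rewrite subr_ge0 ler_ln ?posrE// ler_nat.
  rewrite -ln_div ?posrE//.
  have -> : (lat k)%:R / (h * k)%:R = 1 + (h * k)%:R^-1 :> R.
    by rewrite /lattice_point -natr1 mulrDl mulfV ?mul1r// gt_eqF.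
  by apply: le_ln1Dx; rewrite (lt_trans (ltrN10 _))// invr_gt0.
have cl : cabs (c * l%:C) <= M / (h * k)%:R.
  by rewrite cabsM cabs_real; apply: ler_pM; rewrite ?cabs_ge0.
have cl2 : cabs (c * l%:C) <= 2^-1.
  apply: (le_trans cl); rewrite ler_pdivrMr// ler_pdivlMl//.
rewrite (npow_ratio (h * k) (lat k)) -/l -[X in _ * _ - X]mulr1 -mulrBr cabsM mulrC.
rewrite ler_wpM2r ?cabs_ge0//; apply: (le_trans (cexp_linear cl2)).
apply: le_trans (ler_wpM2l _ cl) _ => //.
rewrite mulrA ler_pdivrMr// mulrAC ler_pdivlMr//.
have : (lat k)%:R <= 2 * (h * k)%:R :> R.
  by rewrite -natrM ler_nat /lattice_point mul2n -addnn -addn1 leq_add2l.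
by move=> hl; have := ler_wpM2l (ltW M0) hl; lra.
Qed.

(** From the Stirling formula for the rising factorials. *)
Lemma v_approx (d M : R) : 0 < d -> 1 <= M -> exists2 C, 0 < C & forall k a, region d M a ->
  cabs (v a k - kV%:C * npow (lat k) (b_ a - 1)) <= C * (lat k)%:R `^ (Re (b_ a) - 2).
Proof.
move=> d0 M1; have M11 : 1 <= M + 1 by move: M1; lra.
have M21 : 1 <= M + 2 by move: M1; lra.
have [c c0 Hc] := rGamma_bounds M11 d0.
have [C1 C10 [N1 [N10 H1]]] := rising_asymp M11.
have [C2 C20 [N2 [N20 H2]]] := npow_lat_shift M21.
pose C := kV * (C1 / c * (h.+1)%:R ^+ 3 + C2).
apply: (@fill_bound d M C _ (maxn N1 N2) d0); last first.
  move=> k; exists (kV * ((\prod_(j < k) (M + 1 + j%:R)) / c) + kV) => a ra.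
  have [r1 r2 r3 r4] := region_facts d0 ra.
  have cG := Hc _ r3 r4.
  apply: le_trans (ler_cabsB _ _) _; apply: lerD.
    rewrite /model_term (cabsM (_ * _)) (cabsM kV%:C) (cabsM (rising _ _)) cabs_real (gtr0_norm kV0) -mulrA ler_wpM2l ?(ltW kV0)//.
    rewrite -[leRHS]mul1r; apply: ler_pM; rewrite ?mulr_ge0 ?cabs_ge0//.
      exact: cabs_npow_h_le1 d0 ra.
    rewrite cabsV; apply: ler_pM; rewrite ?cabs_ge0 ?invr_ge0 ?cabs_ge0//; last first.
      by rewrite lef_pV2 ?posrE//; exact: lt_le_trans cG.
    rewrite /rising cabsM cabsV cabs_nat.
    have -> : cabs (\prod_(j < k) (b_ a + j%:R)) = \prod_(j < k) cabs (b_ a + j%:R).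
      by apply: (big_morph (fun z => cabs z)); [exact: cabsM|exact: cabs1].
    rewrite ler_pdivrMr ?ltr0n ?fact_gt0//.
    have P0 : 0 <= \prod_(j < k) (M + 1 + j%:R).
      by apply: prodr_ge0 => j _; rewrite addr_ge0//; move: M1; lra.
    apply: (@le_trans _ _ (\prod_(j < k) (M + 1 + j%:R))); last first.
      by rewrite ler_peMr// ler1n fact_gt0.
    apply: ler_prod => j _; rewrite cabs_ge0/=.
    by apply: le_trans (ler_cabsD _ _) _; rewrite cabs_nat lerD2r.
  rewrite cabsM cabs_real (gtr0_norm kV0) ler_piMr ?(ltW kV0)// cabs_npow_lat.
  by apply: powR_le1 => //; lra.
move=> k; rewrite geq_max => /andP[k1 k2] a ra.
have [r1 r2 r3 r4] := region_facts d0 ra.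
have cG := Hc _ r3 r4; have G0 : rGamma (b_ a) != 0 by rewrite -cabs_gt0 (lt_le_trans c0).
have k0 : (0 < k)%N by apply: leq_trans k1.
have -> : v a k - kV%:C * npow (lat k) (b_ a - 1) =
  kV%:C * (npow h (b_ a - 1) * ((rising k (b_ a) - rGamma (b_ a) * npow k (b_ a - 1)) / rGamma (b_ a))
   + (npow (h * k) (b_ a - 1) - npow (lat k) (b_ a - 1))).
  by rewrite npowM// /model_term; field.
rewrite cabsM cabs_real (gtr0_norm kV0) /C -mulrA ler_wpM2l ?(ltW kV0)// [leRHS]mulrDl.
apply: le_trans (ler_cabsD _ _) _; apply: lerD; last first.
  apply: le_trans (H2 k k2 _ _) _.
    apply: le_trans (ler_cabsB _ _) _; rewrite cabs1; move: r3; lra.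
  rewrite cabs_npow_lat.
  have -> : Re (b_ a) - 2 = Re (b_ a) - 1 - 1 by ring.
  by rewrite (powRB1 (Re (b_ a) - 1))// mulrA mulrAC.
rewrite cabsM -[leRHS]mul1r; apply: ler_pM; rewrite ?cabs_ge0//.
  exact: cabs_npow_h_le1 d0 ra.
rewrite cabsM cabsV; have := H1 k k1 _ r3 => h1.
apply: (@le_trans _ _ (C1 * k%:R `^ (Re (b_ a) - 2) / c)).
  apply: ler_pM; rewrite ?invr_ge0 ?cabs_ge0//.
  by rewrite lef_pV2 ?posrE//; exact: lt_le_trans cG.
rewrite mulrAC -[leRHS]mulrA ler_wpM2l ?divr_ge0 ?(ltW c0) ?(ltW C10)//.
apply: powR_scale; rewrite ?ltr0n ?ler1n//; [|by lra|by lra].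
by rewrite -natrM ler_nat /lattice_point mulSn -add1n leq_add2r.
Qed.

Lemma v_bound (d M : R) : 0 < d -> 1 <= M -> exists2 C, 0 < C & forall k a, region d M a ->
  cabs (v a k) <= C * (lat k)%:R `^ (Re (b_ a) - 1).
Proof.
move=> d0 M1; have [C C0 HC] := v_approx d0 M1; exists (kV + C); first exact: addr_gt0.
move=> k a ra; have := HC k a ra; have := lerB_cabs (v a k) (kV%:C * npow (lat k) (b_ a - 1)).
rewrite cabsM cabs_real (gtr0_norm kV0) cabs_npow_lat => h1 h2.
have : (lat k)%:R `^ (Re (b_ a) - 2) <= (lat k)%:R `^ (Re (b_ a) - 1).
  by rewrite ler_powR//; lra.
move=> /(ler_wpM2l (ltW C0)); move: h1 h2; rewrite mulrDl; lra.
Qed.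

Lemma u_bound : exists2 C, 0 < C & forall k a,
  cabs (u a k) <= C * (lat k)%:R `^ (Re (b_ a) - 1).
Proof.
have [C C0 HC] := tends_bounded (tends_hit crit h0 h_span h_spanned).
exists C => // k a; rewrite uE cabsM cabs_npow_lat cabs_real mulrC.
by rewrite ler_wpM2r ?powR_ge0.
Qed.

Lemma u_sub_v (d M : R) : 0 < d -> 1 <= M -> exists2 e : nat -> R, tends e 0 &
  (forall k, 0 <= e k) /\ forall k a, region d M a ->
  cabs (u a k - v a k) <= e k * (lat k)%:R `^ (Re (b_ a) - 1).
Proof.
move=> d0 M1; have [C C0 HC] := v_approx d0 M1.
exists (fun k => `|sq (lat k) * hit k - kV| + C / (lat k)%:R).
  move=> e e0; have e2 : 0 < e / 2 by rewrite divr_gt0.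
  have [N1 H1] := tends_hit crit h0 h_span h_spanned e2.
  exists (maxn N1 (Num.truncn (C / (e / 2))).+1) => k; rewrite geq_max => /andP[k1 k2].
  rewrite subr0 ger0_norm ?addr_ge0 ?divr_ge0 ?(ltW C0)//.
  have : C / (lat k)%:R <= e / 2.
    rewrite ler_pdivrMr// mulrC -ler_pdivrMr//; apply/ltW/(lt_le_trans (truncnS_gt _)).
    by rewrite ler_nat (leq_trans k2)// ltnW// le_lat.
  by have := H1 k k1; lra.
split=> [k|k a ra]; first by rewrite addr_ge0 ?divr_ge0 ?(ltW C0).
have -> : u a k - v a k = npow (lat k) (b_ a - 1) * (sq (lat k) * hit k - kV)%:C -
  (v a k - kV%:C * npow (lat k) (b_ a - 1)) by rewrite uE rmorphB; ring.
apply: le_trans (ler_cabsB _ _) _; rewrite mulrDl; apply: lerD.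
  by rewrite cabsM cabs_npow_lat cabs_real mulrC.
apply: (le_trans (HC k a ra)); have -> : Re (b_ a) - 2 = Re (b_ a) - 1 - 1 by ring.
by rewrite (powRB1 (Re (b_ a) - 1))// mulrA mulrAC.
Qed.

Lemma lat_le_scale k : (lat k.+1)%:R <= (h.+1)%:R * (lat k)%:R :> R.
Proof. by rewrite -natrM ler_nat latS mulSn leq_add2l leq_pmulr. Qed.

Lemma sum_vE a N : \sum_(k < N.+1) v a k =
  kV%:C * npow h (b_ a - 1) * (rising N (b_ a + 1) / rGamma (b_ a)).
Proof. by rewrite -sum_rising mulr_suml mulr_sumr. Qed.

Lemma sum_v_bound (d M : R) : 0 < d -> 1 <= M -> exists2 C, 0 < C & exists N0, forall N, (N0 <= N)%N ->
  forall a, region d M a -> cabs (\sum_(k < N) v a k) <= C * (lat N)%:R `^ Re (b_ a).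
Proof.
move=> d0 M1; have M11 : 1 <= M + 1 by move: M1; lra.
have [c c0 Hc] := rGamma_bounds M11 d0.
have [B B0 [N0 [N00 HB]]] := rising_shift_bound M11.
exists (kV * (B / d / c * (h.+1)%:R ^+ 3 * (h.+1)%:R ^+ 3)).
  by apply: (mulr_gt0 kV0); rewrite !mulr_gt0 ?invr_gt0 ?exprn_gt0.
exists N0.+1 => -[//|N]; rewrite ltnS => NN a ra.
have [r1 r2 r3 r4] := region_facts d0 ra.
have cG := Hc _ r3 r4; have N1 : (0 < N)%N by apply: leq_trans NN.
have z0 := r4 0%N; rewrite addr0 in z0.
have zn : b_ a != 0 by rewrite -cabs_gt0 (lt_le_trans d0).
have rr : - 3 <= Re (b_ a) by lra.
rewrite sum_vE (cabsM (_ * _)) (cabsM kV%:C) (cabsM (rising _ _)) cabs_real (gtr0_norm kV0) -[leLHS]mulrA -[leRHS]mulrA ler_wpM2l ?(ltW kV0)//.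
rewrite -[leRHS]mul1r; apply: ler_pM; rewrite ?mulr_ge0 ?cabs_ge0 ?cabsV ?invr_ge0 ?cabs_ge0//.
  exact: cabs_npow_h_le1 d0 ra.
apply: (@le_trans _ _ (B * N%:R `^ Re (b_ a) / d / c)).
  apply: ler_pM; rewrite ?invr_ge0 ?cabs_ge0//; last first.
    by rewrite lef_pV2 ?posrE//; exact: lt_le_trans cG.
  apply: le_trans (HB N NN _ r3 zn) _; apply: ler_wpM2l.
    by rewrite mulr_ge0 ?powR_ge0 ?(ltW B0).
  by rewrite lef_pV2 ?posrE// cabs_gt0.
have s1 : N%:R `^ Re (b_ a) <= (h.+1)%:R ^+ 3 * (lat N)%:R `^ Re (b_ a).
  apply: powR_scale; rewrite ?ltr0n ?ler1n//.
  by rewrite -natrM ler_nat /lattice_point mulSn -add1n leq_add2r.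
have s2 : (lat N)%:R `^ Re (b_ a) <= (h.+1)%:R ^+ 3 * (lat N.+1)%:R `^ Re (b_ a).
  by apply: powR_scale; rewrite ?ltr0n ?ler1n//; exact: lat_le_scale.
have h3 : 0 <= (h.+1)%:R ^+ 3 :> R by rewrite exprn_ge0.
have s3 := le_trans s1 (ler_wpM2l h3 s2).
have Bdc : 0 <= B / d / c by rewrite !divr_ge0 ?ltW.
have := ler_wpM2l Bdc s3; congr (_ <= _); ring.
Qed.

Lemma sum_lat_inv2 K L : \sum_(K <= k < L) ((lat k)%:R ^+ 2)^-1 <= 2 / (lat K)%:R :> R.
Proof.
have [LK|KL] := leqP L K; first by rewrite big_geq// divr_ge0.
suff H : \sum_(K <= k < L) ((lat k)%:R ^+ 2)^-1 <= 2 / (lat K)%:R - 2 / (lat L)%:R :> R.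
  apply: (le_trans H); rewrite lerBlDr lerDl divr_ge0//.
elim: L KL => [//|L IH]; rewrite ltnS leq_eqVlt => /predU1P[<-|KL].
  rewrite big_nat1; apply: (@le_trans _ _ (2 * ((lat K)%:R^-1 - (lat K.+1)%:R^-1))); last by rewrite mulrBr.
  have -> : (lat K)%:R^-1 - (lat K.+1)%:R^-1 = h%:R / ((lat K)%:R * (lat K.+1)%:R) :> R.
    by rewrite latS natrD; field; rewrite -natrD !pnatr_eq0 addn_eq0 !gtn_eqF.
  rewrite mulrA ler_pdivlMr ?mulr_gt0// ler_pdivrMl ?exprn_gt0// expr2.
  rewrite -[leRHS]mulrA ler_wpM2l// -!natrM ler_nat latS.
  by have l0 : (0 < lat K)%N by []; move: l0 h0; move: (lat K) => l; nia.
rewrite big_nat_recr ?(ltnW KL)//=; have := IH KL.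
suff : ((lat L)%:R ^+ 2)^-1 <= 2 / (lat L)%:R - 2 / (lat L.+1)%:R :> R by lra.
apply: (@le_trans _ _ (2 * ((lat L)%:R^-1 - (lat L.+1)%:R^-1))); last by rewrite mulrBr.
have -> : (lat L)%:R^-1 - (lat L.+1)%:R^-1 = h%:R / ((lat L)%:R * (lat L.+1)%:R) :> R.
  by rewrite latS natrD; field; rewrite -natrD !pnatr_eq0 addn_eq0 !gtn_eqF.
rewrite mulrA ler_pdivlMr ?mulr_gt0// ler_pdivrMl ?exprn_gt0// expr2.
rewrite -[leRHS]mulrA ler_wpM2l// -!natrM ler_nat latS.
  by have l0 : (0 < lat L)%N by []; move: l0 h0; move: (lat L) => l; nia.
Qed.

Lemma sum_lat_powR (r : R) K L : r <= 0 ->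
  \sum_(K <= k < L) (lat k)%:R `^ (r - 2) <= 2 / (lat K)%:R * (lat K)%:R `^ r.
Proof.
move=> r0; apply: (@le_trans _ _ (\sum_(K <= k < L) ((lat k)%:R ^+ 2)^-1 * (lat K)%:R `^ r)).
  rewrite big_nat [leRHS]big_nat; apply: ler_sum => k /andP[Kk _].
  rewrite powRB2// mulrC ler_wpM2l ?invr_ge0 ?exprn_ge0//; apply: powR_anti => //.
  by rewrite ler_nat /lattice_point ltnS leq_mul2l Kk orbT.
by rewrite -mulr_suml ler_wpM2r ?powR_ge0// sum_lat_inv2.
Qed.

Lemma sum_big_nat_ord (z : nat -> R[i]) K L : (K <= L)%N ->
  \sum_(K <= k < L) z k = \sum_(k < L) z k - \sum_(k < K) z k.
Proof.
move=> KL; rewrite -!(big_mkord xpredT) (@big_cat_nat _ _ _ K 0 L)//=.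
by rewrite addrAC subrr add0r.
Qed.

(** The powers differ from multiples of the model terms by a summable sequence, and the
   model terms sum to a rising factorial. *)
Lemma sum_npow_bound (d M : R) : 0 < d -> 1 <= M -> exists2 C, 0 < C & exists N0, forall K, (N0 <= K)%N ->
  forall L a, region d M a ->
  cabs (\sum_(K <= k < L) npow (lat k) (b_ a - 1)) <= C * (lat K)%:R `^ Re (b_ a).
Proof.
move=> d0 M1; have [C1 C10 H1] := v_approx d0 M1.
have [C2 C20 [N0 H2]] := sum_v_bound d0 M1.
exists ((2 * C2 + 2 * C1) / kV); first by rewrite divr_gt0// addr_gt0// mulr_gt0.
exists N0 => K NK L a ra; have [r1 r2 r3 r4] := region_facts d0 ra.
have [LK|/ltnW KL] := leqP L K.
  rewrite big_geq// cabs0 mulr_ge0 ?powR_ge0// divr_ge0 ?(ltW kV0)//.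
  by rewrite addr_ge0// mulr_ge0 ?(ltW C10) ?(ltW C20).
set P := \sum_(K <= k < L) _.
have E : kV%:C * P = (\sum_(k < L) v a k - \sum_(k < K) v a k) -
    \sum_(K <= k < L) (v a k - kV%:C * npow (lat k) (b_ a - 1)).
  by rewrite -sum_big_nat_ord// sumrB opprB addrC subrK -mulr_sumr.
have S1 : cabs (\sum_(k < L) v a k - \sum_(k < K) v a k) <= 2 * C2 * (lat K)%:R `^ Re (b_ a).
  apply: le_trans (ler_cabsB _ _) _.
  have h1 := H2 K NK a ra; have h2 := H2 L (leq_trans NK KL) a ra.
  have : (lat L)%:R `^ Re (b_ a) <= (lat K)%:R `^ Re (b_ a).
    by apply: powR_anti => //; rewrite ler_nat /lattice_point ltnS leq_mul2l KL orbT.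
  by move=> /(ler_wpM2l (ltW C20)); move: h1 h2; lra.
have S2 : cabs (\sum_(K <= k < L) (v a k - kV%:C * npow (lat k) (b_ a - 1))) <=
    2 * C1 * (lat K)%:R `^ Re (b_ a).
  apply: le_trans (ler_cabs_sum _ _ _) _.
  apply: (@le_trans _ _ (C1 * \sum_(K <= k < L) (lat k)%:R `^ (Re (b_ a) - 2))).
    by rewrite mulr_sumr; apply: ler_sum => k _; exact: H1.
  rewrite mulrAC [leRHS]mulrC ler_wpM2l ?(ltW C10)//.
  apply: (le_trans (sum_lat_powR K L r2)); rewrite ler_wpM2r ?powR_ge0//.
  by rewrite ler_pdivrMr// ler_peMr.
have : kV * cabs P <= (2 * C2 + 2 * C1) * (lat K)%:R `^ Re (b_ a).
  rewrite -{1}(gtr0_norm kV0) -cabs_real -cabsM E.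
  by apply: le_trans (ler_cabsB _ _) _; rewrite mulrDl; exact: lerD.
by move=> H; rewrite [leRHS]mulrAC ler_pdivlMr// [cabs P * _]mulrC.
Qed.

(** On the line [Re a = 1/2] the sum need not converge absolutely. Three parts are
   separated: the effect of truncating the variance, with monotone moduli, is treated by
   summation by parts; the error of the truncated local limit theorem and the error of
   [v_approx] are absolutely summable. *)
Lemma sum_u_sub_v (d M : R) : 0 < d -> 1 <= M -> forall e, 0 < e -> exists N, forall K, (N <= K)%N ->
  forall L a, region d M a ->
  cabs (\sum_(K <= k < L) (u a k - v a k)) <= e * (lat K)%:R `^ Re (b_ a).
Proof.
move=> d0 M1 e e0; have [C1 C10 H1] := v_approx d0 M1.
have [C2 C20 [N2 H2]] := sum_npow_bound d0 M1.
have [C3 C30 [N3 H3]] := hit_trunc crit h0 h_span h_spanned.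
have [N4 H4] := kap_excess_mono crit h0 h_span h_spanned.
have e6 : 0 < e / 6 / C2 by rewrite !divr_gt0.
have [N5 H5] := kap_excess_small crit h0 e6.
have e3 : 0 < e / 3 / C3 by rewrite !divr_gt0.
have [N6 H6] := truncation_error_tail crit h0 e3.
pose N7 := (Num.truncn (2 * C1 / (e / 3))).+1.
exists (maxn (maxn (maxn N2 N3) (maxn N4 N5)) (maxn N6 N7)) => K.
rewrite !geq_max -!andbA => /and5P[K2 K3 K4 K5 /andP[K6 K7]] L a ra.
have [r1 r2 r3 r4] := region_facts d0 ra.
pose W k := trunc_var xi h (sq (lat k)).
pose z k := npow (lat k) (b_ a - 1).
pose r k := hit k - kap (W k) / sq (lat k).
have s0 k : 0 < sq (lat k) by apply: sq_gt0.
have D k : u a k - v a k = (kap_excess xi sigma h k)%:C * z k + z k * (sq (lat k) * r k)%:C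
    - (v a k - kV%:C * z k).
  rewrite uE /z /r /kap_excess -/(W k).
  have -> : sq (lat k) * hit k = (kap (W k) - kV) + kV + sq (lat k) * (hit k - kap (W k) / sq (lat k)).
    by field; rewrite gt_eqF.
  by rewrite !rmorphD; ring.
rewrite (eq_bigr _ (fun k _ => D k)) sumrB big_split/=.
have P0 : 0 <= (lat K)%:R `^ Re (b_ a) by exact: powR_ge0.
have T1 : cabs (\sum_(K <= k < L) (kap_excess xi sigma h k)%:C * z k) <= e / 3 * (lat K)%:R `^ Re (b_ a).
  apply: le_trans (@abel_bound _ _ z K (C2 * (lat K)%:R `^ Re (b_ a)) _ _ L) _.
  - by move=> k Kk; apply: H4; exact: leq_trans Kk.
  - by move=> L'; exact: H2.
  rewrite !mulrA ler_wpM2r//; have := H5 K K5; rewrite ler_pdivlMr//; lra.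
have T2 : cabs (\sum_(K <= k < L) z k * (sq (lat k) * r k)%:C) <= e / 3 * (lat K)%:R `^ Re (b_ a).
  apply: le_trans (ler_cabs_sum _ _ _) _.
  apply: (@le_trans _ _ (\sum_(K <= k < L) (lat K)%:R `^ Re (b_ a) *
     (C3 * (truncation_error xi h (lat k) / sq (lat k))))).
    rewrite big_nat [leRHS]big_nat; apply: ler_sum => k /andP[Kk _].
    have [_ h3] := H3 k (leq_trans K3 Kk).
    rewrite cabsM /z cabs_npow_lat cabs_real normrM (gtr0_norm (s0 k)) powRB1//.
    have -> : (lat k)%:R `^ Re (b_ a) / (lat k)%:R * (sq (lat k) * `|r k|) =
      (lat k)%:R `^ Re (b_ a) * (`|r k| / sq (lat k)).
      rewrite -{2}(@sq_sqr R (lat k)); move: (sq (lat k)) (s0 k) => s s00.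
      by field; rewrite gt_eqF.
    apply: ler_pM; rewrite ?powR_ge0 ?divr_ge0 ?(ltW (s0 k))//.
      by apply: powR_anti => //; rewrite ler_nat /lattice_point ltnS leq_mul2l Kk orbT.
    by rewrite mulrA ler_wpM2r ?invr_ge0 ?(ltW (s0 k)).
  rewrite -mulr_sumr mulrC ler_wpM2r// -mulr_sumr.
  by have := H6 K L K6; rewrite ler_pdivlMr// mulrC.
have T3 : cabs (\sum_(K <= k < L) (v a k - kV%:C * z k)) <= e / 3 * (lat K)%:R `^ Re (b_ a).
  apply: le_trans (ler_cabs_sum _ _ _) _.
  apply: (@le_trans _ _ (C1 * \sum_(K <= k < L) (lat k)%:R `^ (Re (b_ a) - 2))).
    by rewrite mulr_sumr; apply: ler_sum => k _; exact: H1.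
  apply: le_trans (ler_wpM2l (ltW C10) (sum_lat_powR K L r2)) _.
  rewrite mulrA ler_wpM2r// mulrA ler_pdivrMr// [e / 3 * _]mulrC -ler_pdivrMr ?divr_gt0// mulrC.
  rewrite [C1 * 2]mulrC mulrC; apply/ltW/(lt_le_trans (truncnS_gt _)).
  by rewrite ler_nat (leq_trans K7)// ltnW// le_lat.
apply: le_trans (ler_cabsB _ _) _; have := ler_cabsD (\sum_(K <= k < L) (kap_excess xi sigma h k)%:C * z k)
  (\sum_(K <= k < L) z k * (sq (lat k) * r k)%:C).
by move: T1 T2 T3; lra.
Qed.

End Coefficients.

(** * Convolutions with slowly varying sequences *)

Section Slow.
Context {R : realType}.
Local Notation sq n := (Num.sqrt (n%:R : R)).
Implicit Types (x : nat -> R) (B d e : R).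

(** The behaviour of the return probabilities: of order [l^(-1/2)], with increments of order
   [l^(-3/2)]. *)
Definition slow B x := forall l, `|x l| <= B / sq l.+1 /\ `|x l - x l.+1| <= B / sq l.+1 ^+ 3.

Lemma slow_shift B x N k : 0 <= B -> slow B x -> (2 * k <= N)%N ->
  `|x (N - k)%N - x N| <= 4 * B * k%:R / sq N.+1 ^+ 3.
Proof.
move=> B0 xB kN; have s0 : 0 < sq N.+1 by exact: sq_gt0.
have step j : (N - k <= j)%N -> B / sq j.+1 ^+ 3 <= 4 * B / sq N.+1 ^+ 3.
  move=> Nj; have sj : 0 < sq j.+1 by exact: sq_gt0.
  have h1 : sq N.+1 <= 3 / 2 * sq j.+1.
    rewrite -(ler_pXn2r (_ : 0 < 2)%N) ?nnegrE ?mulr_ge0 ?sqrtr_ge0// exprMn !sq_sqr.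
    have : (N.+1)%:R <= 2 * (j.+1)%:R :> R by rewrite -natrM ler_nat; lia.
    have : 0 <= (j.+1)%:R :> R by [].
    by move: (N.+1%:R : R) (j.+1%:R : R) => y z; lra.
  rewrite ler_pdivrMr ?exprn_gt0// mulrAC ler_pdivlMr ?exprn_gt0// mulrAC -mulrA.
  rewrite mulrA [leRHS]mulrC ler_wpM2l//.
  move: (sq N.+1) (sq j.+1) s0 sj h1 => s t s0 t0 st.
  have h3 : s ^+ 3 <= (3 / 2 * t) ^+ 3.
    by rewrite lerXn2r ?nnegrE ?(ltW s0)// mulr_ge0// ltW.
  apply: (le_trans h3); rewrite exprMn ler_wpM2r ?exprn_ge0 ?(ltW t0)//.
  by rewrite !exprS expr0; lra.
have H i : (i <= k)%N -> `|x (N - k)%N - x (N - k + i)%N| <= 4 * B * i%:R / sq N.+1 ^+ 3.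
  elim: i => [|i IH] ik; first by rewrite addn0 subrr normr0 mulr0 mul0r.
  have := IH (ltnW ik); have [_ ] := xB (N - k + i)%N.
  have := step _ (leq_addr i (N - k)%N); rewrite addnS -(natr1 i) mulrDr mulr1 mulrDl.
  have := ler_normD (x (N - k)%N - x (N - k + i)%N) (x (N - k + i)%N - x (N - k + i).+1).
  by rewrite addrA subrK; lra.
by have := H k (leqnn _); rewrite subnK//; lia.
Qed.

Lemma sum_inv_sqrt N : \sum_(l < N) (sq l.+1)^-1 <= 2 * sq N.
Proof.
elim: N => [|N IH]; first by rewrite big_ord0 mulr_ge0 ?sqrtr_ge0.
rewrite big_ord_recr/=; apply: le_trans (lerD IH (lexx _)) _.
have s1 : 0 < sq N.+1 by exact: sq_gt0.
have s0 : 0 <= sq N by exact: sqrtr_ge0.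
have e1 : sq N.+1 ^+ 2 = sq N ^+ 2 + 1 by rewrite !sq_sqr -natr1.
have le1 : sq N <= sq N.+1 by apply: le_sq.
move: (sq N) (sq N.+1) s0 s1 e1 le1 => s t s0 t0 e1 st.
have : t^-1 <= 2 * (t - s); last by lra.
rewrite -div1r ler_pdivrMr//; have : 1 = (t - s) * (t + s) by rewrite -subr_sqr e1; ring.
move=> E; rewrite [leLHS]E -mulrA mulrCA ler_wpM2l ?subr_ge0//; lra.
Qed.

Lemma slow_sum B x N : 0 <= B -> slow B x ->
  \sum_(k < N.+1) `|x (N - k)%N - x N| <= 3 * B * sq N.+1.
Proof.
move=> B0 xB; have s0 : 0 < sq N.+1 by exact: sq_gt0.
apply: (@le_trans _ _ (\sum_(k < N.+1) (`|x (N - k)%N| + `|x N|))).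
  by apply: ler_sum => k _; exact: ler_normB.
rewrite big_split/= sumr_const card_ord.
have -> : \sum_(k < N.+1) `|x (N - k)%N| = \sum_(l < N.+1) `|x l|.
  rewrite (reindex_inj rev_ord_inj)/=; apply: eq_bigr => i _.
  by rewrite subSS subKn// -ltnS.
have h1 : \sum_(l < N.+1) `|x l| <= B * (2 * sq N.+1).
  apply: le_trans (ler_wpM2l B0 (sum_inv_sqrt N.+1)).
  by rewrite mulr_sumr; apply: ler_sum => l _; have [] := xB l.
have h2 : `|x N| *+ N.+1 <= B * sq N.+1.
  rewrite -[leLHS]mulr_natr -[X in _ * X <= _](@sq_sqr R N.+1); have [+ _] := xB N; rewrite ler_pdivlMr//.
  by rewrite expr2 mulrA => h; rewrite ler_wpM2r// ltW.
by move: h1 h2; lra.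
Qed.

Lemma small_sum B x : 0 <= B -> slow B x -> tends (fun l => sq l.+1 * x l) 0 ->
  forall e, 0 < e -> exists N0, forall N, (N0 <= N)%N ->
  \sum_(k < N.+1) `|x (N - k)%N - x N| <= e * sq N.+1.
Proof.
move=> B0 xB x0 e e0; have e4 : 0 < e / 4 by rewrite divr_gt0.
have [L0 HL] := x0 _ e4.
have [N1 N10 H1] := @sq_large R (L0%:R * B / (e / 4)).
exists (maxn L0 N1) => N; rewrite geq_max => /andP[NL NN].
have s0 : 0 < sq N.+1 by exact: sq_gt0.
apply: (@le_trans _ _ (\sum_(k < N.+1) (`|x (N - k)%N| + `|x N|))).
  by apply: ler_sum => k _; exact: ler_normB.
rewrite big_split/= sumr_const card_ord.
have -> : \sum_(k < N.+1) `|x (N - k)%N| = \sum_(l < N.+1) `|x l|.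
  rewrite (reindex_inj rev_ord_inj)/=; apply: eq_bigr => i _.
  by rewrite subSS subKn// -ltnS.
have small l : (L0 <= l)%N -> `|x l| <= e / 4 / sq l.+1.
  move=> Ll; have sl : 0 < sq l.+1 by exact: sq_gt0.
  by have := HL l Ll; rewrite subr0 normrM (gtr0_norm sl) (ler_pdivlMr _ _ sl) [_ * `|x l|]mulrC.
have h0 l : `|x l| <= (if (l < L0)%N then B else 0) + e / 4 / sq l.+1.
  have sl : 1 <= sq l.+1 by rewrite -[leLHS]sqrtr1 ler_sqrt// ler1n.
  case: ltnP => [lL|]; last by rewrite add0r; exact: small.
  have [+ _] := xB l; move=> /le_trans; apply; rewrite ler_wpDr ?divr_ge0 ?(ltW e0) ?(ltW e4)//.
  by rewrite ler_pdivrMr ?(lt_le_trans ltr01)// ler_peMr.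
have h1 : \sum_(l < N.+1) `|x l| <= L0%:R * B + e / 4 * (2 * sq N.+1).
  apply: (@le_trans _ _ (\sum_(l < N.+1) ((if (l < L0)%N then B else 0) + e / 4 / sq l.+1))).
    by apply: ler_sum => l _; exact: h0.
  rewrite big_split/=; apply: lerD.
    rewrite -big_mkcond/= (big_ord_narrow (leqW NL))/= sumr_const card_ord.
    by rewrite mulr_natl.
  by rewrite -mulr_sumr ler_wpM2l ?(ltW e4)// sum_inv_sqrt.
have h2 : `|x N| *+ N.+1 <= e / 4 * sq N.+1.
  rewrite -[leLHS]mulr_natr -[X in _ * X <= _](@sq_sqr R N.+1); have := small N NL; rewrite (ler_pdivlMr _ _ s0).
  by rewrite expr2 mulrA => h; rewrite ler_wpM2r// ltW.
have h3 : L0%:R * B <= e / 4 * sq N.+1.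
  by rewrite [e / 4 * _]mulrC -ler_pdivrMr// H1// ltnW.
by move: h1 h2 h3; lra.
Qed.

(** Compare with the telescoping sum of [k^d - (k-1)^d]. *)
Lemma sum_powR_le d J : 0 < d -> d <= 1 ->
  \sum_(k < J) (k.+1)%:R `^ (d - 1) <= 2 / d * J%:R `^ d.
Proof.
move=> d0 d1; elim: J => [|J IH]; first by rewrite big_ord0 mulr_ge0 ?powR_ge0// divr_ge0// ltW.
rewrite big_ord_recr/=; apply: le_trans (lerD IH (lexx _)) _.
have y0 : 0 < J.+1%:R :> R by rewrite ltr0n.
rewrite powRB1// -lerBrDl -mulrBr mulrAC ler_pdivlMr// mulrAC ler_pdivrMr//.
have -> : J%:R = J.+1%:R - 1 :> R by rewrite -natr1 addrK.
have : (1 : R) <= J.+1%:R by rewrite ler1n.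
move: (J.+1%:R : R) y0 => y y0 y1.
suff H : (y - 1) `^ d <= y `^ d * (1 - d / (2 * y)).
  have : 2 * (y `^ d - (y - 1) `^ d) * y >= 2 * (y `^ d - y `^ d * (1 - d / (2 * y))) * y.
    by rewrite ler_wpM2r ?(ltW y0)// ler_wpM2l// lerB.
  apply: le_trans; rewrite le_eqVlt; apply/orP; left; apply/eqP.
  by field; rewrite gt_eqF.
have dy : d / y <= 1 by rewrite ler_pdivrMr// mul1r (le_trans d1).
have dy0 : 0 < d / y by rewrite divr_gt0.
have [y2|y2] := eqVneq y 1.
  by rewrite y2 subrr powR0 ?gt_eqF// powR1 mul1r; lra.
have y3 : 0 < y - 1 by rewrite subr_gt0 lt_neqAle eq_sym y2.
have yy : y - 1 = y * (1 - y^-1) by field; rewrite gt_eqF.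
have q0 : 0 < 1 - y^-1 by rewrite -(pmulr_rgt0 _ y0) -yy.
rewrite yy powRM ?(ltW y0) ?(ltW q0)// ler_wpM2l ?powR_ge0//.
rewrite /powR (gt_eqF q0).
apply: (@le_trans _ _ (expR (- (d / y)))).
  rewrite ler_expR -mulrN ler_wpM2l ?(ltW d0)// -[X in ln X]/(1 + - y^-1).
  by apply: le_ln1Dx; rewrite ltrN2 invf_lt1// -subr_gt0.
have : expR (- (d / y)) * (1 + d / y) <= 1.
  have := expR_ge1Dx (d / y) => h; rewrite -[leRHS](@expR0 R) -(addNr (d / y)) expRD.
  by rewrite ler_wpM2l ?expR_ge0.
have -> : d / (2 * y) = d / y / 2 by field; rewrite gt_eqF.
move: (d / y) (expR (- (d / y))) dy dy0 => s E s1 s0 HE.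
have : E <= (1 + s)^-1 by rewrite -div1r ler_pdivlMr// ltr_wpDl.
move=> /le_trans; apply; rewrite -div1r ler_pdivrMr ?ltr_wpDl//.
have : s * s <= s * 1 by rewrite ler_wpM2l// ltW.
lra.
Qed.

End Slow.

Section Convolution.
Context {R : realType} (xi : probability nat R) (sigma : R).
Hypothesis crit : critical xi sigma.
Local Notation p := (offspring_prob xi).
Variable h : nat.
Hypothesis h0 : (0 < h)%N.
Hypothesis h_span : forall k, 0 < p k -> (h %| k)%N.
Hypothesis h_spanned : spanned xi h.
Local Notation sq n := (Num.sqrt (n%:R : R)).
Local Notation V := (step_var sigma h).
Local Notation Re := complex.Re.
Local Notation lat := (lattice_point h).
Local Notation hit := (hit_prob xi h).
Local Notation ret := (return_prob xi h).
Local Notation kV := (kap (step_var sigma h)).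
Local Notation u := (size_term xi h).
Local Notation v := (model_term sigma h).
Local Notation b_ a := (a - one_half).
Let hR : 0 < h%:R :> R. Proof. by rewrite ltr0n. Qed.
Let V0 : 0 < V := step_var_gt0 crit h0.
Let kV0 : 0 < kV := kap_gt0 V0.
Let latR k : 0 < (lat k)%:R :> R. Proof. by rewrite ltr0n. Qed.
Let lat1 k : 1 <= (lat k)%:R :> R. Proof. by rewrite ler1n. Qed.

Lemma lat_le_mul N : (lat N <= h.+1 * N.+1)%N.
Proof. by rewrite /lattice_point mulSn mulnS addSn ltnS; lia. Qed.

Lemma exists_inv_powR (d e : R) : 0 < d -> 0 < e -> exists2 m : nat, (2 <= m)%N & (m%:R^-1 : R) `^ d <= e.
Proof.
move=> d0 e0; pose y := e `^ d^-1; have y0 : 0 < y by exact: powR_gt0.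
exists (Num.truncn y^-1).+2 => //; set m := _.+2.
have m0 : 0 < m%:R :> R by rewrite ltr0n.
have my : m%:R^-1 <= y.
  rewrite -[leRHS]invrK lef_pV2 ?posrE ?invr_gt0//; apply/ltW/(lt_trans (truncnS_gt _)).
  by rewrite ltr_nat.
have -> : e = y `^ d by rewrite /y -powRrM mulVf ?gt_eqF// powRr1// ltW.
by apply: ge0_ler_powR; rewrite ?nnegrE ?invr_ge0 ?(ltW d0) ?(ltW y0).
Qed.

(** On the right the power of [k] does not depend on [r], so that its sums are bounded
   uniformly. *)
Lemma near_weight (d r : R) (N k : nat) : d <= 1 -> - 1 + d <= r -> (0 < k)%N -> (k <= N)%N ->
  (lat k)%:R `^ (r - 1) * k%:R <= (lat N)%:R `^ (r + 1 - d) * k%:R `^ (d - 1).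
Proof.
move=> d1 r1 k0 kN; have kR : 0 < k%:R :> R by rewrite ltr0n.
have kl : k%:R <= (lat k)%:R :> R by rewrite ler_nat ltnW// le_lat.
apply: (@le_trans _ _ ((lat k)%:R `^ r)).
  by rewrite powRB1// mulrAC ler_pdivrMr// ler_wpM2l ?powR_ge0.
have -> : r = (r + 1 - d) + (d - 1) by ring.
rewrite powRD; last by rewrite (gt_eqF (latR k)) implybT.
have -> : r + 1 - d + (d - 1) + 1 - d = r + 1 - d by ring.
apply: ler_pM; rewrite ?powR_ge0//.
  apply: ge0_ler_powR; rewrite ?nnegrE//; first by lra.
  by rewrite ler_nat ltnS leq_mul2l kN orbT.
by apply: powR_anti => //; lra.
Qed.

Lemma near_scale N : (lat N)%:R / sq N.+1 ^+ 3 <= (h.+1)%:R ^+ 3 / sq (lat N).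
Proof.
have s0 : 0 < sq N.+1 by exact: sq_gt0.
have t0 : 0 < sq (lat N) by exact: sq_gt0.
have hh : (1 : R) <= h.+1%:R by rewrite ler1n.
have H : sq (lat N) <= h.+1%:R * sq N.+1.
  rewrite -(ler_pXn2r (_ : 0 < 2)%N) ?nnegrE ?mulr_ge0 ?sqrtr_ge0// exprMn !sq_sqr.
  apply: (@le_trans _ _ (h.+1%:R * N.+1%:R)).
    by rewrite -natrM ler_nat lat_le_mul.
  by rewrite ler_wpM2r// expr2 ler_peMr.
rewrite -[X in X / _](@sq_sqr R (lat N)); move: (sq N.+1) (sq (lat N)) (h.+1%:R : R) s0 t0 hh H => s t c s0 t0 c1 H.
rewrite ler_pdivlMr// mulrAC ler_pdivrMr ?exprn_gt0// -exprSr -exprMn.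
by rewrite lerXn2r ?nnegrE ?(ltW t0)// (le_trans (ltW t0)).
Qed.

(** Terms with [k <= N/m] use that [x] varies slowly near [N], the others that the weights
   are of the size of the last one. With [m] large the first part is small; the second one
   is controlled by the product of [E1] and [E2], one of which will be small. *)
Lemma conv_bound (d C B : R) : 0 < d -> d <= 1 -> 0 < C -> 0 < B -> forall e, 0 < e ->
  exists2 m : nat, (2 <= m)%N &
  forall N (x : nat -> R) (r : R) (g : nat -> R[i]) (E1 E2 : R),
  - 1 + d <= r -> r <= 0 -> 0 <= E1 -> slow B x ->
  (forall k, cabs (g k) <= C * (lat k)%:R `^ (r - 1)) ->
  (forall k, (N < m * k)%N -> cabs (g k) <= E1 * (lat k)%:R `^ (r - 1)) ->
  \sum_(k < N.+1) `|x (N - k)%N - x N| <= E2 * sq N.+1 ->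
  cabs (\sum_(k < N.+1) g k * (x (N - k)%N - x N)%:C) <=
    (e + m%:R ^+ 3 * E1 * E2) * ((lat N)%:R `^ r / sq (lat N)).
Proof.
move=> d0 d1 C0 B0 e e0.
pose Q := C * (4 * B) * (2 / d) * (h.+1)%:R ^+ 3.
have Q0 : 0 < Q by rewrite !mulr_gt0 ?invr_gt0 ?exprn_gt0.
(* The near part is at most Q m^(-d), whatever N. *)
have [m m2 Hm] := exists_inv_powR d0 (divr_gt0 e0 Q0).
have m0 : (0 < m)%N by apply: leq_trans m2.
have mR : 0 < m%:R :> R by rewrite ltr0n.
exists m => // N x r g E1 E2 r1 r2 E10 xB gC gE xE.
have s0 : 0 < sq N.+1 by exact: sq_gt0.
have t0 : 0 < sq (lat N) by exact: sq_gt0.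
pose J := (N %/ m)%N.
pose c := C * (4 * B) / sq N.+1 ^+ 3 * (lat N)%:R `^ (r + 1 - d).
have c0 : 0 <= c.
  by rewrite mulr_ge0 ?powR_ge0// divr_ge0 ?exprn_ge0 ?sqrtr_ge0// !mulr_ge0 ?ltW.
pose nr k := if (0 < k)%N && (k <= J)%N then c * k%:R `^ (d - 1) else 0.
pose fr k := E1 * (m%:R ^+ 3 * (lat N)%:R `^ (r - 1)) * `|x (N - k)%N - x N|.
have fr0 k : 0 <= fr k by rewrite !mulr_ge0 ?exprn_ge0 ?powR_ge0.
have nr0 k : 0 <= nr k by rewrite /nr; case: ifP => // _; rewrite mulr_ge0 ?powR_ge0.
have term k : (k < N.+1)%N -> cabs (g k * (x (N - k)%N - x N)%:C) <= nr k + fr k.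
  rewrite ltnS => kN; rewrite cabsM cabs_real.
  have [->|k0] := posnP k.
    by rewrite subn0 subrr normr0 mulr0 addr_ge0.
  have [kJ|Jk] := leqP k J.
    have mk : (m * k <= N)%N by rewrite mulnC -leq_divRL.
    rewrite ler_wpDr// /nr k0 kJ/=.
    apply: (@le_trans _ _ (C * (lat k)%:R `^ (r - 1) * (4 * B * k%:R / sq N.+1 ^+ 3))).
      apply: ler_pM; rewrite ?cabs_ge0 ?normr_ge0//; apply: (slow_shift (ltW B0) xB).
      by apply: leq_trans mk; rewrite leq_mul2r m2 orbT.
    have W0 : 0 <= C * (4 * B) / sq N.+1 ^+ 3.
      by rewrite divr_ge0 ?exprn_ge0 ?sqrtr_ge0// !mulr_ge0 ?ltW.
    have := ler_wpM2l W0 (near_weight d1 r1 k0 kN); rewrite /c -[X in _ -> _ <= X]mulrA.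
    by apply: le_trans; rewrite le_eqVlt; apply/orP; left; apply/eqP; ring.
  have mk : (N < m * k)%N by rewrite mulnC -ltn_divLR.
  rewrite ler_wpDl// /fr ler_wpM2r//.
  apply: (le_trans (gE k mk)); rewrite ler_wpM2l//.
  apply: powR_scale => //; [by rewrite ler1n|  |by lra|by lra].
  rewrite -natrM ler_nat /lattice_point mulnS -addn1 addnC; apply: leq_add => //.
  by rewrite mulnCA leq_mul2l (ltnW mk) orbT.
apply: le_trans (ler_cabs_sum _ _ _) _.
apply: (@le_trans _ _ (\sum_(k < N.+1) (nr k + fr k))).
  by apply: ler_sum => k _; exact: term.
rewrite big_split/= [leRHS]mulrDl; apply: lerD; last first.
  rewrite -mulr_sumr powRB1//.
  have tt : sq N.+1 <= sq (lat N) by apply: le_sq; exact: le_lat.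
  have E20 : 0 <= E2.
    by rewrite -(pmulr_lge0 _ s0); apply: le_trans xE; exact: sumr_ge0.
  have xE' := le_trans xE (ler_wpM2l E20 tt).
  have D0 : 0 <= E1 * (m%:R ^+ 3 * ((lat N)%:R `^ r / (lat N)%:R)).
    by rewrite !mulr_ge0 ?exprn_ge0 ?powR_ge0 ?invr_ge0.
  apply: le_trans (ler_wpM2l D0 xE') _; rewrite le_eqVlt; apply/orP; left; apply/eqP.
  move: (@sq_sqr R (lat N)); move: (sq (lat N)) t0 ((lat N)%:R `^ r) => t t0 q <-.
  by field; rewrite gt_eqF.
have JN : (J <= N)%N by exact: leq_div.
rewrite big_ord_recl/= {1}/nr ltnn/= add0r.
have -> : \sum_(k < N) nr (bump 0 k) = \sum_(k < J) c * (k.+1)%:R `^ (d - 1).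
  transitivity (\sum_(k < N | (k < J)%N) c * (k.+1)%:R `^ (d - 1)).
    by rewrite [RHS]big_mkcond; apply: eq_bigr.
  by rewrite (big_ord_narrow JN).
rewrite -mulr_sumr; apply: le_trans (ler_wpM2l c0 (sum_powR_le J d0 d1)) _.
have Jd : J%:R `^ d <= (lat N)%:R `^ d * (m%:R^-1) `^ d.
  rewrite -powRM ?invr_ge0//; apply: ge0_ler_powR; rewrite ?nnegrE ?(ltW d0) ?divr_ge0//.
  rewrite ler_pdivlMr// -natrM ler_nat; apply: (leq_trans (leq_divM _ _)).
  by rewrite ltnW// le_lat.
have d2 : 0 <= 2 / d by rewrite divr_ge0// ltW.
apply: le_trans (ler_wpM2l c0 (ler_wpM2l d2 Jd)) _.
have pw : (lat N)%:R `^ (r + 1 - d) * (lat N)%:R `^ d = (lat N)%:R `^ r * (lat N)%:R.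
  rewrite -powRD; last by rewrite (gt_eqF (latR N)) implybT.
  by rewrite subrK powRD ?powRr1// (gt_eqF (latR N)) implybT.
have -> : c * (2 / d * ((lat N)%:R `^ d * m%:R^-1 `^ d)) =
  C * (4 * B) * (2 / d) * m%:R^-1 `^ d * (lat N)%:R `^ r * ((lat N)%:R / sq N.+1 ^+ 3).
  have -> : c * (2 / d * ((lat N)%:R `^ d * m%:R^-1 `^ d)) = C * (4 * B) / sq N.+1 ^+ 3 *
     (2 / d) * m%:R^-1 `^ d * ((lat N)%:R `^ (r + 1 - d) * (lat N)%:R `^ d) by rewrite /c; ring.
  by rewrite pw; ring.
have Z0 : 0 <= C * (4 * B) * (2 / d) * m%:R^-1 `^ d * (lat N)%:R `^ r.
  by rewrite !mulr_ge0 ?powR_ge0 ?invr_ge0 ?(ltW d0) ?(ltW C0) ?(ltW B0).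
apply: le_trans (ler_wpM2l Z0 (near_scale N)) _.
have -> : C * (4 * B) * (2 / d) * m%:R^-1 `^ d * (lat N)%:R `^ r * (h.+1%:R ^+ 3 / sq (lat N)) =
  Q * m%:R^-1 `^ d * ((lat N)%:R `^ r / sq (lat N)) by rewrite /Q; ring.
rewrite ler_wpM2r ?divr_ge0 ?powR_ge0 ?sqrtr_ge0//.
by rewrite mulrC -ler_pdivlMr.
Qed.

(** The factor that makes the multiples of [cb] asymptotic to the return probabilities. *)
Definition return_scale : R := kV / (kap 2^-1 * sq h).
Local Notation amp := return_scale.
(** The convolution of the model terms with the multiples of [cb]. *)
Definition main_term (a : R[i]) (N : nat) : R[i] :=
  (kV * amp)%:C * npow h (b_ a - 1) * (rising N a / rGamma (b_ a)).
Local Notation main := main_term.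

Lemma sum_v_cb a N : \sum_(k < N.+1) v a k * (amp * cb (N - k))%:C = main a N.
Proof.
have := vandermonde N (b_ a) one_half; rewrite subrK /main_term => <-; rewrite mulr_suml mulr_sumr; apply: eq_bigr => k _.
rewrite -cb_rising /model_term !rmorphM /=; ring.
Qed.

Lemma tends_add (x y : nat -> R) (c c' : R) : tends x c -> tends y c' -> tends (fun n => x n + y n) (c + c').
Proof.
move=> xc yc e e0; have e2 : 0 < e / 2 by rewrite divr_gt0.
have [N1 H1] := xc _ e2; have [N2 H2] := yc _ e2; exists (maxn N1 N2) => n.
rewrite geq_max => /andP[/H1 n1 /H2 n2]; rewrite opprD addrACA.
by have := ler_normD (x n - c) (y n - c'); lra.
Qed.

(** Write [ret = w + delta] with [w] a multiple of [cb] and [delta l = o(l^(-1/2))]. Two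
   applications of [conv_bound] treat the convolutions of [u - v] with [ret], where the
   weights are small, and of [v] with [delta], where the sequence is small. *)
Lemma convolution_expansion (d M : R) : 0 < d -> d <= 1 -> 1 <= M -> forall e, 0 < e ->
  exists N0, forall N, (N0 <= N)%N -> forall a, region d M a ->
  cabs (\sum_(k < N.+1) u a k * (ret (N - k))%:C - main a N
        - (ret N)%:C * \sum_(k < N.+1) (u a k - v a k))
    <= e * (lat N)%:R `^ Re (b_ a) / sq (lat N).
Proof.
move=> d0 d1 M1 e e0.
have [Cv Cv0 Hv] := v_bound crit h0 d0 M1.
have [Cu Cu0 Hu] := u_bound crit h0 h_span h_spanned.
have [ee ee0 [eep He]] := u_sub_v crit h0 h_span h_spanned d0 M1.
have [Br Br0 Hr] := ret_bound crit h0 h_span h_spanned.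
have [Bc Bc0 Hc] := @cb_bound R.
have k2 : 0 < kap (2^-1 : R) by rewrite kap_gt0// invr_gt0.
have sh : 0 < sq h by exact: sq_gt0.
have amp0 : 0 < amp by apply: divr_gt0 kV0 _; exact: mulr_gt0.
pose delta l := ret l - amp * cb l.
have slow_ret : slow Br ret by exact: Hr.
pose B := Br + amp * Bc; have B0 : 0 < B by rewrite addr_gt0// mulr_gt0.
have slow_delta : slow B delta.
  move=> l; have [h1 h2] := Hr l; have [h3 h4] := Hc l.
  have := ler_wpM2l (ltW amp0) h3; have := ler_wpM2l (ltW amp0) h4.
  rewrite -[X in X * `|_|](gtr0_norm amp0) -normrM -[X in X * `|_|](gtr0_norm amp0) -normrM => h5 h6; split.
    by apply: le_trans (ler_normB _ _) _; rewrite /B mulrDl -[amp * Bc / _]mulrA lerD.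
  have -> : delta l - delta l.+1 = (ret l - ret l.+1) - amp * (cb l - cb l.+1) by rewrite /delta; ring.
  by apply: le_trans (ler_normB _ _) _; rewrite /B mulrDl -[amp * Bc / _]mulrA lerD.
have delta0 : tends (fun l => sq l.+1 * delta l) 0.
  have t1 := tends_ret crit h0 h_span h_spanned.
  have t2 := tendsZ (- amp) (tends_sq_shift (@cb_llt R)).
  have := tends_add t1 t2.
  have -> : kV / sq h + - amp * kap 2^-1 = 0.
    by rewrite /return_scale; field; rewrite !gt_eqF.
  by move=> t3; apply: (tends_eq_near (N0 := 0) t3) => n _; rewrite /delta; ring.
have e3 : 0 < e / 5 by rewrite divr_gt0.
have Cuv : 0 < Cu + Cv by exact: addr_gt0.
have [m1 m12 H1] := conv_bound d0 d1 Cuv Br0 e3.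
have [m2 m22 H2] := conv_bound d0 d1 Cv0 B0 e3.
have m1R : 0 < m1%:R :> R by rewrite ltr0n (leq_trans _ m12).
have m2R : 0 < m2%:R :> R by rewrite ltr0n (leq_trans _ m22).
pose E1 := e / 5 / (m1%:R ^+ 3 * (3 * Br)).
have E10 : 0 < E1 by rewrite !divr_gt0// !mulr_gt0// exprn_gt0.
(* The far part involves only k > N / m1, hence k >= K1 once N >= m1 * K1. *)
have [K1 HK1] := ee0 _ E10.
pose E2 := e / 5 / (m2%:R ^+ 3 * Cv).
have E20 : 0 < E2 by rewrite !divr_gt0// !mulr_gt0// exprn_gt0.
have [K2 HK2] := small_sum (ltW B0) slow_delta delta0 E20.
have [C3 C30 [K3 HK3]] := sum_v_bound crit h0 d0 M1.
have hh : 0 < sq h.+1 by exact: sq_gt0.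
have e4 : 0 < e / 5 / C3 / sq h.+1 by rewrite !divr_gt0.
have [K4 HK4] := delta0 _ e4.
exists (maxn (maxn (m1 * K1) K2) (maxn K3 K4)) => N.
rewrite !geq_max => /andP[/andP[N1 N2] /andP[N3 N4]] a ra.
have [r1 r2 r3 r4] := region_facts d0 ra.
have t0 : 0 < sq (lat N) by exact: sq_gt0.
have s0 : 0 < sq N.+1 by exact: sq_gt0.
pose P := (lat N)%:R `^ Re (b_ a) / sq (lat N).
have P0 : 0 <= P by rewrite divr_ge0 ?powR_ge0 ?sqrtr_ge0.
have dec : \sum_(k < N.+1) u a k * (ret (N - k))%:C - main a N
        - (ret N)%:C * \sum_(k < N.+1) (u a k - v a k) =
   \sum_(k < N.+1) (u a k - v a k) * (ret (N - k) - ret N)%:C +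
   \sum_(k < N.+1) v a k * (delta (N - k)%N - delta N)%:C + (delta N)%:C * \sum_(k < N.+1) v a k.
  rewrite -sum_v_cb !mulr_sumr -!sumrB -!big_split/=; apply: eq_bigr => k _.
  by rewrite /delta !rmorphB !rmorphM; ring.
have T1 : cabs (\sum_(k < N.+1) (u a k - v a k) * (ret (N - k) - ret N)%:C) <= (e / 5 + e / 5) * P.
  have := H1 N ret (Re (b_ a)) (fun k => u a k - v a k) E1 (3 * Br) r1 r2 (ltW E10) slow_ret.
  rewrite -/P => T; apply: (le_trans (T _ _ (slow_sum N (ltW Br0) slow_ret))).
  - move=> k; apply: le_trans (ler_cabsB _ _) _; rewrite mulrDl lerD//.
    exact: Hv.
  - move=> k mk; apply: (le_trans (He k a ra)); rewrite ler_wpM2r ?powR_ge0//.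
    have Kk : (K1 <= k)%N.
      by rewrite -(@leq_pmul2l m1) ?(leq_trans _ m12)// (leq_trans N1)// ltnW.
    by have := HK1 k Kk; rewrite subr0 ger0_norm.
  rewrite ler_wpM2r// lerD2l le_eqVlt; apply/orP; left; apply/eqP.
  by rewrite /E1; field; rewrite !gt_eqF.
have T2 : cabs (\sum_(k < N.+1) v a k * (delta (N - k)%N - delta N)%:C) <= (e / 5 + e / 5) * P.
  have := H2 N delta (Re (b_ a)) (v a) Cv E2 r1 r2 (ltW Cv0) slow_delta.
  rewrite -/P => T; apply: (le_trans (T _ _ (HK2 N N2))).
  - by move=> k; exact: Hv.
  - by move=> k _; exact: Hv.
  rewrite ler_wpM2r// lerD2l le_eqVlt; apply/orP; left; apply/eqP.
  by rewrite /E2; field; rewrite !gt_eqF.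
have T3 : cabs ((delta N)%:C * \sum_(k < N.+1) v a k) <= e / 5 * P.
  rewrite cabsM cabs_real.
  have D : `|delta N| <= e / 5 / C3 / sq (lat N).
    have := HK4 N N4; rewrite subr0 normrM (gtr0_norm s0) => D.
    rewrite ler_pdivlMr//.
    have tl : sq (lat N) <= sq h.+1 * sq N.+1.
      by rewrite -sqrtrM// ler_sqrt ?mulr_ge0// -natrM ler_nat lat_le_mul.
    apply: le_trans (ler_wpM2l (normr_ge0 (delta N)) tl) _.
    by move: D; rewrite (ler_pdivlMr _ _ hh); congr (_ <= _); ring.
  have S : cabs (\sum_(k < N.+1) v a k) <= C3 * (lat N)%:R `^ Re (b_ a).
    apply: le_trans (HK3 N.+1 (leqW N3) a ra) _; rewrite ler_wpM2l ?(ltW C30)//.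
    by apply: powR_anti => //; rewrite ler_nat latS leq_addr.
  apply: le_trans (ler_pM (normr_ge0 _) (cabs_ge0 _) D S) _.
  rewrite le_eqVlt; apply/orP; left; apply/eqP.
  by rewrite /P; field; rewrite !gt_eqF.
rewrite dec -[leRHS]mulrA -/P; apply: le_trans (ler_cabsD _ _) _.
by have := ler_cabsD (\sum_(k < N.+1) (u a k - v a k) * (ret (N - k) - ret N)%:C)
  (\sum_(k < N.+1) v a k * (delta (N - k)%N - delta N)%:C); lra.
Qed.

End Convolution.

(** * The extension of the moment function *)

Section RegionTopology.
Context {R : realType}.
Local Notation Re := complex.Re.

Lemma strip_neq (a : R[i]) : strip a -> a - one_half != 0.
Proof. by move=> -[_ /eqP]; rewrite subr_eq0. Qed.

Lemma region_strip (d M : R) a : 0 < d -> region d M a -> strip a.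
Proof.
move=> d0 [h1 h2 h3 _]; split; first by rewrite /= h2 andbT; lra.
by move=> /= E; move: h3; rewrite E subrr cabs0; lra.
Qed.

Lemma region_weaken (d d' M M' : R) a : d' <= d -> M <= M' -> region d M a -> region d' M' a.
Proof. by move=> dd MM [h1 h2 h3 h4]; split; lra. Qed.

Lemma near_region (a : R[i]) : strip a -> exists d M : R,
  [/\ 0 < d, d <= 1, 1 <= M, region d M a & \forall b \near a, Re b <= 2^-1 -> region d M b].
Proof.
move=> sa; have := strip_neq sa; rewrite -cabs_gt0 => c0; case: sa => /andP[r1 r2] _.
pose c := cabs (a - one_half); pose d := Num.min ((Re a + 2^-1) / 2) (Num.min (c / 2) 1).
have d0 : 0 < d by rewrite !lt_min !divr_gt0 ?ltr01 //; lra.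
have d1 : d <= (Re a + 2^-1) / 2 by rewrite ge_min lexx.
have d2 : d <= c / 2 by rewrite !ge_min lexx orbT.
have d3 : d <= 1 by rewrite !ge_min lexx !orbT.
exists d, (cabs a + 1); have ca := cabs_ge0 a; split => //; first by lra.
  by split; rewrite -?/c; lra.
apply/nbhscP; exists d => // b bd br; split=> //.
- have := abs_Re_le (b - a); have -> : Re (b - a) = Re b - Re a by case: (b); case: (a).
  by rewrite ler_norml => /andP[h _]; lra.
- have := ler_cabsD (b - one_half) (a - b); have -> : b - one_half + (a - b) = a - one_half by ring.
  by rewrite (cabs_distC a b) -/c; lra.
- by have := ler_cabsD a (b - a); rewrite addrC subrK; lra.
Qed.

Lemma compact_region (K : set R[i]) : K `<=` strip -> compact K ->
  exists d M : R, [/\ 0 < d, d <= 1, 1 <= M & K `<=` region d M].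
Proof.
move=> Ks /compact_near_coveringP H.
have [|n _ Hn] := H nat \oo (fun n b => strip b -> region (n.+1%:R^-1) (n.+1%:R : R) b) _; last first.
  exists (n.+1%:R^-1), n.+1%:R; split; rewrite ?invr_gt0 ?ler1n// ?invf_le1 ?ler1n//.
  by move=> b Kb; apply: (Hn n (leqnn n) b Kb); exact: Ks.
move=> a /Ks sa; have [d [M [d0 d1 M1 _ near_a]]] := near_region sa.
exists ([set b | Re b <= 2^-1 -> region d M b],
  [set n | (maxn (Num.truncn d^-1) (Num.truncn M) <= n)%N]).
  by split=> //; exists (maxn (Num.truncn d^-1) (Num.truncn M)).
move=> [b n] /= [bM]; rewrite geq_max => /andP[n1 n2] sb.
have rb : region d M b by apply: bM; case: sb => /andP[].
apply: region_weaken rb.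
  rewrite -[leRHS]invrK lef_pV2 ?posrE ?invr_gt0//.
  by apply/ltW/(lt_le_trans (truncnS_gt _)); rewrite ler_nat ltnS.
by apply/ltW/(lt_le_trans (truncnS_gt _)); rewrite ler_nat ltnS.
Qed.

End RegionTopology.

Section Mu.
Context {R : realType} (xi : probability nat R) (sigma : R).
Hypothesis crit : critical xi sigma.
Local Notation p := (offspring_prob xi).
Variable h : nat.
Hypothesis h0 : (0 < h)%N.
Hypothesis h_span : forall k, 0 < p k -> (h %| k)%N.
Hypothesis h_spanned : spanned xi h.
Local Notation Re := complex.Re.
Local Notation lat := (lattice_point h).
Local Notation hit := (hit_prob xi h).
Local Notation kV := (kap (step_var sigma h)).
Local Notation u := (size_term xi h).
Local Notation v := (model_term sigma h).
Local Notation b_ a := (a - one_half).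
Let latR k : 0 < (lat k)%:R :> R. Proof. by rewrite ltr0n. Qed.
Let lat1 k : 1 <= (lat k)%:R :> R. Proof. by rewrite ler1n. Qed.

Definition excess (K : nat) (a : R[i]) : R[i] := \sum_(k < K) (u a k - v a k).
(** The continuous extension of the moment function, as a locally uniform limit. *)
Definition mu_limit (a : R[i]) : R[i] := limn (excess ^~ a).

Lemma excess_cauchy (d M : R) : 0 < d -> 1 <= M -> forall e, 0 < e -> exists N, forall K, (N <= K)%N ->
  forall L, (K <= L)%N -> forall a, region d M a ->
  cabs (excess L a - excess K a) <= e * (lat K)%:R `^ Re (b_ a).
Proof.
move=> d0 M1 e e0; have [N HN] := sum_u_sub_v crit h0 h_span h_spanned d0 M1 e0.
exists N => K NK L KL a ra; have := HN K NK L a ra.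
by rewrite (sum_big_nat_ord (fun k => u a k - v a k) KL).
Qed.

Lemma powR_lat_le1 (d M : R) a K : 0 < d -> region d M a -> (lat K)%:R `^ Re (b_ a) <= 1.
Proof. by move=> d0 /(region_facts d0)[_ hb _ _]; exact: powR_le1. Qed.

Lemma excess_cvg (d M : R) a : 0 < d -> 1 <= M -> region d M a -> excess ^~ a @ \oo --> mu_limit a.
Proof.
move=> d0 M1 ra; suff [l hl] : exists l : R[i], excess ^~ a @ \oo --> l.
  by rewrite /mu_limit (cvg_lim (@hausdorffc R) hl).
apply: complete_cabs => e e0; have e2 : 0 < e / 2 by rewrite divr_gt0.
have [N HN] := excess_cauchy d0 M1 e2; exists N => n Nn.
apply: le_lt_trans (HN N (leqnn _) n Nn a ra) _.
apply: (@le_lt_trans _ _ (e / 2)); last by lra.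
by rewrite ler_piMr ?(ltW e2)//; exact: powR_lat_le1 d0 ra.
Qed.

Lemma excess_unif (d M : R) : 0 < d -> 1 <= M -> forall e, 0 < e -> exists N, forall K, (N <= K)%N ->
  forall a, region d M a -> cabs (excess K a - mu_limit a) <= e * (lat K)%:R `^ Re (b_ a).
Proof.
move=> d0 M1 e e0; have [N HN] := excess_cauchy d0 M1 e0.
exists N => K NK a ra; rewrite cabs_distC.
apply: (@cvg_cabs_le _ nat \oo _ (excess ^~ a)) (excess_cvg d0 M1 ra) _.
by exists K => // L /= KL; exact: HN.
Qed.

Lemma mu_limit_bound (d M : R) : 0 < d -> 1 <= M -> exists2 B, 0 < B &
  (forall a, region d M a -> cabs (mu_limit a) <= B) /\
  exists N, forall K, (N <= K)%N -> forall a, region d M a -> cabs (excess K a) <= B.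
Proof.
move=> d0 M1; have [N HN] := excess_unif d0 M1 ltr01.
have [Cv Cv0 Hv] := v_bound crit h0 d0 M1.
have [Cu Cu0 Hu] := u_bound crit h0 h_span h_spanned.
pose B := (Cu + Cv) * N%:R + 2.
have L a : region d M a -> cabs (mu_limit a) <= B - 1.
  move=> ra; have := HN N (leqnn _) a ra; have := lerB_cabs (mu_limit a) (excess N a).
  rewrite cabs_distC mul1r; have := powR_lat_le1 N d0 ra.
  suff : cabs (excess N a) <= (Cu + Cv) * N%:R by rewrite /B; lra.
  apply: le_trans (ler_cabs_sum _ _ _) _.
  apply: (@le_trans _ _ (\sum_(k < N) (Cu + Cv))); last first.
    by rewrite sumr_const card_ord mulr_natr.
  apply: ler_sum => k _; apply: le_trans (ler_cabsB _ _) _.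
  have l1 : (lat k)%:R `^ (Re (b_ a) - 1) <= 1.
    by apply: powR_le1 => //; have [_ + _ _] := region_facts d0 ra; lra.
  apply: lerD; [apply: le_trans (Hu _ _) _|apply: le_trans (Hv _ _ ra) _];
    by rewrite ler_piMr// ltW.
exists B; first by rewrite /B ltr_wpDl// mulr_ge0// addr_ge0 ?ltW.
split=> [a /L|]; first by lra.
exists N => K NK a ra; have := HN K NK a ra; have := lerB_cabs (excess K a) (mu_limit a).
by have := L a ra; have := powR_lat_le1 K d0 ra; rewrite mul1r; lra.
Qed.

Lemma cvg_shiftB (a c : R[i]) : (fun b => b - c) b @[b --> a] --> a - c.
Proof.
apply: (@cvgB _ (R[i])^o _ (nbhs a) _ id (fun=> c)); [exact: cvg_id|exact: cvg_cst].
Qed.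

Lemma cvg_rGamma_shift (a : R[i]) : rGamma (b - one_half) @[b --> a] --> rGamma (a - one_half).
Proof.
apply: (@cvg_comp _ _ _ (fun b : R[i] => b - one_half) rGamma); last exact: continuous_rGamma.
exact: cvg_shiftB.
Qed.

Lemma rGamma_neq0 (a : R[i]) : strip a -> rGamma (a - one_half) != 0.
Proof.
move=> /near_region[d [M [d0 d1 M1 ra _]]]; have [r1 r2 r3 r4] := region_facts d0 ra.
have M11 : 1 <= M + 1 by lra.
have [c c0 Hc] := rGamma_bounds M11 d0.
by rewrite -cabs_gt0; apply: lt_le_trans (Hc _ r3 r4).
Qed.

Lemma cvg_rising k (a : R[i]) : rising k (b - one_half) @[b --> a] --> rising k (a - one_half).
Proof.
rewrite /rising; apply: (@cvgM R[i] _ (nbhs a) _ _ (fun=> _)); last exact: cvg_cst.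
elim: k => [|k IH].
  rewrite big_ord0; have -> : (fun b : R[i] => \prod_(i < 0) (b - one_half + i%:R)) = fun=> 1.
    by apply/funext => b; rewrite big_ord0.
  exact: cvg_cst.
rewrite big_ord_recr/=.
have -> : (fun b : R[i] => \prod_(i < k.+1) (b - one_half + i%:R)) =
   (fun b => \prod_(i < k) (b - one_half + i%:R)) \* (fun b => b - (one_half - k%:R)).
  by apply/funext => b; rewrite big_ord_recr/=; congr (_ * _); ring.
have E : a - one_half + k%:R = a - (one_half - k%:R) by ring.
rewrite E; apply: (@cvgM R[i] _ (nbhs a) _ (fun b : R[i] => \prod_(i < k) (b - one_half + i%:R))
  (fun b => b - (one_half - k%:R))); first exact: IH.
exact: cvg_shiftB.
Qed.

Lemma cvg_npow_shift n (c a : R[i]) : npow n (b - c) @[b --> a] --> npow n (a - c).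
Proof.
apply: (@cvg_comp _ _ _ (fun b : R[i] => b - c) (npow n)); last exact: continuous_npow.
exact: cvg_shiftB.
Qed.

Lemma excess_continuous K a : strip a -> excess K b @[b --> a] --> excess K a.
Proof.
move=> sa; elim: K => [|K IH].
  have -> : excess 0 = fun=> 0 by apply/funext => b; rewrite /excess big_ord0.
  by apply/(@cvgcP _ _ _ (nbhs_filter a)) => e e0; apply: filterE => b; rewrite subrr cabs0.
have E b : excess K.+1 b = excess K b + (u b K - v b K) by rewrite /excess big_ord_recr.
rewrite E (_ : excess K.+1 = fun b => excess K b + (u b K - v b K)); last exact/funext.
apply: (@cvgD _ (R[i])^o _ (nbhs a) _ (excess K) (fun b => u b K - v b K)); first exact: IH.
apply: (@cvgB _ (R[i])^o _ (nbhs a) _ (u ^~ K) (v ^~ K)).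
  apply: (@cvgM R[i] _ (nbhs a) _ (fun b => npow (lat K) (b - 1)) (fun=> (hit K)%:C));
    last exact: cvg_cst.
  exact: cvg_npow_shift.
have E2 b : b_ b - 1 = b - (one_half + 1) by rewrite opprD addrA.
apply: (@cvgM R[i] _ (nbhs a) _ (fun b => kV%:C * npow h (b_ b - 1))
  (fun b => rising K (b_ b) / rGamma (b_ b))).
  apply: (@cvgM R[i] _ (nbhs a) _ (fun=> kV%:C) (fun b => npow h (b_ b - 1))); first exact: cvg_cst.
  rewrite E2 (_ : (fun b : R[i] => npow h (b_ b - 1)) = (fun b => npow h (b - (one_half + 1)))).
    exact: cvg_npow_shift.
  by apply/funext => b; rewrite E2.
apply: (@cvgM R[i] _ (nbhs a) _ (fun b => rising K (b_ b)) (fun b => (rGamma (b_ b))^-1)).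
  exact: cvg_rising.
by apply: (@cvgV R[i] _ (nbhs a) _ (fun b => rGamma (b_ b)) _ (rGamma_neq0 sa)); exact: cvg_rGamma_shift.
Qed.

(** A locally uniform limit of continuous functions. *)
Lemma mu_limit_continuous a : strip a -> forall e, 0 < e ->
  \forall b \near a, Re b <= 2^-1 -> cabs (mu_limit b - mu_limit a) < e.
Proof.
move=> sa e e0; have [d [M [d0 d1 M1 ra near_a]]] := near_region sa.
have e4 : 0 < e / 4 by rewrite divr_gt0.
have [N HN] := excess_unif d0 M1 e4.
have near_e := proj1 (@cvgcP _ _ _ (nbhs_filter a) (excess N) (excess N a)) (@excess_continuous N a sa) _ e4.
have F b : region d M b -> cabs (excess N b - mu_limit b) <= e / 4.
  move=> rb; apply: le_trans (HN N (leqnn _) b rb) _.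
  by rewrite ler_piMr ?(ltW e4)//; exact: powR_lat_le1 d0 rb.
apply: filterS2 near_a near_e => b rb eb br.
have Fb := F _ (rb br); have Fa := F _ ra.
move: (excess N a) (excess N b) (mu_limit a) (mu_limit b) Fa Fb eb => xa xb la lb Fa Fb eb.
have -> : lb - la = (xa - la) - (xb - lb) + (xb - xa) by ring.
apply: le_lt_trans (ler_cabsD _ _) _; have D := ler_cabsB (xa - la) (xb - lb).
move: (cabs (xa - la)) (cabs (xb - lb)) (cabs (xb - xa)) (cabs (xa - la - (xb - lb))) Fa Fb eb D.
by move=> y1 y2 y3 y4; lra.
Qed.

Lemma gw_size_lat k : gw_size_prob xi (lat k) = hit k / (lat k)%:R.
Proof.
apply: (mulfI (lt0r_neq0 (latR k))); rewrite otter_dwass mulrCA divff ?lt0r_neq0// mulr1.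
by rewrite /walk_to /= subn1.
Qed.

Lemma gw_size_off n : (0 < n)%N -> (forall k, n != lat k) -> gw_size_prob xi n = 0.
Proof.
move=> n0 nl; have nR : (n%:R : R) != 0 by rewrite pnatr_eq0 -lt0n.
apply: (mulfI nR); rewrite otter_dwass mulr0 /walk_to n0.
apply: (@walk_span _ _ h h_span); apply/negP => /dvdnP[k E].
by move/eqP: (nl k); apply; rewrite /lattice_point mulnC -E subn1 prednK.
Qed.

Lemma sum_lattice (f : nat -> R[i]) N : (forall n, (0 < n)%N -> (forall k, n != lat k) -> f n = 0) ->
  (0 < N)%N -> exists K, [/\ (N <= lat K)%N, forall k, (k < K)%N -> (lat k < N)%N &
  \sum_(1 <= n < N) f n = \sum_(k < K) f (lat k)].
Proof.
move=> f0; elim: N => [//|[|N] IH] _.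
  by exists 0%N; split=> //; rewrite big_geq// big_ord0.
have [//|K [NK KN E]] := IH; move: NK; rewrite leq_eqVlt => /predU1P[NK|NK].
  exists K.+1; split.
  - by rewrite latS NK -addn1 leq_add2l.
  - by move=> k; rewrite ltnS leq_eqVlt => /predU1P[->|/KN/ltnW //]; rewrite -NK.
  by rewrite big_nat_recr//= E big_ord_recr/= NK.
exists K; split=> //; first by move=> k /KN/ltnW.
rewrite big_nat_recr//= E f0//; first by rewrite addr0.
move=> k; apply/eqP => kE; have [kK|Kk] := ltnP k K.
  by have := KN k kK; rewrite -kE ltnn.
have : (lat K <= lat k)%N by rewrite ltnS leq_mul2l Kk orbT.
by rewrite -kE leqNgt NK.
Qed.

Lemma npow_gw_size_lat a k : npow (lat k) a * (gw_size_prob xi (lat k))%:C = u a k.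
Proof.
rewrite gw_size_lat /size_term rmorphM fmorphV/= rmorph_nat npowD npowN npow_id//.
by rewrite mulrA mulrAC.
Qed.

Lemma mu_sum a N : (0 < N)%N -> exists2 K, (N <= lat K)%N &
  \sum_(1 <= n < N) npow n a * (gw_size_prob xi n)%:C = \sum_(k < K) u a k.
Proof.
move=> N0; have [|K [NK _ ->]] := @sum_lattice (fun n => npow n a * (gw_size_prob xi n)%:C) N _ N0.
  by move=> n n0 nl; rewrite gw_size_off// mulr0.
by exists K => //; apply: eq_bigr => k _; exact: npow_gw_size_lat.
Qed.

(** To the left of the line the partial sums of [v] tend to [0], so [u] and [u - v] have the
   same sum. *)
Lemma mu_seriesE a : strip a -> Re a < 2^-1 -> mu_series xi a = mu_limit a.
Proof.
move=> sa ra; have [d [M [d0 d1 M1 reg _]]] := near_region sa.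
apply: (cvg_lim (@hausdorffc R)); apply/cvgcP => e e0.
have e2 : 0 < e / 2 by rewrite divr_gt0.
have [N1 H1] := excess_unif d0 M1 e2.
have [C C0 [N2 H2]] := sum_v_bound crit h0 d0 M1.
have r0 : 0 < 2^-1 - Re a by rewrite subr_gt0.
have e4 : 0 < e / 4 / C by rewrite !divr_gt0.
have [m m2 Hm] := exists_inv_powR r0 e4.
exists (lat (maxn N1 (maxn N2 m))) => // N /= NN.
have N0 : (0 < N)%N by apply: leq_trans NN.
have [K NK ->] := mu_sum a N0.
have : (maxn N1 (maxn N2 m) <= K)%N.
  by have := leq_trans NN NK; rewrite ltnS leq_pmul2l.
rewrite !geq_max => /and3P[K1 K2 K3].
have -> : \sum_(k < K) u a k = excess K a + \sum_(k < K) v a k by rewrite /excess sumrB subrK.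
rewrite addrAC; apply: le_lt_trans (ler_cabsD _ _) _.
have h1 : cabs (excess K a - mu_limit a) <= e / 2.
  apply: le_trans (H1 K K1 a reg) _.
  by rewrite ler_piMr ?(ltW e2)//; exact: powR_lat_le1 d0 reg.
suff : cabs (\sum_(k < K) v a k) <= e / 4 by lra.
apply: le_trans (H2 K K2 a reg) _; rewrite mulrC -ler_pdivlMr//; apply: le_trans Hm.
have mR : 0 < m%:R :> R by rewrite ltr0n (leq_trans _ m2).
have -> : (m%:R^-1 : R) `^ (2^-1 - Re a) = m%:R `^ (Re a - 2^-1).
  by rewrite -(powR_inv1 (ltW mR)) -powRrM mulN1r opprB.
rewrite Re_sub_half; apply: powR_anti => //; last by rewrite subr_le0 ltW.
by rewrite ler_nat (leq_trans K3)// ltnW// le_lat.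
Qed.

Lemma within_left_proper (a : R[i]) : Re a = 2^-1 ->
  ProperFilter (within [set b : R[i] | Re b < 2^-1] (nbhs a)).
Proof.
move=> ra; split; last exact: within_filter.
rewrite /within /= => /nbhscP[e e0 He].
have e2 : 0 < e / 2 by rewrite divr_gt0.
apply: (He (a - (e / 2)%:C)).
  by rewrite addrAC subrr add0r cabsN cabs_real gtr0_norm//; lra.
by have -> : Re (a - (e / 2)%:C) = Re a - e / 2; [case: (a) | rewrite ra ltrBlDr ltrDl].
Qed.

Lemma muE a : strip a -> mu xi a = mu_limit a.
Proof.
move=> sa; rewrite /mu; case: ifP => [ra|/negbT]; first exact: mu_seriesE.
rewrite -leNgt => ra; have [/andP[r1 r2] _] := sa.
have E : Re a = 2^-1 by apply/le_anti; rewrite r2.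
have PF := within_left_proper E.
apply: (cvg_lim (@hausdorffc R)).
apply/(@cvgcP _ _ (within _ (nbhs a)) (@within_filter _ _ _ (nbhs_filter a))) => e e0.
have [d [M [d0 d1 M1 _ near_a]]] := near_region sa.
rewrite near_withinE; apply: filterS2 near_a (mu_limit_continuous sa e0) => b rb lb br.
have rgb := rb (ltW br).
by rewrite mu_seriesE//; [apply: lb; exact: ltW|exact: region_strip rgb].
Qed.

Lemma mu_continuous a : strip a -> forall e, 0 < e ->
  \forall b \near a, strip b -> cabs (mu xi b - mu xi a) < e.
Proof.
move=> sa e e0; apply: filterS (mu_limit_continuous sa e0) => b lb sb.
by rewrite !muE//; apply: lb; case: sb => /andP[].
Qed.

End Mu.

(** * The expectation *)

Section Expectation.
Context {R : realType} (xi : probability nat R) (sigma : R).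
Hypothesis crit : critical xi sigma.
Local Notation p := (offspring_prob xi).
Variable h : nat.
Hypothesis h0 : (0 < h)%N.
Hypothesis h_span : forall k, 0 < p k -> (h %| k)%N.
Hypothesis h_spanned : spanned xi h.
Local Notation sq n := (Num.sqrt (n%:R : R)).
Local Notation V := (step_var sigma h).
Local Notation Re := complex.Re.
Local Notation lat := (lattice_point h).
Local Notation hit := (hit_prob xi h).
Local Notation ret := (return_prob xi h).
Local Notation kV := (kap (step_var sigma h)).
Local Notation u := (size_term xi h).
Local Notation v := (model_term sigma h).
Local Notation excess := (excess xi sigma h).
Local Notation main := (main_term sigma h).
Local Notation amp := (return_scale sigma h).
Local Notation b_ a := (a - one_half).
Let hR : 0 < h%:R :> R. Proof. by rewrite ltr0n. Qed.
Let V0 : 0 < V := step_var_gt0 crit h0.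
Let kV0 : 0 < kV := kap_gt0 V0.
Let latR k : 0 < (lat k)%:R :> R. Proof. by rewrite ltr0n. Qed.
Let lat1 k : 1 <= (lat k)%:R :> R. Proof. by rewrite ler1n. Qed.
Let sl k : 0 < sq (lat k). Proof. exact: sq_gt0. Qed.

Lemma EX_lat a N : EX xi (lat N) a =
  ((lat N)%:R / hit N)%:C * \sum_(k < N.+1) u a k * (ret (N - k))%:C.
Proof.
rewrite EX_formula.
pose f m := npow m a * (gw_size_prob xi m * walk p (lat N - m) (lat N - m) / gw_size_prob xi (lat N))%:C.
have [|K [NK KN ->]] := @sum_lattice _ _ h0 f (lat N).+1 _ (ltn0Sn _).
  by move=> n n0 nl; rewrite /f (gw_size_off h_span n0 nl) !mul0r mulr0.
have KE : K = N.+1.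
  apply/eqP; rewrite eqn_leq; apply/andP; split.
    rewrite leqNgt; apply/negP => /KN; rewrite latS ltnS -[leqRHS]addn0 leq_add2l leqNgt.
    by rewrite h0.
  by rewrite ltnNge; apply/negP => KN'; move: NK; rewrite ltnNge ltnS leq_mul2l KN' orbT.
rewrite KE mulr_sumr; apply: eq_bigr => k _; rewrite /f.
rewrite -(npow_gw_size_lat xi h).
have -> : (lat N - lat k)%N = (h * (N - k))%N by rewrite subSS mulnBr.
rewrite (gw_size_lat xi h N) -/(return_prob xi h (N - k)) invfM invrK.
rewrite !rmorphM /=; ring.
Qed.

Lemma rGamma_upper (M : R) : 1 <= M -> exists2 G, 0 < G & forall z : R[i], cabs z <= M -> cabs (rGamma z) <= G.
Proof.
move=> M1; have [C C0 [N1 [N10 H1]]] := @gauss_limit R M M1.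
have [B B0 [N2 [N20 H2]]] := @gauss_prod_bound R M M1.
exists (B + B * C); first by rewrite addr_gt0// mulr_gt0.
move=> z zM; pose n := maxn N1 N2.
have g1 := H1 n (leq_maxl _ _) z zM; have g2 := H2 n (leq_maxr _ _) z zM.
have := lerB_cabs (rGamma z) (gauss_prod n z).
have : cabs (gauss_prod n z) * (C / n%:R) <= B * C.
  apply: ler_pM; rewrite ?cabs_ge0 ?divr_ge0 ?(ltW C0)//.
  by rewrite ler_pdivrMr ?ltr0n ?leq_max ?N10// ler_peMr ?(ltW C0)// ler1n leq_max N10.
by move: g1 g2; lra.
Qed.

Lemma ampE : amp / sq h = (Num.sqrt 2)^-1 / sigma.
Proof.
have [s0 _ _] := crit; have pi0 : 0 < pi :> R by exact: pi_gt0.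
have sh : 0 < sq h by exact: sq_gt0.
have s2 : 0 < Num.sqrt 2 :> R by rewrite sqrtr_gt0.
have sp : 0 < Num.sqrt (2 * pi) :> R by rewrite sqrtr_gt0 mulr_gt0.
rewrite /return_scale /kap.
have -> : Num.sqrt (2 * pi / V) = Num.sqrt (2 * pi) * (h%:R / sigma).
  have -> : 2 * pi / V = 2 * pi * (h%:R / sigma) ^+ 2.
    by rewrite /step_var; field; rewrite !gt_eqF.
  by rewrite sqrtrM ?mulr_ge0 ?pi_ge0// sqrtr_sqr ger0_norm// divr_ge0// ltW.
have -> : Num.sqrt (2 * pi / 2^-1) = Num.sqrt (2 * pi) * Num.sqrt 2 :> R.
  by rewrite invrK sqrtrM// mulr_ge0// pi_ge0.
move: (@sq_sqr R h); move: (sq h) (Num.sqrt 2 : R) (Num.sqrt (2 * pi) : R) sh s2 sp => x y z x0 y0 z0 <-.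
move: (pi : R) pi0 => w w0.
by field; rewrite !gt_eqF.
Qed.

Lemma hit_large : exists N0, forall N, (N0 <= N)%N ->
  kV / 2 <= sq (lat N) * hit N /\ (lat N)%:R / hit N <= 2 / kV * (lat N)%:R * sq (lat N).
Proof.
have k2 : 0 < kV / 2 by rewrite divr_gt0.
have [N0 H] := tends_hit crit h0 h_span h_spanned k2.
exists N0 => N NN; have := H N NN; rewrite ler_norml => /andP[h1 _].
have h2 : kV / 2 <= sq (lat N) * hit N by lra.
split=> //; have hN : 0 < hit N by rewrite -(pmulr_rgt0 _ (sl N)) (lt_le_trans k2).
rewrite ler_pdivrMr//.
have -> : 2 / kV * (lat N)%:R * sq (lat N) * hit N = (lat N)%:R * (2 / kV * (sq (lat N) * hit N)) by ring.
rewrite ler_peMr//; move/(ler_wpM2l (ltW (divr_gt0 (ltr0n _ 2) kV0))): h2.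
by apply: le_trans; rewrite le_eqVlt; apply/orP; left; apply/eqP; field; rewrite gt_eqF.
Qed.

Lemma npow_expand a n : (0 < n)%N -> npow n (a + one_half) = (n%:R * sq n)%:C * npow n (a - 1).
Proof.
move=> n0; have -> : a + one_half = 1 + one_half + (a - 1) by ring.
by rewrite !npowD npow_half// npow_id// rmorphM rmorph_nat.
Qed.

Lemma powR_expand r n : (0 < n)%N -> (n%:R : R) `^ (r + 2^-1) = n%:R * sq n * n%:R `^ (r - 1).
Proof.
move=> n0; have nR : 0 < n%:R :> R by rewrite ltr0n.
have -> : r + 2^-1 = 1 + 2^-1 + (r - 1) by ring.
rewrite !powRD; [|by rewrite (gt_eqF nR) implybT..].
by rewrite powRr1// powR12_sqrt.
Qed.

(** Stirling for the rising factorial, the local limit theorem for the denominator, and [h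
   N] replaced by [h N + 1]: three relative errors that tend to [0] uniformly. *)
Lemma main_asymp (d M : R) : 0 < d -> 1 <= M -> forall e, 0 < e ->
  exists N0, forall N, (N0 <= N)%N -> forall a, region d M a ->
  cabs (((lat N)%:R / hit N)%:C * main a N -
    (sigma%:C)^-1 * gamma_term a * npow (lat N) (a + one_half))
  <= e * (lat N)%:R `^ (Re a + 2^-1).
Proof.
move=> d0 M1 e e0; have M11 : 1 <= M + 1 by lra.
have [s0 _ _] := crit.
have [c c0 Hc] := rGamma_bounds M11 d0.
have [G G0 HG] := rGamma_upper M1.
have [C1 C10 [N1 [N10 H1]]] := rising_asymp M1.
have [C2 C20 [N2 [N20 H2]]] := npow_lat_shift h0 M11.
have sh : 0 < sq h by exact: sq_gt0.
have A0 : 0 < amp / sq h by rewrite ampE divr_gt0// invr_gt0 sqrtr_gt0.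
pose A := amp / sq h / c; have Ac0 : 0 < A by rewrite divr_gt0.
pose C3 := 2 * (G * C2 + C1 * (h.+1)%:R ^+ 3).
have C30 : 0 < C3 by rewrite mulr_gt0// addr_gt0// mulr_gt0// exprn_gt0.
have e2 : 0 < Num.min 1 (e / 2 / A / G) by rewrite lt_min ltr01; apply: (divr_gt0 _ G0); apply: (divr_gt0 _ Ac0); exact: divr_gt0.
have kh : 0 < Num.min (kV / 2) (kV / 2 * Num.min 1 (e / 2 / A / G)).
  by rewrite lt_min divr_gt0//= (mulr_gt0 _ e2)// divr_gt0.
have [N3 H3] := tends_hit crit h0 h_span h_spanned kh.
pose N4 := (Num.truncn (C3 / (e / 2 / A))).+1.
exists (maxn (maxn N1 N2) (maxn N3 N4)) => N; rewrite !geq_max => /andP[/andP[n1 n2] /andP[n3 n4]] a ra.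
have [r1 r2 r3 r4] := region_facts d0 ra.
have [q1 q2 q3 q4] := ra.
have N0 : (0 < N)%N by apply: leq_trans n1.
have NR : 0 < N%:R :> R by rewrite ltr0n.
have cG := Hc _ r3 r4; have Gn : rGamma (b_ a) != 0 by rewrite -cabs_gt0 (lt_le_trans c0).
pose n := lat N; have nR : 0 < n%:R :> R by exact: latR.
have h3 := H3 N n3; rewrite -/n in h3.
have hh : kV / 2 <= sq n * hit N.
  have : `|sq n * hit N - kV| <= kV / 2 by apply: (le_trans h3); rewrite ge_min lexx.
  by rewrite ler_norml => /andP[]; lra.
have hN : 0 < hit N by rewrite -(pmulr_rgt0 _ (sl N)) (lt_le_trans _ hh)// divr_gt0.
have sn : 0 < sq n by exact: sl.
pose eps := kV / (sq n * hit N) - 1.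
have epsle : `|eps| <= Num.min 1 (e / 2 / A / G).
  have -> : eps = (kV - sq n * hit N) / (sq n * hit N) by rewrite /eps; field; rewrite !gt_eqF.
  rewrite normrM normfV distrC [X in _ / X]gtr0_norm; last by rewrite mulr_gt0.
  rewrite ler_pdivrMr ?mulr_gt0//; apply: (le_trans h3).
  apply: (@le_trans _ _ (kV / 2 * Num.min 1 (e / 2 / A / G))); first by rewrite ge_min lexx orbT.
  by rewrite mulrC ler_wpM2l ?(ltW e2).
have eps1 : `|eps| <= 1 by apply: (le_trans epsle); rewrite ge_min lexx.
have eps2 : `|eps| <= e / 2 / A / G by apply: (le_trans epsle); rewrite ge_min lexx orbT.
pose x1 := rising N a - rGamma a * npow N (a - 1).
pose x2 := npow (h * N) (a - 1) - npow n (a - 1).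
have E : (n%:R / hit N)%:C * main a N - (sigma%:C)^-1 * gamma_term a * npow n (a + one_half) =
  (amp / sq h)%:C * (n%:R * sq n)%:C / rGamma (b_ a) *
   ((1 + eps)%:C * (rGamma a * x2 + npow h (a - 1) * x1) + eps%:C * (rGamma a * npow n (a - 1))).
  have k1 : (n%:R / hit N)%:C * main a N =
    (amp / sq h)%:C * (n%:R * sq n)%:C / rGamma (b_ a) * ((1 + eps)%:C * (npow h (a - 1) * rising N a)).
    have -> : (1 + eps)%:C = (kV / (sq n * hit N))%:C by rewrite /eps addrC subrK.
    have hb : npow h (b_ a - 1) = npow h (a - 1) / (sq h)%:C.
      have -> : b_ a - 1 = (a - 1) - one_half by ring.
      by rewrite npowD npowN npow_half.
    rewrite /main_term hb.
    have F : (n%:R / hit N)%:C * ((kV * amp)%:C / (sq h)%:C) =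
      (amp / sq h)%:C * (n%:R * sq n)%:C * (kV / (sq n * hit N))%:C :> R[i].
      rewrite -fmorphV -!rmorphM; congr (_%:C); field.
      by rewrite !gt_eqF.
    have -> : (n%:R / hit N)%:C * ((kV * amp)%:C * (npow h (a - 1) / (sq h)%:C) * (rising N a / rGamma (b_ a)))
      = (n%:R / hit N)%:C * ((kV * amp)%:C / (sq h)%:C) * (npow h (a - 1) * (rising N a / rGamma (b_ a))).
      by ring.
    by rewrite F; ring.
  have k2 : (sigma%:C)^-1 * gamma_term a * npow n (a + one_half) =
     (amp / sq h)%:C * (n%:R * sq n)%:C / rGamma (b_ a) * (rGamma a * npow n (a - 1)).
    rewrite npow_expand// /gamma_term /Gamma ampE [in RHS]rmorphM/= !fmorphV/=; ring.
  rewrite k1 k2 -mulrBr; congr (_ * _).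
  have -> : npow h (a - 1) * rising N a = rGamma a * (x2 + npow n (a - 1)) + npow h (a - 1) * x1.
    by rewrite /x1 /x2 npowM//; ring.
  by rewrite rmorphD rmorph1; ring.
rewrite -/n E cabsM powR_expand//.
pose W := n%:R * sq n; have W0 : 0 < W by rewrite mulr_gt0.
have B1 : cabs ((amp / sq h)%:C * (n%:R * sq n)%:C / rGamma (b_ a)) <= A * W.
  rewrite !cabsM !cabs_real cabsV (gtr0_norm A0) (gtr0_norm W0) /A -/W mulrAC.
  rewrite ler_wpM2r ?(ltW W0)// ler_wpM2l ?(ltW A0)//.
  by rewrite lef_pV2 ?posrE//; exact: lt_le_trans cG.
pose Q := n%:R `^ (Re a - 1); have Q0 : 0 < Q by exact: powR_gt0.
have aM1 : cabs (a - 1) <= M + 1.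
  by apply: le_trans (ler_cabsB _ _) _; rewrite cabs1; lra.
have X2 : cabs x2 <= C2 / n%:R * Q.
  by apply: (le_trans (H2 N n2 _ aM1)); rewrite cabs_npow// Re_sub1.
have X1 : cabs x1 <= C1 * (h.+1)%:R ^+ 3 / n%:R * Q.
  apply: (le_trans (H1 N n1 _ q4)).
  have -> : C1 * h.+1%:R ^+ 3 / n%:R * Q = C1 * (h.+1%:R ^+ 3 * n%:R `^ (Re a - 2)).
    have -> : Re a - 2 = Re a - 1 - 1 by ring.
    by rewrite (powRB1 (Re a - 1))// /Q; ring.
  rewrite ler_wpM2l ?(ltW C10)//; apply: powR_scale; rewrite ?ltr0n ?ler1n//; [|by lra|by lra].
  by rewrite -natrM ler_nat /n /lattice_point mulSn -add1n leq_add2r.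
have H0 : cabs (npow h (a - 1)) <= 1.
  by rewrite cabs_npow// Re_sub1; apply: powR_le1; [rewrite ler1n|lra].
have Y : cabs (rGamma a * x2 + npow h (a - 1) * x1) <= C3 / 2 / n%:R * Q.
  apply: le_trans (ler_cabsD _ _) _.
  have Y1 : cabs (rGamma a * x2) <= G * (C2 / n%:R * Q).
    by rewrite cabsM; apply: ler_pM; rewrite ?cabs_ge0 ?HG.
  have Y2 : cabs (npow h (a - 1) * x1) <= 1 * (C1 * (h.+1)%:R ^+ 3 / n%:R * Q).
    by rewrite cabsM; apply: ler_pM; rewrite ?cabs_ge0.
  have -> : C3 / 2 / n%:R * Q = G * (C2 / n%:R * Q) + 1 * (C1 * (h.+1)%:R ^+ 3 / n%:R * Q).
    by rewrite /C3; move: (n%:R : R) nR => y y0; field; rewrite gt_eqF.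
  exact: lerD.
have B2 : cabs ((1 + eps)%:C * (rGamma a * x2 + npow h (a - 1) * x1) + eps%:C * (rGamma a * npow n (a - 1)))
   <= (C3 / n%:R + `|eps| * G) * Q.
  apply: le_trans (ler_cabsD _ _) _; rewrite [leRHS]mulrDl; apply: lerD; last first.
    rewrite (cabsM eps%:C) cabs_real -[leRHS]mulrA ler_wpM2l// (cabsM (rGamma a)) cabs_npow// Re_sub1.
    by rewrite ler_wpM2r ?powR_ge0// HG.
  rewrite (cabsM (1 + eps)%:C) cabs_real.
  have -> : C3 / n%:R * Q = 2 * (C3 / 2 / n%:R * Q).
    by move: (n%:R : R) nR => y y0; field; rewrite gt_eqF.
  apply: ler_pM; rewrite ?cabs_ge0//.
  by have := ler_normD 1 eps; rewrite normr1; lra.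
apply: (le_trans (ler_pM (cabs_ge0 _) (cabs_ge0 _) B1 B2)).
have -> : A * W * ((C3 / n%:R + `|eps| * G) * Q) = A * (C3 / n%:R + `|eps| * G) * (W * Q) by ring.
rewrite ler_wpM2r ?mulr_ge0 ?(ltW W0) ?(ltW Q0)//.
have eA : 0 < e / 2 / A by apply: (divr_gt0 _ Ac0); exact: divr_gt0.
have s1 : C3 / n%:R <= e / 2 / A.
  rewrite ler_pdivrMr// [e / 2 / A * _]mulrC -(ler_pdivrMr _ _ eA).
  by apply/ltW/(lt_le_trans (truncnS_gt _)); rewrite ler_nat (leq_trans n4)// ltnW// le_lat.
have s2 : `|eps| * G <= e / 2 / A by rewrite -ler_pdivlMr.
apply: (le_trans (ler_wpM2l (ltW Ac0) (lerD s1 s2))).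
by rewrite le_eqVlt; apply/orP; left; apply/eqP; field; rewrite !gt_eqF.
Qed.

(** Besides the remainder of the convolution there are three errors: that of the main term,
   that of the partial sum of [u - v] in place of its limit, and that of the quotient [ret N
   / hit N] in place of [1]. *)
Lemma EX_lat_asymp (d M : R) : 0 < d -> d <= 1 -> 1 <= M -> forall e, 0 < e ->
  exists N0, forall N, (N0 <= N)%N -> forall a, region d M a ->
  cabs (EX xi (lat N) a - (mu xi a * (lat N)%:R +
    (sigma%:C)^-1 * gamma_term a * npow (lat N) (a + one_half)))
  <= e * (lat N)%:R `^ (Num.max (Re a) 0 + 2^-1).
Proof.
move=> d0 d1 M1 e e0; have e4 : 0 < e / 4 by rewrite divr_gt0.
have [N1 H1] := main_asymp d0 M1 e4.
have k20 : 0 < 2 / kV by exact: divr_gt0.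
have e2 := divr_gt0 e4 k20.
have [N2 H2] := convolution_expansion crit h0 h_span h_spanned d0 d1 M1 e2.
have [N3 H3] := excess_unif crit h0 h_span h_spanned d0 M1 e4.
have [B B0 [_ [N4 H4]]] := mu_limit_bound crit h0 h_span h_spanned d0 M1.
have k4B : 0 < 4 / kV * B by apply: mulr_gt0 B0; exact: divr_gt0.
have e5 := divr_gt0 e4 k4B.
have [N5 H5] := hit_sub_ret crit h0 h_span h_spanned e5.
have [N6 H6] := hit_large.
exists (maxn (maxn (maxn N1 N2) (maxn N3 N4)) (maxn (maxn N5 N6) 1)) => N.
rewrite !geq_max => /andP[/andP[/andP[n1 n2] /andP[n3 n4]] /andP[/andP[n5 n6] N0]] a ra.
have [r1 r2 r3 r4] := region_facts d0 ra.
have [hh q2] := H6 N n6.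
pose n := lat N; have nR : 0 < n%:R :> R by exact: latR.
have hN : 0 < hit N by rewrite -(pmulr_rgt0 _ (sl N)) (lt_le_trans _ hh)// divr_gt0.
have sn : 0 < sq n by exact: sl.
pose D := n%:R `^ (Num.max (Re a) 0 + 2^-1).
have D1 : n%:R `^ (Re a + 2^-1) <= D.
  by apply: ler_powR; rewrite ?ler1n// lerD2r le_max lexx.
have D2 : sq n <= D.
  rewrite -powR12_sqrt//; apply: ler_powR; rewrite ?ler1n//.
  by rewrite lerDr le_max lexx orbT.
have sa := region_strip d0 ra.
pose q := n%:R / hit N; have q0 : 0 <= q by rewrite divr_ge0// ltW.
set Er := \sum_(k < N.+1) u a k * (ret (N - k))%:C - main a N
        - (ret N)%:C * \sum_(k < N.+1) (u a k - v a k) in H2.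
pose Er' := \sum_(k < N.+1) u a k * (ret (N - k))%:C - main a N - (ret N)%:C * excess N.+1 a.
have HEr : cabs Er' <= e / 4 / (2 / kV) * n%:R `^ Re (b_ a) / sq n by exact: H2.
have E : EX xi n a - (mu xi a * n%:R + (sigma%:C)^-1 * gamma_term a * npow n (a + one_half)) =
  (q%:C * main a N - (sigma%:C)^-1 * gamma_term a * npow n (a + one_half)) +
  (q * (ret N - hit N))%:C * excess N.+1 a + n%:R%:C * (excess N.+1 a - mu xi a) + q%:C * Er'.
  have qh : q * hit N = n%:R by rewrite /q divfK ?gt_eqF.
  have -> : (q * (ret N - hit N))%:C = q%:C * (ret N)%:C - n%:R :> R[i].
    by rewrite mulrBr qh rmorphB rmorphM rmorph_nat.
  rewrite EX_lat -/n -/q /Er' rmorph_nat; ring.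
rewrite -/n E.
have T1 := H1 N n1 a ra; rewrite -/n -/q in T1.
have T2 : cabs ((q * (ret N - hit N))%:C * excess N.+1 a) <= e / 4 * D.
  rewrite cabsM cabs_real normrM (ger0_norm q0) distrC.
  have hNR : 0 < (h * N)%:R :> R by rewrite ltr0n muln_gt0 h0.
  apply: (@le_trans _ _ (2 / kV * n%:R * sq n * (e / 4 / (4 / kV * B) / (h * N)%:R) * B)).
    apply: ler_pM; [exact: mulr_ge0|exact: cabs_ge0| |exact: H4 (leqW n4) a ra].
    by apply: ler_pM => //; exact: H5.
  have nh : n%:R / (h * N)%:R <= 2 :> R.
    by rewrite ler_pdivrMr// -natrM ler_nat /n /lattice_point mulSn mul1n -add1n leq_add2r muln_gt0 h0.
  have -> : 2 / kV * n%:R * sq n * (e / 4 / (4 / kV * B) / (h * N)%:R) * B =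
     (e / 4) / 2 * (n%:R / (h * N)%:R) * sq n.
    have := kV0; move: (kap V) ((h * N)%:R : R) hNR (n%:R : R) (sq n) => k y y0 x t k0.
    by field; rewrite !gt_eqF.
  apply: ler_pM => //; first by rewrite mulr_ge0 ?divr_ge0 ?(ltW e0).
  by move/(ler_wpM2l (_ : 0 <= e / 4 / 2)): nh; lra.
have nn : n%:R * n%:R `^ Re (b_ a) <= D.
  apply: le_trans D1; have -> : Re a + 2^-1 = 1 + Re (b_ a) by rewrite Re_sub_half; lra.
  by rewrite powRD ?powRr1// (gt_eqF nR) implybT.
have T3 : cabs (n%:R%:C * (excess N.+1 a - mu xi a)) <= e / 4 * D.
  rewrite cabsM cabs_real ger0_norm// (muE crit h0 h_span h_spanned sa).
  apply: (@le_trans _ _ (n%:R * (e / 4 * n%:R `^ Re (b_ a)))); last first.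
    by rewrite mulrCA ler_wpM2l// ltW.
  rewrite ler_wpM2l//; apply: (le_trans (H3 N.+1 (leqW n3) a ra)); rewrite ler_wpM2l ?(ltW e4)//.
  by apply: powR_anti => //; rewrite ler_nat latS leq_addr.
have T4 : cabs (q%:C * Er') <= e / 4 * D.
  rewrite cabsM cabs_real (ger0_norm q0).
  apply: le_trans (ler_pM q0 (cabs_ge0 _) q2 HEr) _; rewrite -/n.
  have -> : 2 / kV * n%:R * sq n * (e / 4 / (2 / kV) * n%:R `^ Re (b_ a) / sq n) =
    e / 4 * (n%:R * n%:R `^ Re (b_ a)).
    have := kV0; move: (kap V) (n%:R `^ Re (b_ a)) (n%:R : R) (sq n) sn => k y x t t0 k0.
    by field; rewrite !gt_eqF.
  by rewrite ler_wpM2l// ltW.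
have T1' := le_trans T1 (ler_wpM2l (ltW e4) D1).
apply: le_trans (ler_cabsD _ _) _.
set z1 := q%:C * main a N - _ in T1' *; set z2 := _ * excess _ _ in T2 *; set z3 := n%:R%:C * _ in T3 *.
have := ler_cabsD (z1 + z2) z3; have := ler_cabsD z1 z2; move: T1' T2 T3 T4; rewrite -/D; lra.
Qed.

End Expectation.

Section EstimateOnRegions.
Context {R : realType} (xi : probability nat R) (sigma : R).
Hypothesis crit : critical xi sigma.
Local Notation Re := complex.Re.

Lemma EX_asymp (K : set R[i]) : K `<=` strip -> compact K ->
  uniformly_little_o (admissible_oo xi) K
   (fun n a => EX xi n a - (mu xi a * n%:R + (sigma%:C)^-1 * gamma_term a * npow n (a + one_half)))
   (fun n a => (n%:R : R) `^ (Num.max (Re a) 0 + 2^-1)).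
Proof.
move=> Ks Kc e e0; have [d [M [d0 d1 M1 Kr]]] := compact_region Ks Kc.
have [h [h0 h_span h_spanned]] := span_exists crit.
have [N0 H] := EX_lat_asymp crit h0 h_span h_spanned d0 d1 M1 e0.
exists (lattice_point h N0) => // n /= Nn an a Ka.
have [N En] : exists N, n = lattice_point h N.
  apply: contrapT => nl; move: an; rewrite /admissible/= (@gw_size_off _ _ h) ?ltxx//.
    exact: leq_trans Nn.
  by move=> k; apply/eqP => E; apply: nl; exists k.
have NN : (N0 <= N)%N by move: Nn; rewrite En /lattice_point ltnS leq_pmul2l.
by rewrite En cabsE lecR; apply: H => //; exact: Kr.
Qed.

End EstimateOnRegions.

(** * Convergence in distribution *)

Section FunctionSpace.
Context {R : realType}.

Lemma entourage_cabs (E : set (R[i] * R[i])) :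
  entourage E <-> exists2 e : R, 0 < e & forall x y, cabs (y - x) < e -> E (x, y).
Proof.
rewrite -(@entourage_ballE _ (R[i])^o); split=> [[e /= e0 eE]|[e e0 eE]].
  have eR : e = (complex.Re e)%:C.
    by move: e0; rewrite ltcE/= => /andP[/eqP i0 _]; case: e i0 {eE} => a b /= ->.
  exists (complex.Re e); first by move: e0; rewrite ltcE => /andP[].
  move=> x y xy; apply: eE; rewrite /= -ball_normE/= cabsE cabs_distC eR ltcR.
  exact: xy.
exists e%:C; first by rewrite /= ltcR.
by move=> [x y]/=; rewrite -ball_normE/= cabsE cabs_distC ltcR => /eE.
Qed.

(** The topology of [funs D], in terms of uniform convergence on compact sets. *)
Lemma funs_cvgP (D : set R[i]) {I} (F : set_system I) {FF : Filter F} (g : I -> funs D) (f : funs D) :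
  g @ F --> f <-> forall K, K `<=` D -> compact K -> forall e : R, 0 < e ->
    \forall i \near F, forall a, K a -> cabs ((g i : R[i] -> R[i]) a - (f : R[i] -> R[i]) a) < e.
Proof.
have H := @fam_cvgP R[i] R[i] (compactly_in D) (g @ F) f (fmap_filter g FF).
split=> [gf K KD Kc e e0|gf].
  have {}H := proj1 H gf K (conj KD Kc).
  apply: (H [set k | forall a, K a -> cabs (k a - f a) < e]).
  apply/uniform_nbhs; exists [set xy | cabs (xy.2 - xy.1) < e]; split; last by move=> k /=.
  by apply/entourage_cabs; exists e.
apply: (proj2 H) => K [KD Kc] A /uniform_nbhs[E [/entourage_cabs[e e0 eE] EA]].
apply: filterS (gf K KD Kc e e0) => i gi; apply: EA => a Ka; apply: eE; exact: gi.
Qed.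

End FunctionSpace.

Section Slutsky.
Context {R : realType} d (T : measurableType d) (P : probability T R).
Context (V : topologicalType) (S : set V) (xi : probability nat R).

Lemma cgw_expect_le n (f g : tree -> R) : admissible xi n ->
  (forall t, tree_size t = n -> f t <= g t) -> cgw_expect xi n f <= cgw_expect xi n g.
Proof.
move=> an fg; rewrite !cgw_expectE ler_wpM2r ?invr_ge0 ?(ltW an)//.
rewrite big_seq [leRHS]big_seq; apply: ler_sum => t; rewrite mem_trees => /eqP tn.
by rewrite ler_wpM2l ?gw_prob_ge0// fg.
Qed.

Lemma cgw_expectD n (f g : tree -> R) :
  cgw_expect xi n (fun t => f t + g t) = cgw_expect xi n f + cgw_expect xi n g.
Proof.
rewrite !cgw_expectE -mulrDl -big_split/=; congr (_ / _).
by apply: eq_bigr => t _; rewrite mulrDr.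
Qed.

Lemma cgw_expect_dist n (f g k : tree -> R) : admissible xi n ->
  (forall t, tree_size t = n -> `|f t - g t| <= k t) ->
  `|cgw_expect xi n f - cgw_expect xi n g| <= cgw_expect xi n k.
Proof.
move=> an fgk; rewrite ler_norml lerBlDr lerNl opprB lerBlDr -!cgw_expectD.
by apply/andP; split; apply: cgw_expect_le => // t /fgk; rewrite ler_norml => /andP[]; lra.
Qed.

Lemma measurable_within (Y : T -> V) (phi : V -> R) :
  random_element S Y -> {within S, continuous phi} -> measurable_fun setT (phi \o Y).
Proof.
move=> [SY mY] cphi; apply: (measurability _ (measurable_realfun.RGenOpens.measurableE R)) => _ [_ [a [b ->]] <-].
rewrite setTI.
have /open_subspaceP[U oU US] : open (phi @^-1` `]a, b[%classic : set (subspace S)).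
  by move/continuousP : cphi; apply; exact: interval_open.
rewrite (_ : _ @^-1` _ = Y @^-1` U); first exact: mY.
apply/seteqP; split=> w /= hw.
  by move/seteqP : US => [_ /(_ (Y w) (conj hw (SY w)))[]].
by move/seteqP : US => [/(_ (Y w) (conj hw (SY w)))[]].
Qed.

Lemma near_forall_lt {I} (F : set_system I) {FF : Filter F} (Q : nat -> I -> Prop) N :
  (forall n, \forall x \near F, Q n x) -> \forall x \near F, forall n, (n < N)%N -> Q n x.
Proof.
move=> HQ; elim: N => [|N IH]; first by apply: filterE.
apply: filterS2 IH (HQ N) => x h1 h2 n; rewrite ltnS leq_eqVlt => /predU1P[->//|]; exact: h1.
Qed.

Section UniformMapping.
Context (Z : nat -> tree -> V) (Y : T -> V) (h_ : nat -> V -> R) (h : V -> R) (M : R).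
Hypothesis ZY : cvg_in_distribution P S xi Z Y.
Hypothesis h_bounded : forall n f, S f -> `|h_ n f| <= M.
Hypothesis h_lim_bounded : forall f, S f -> `|h f| <= M.
Hypothesis h_cont : forall n f, S f -> forall e, 0 < e ->
  \forall g \near f, S g -> `|h_ n g - h_ n f| <= e.
Hypothesis h_lim_cont : forall f, S f -> forall e, 0 < e ->
  \forall g \near f, S g -> `|h g - h f| <= e.
Hypothesis h_cvg : forall f, S f -> forall e, 0 < e -> exists N,
  \forall g \near f, S g -> forall n, (N <= n)%N -> `|h_ n g - h f| <= e.

(** It dominates the error of all later [h_ n] and, unlike a single one, is a test function
   that does not depend on [n]. *)
Definition tail_sup (k : nat) (f : V) : R :=
  sup [set x | exists2 n, (k <= n)%N & x = `|h_ n f - h f|].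

Let dist_le n f : S f -> `|h_ n f - h f| <= 2 * M.
Proof.
move=> Sf; apply: le_trans (ler_normB _ _) _.
by have := h_bounded n Sf; have := h_lim_bounded Sf; lra.
Qed.

Lemma tail_sup_ge k n f : S f -> (k <= n)%N -> `|h_ n f - h f| <= tail_sup k f.
Proof.
move=> Sf kn; apply: ub_le_sup; last by exists n.
by exists (2 * M) => _ [m _ ->]; exact: dist_le.
Qed.

Lemma tail_sup_le k f c : (forall n, (k <= n)%N -> `|h_ n f - h f| <= c) -> tail_sup k f <= c.
Proof.
move=> H; apply: ge_sup; first by exists `|h_ k f - h f|, k.
by move=> _ [n kn ->]; exact: H.
Qed.

Lemma tail_sup_ge0 k f : S f -> 0 <= tail_sup k f.
Proof. by move=> Sf; apply: le_trans (tail_sup_ge Sf (leqnn k)). Qed.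

Lemma tail_sup_small f : S f -> forall e, 0 < e -> exists N, forall k, (N <= k)%N -> tail_sup k f <= e.
Proof.
move=> Sf e e0; have [N HN] := h_cvg Sf e0; exists N => k Nk; apply: tail_sup_le => n kn.
by apply: (nbhs_singleton HN) => //; exact: leq_trans kn.
Qed.

(** Near a point the tail of the sequence is uniformly close to its limit, and the finitely
   many other terms are continuous. *)
Lemma tail_sup_continuous k : {within S, continuous (tail_sup k)}.
Proof.
apply/subspace_continuousP => f Sf; apply/cvgrPdist_le => e e0.
have e4 : 0 < e / 4 by rewrite divr_gt0.
have [N HN] := h_cvg Sf e4.
have Hlt : \forall g \near f, forall n, (n < N)%N -> S g -> `|h_ n g - h_ n f| <= e / 4.
  by apply: near_forall_lt => n; exact: h_cont.
have Hf := nbhs_singleton HN Sf.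
rewrite /within /= near_withinE.
apply: filterS3 HN Hlt (h_lim_cont Sf e4) => g Hg Hlg Hhg Sg.
have D n : `| `|h_ n g - h g| - `|h_ n f - h f| | <= e.
  have [nN|Nn] := ltnP n N.
    apply: le_trans (ler_dist_dist _ _) _.
    have -> : h_ n g - h g - (h_ n f - h f) = (h_ n g - h_ n f) - (h g - h f) by ring.
    apply: le_trans (ler_normB _ _) _.
    by have := Hlg n nN Sg; have := Hhg Sg; lra.
  have A1 : `|h_ n g - h g| <= e / 2.
    have -> : h_ n g - h g = (h_ n g - h f) - (h g - h f) by ring.
    apply: le_trans (ler_normB _ _) _.
    by have := Hg Sg n Nn; have := Hhg Sg; lra.
  have A2 := Hf n Nn.
  have B1 := normr_ge0 (h_ n g - h g); have B2 := normr_ge0 (h_ n f - h f).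
  by rewrite ler_norml; apply/andP; split; lra.
rewrite ler_norml; apply/andP; split.
  suff : tail_sup k g <= tail_sup k f + e by rewrite /from_subspace; lra.
  apply: tail_sup_le => n kn.
  by have /ler_normlP[] := D n; have := tail_sup_ge Sf kn; lra.
suff : tail_sup k f <= tail_sup k g + e by rewrite /from_subspace; lra.
apply: tail_sup_le => n kn.
by have /ler_normlP[] := D n; have := tail_sup_ge Sg kn; lra.
Qed.

Lemma within_cont_of_near : {within S, continuous h}.
Proof.
apply/subspace_continuousP => f Sf; apply/cvgrPdist_le => e e0.
rewrite near_withinE; apply: filterS (h_lim_cont Sf e0) => g Hg Sg.
by rewrite distrC; exact: Hg.
Qed.

Lemma expectation_tail_sup : 'E_P[tail_sup k \o Y]%E @[k --> \oo] --> (0 : R)%:E.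
Proof.
have [_ [SY mY] _] := ZY.
have H : (\int[P]_(w in setT) (tail_sup k (Y w))%:E)%E @[k --> \oo] --> (\int[P]_(w in setT) 0%:E)%E.
  apply: (@dominated_cvg _ _ _ P setT measurableT
      (fun k w => (tail_sup k (Y w))%:E) (fun=> 0%:E) (fun=> (2 * M)%:E)) => //.
  - move=> k; apply/measurable_realfun.measurable_EFinP.
    exact: (@measurable_within Y (tail_sup k) (conj SY mY) (@tail_sup_continuous k)).
  - move=> w _; apply: cvg_EFin; first exact: nearW.
    apply/cvgrPdist_le => e e0; have [N HN] := tail_sup_small (SY w) e0.
    exists N => // k Nk /=; rewrite sub0r normrN ger0_norm; first exact: HN.
    exact: tail_sup_ge0.
  - by apply: finite_measure_integrable_cst.
  - move=> k w _ /=; rewrite lee_fin ger0_norm; last exact: tail_sup_ge0.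
    by apply: tail_sup_le => n _; exact: dist_le.
rewrite integral0 in H.
by rewrite unlock.
Qed.

Lemma bounded_expectation_fin (phi : V -> R) C : {within S, continuous phi} ->
  (forall f, S f -> `|phi f| <= C) -> ('E_P[phi \o Y])%E \is a fin_num.
Proof.
move=> cphi bphi; have [_ [SY mY] _] := ZY.
rewrite unlock; apply: integrable_fin_num => //.
apply: measurable_bounded_integrable => //.
- by apply: (le_lt_trans (probability_le1 P measurableT)); rewrite ltry.
- exact: (@measurable_within Y phi (conj SY mY) cphi).
- exists C; split; first exact: num_real.
  by move=> y Cy w _ /=; rewrite (le_trans (bphi _ (SY w)))// ltW.
Qed.

(** The functions [tail_sup k] are continuous and bounded and tend pointwise to [0], so
   their expectations under the limit law are small for large [k]; by convergence in
   distribution so are those under the law of the tree, which bound the error made on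
   replacing [h_ n] by [h]. *)
Lemma uniform_mapping :
  (cgw_expect xi n (h_ n \o Z n))%:E @[n --> admissible_oo xi] --> ('E_P[h \o Y])%E.
Proof.
have [SZ [SY mY] cvgZ] := ZY.
have FF : Filter (admissible_oo xi) by exact: within_filter.
have ch := within_cont_of_near.
have fh := bounded_expectation_fin ch h_lim_bounded.
have bc k : bounded_continuous S (tail_sup k).
  split; first exact: tail_sup_continuous.
  exists (2 * M) => f Sf; rewrite ger0_norm ?tail_sup_ge0//.
  by apply: tail_sup_le => n _; exact: dist_le.
have fk k : ('E_P[tail_sup k \o Y])%E \is a fin_num.
  have [c [C HC]] := bc k; exact: bounded_expectation_fin c HC.
have hcv := cvgZ h (conj ch (ex_intro _ M h_lim_bounded)).
rewrite -(fineK fh) in hcv *.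
apply: cvg_EFin; first exact: nearW.
apply/cvgrPdist_le => e e0; have e3 : 0 < e / 3 by rewrite divr_gt0.
have tk : \forall k \near \oo, `|0 - fine ('E_P[tail_sup k \o Y])%E| <= e / 3.
  have /cvgrPdist_le := @fine_cvg _ _ _ eventually_filter _ _ expectation_tail_sup.
  exact.
have [k _ /(_ k (leqnn k)) Hk] := tk.
have hk := cvgZ _ (bc k); rewrite -(fineK (fk k)) in hk.
have /cvgrPdist_le/(_ _ e3) N1 := @fine_cvg _ _ _ FF _ _ hk.
have /cvgrPdist_le/(_ _ e3) N2 := @fine_cvg _ _ _ FF _ _ hcv.
have N3 : \forall n \near admissible_oo xi, (k <= n)%N /\ admissible xi n.
  by exists k => // n kn an; split.
apply: filterS3 N1 N2 N3 => n /= n1 n2 [kn an].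
have D := @cgw_expect_dist n (h_ n \o Z n) (h \o Z n) (tail_sup k \o Z n) an.
have {}D := D (fun t tn => tail_sup_ge (SZ n t an tn) kn).
move: Hk n1 n2 D; rewrite sub0r normrN.
move: (fine _) (fine _) (cgw_expect _ _ _) (cgw_expect _ _ _) (cgw_expect _ _ _) => x y z1 z2 z3.
rewrite !ler_norml => /andP[a1 a2] /andP[a3 a4] /andP[a5 a6] /andP[a7 a8].
by apply/andP; split; lra.
Qed.

End UniformMapping.
End Slutsky.

Section Composition.
Context {R : realType} (A B : topologicalType) (SA : set A) (SB : set B).
Context (phi : B -> R) (phi_cont : {within SB, continuous phi}).

Let near_phi g : SB g -> forall e, 0 < e -> nbhs g [set k | SB k -> `|phi k - phi g| <= e].
Proof.
move=> Sg e e0; have /subspace_continuousP c := phi_cont.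
have /cvgrPdist_le/(_ _ e0) := c g Sg.
by rewrite near_withinE; apply: filterS => k H /H; rewrite distrC.
Qed.

Lemma within_cont_comp (G : A -> B) : continuous G -> (forall f, SA f -> SB (G f)) ->
  forall f, SA f -> forall e, 0 < e -> \forall g \near f, SA g -> `|phi (G g) - phi (G f)| <= e.
Proof.
move=> cG SG f Sf e e0.
have NB : nbhs f [set g | SB (G g) -> `|phi (G g) - phi (G f)| <= e] := cG f _ (near_phi (SG f Sf) e0).
by apply: filterS NB => g Hg Sg; apply: Hg; exact: SG.
Qed.

Lemma continuous_cvg_comp (G_ : nat -> A -> B) (G : A -> B) :
  (forall f, (fun z : nat * A => G_ z.1 z.2) @ filter_prod \oo (nbhs f) --> G f) ->
  (forall n f, SA f -> SB (G_ n f)) -> (forall f, SA f -> SB (G f)) ->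
  forall f, SA f -> forall e, 0 < e -> exists N,
  \forall g \near f, SA g -> forall n, (N <= n)%N -> `|phi (G_ n g) - phi (G f)| <= e.
Proof.
move=> cG Sn Sl f Sf e e0.
have NB : filter_prod \oo (nbhs f) [set z : nat * A | SB (G_ z.1 z.2) -> `|phi (G_ z.1 z.2) - phi (G f)| <= e].
  exact: cG f _ (near_phi (Sl f Sf) e0).
move: NB => [[U U'] /= [[N _ UN] Uf] UU]; exists N; apply: filterS Uf => g Ug Sg n Nn.
by apply: (UU (n, g)) => //=; [split=> //; exact: UN|exact: Sn].
Qed.

End Composition.

(** * The limit law *)

Section Limit.
Context {R : realType} (xi : probability nat R) (sigma : R).
Hypothesis crit : critical xi sigma.
Local Notation Re := complex.Re.

Lemma Dhat_strip : @Dhat R `<=` strip.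
Proof. by move=> a [/andP[h1 h2] h3]; split=> //=; rewrite h2 andbT; move: h1 => /=; lra. Qed.

Lemma mu_near (a : R[i]) : strip a -> forall e, 0 < e ->
  \forall b \near a, strip b -> cabs (mu xi b - mu xi a) < e.
Proof.
move=> sa e e0; have [h [h0 h_span h_spanned]] := span_exists crit.
exact: (mu_continuous crit h0 h_span h_spanned sa e0).
Qed.

Lemma cvg_sumc (I : Type) (r : seq I) (f : I -> R[i] -> R[i]) (a : R[i]) :
  (forall i, f i b @[b --> a] --> f i a) -> \sum_(i <- r) f i b @[b --> a] --> \sum_(i <- r) f i a.
Proof.
move=> fa; elim: r => [|i r IH].
  rewrite big_nil (_ : (fun b : R[i] => _) = fun=> 0); last by apply/funext => b; rewrite big_nil.
  by apply/(@cvgcP _ _ _ (nbhs_filter a)) => e e0; apply: filterE => b; rewrite subrr cabs0.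
rewrite big_cons (_ : (fun b : R[i] => _) = fun b => f i b + \sum_(j <- r) f j b); last first.
  by apply/funext => b; rewrite big_cons.
apply: (@cvgD _ (R[i])^o _ (nbhs a) _ (f i) (fun b => \sum_(j <- r) f j b)); first exact: fa.
exact: IH.
Qed.

Lemma EX_continuous n (a : R[i]) : EX xi n b @[b --> a] --> EX xi n a.
Proof.
rewrite EX_formula (_ : EX xi n = fun b => \sum_(1 <= m < n.+1) npow m b *
    (gw_size_prob xi m * walk (offspring_prob xi) (n - m) (n - m) / gw_size_prob xi n)%:C); last first.
  by apply/funext => b; rewrite EX_formula.
apply: cvg_sumc => m; apply: (@cvgM R[i] _ (nbhs a) _ (npow m) (fun=> _)); last exact: cvg_cst.
exact: continuous_npow.
Qed.

Lemma gamma_term_continuous (a : R[i]) : strip a -> gamma_term b @[b --> a] --> gamma_term a.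
Proof.
move=> sa; rewrite /gamma_term /Gamma.
apply: (@cvgM R[i] _ (nbhs a) _ (fun=> _) (fun b => (rGamma (b - one_half))^-1 * rGamma b));
  first exact: cvg_cst.
apply: (@cvgM R[i] _ (nbhs a) _ (fun b => (rGamma (b - one_half))^-1) rGamma);
  last exact: continuous_rGamma.
apply: (@cvgV R[i] _ (nbhs a) _ (fun b => rGamma (b - one_half)) _ (rGamma_neq0 sa)).
exact: cvg_rGamma_shift.
Qed.

Definition limit_shift (a : R[i]) : R[i] := (sigma%:C)^-1 * gamma_term a.

(** The deterministic difference between the two normalizations. At indices that are not
   admissible it is given its limiting value, so that it converges along all integers. *)
Definition shift (n : nat) (a : R[i]) : R[i] :=
  if `[< admissible xi n >] then npow n (- a - one_half) * (EX xi n a - n%:R * mu xi a)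
  else limit_shift a.

(** The map from the centred analytic process to the process of the theorem. *)
Definition rescale (d : R[i] -> R[i]) (f : funs right_half_plane) : funs Dhat :=
  fun a => (sigma%:C)^-1 * (f : R[i] -> R[i]) a + d a.

Lemma shift_cvg (K : set R[i]) : K `<=` Dhat -> compact K -> forall e : R, 0 < e ->
  \forall n \near \oo, forall a, K a -> cabs (shift n a - limit_shift a) < e.
Proof.
move=> KD Kc e e0; have e2 : 0 < e / 2 by rewrite divr_gt0.
have Ks : K `<=` strip by move=> a /KD; exact: Dhat_strip.
have H := EX_asymp crit Ks Kc e2; rewrite /admissible_oo near_withinE in H.
have n1 : \forall n \near \oo, (0 < n)%N by exists 1%N.
apply: filterS2 H n1 => n Hn n0 a Ka; rewrite /shift; case: asboolP => an; last by rewrite subrr cabs0.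
have {Hn}Hn := Hn an a Ka; have [/andP[ra _] _] := KD a Ka.
rewrite cabsE lecR max_l ?(ltW ra)// in Hn.
have nz := npow_neq0 n (a + one_half).
have E : npow n (- a - one_half) = (npow n (a + one_half))^-1 by rewrite -npowN opprD.
have -> : npow n (- a - one_half) * (EX xi n a - n%:R * mu xi a) - limit_shift a =
   (npow n (a + one_half))^-1 * (EX xi n a - (mu xi a * n%:R + limit_shift a * npow n (a + one_half))).
  by rewrite E; field.
rewrite cabsM cabsV cabs_npow//.
have -> : Re (a + one_half) = Re a + 2^-1 by case: (a).
have p0 : 0 < n%:R `^ (Re a + 2^-1) :> R by rewrite powR_gt0// ltr0n.
rewrite mulrC ltr_pdivrMr//; apply: (le_lt_trans Hn); rewrite ltr_pM2r//; lra.
Qed.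

Lemma rescale_near (K : set R[i]) (f : funs right_half_plane) : K `<=` Dhat -> compact K ->
  forall e : R, 0 < e -> \forall g \near f, forall a, K a ->
  cabs ((sigma%:C)^-1 * ((g : R[i] -> R[i]) a - (f : R[i] -> R[i]) a)) < e.
Proof.
move=> KD Kc e e0; have [s0 _ _] := crit.
have Kr : K `<=` right_half_plane by move=> a /KD[/andP[]].
have := proj1 (@funs_cvgP _ right_half_plane _ (nbhs f) (nbhs_filter f) id f) cvg_id K Kr Kc.
move=> /(_ (e * sigma) (mulr_gt0 e0 s0)); apply: filterS => g gf a Ka.
rewrite cabsM cabsV cabs_real gtr0_norm// mulrC ltr_pdivrMr//; exact: gf.
Qed.

Lemma rescale_continuous d : continuous (rescale d).
Proof.
move=> f; apply/(@funs_cvgP _ Dhat _ _ (nbhs_filter f)) => K KD Kc e e0.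
apply: filterS (rescale_near f KD Kc e0) => g gf a Ka; have := gf a Ka; congr (cabs _ < _).
by rewrite /rescale; ring.
Qed.

Lemma rescale_shift_cvg (f : funs right_half_plane) :
  (fun z : nat * funs right_half_plane => rescale (shift z.1) z.2) @ filter_prod \oo (nbhs f)
  --> rescale limit_shift f.
Proof.
apply/(@funs_cvgP _ Dhat _ _ (filter_prod_filter _ _)) => K KD Kc e e0.
have e2 : 0 < e / 2 by rewrite divr_gt0.
exists ([set n | forall a, K a -> cabs (shift n a - limit_shift a) < e / 2],
  [set g | forall a, K a -> cabs ((sigma%:C)^-1 * ((g : R[i] -> R[i]) a - (f : R[i] -> R[i]) a)) < e / 2]).
  by split; [exact: shift_cvg | exact: rescale_near].
move=> [n g] /= [Hn Hg] a Ka.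
have -> : rescale (shift n) g a - rescale limit_shift f a =
  (sigma%:C)^-1 * ((g : R[i] -> R[i]) a - (f : R[i] -> R[i]) a) + (shift n a - limit_shift a).
  by rewrite /rescale; ring.
by apply: le_lt_trans (ler_cabsD _ _) _; have := Hn a Ka; have := Hg a Ka; lra.
Qed.

Lemma analytic_cvg (f : funs (@right_half_plane R)) a : analytic_funs right_half_plane f ->
  right_half_plane a -> (f : R[i] -> R[i]) b @[b --> a] --> (f : R[i] -> R[i]) a.
Proof.
move=> fa Ha; have /derivable1_diffP := fa a Ha.
exact: (@differentiable_continuous _ (R[i])^o (R[i])^o a f).
Qed.

Definition wcont (f : R[i] -> R[i]) := forall a, Dhat a -> f b @[b --> within Dhat (nbhs a)] --> f a.

Lemma rescale_wcont d f : analytic_funs right_half_plane f -> wcont d ->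
  continuous_funs Dhat (rescale d f).
Proof.
move=> fa dc; apply/subspace_continuousP => a Da.
have FF : Filter (within Dhat (nbhs a)) by exact: within_filter.
apply: (@cvgD _ (R[i])^o _ (within Dhat (nbhs a)) FF
  (fun b => (sigma%:C)^-1 * (f : R[i] -> R[i]) b) d); last exact: dc.
apply: (@cvgM R[i] _ (within Dhat (nbhs a)) FF (fun=> (sigma%:C)^-1) f); first exact: cvg_cst.
by apply: cvg_within_filter; apply: analytic_cvg => //; case: Da => /andP[].
Qed.

Lemma limit_shift_wcont : wcont limit_shift.
Proof.
move=> a Da; apply: cvg_within_filter.
apply: (@cvgM R[i] _ (nbhs a) _ (fun=> (sigma%:C)^-1) gamma_term); first exact: cvg_cst.
exact: gamma_term_continuous (Dhat_strip Da).
Qed.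

Lemma shift_wcont n : wcont (shift n).
Proof.
rewrite /shift; case: asboolP => _; last exact: limit_shift_wcont.
move=> a Da; have FF : Filter (within Dhat (nbhs a)) by exact: within_filter.
apply: (@cvgM R[i] _ (within Dhat (nbhs a)) FF (fun b => npow n (- b - one_half))
  (fun b => EX xi n b - n%:R * mu xi b)).
  apply: cvg_within_filter.
  apply: (@cvg_comp _ _ _ (fun b : R[i] => - b - one_half) (npow n)); last exact: continuous_npow.
  apply: (@cvgB _ (R[i])^o _ (nbhs a) _ (fun b => - b) (fun=> one_half)); last exact: cvg_cst.
  by apply: (@cvgN _ (R[i])^o _ (nbhs a) _ id); exact: cvg_id.
apply: (@cvgB _ (R[i])^o _ (within Dhat (nbhs a)) FF (EX xi n) (fun b => n%:R * mu xi b)).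
  by apply: cvg_within_filter; exact: EX_continuous.
apply: (@cvgM R[i] _ (within Dhat (nbhs a)) FF (fun=> n%:R) (mu xi)); first exact: cvg_cst.
apply/(@cvgcP _ _ _ FF) => e e0; rewrite near_withinE.
apply: filterS (mu_near (Dhat_strip Da) e0) => b mb /Dhat_strip; exact: mb.
Qed.

Section WithLimit.
Context d (T : measurableType d) (P : probability T R) (Yt : T -> R[i] -> R[i]).
Hypothesis Y_limit : is_Ytilde P Yt.

(** The process whose limit in law characterizes [Yt]. *)
Definition centred (n : nat) (t : tree) : funs right_half_plane :=
  fun a => sigma%:C * npow n (- a - one_half) * (X t a - EX xi n a).

Lemma centred_cvg : cvg_in_distribution P (analytic_funs right_half_plane) xi centred Yt.
Proof. exact: Y_limit crit. Qed.

Lemma rescale_centred n t : admissible xi n ->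
  rescale (shift n) (centred n t) = fun a => npow n (- a - one_half) * (X t a - n%:R * mu xi a).
Proof.
move=> an; apply/funext => a; rewrite /rescale /centred /shift asboolT//.
have [s0 _ _] := crit.
have : sigma%:C != 0 :> R[i] by rewrite -cabs_gt0 cabs_real normr_gt0 gt_eqF.
by move=> s1; field.
Qed.

Lemma cvg_in_C :
  cvg_in_distribution P (continuous_funs Dhat) xi
    (fun n t a => npow n (- a - one_half) * (X t a - n%:R * mu xi a))
    (fun w a => (sigma%:C)^-1 * Y_of Yt w a).
Proof.
have [SZ [SY mY] _] := centred_cvg.
have WE w : (fun a => (sigma%:C)^-1 * Y_of Yt w a) = rescale limit_shift (Yt w).
  by apply/funext => a; rewrite /rescale /Y_of mulrDr.
split.
- move=> n t an tn; rewrite -(rescale_centred t an); apply: rescale_wcont; first exact: SZ.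
  exact: shift_wcont.
- split=> [w|U oU].
    by rewrite WE; apply: rescale_wcont; [exact: SY|exact: limit_shift_wcont].
  have -> : (fun w a => (sigma%:C)^-1 * Y_of Yt w a) @^-1` U = Yt @^-1` (rescale limit_shift @^-1` U).
    by apply/seteqP; split=> w /=; rewrite WE.
  apply: mY; have /continuousP := @rescale_continuous limit_shift; exact.
move=> phi [cphi [M phiM]].
pose h_ n f := phi (rescale (shift n) f); pose h f := phi (rescale limit_shift f).
have H := @uniform_mapping R _ T P _ (analytic_funs right_half_plane) xi centred Yt h_ h M centred_cvg.
have Sn n f : analytic_funs right_half_plane f -> continuous_funs Dhat (rescale (shift n) f).
  by move=> fa; apply: rescale_wcont => //; exact: shift_wcont.
have Sl f : analytic_funs right_half_plane f -> continuous_funs Dhat (rescale limit_shift f).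
  by move=> fa; apply: rescale_wcont => //; exact: limit_shift_wcont.
have {}H : (cgw_expect xi n (h_ n \o centred n))%:E @[n --> admissible_oo xi] --> ('E_P[h \o Yt])%E.
  apply: H.
  - by move=> n f fa; apply: phiM; exact: Sn.
  - by move=> f fa; apply: phiM; exact: Sl.
  - by move=> n; exact: (within_cont_comp cphi (@rescale_continuous (shift n)) (Sn n)).
  - exact: (within_cont_comp cphi (@rescale_continuous limit_shift) Sl).
  - exact: (continuous_cvg_comp cphi rescale_shift_cvg Sn Sl).
have -> : (phi \o (fun w a => (sigma%:C)^-1 * Y_of Yt w a)) = h \o Yt.
  by apply/funext => w /=; rewrite WE.
apply: cvg_trans H; apply: near_eq_cvg; rewrite near_withinE; apply: filterE => n an.
congr (_%:E); rewrite !cgw_expectE; congr (_ / _); apply: eq_bigr => t _.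
by rewrite /h_ /= rescale_centred.
Qed.

Lemma eval_continuous (a : R[i]) : Dhat a ->
  continuous (fun f : funs Dhat => (f : R[i] -> R[i]) a : R[i]).
Proof.
move=> Da f; apply/(@cvgcP _ _ _ (nbhs_filter f)) => e e0.
have aD : [set a] `<=` Dhat by move=> _ ->.
have ac : compact [set a] by exact: compact_set1.
have := proj1 (@funs_cvgP _ Dhat _ (nbhs f) (nbhs_filter f) id f) cvg_id _ aD ac _ e0.
by apply: filterS => g; apply.
Qed.

(** Evaluation is continuous, so this is a consequence of the convergence of the process. *)
Lemma cvg_at_point (a : R[i]) : Dhat a ->
  cvg_in_distribution P [set: R[i]] xi
    (fun n t => npow n (- a - one_half) * (X t a - n%:R * mu xi a))
    (fun w => (sigma%:C)^-1 * Y_of Yt w a).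
Proof.
move=> Da; have [_ [SY mY] cvgZ] := cvg_in_C; split=> //.
  split=> // U oU.
  apply: (mY ((fun f : funs Dhat => (f : R[i] -> R[i]) a) @^-1` U)).
  by move/continuousP : (eval_continuous Da); apply.
move=> phi [cphi [M phiM]].
apply: (cvgZ (fun f : funs Dhat => phi ((f : R[i] -> R[i]) a))); split; last first.
  by exists M => f _; exact: phiM.
apply/subspace_continuousP => f Sf; apply: cvg_within_filter.
apply: (@cvg_comp _ _ _ (fun f : funs Dhat => (f : R[i] -> R[i]) a) phi); first exact: eval_continuous.
have /subspace_continuousP c := cphi.
move=> U nU; have W : nbhs ((f : R[i] -> R[i]) a) [set x | [set: R[i]] x -> U (phi x)].
  exact: (c ((f : R[i] -> R[i]) a) I U nU).
by apply: filterS W => x; apply.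
Qed.

End WithLimit.
End Limit.

Lemma half_line_Dhat (R : realType) (y : R) : y != 0 -> Dhat (2^-1 +i* y).
Proof.
move=> y0; split; first by rewrite /= lexx andbT invr_gt0.
by move=> /(congr1 (@complex.Im R))/= /eqP; rewrite (negbTE y0).
Qed.

Theorem theorem10p8 (R : realType) (xi : probability nat R) (sigma : R)
    (d : measure_display) (T : measurableType d) (P : probability T R)
    (Yt : T -> R[i] -> R[i]) :
  critical xi sigma ->
  is_Ytilde P Yt ->
  let err (n : nat) (a : R[i]) : R[i] :=
    EX xi n a - (mu xi a * n%:R
                 + (sigma%:C)^-1 * gamma_term a * npow n (a + one_half)) in
  let bound (n : nat) (a : R[i]) : R :=
    (n%:R : R) `^ (Num.max (complex.Re a) 0 + 2^-1) in
  let Z (n : nat) (t : tree) (a : R[i]) : R[i] :=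
    npow n (- a - one_half) * (X t a - n%:R * mu xi a) in
  let W (w : T) (a : R[i]) : R[i] := (sigma%:C)^-1 * Y_of Yt w a in
  [/\ (forall y : R, y != 0 ->
         uniformly_little_o (admissible_oo xi) [set (2^-1 +i* y)] err bound),
      (forall K : set R[i], K `<=` strip -> compact K ->
         uniformly_little_o (admissible_oo xi) K err bound),
      (forall y : R, y != 0 ->
         cvg_in_distribution P [set: R[i]] xi
           (fun n t => Z n t (2^-1 +i* y)) (fun w => W w (2^-1 +i* y))) &
      cvg_in_distribution P (continuous_funs Dhat) xi Z W].
Proof.
move=> crit Yl err bound Z W; split.
- move=> y y0; have Ks : [set 2^-1 +i* y] `<=` strip.
    by move=> _ ->; apply: Dhat_strip; exact: half_line_Dhat.
  have Kc : compact [set 2^-1 +i* y] by exact: compact_set1.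
  exact: (EX_asymp crit Ks Kc).
- by move=> K Ks Kc; exact: (EX_asymp crit Ks Kc).
- by move=> y y0; exact: (cvg_at_point crit Yl (half_line_Dhat y0)).
- exact: (cvg_in_C crit Yl).
Qed.
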